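(* Let $N \geq 3$ be arbitrary and define the two subspaces of $\mathrm{Im}\, \Pi_{\leq N}$ $$V_1 \oplus V_2 = \mathrm{span}(\cos \ell x_1, \sin \ell x_1) \oplus \mathrm{span}(\cos k x_2, \sin k x_2),$$ for two arbitrary integers $\ell,k \geq 2$ such that $\ell \neq k$ and $\max(\ell,k) \leq N$. Suppose further that the forcing coefficients $\sigma_p^{(j)}$ ($j\in\{1,2\}$, $0<|p|_\infty\le N$) are all non-zero. If $\ker A = V_1 \oplus V_2$, then there exists a unique invariant measure $\mu_\ast$ of the Galerkin Navier-Stokes equations with truncation $N$, and for all $p < 2/3$ there holds $$\int_{\mathrm{Im}\, \Pi_{\leq N}} |w|^p \, d\mu_\ast(w) < \infty.$$
   Context: Let $\mathbb{T}^2$ be the square torus of side $2\pi$. $\Pi_{\leq N}$ is the projection onto Fourier modes $k\in\mathbb{Z}^2$ with $|k|_\infty=\max(|k_1|,|k_2|)\le N$. The Galerkin Navier-Stokes equations with truncation $N$ are the SDE for the mean-zero, real-valued vorticity $w \in \mathrm{Im}\,\Pi_{\leq N}$ given by $$d w + \big(\Pi_{\leq N}(u \cdot \nabla w) + Aw\big) dt = \sum_{0 < |k|_\infty \leq N} \sigma_k^{(1)} \cos(k \cdot x)\, dW_t^{(k;1)} + \sigma_k^{(2)} \sin(k \cdot x)\, dW_t^{(k;2)},$$ $$u = \begin{pmatrix} -\partial_{x_2} \\ \partial_{x_1} \end{pmatrix} (-\Delta)^{-1} w,$$ where the $W^{(k;j)}$ are independent standard Brownian motions, $\sigma_k^{(j)}\in\mathbb{R}$,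 and $A$ is a positive semi-definite linear operator (with respect to the $L^2$ inner product) on the finite-dimensional space of mean-zero elements of $\mathrm{Im}\,\Pi_{\le N}$. An invariant measure is a Borel probability measure on this space that is invariant under the Markov semigroup of the SDE.
   Formalization: ''For all p < 2/3'' is read as 0 ≤ p < 2/3: for very negative p (p ≤ −dim of the state space) the integral of |w|^p is infinite, since the invariant measure has positive density near w = 0. *)

(* Defs.v *)
From HB Require Import structures.
From mathcomp Require Import all_boot all_order all_algebra.
From mathcomp Require Import all_classical all_reals all_analysis.
Set Implicit Arguments.
Unset Strict Implicit.
Unset Printing Implicit Defensive.
Import Order.TTheory GRing.Theory Num.Theory numFieldNormedType.Exports.
Local Open Scope classical_set_scope.
Local Open Scope ring_scope.

(* The frequencies k in Z^2 with |k|_oo <= N: each component ranges over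
   'I_(2N+1), shifted by N. *)
Definition box (N : nat) : finType := ('I_(N.*2.+1) * 'I_(N.*2.+1))%type.

Definition freq (N : nat) (k : box N) : int * int :=
  ((k.1 : nat)%:Z - N%:Z, (k.2 : nat)%:Z - N%:Z).

Definition mode (N : nat) : finType := {k : box N | freq k != 0}.

Definition mfreq (N : nat) (k : mode N) : int * int := freq (val k).

Section Torus.
Context {R : realType}.

(* Functions on the torus of side 2 pi are handled through their 2 pi-periodic
   lifts R * R -> R; integrals are over the fundamental domain. *)
Definition phase (k : int * int) (x : R * R) : R :=
  k.1%:~R * x.1 + k.2%:~R * x.2.

Definition torus_dom : set (R * R) := `[0, 2 * pi] `*` `[0, 2 * pi].

Definition torus_int (f : R * R -> R) : R :=
  \int[(lebesgue_measure \x lebesgue_measure)%E]_(x in torus_dom) f x.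

Definition L2_ip (f g : R * R -> R) : R := torus_int (fun x => f x * g x).

(* The projection sum_{|k|_oo <= N} fhat_k exp(i k.x), where
   fhat_k = (2 pi)^-2 int f(y) exp(- i k.y) dy, for a real-valued f: the
   imaginary parts of the terms k and -k cancel, and the real part of the term
   k is the summand below. *)
Definition Pi_le (N : nat) (f : R * R -> R) (x : R * R) : R :=
  \sum_(k : box N)
    (2 * pi) ^- 2 *
    (torus_int (fun y => f y * cos (phase (freq k) y)) * cos (phase (freq k) x)
     + torus_int (fun y => f y * sin (phase (freq k) y)) * sin (phase (freq k) x)).

Definition partial1 (f : R * R -> R) (x : R * R) : R := 'D_((1, 0) : R * R) f x.
Definition partial2 (f : R * R -> R) (x : R * R) : R := 'D_((0, 1) : R * R) f x.

(* A real basis of the mean-zero elements of the image of Pi_le N: of each pair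
   {k, -k} of nonzero frequencies, the lexicographically positive one carries
   the cosine and the other one the sine. *)
Definition lex_pos (k : int * int) : bool :=
  (0 < k.1) || ((k.1 == 0) && (0 < k.2)).

Definition basis_fun (N : nat) (k : mode N) (x : R * R) : R :=
  if lex_pos (mfreq k) then cos (phase (mfreq k) x) else sin (phase (mfreq k) x).

End Torus.

(* The space of mean-zero real-valued elements of the image of Pi_le N, in
   coordinates with respect to basis_fun. *)
Definition state (R : realType) (N : nat) : Type := 'rV[R]_(#|{: mode N}|).

Section State.
Context {R : realType} {N : nat}.
Local Notation state := (state R N).

Definition vort (w : state) (x : R * R) : R :=
  \sum_(i < #|{: mode N}|) w 0 i * basis_fun (enum_val i) x.

Definition L2_norm (w : state) : R := Num.sqrt (L2_ip (vort w) (vort w)).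

(* (- Delta)^-1 is the Fourier multiplier |k|^-2. *)
Definition inv_laplacian (w : state) : state :=
  \row_i (w 0 i / ((mfreq (enum_val i)).1 ^+ 2 + (mfreq (enum_val i)).2 ^+ 2)%:~R).

Definition velocity1 (w : state) (x : R * R) : R :=
  - partial2 (vort (inv_laplacian w)) x.
Definition velocity2 (w : state) (x : R * R) : R :=
  partial1 (vort (inv_laplacian w)) x.

Definition advection (w : state) (x : R * R) : R :=
  velocity1 w x * partial1 (vort w) x + velocity2 w x * partial2 (vort w) x.

Definition L2_symmetric (A : {linear state -> state}) : Prop :=
  forall v w : state, L2_ip (vort (A v)) (vort w) = L2_ip (vort v) (vort (A w)).

Definition L2_psd (A : {linear state -> state}) : Prop :=
  L2_symmetric A /\ forall w : state, 0 <= L2_ip (vort (A w)) (vort w).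

Definition V1 (l : nat) : set state :=
  [set w | exists a b : R, forall x : R * R,
     vort w x = a * cos (l%:R * x.1) + b * sin (l%:R * x.1)].

Definition V2 (k : nat) : set state :=
  [set w | exists a b : R, forall x : R * R,
     vort w x = a * cos (k%:R * x.2) + b * sin (k%:R * x.2)].

End State.

Definition borel_state (R : realType) (N : nat) : measurableType _ :=
  g_sigma_algebraType (@open (state R N)).

Section Brownian.
Context {R : realType} {d : measure_display} {Omega : measurableType d}.
Variable P : probability Omega R.

Definition sigma_process (D : set R) (B : R -> Omega -> R) : set (set Omega) :=
  <<s [set E | exists2 t, D t & exists2 C, measurable C & E = B t @^-1` C] >>.

(* Processes are indexed by R but only their values at times t >= 0 matter. *)
Record brownian (B : R -> Omega -> R) : Prop := Brownian {
  brownian_meas : forall t : R, 0 <= t -> measurable_fun setT (B t);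
  brownian_0 : {ae P, forall om, B 0 om = 0};
  brownian_cont :
    {ae P, forall om, {within `[0, +oo[%classic, continuous (B ^~ om)}};
  brownian_law : forall (s t : R) (C : set R), 0 <= s -> s < t -> measurable C ->
    P ((fun om => B t om - B s om) @^-1` C) =
    normal_prob 0 (Num.sqrt (t - s)) C;
  brownian_indep : forall (s t : R) (E : set Omega) (C : set R),
    0 <= s -> s < t -> sigma_process `[0, s] B E -> measurable C ->
    P (E `&` (fun om => B t om - B s om) @^-1` C) =
    (P E * P ((fun om => (B t om - B s om)%R) @^-1` C))%E }.

(* Since I is finite and the events E i may be taken to be the full space,
   the product rule over the whole family covers all subfamilies. *)
Definition independent_processes (I : finType) (W : I -> R -> Omega -> R) : Prop :=
  forall E : I -> set Omega,
    (forall i, sigma_process `[0, +oo[ (W i) (E i)) ->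
    P (\bigcap_(i in [set: I]) E i) = (\prod_(i : I) P (E i))%E.

End Brownian.

Section SDE.
Context {R : realType} {N : nat} {d : measure_display} {Omega : measurableType d}.
Variable P : probability Omega R.
Variable A : {linear state R N -> state R N}.
(* In sigma k j and W (k, j), j = false is the cosine forcing (index 1)
   and j = true the sine forcing (index 2). *)
Variable sigma : mode N -> bool -> R.
Variable W : mode N * bool -> R -> Omega -> R.

Definition forcing (t : R) (om : Omega) (x : R * R) : R :=
  \sum_(k : mode N)
    (sigma k false * cos (phase (mfreq k) x) * W (k, false) t om
     + sigma k true * sin (phase (mfreq k) x) * W (k, true) t om).

(* The noise is additive, so the SDE is the integral equation below, read
   pathwise as an identity between functions on the torus. *)
Record solves_GNS (w0 : state R N) (w : R -> Omega -> state R N) : Prop := SolvesGNS {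
  GNS_meas : forall t : R, 0 <= t ->
    measurable_fun setT (w t : Omega -> borel_state R N);
  GNS_init : {ae P, forall om, w 0 om = w0};
  GNS_cont :
    {ae P, forall om, {within `[0, +oo[%classic, continuous (w ^~ om)}};
  GNS_eq : {ae P, forall om, forall (t : R) (x : R * R), 0 <= t ->
    vort (w t om) x =
    vort (w 0 om) x
    - (\int[lebesgue_measure]_(s in `[0, t])
         (Pi_le N (advection (w s om)) x + vort (A (w s om)) x))
    + forcing t om x} }.

End SDE.

(* The transition probabilities P_t(w0, B) of the Markov semigroup, where
   w w0 is the solution started from w0. *)
Definition transition {R : realType} {N : nat} {d : measure_display}
    {Omega : measurableType d} (P : probability Omega R)
    (w : state R N -> R -> Omega -> state R N)
    (t : R) (w0 : state R N) (B : set (state R N)) : \bar R :=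
  P (w w0 t @^-1` B).

Definition invariant_measure {R : realType} {N : nat} {d : measure_display}
    {Omega : measurableType d} (P : probability Omega R)
    (w : state R N -> R -> Omega -> state R N)
    (mu : probability (borel_state R N) R) : Prop :=
  forall (t : R) (B : set (borel_state R N)), 0 <= t -> measurable B ->
    (\int[mu]_w0 transition P w t w0 B)%E = mu B.

(* Main.v *)
(* The null space of A consists of the shear flows
   u = a cos (l x1 + s) + b cos (k x2 + t).  There is no dissipation on it, and the work is to
   show that a solution started from x with |x| large leaves it quickly.  Since
   <u.grad u, u> = 0, the energy changes only through the noise and through A, which is coercive
   in the distance to its null space.  For l <> k the nonlinearity sends a state of the null
   space to its orthogonal complement, and vanishes only if a b = 0.  If a b <> 0 the flow pushes
   the solution out.  If a b = 0, u is a steady shear flow of wave number l or k >= 2, and it is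
   linearly unstable: on the modes (m l, 1), respectively (-1, m k), the linearized Euler
   operator is a three-term recursion, whose positive eigenvalue is found by the intermediate
   value theorem.  Two solutions driven by the same noise, from points on either side of x in
   the unstable direction, cannot both remain close to the null space, and the noise puts the
   solution at such points with a probability bounded below.  Writing |x| = Q^18, with
   probability bounded below the solution is at some time at distance at least Q^16 from the
   null space; it stays at a comparable distance during a time of order Q^-20, which dissipates
   an energy of order Q^12 = |x|^(2/3).  Compactness of the sphere gives
     E |w_1|^2 <= |x|^2 + C - eps |x|^(2/3).
   As every mode is forced, the transition probabilities from a bounded set dominate a multiple
   of a fixed measure.  Harris' method then gives a unique invariant measure, and integrating the
   drift inequality gives its moment of order 2/3.  Uniqueness and the Markov property are
   obtained from the pathwise convergence of a cut-off Euler scheme. *)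
From HB Require Import structures.
Require Import Defs.
From mathcomp Require Import all_boot all_order all_algebra.
From mathcomp Require Import all_classical all_reals all_analysis.
From mathcomp Require Import measurable_realfun zify ring lra.
Set Implicit Arguments.
Unset Strict Implicit.
Unset Printing Implicit Defensive.
Import Order.TTheory GRing.Theory Num.Theory numFieldNormedType.Exports.
Local Open Scope classical_set_scope.
Local Open Scope ring_scope.

(** * Harris' theorem with an unbounded Lyapunov function *)

(** The scales are tied together as follows. At |x| = Q^18 the speed is of order Q^36, so a distance
    Q^16 is kept for a time Q^16 / Q^36 = Q^-20. The linear instability acts on the time scale
    Q^-18; the time Q^-17 allowed for the escape is longer by a factor Q, so the growth exp(c Q)
    beats every power of Q, yet in that time a trapped solution moves by only Q^18 Q^16 Q^-17 = Q^17
    along the null space. The two starting points are x plus or minus Q^-54 Y: the noise reaches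
    them in a time Q^-108, during which the drift contributes only Q^-72. Two solutions are compared
    because the additive noise cancels in their difference, which leaves a deterministic
    instability. The solutions are given for each initial state separately, with no regularity in
    that state. Facts about laws are therefore read off Euler iterates, which are explicit
    measurable functions of the initial state and of finitely many Gaussian increments. In this
    setting Ito's formula becomes a discrete energy balance and Girsanov's theorem a shift of a
    Gaussian vector. *)

Lemma integral_kcomp_noparam {d1 d2 d3 : measure_display} {X : measurableType d1}
    {Y : measurableType d2} {Z : measurableType d3} {R : realType}
    (k1 : R.-spker X ~> Y) (k2 : R.-spker Y ~> Z) x (f : Z -> \bar R) :
  (forall z, 0 <= f z)%E -> measurable_fun setT f ->
  (\int[mkcomp_noparam k1 k2 x]_z f z = \int[k1 x]_y \int[k2 y]_z f z)%E.
Proof.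
by move=> f0 mf; rewrite -(@integral_kcomp _ _ _ X Y Z R k1 (kernel.kernel_snd k2) x f f0 mf).
Qed.

Section ConstantKernel.
Local Open Scope ereal_scope.
Context {d : measure_display} {X : measurableType d} {R : realType}.
Variable nu : probability X R.

(** A measure read as a kernel that ignores its argument: the measures [nu P^n] become kernel
    compositions, and integrals against them are given by [integral_kcomp_noparam]. *)
Definition kcst (_ : X) : {measure set X -> \bar R} := nu.

Let mkcst U : measurable U -> measurable_fun setT (fun x => kcst x U).
Proof. by move=> mU; exact: measurable_cst. Qed.

HB.instance Definition _ := @isKernel.Build _ _ _ _ R kcst mkcst.

Let kcst1 : ereal_sup [set kcst x setT | x in setT] <= 1.
Proof. by apply/(sprob_kernelP (fun x A => kcst x A)) => x; rewrite /kcst/= probability_setT. Qed.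

HB.instance Definition _ := @Kernel_isSubProbability.Build _ _ _ _ R kcst kcst1.

Lemma invariant_integral (P : R.-spker X ~> X) (h : X -> \bar R) :
  (forall B, measurable B -> \int[nu]_x P x B = nu B) ->
  (forall y, 0 <= h y) -> measurable_fun setT h ->
  \int[nu]_x \int[P x]_y h y = \int[nu]_x h x.
Proof.
move=> nui h0 mh; rewrite -(integral_kcomp_noparam kcst P point h0 mh).
by apply: eq_measure_integral => A mA _; exact: nui.
Qed.

End ConstantKernel.

(** * Nummelin splitting and regeneration *)

Section Residual.
Local Open Scope ereal_scope.
Context {d : measure_display} {X : measurableType d} {R : realType}.
Variables (P : R.-pker X ~> X) (nu : probability X R) (c : R) (C : set X).
Hypotheses (c0 : (0 < c)%R) (mC : measurable C).
Hypothesis minor : forall x B, C x -> measurable B -> c%:E * nu B <= P x B.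

Let s (x : X) : R := (c * \1_C x)%R.

Let s_ge0 x : (0 <= s x)%R.
Proof. by rewrite mulr_ge0 // ltW. Qed.

Let sP x B : measurable B -> (s x)%:E * nu B <= P x B.
Proof.
move=> mB; rewrite /s indicE; have [|_] := boolP (x \in C).
  by rewrite inE mulr1 => /minor; apply.
by rewrite mulr0 mul0e.
Qed.

Let Pfin x B : measurable B -> P x B \is a fin_num.
Proof. by move=> mB; apply: (finite_kernel_measure P). Qed.

(* Nummelin splitting: what is left of [P] once a fraction [s] of its mass is drawn from [nu]. *)
Definition res (x : X) (B : set X) : \bar R := maxe 0 (P x B - (s x)%:E * nu B).

(** The maximum with 0 in [res] acts only on non-measurable sets, where a measure must still be
    nonnegative; on measurable sets the minorization makes the difference nonnegative. *)
Let resE x B : measurable B -> res x B = P x B - (s x)%:E * nu B.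
Proof.
move=> mB; rewrite /res max_r// sube_ge0 ?sP//.
by rewrite fin_numM// fin_num_measure.
Qed.

Let res0 x : res x set0 = 0.
Proof. by rewrite resE// !measure0 mule0 sube0. Qed.

Let res_ge0 x B : 0 <= res x B.
Proof. by rewrite /res le_max lexx. Qed.

Let res_sigma x : semi_sigma_additive (res x).
Proof.
move=> F mF tF mU; rewrite resE//.
have -> : (fun n => \sum_(0 <= i < n) res x (F i)) =
  (fun n => \sum_(0 <= i < n) P x (F i) - (s x)%:E * \sum_(0 <= i < n) nu (F i)).
  apply/funext => n; rewrite ge0_sume_distrr; last by move=> i _; exact: measure_ge0.
  rewrite -fin_num_sumeN; last first.
    by move=> i _; rewrite fin_numM// fin_num_measure.
  by rewrite -big_split/=; apply: eq_bigr => i _; rewrite resE.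
apply: cvgeB.
- by rewrite fin_num_adde_defr// Pfin.
- exact: measure_semi_sigma_additive.
- apply: cvgeZl => //; exact: measure_semi_sigma_additive.
Qed.

HB.instance Definition _ x := isMeasure.Build _ _ _ (res x) (res0 x) (res_ge0 x) (@res_sigma x).

Definition resk : X -> {measure set X -> \bar R} := res.

Let ms : measurable_fun setT s.
Proof. by apply: measurable_funM => //; exact: measurable_indic. Qed.

Let mres U : measurable U -> measurable_fun setT (fun x => resk x U).
Proof.
move=> mU; have -> : (fun x => resk x U) = (fun x => P x U - (s x)%:E * nu U).
  by apply/funext => x; rewrite /resk/= resE.
apply: emeasurable_funB; first exact: measurable_kernel.
by apply: emeasurable_funM => //; exact/measurable_EFinP.
Qed.

HB.instance Definition _ := @isKernel.Build _ _ _ _ R resk mres.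

Let resk1 : ereal_sup [set resk x setT | x in setT] <= 1.
Proof.
apply/sprob_kernelP => x; rewrite /resk/= resE// prob_kernel -[leRHS]sube0.
by apply: leeB => //; rewrite mule_ge0 ?lee_fin.
Qed.

HB.instance Definition _ := @Kernel_isSubProbability.Build _ _ _ _ R resk resk1.

Let Psplit x (h : X -> \bar R) : (forall y, 0 <= h y) -> measurable_fun setT h ->
  \int[P x]_y h y = \int[resk x]_y h y + (s x)%:E * \int[nu]_y h y.
Proof.
move=> h0 mh.
rewrite (eq_measure_integral (measure_add (resk x) (mscale (NngNum (s_ge0 x)) nu))).
  by rewrite ge0_integral_measure_add// ge0_integral_mscale.
move=> A mA _; rewrite -[RHS]/(measure_add _ _ A) measure_addE /mscale/= resE// subeK//.
by rewrite fin_numM// fin_num_measure.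
Qed.

(** [resit n x] is the law after n steps of the chain started at [x] and killed as soon as a step is
    drawn from [nu]. *)
Fixpoint resit n : R.-spker X ~> X :=
  if n is m.+1 then mkcomp_noparam (resit m) resk
  else kdirac (@measurable_id _ X setT).

Let nun n : {measure set X -> \bar R} := mkcomp_noparam (kcst nu) (resit n) point.

Let resitS n x h : (forall y, 0 <= h y) -> measurable_fun setT h ->
  \int[resit n.+1 x]_y h y = \int[resit n x]_y \int[resk y]_z h z.
Proof. exact: integral_kcomp_noparam. Qed.

Let mres_int h : (forall y, 0 <= h y) -> measurable_fun setT h ->
  measurable_fun setT (fun y => \int[resk y]_z h z).
Proof.
by move=> h0 mh; apply: measurable_fun_integral_kernel => // U mU; exact: mres.
Qed.

Let nunE n h : (forall y, 0 <= h y) -> measurable_fun setT h ->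
  \int[nun n]_y h y = \int[nu]_x \int[resit n x]_y h y.
Proof. by move=> h0 mh; rewrite /nun integral_kcomp_noparam. Qed.

Let nun0 h : (forall y, 0 <= h y) -> measurable_fun setT h ->
  \int[nun 0]_y h y = \int[nu]_x h x.
Proof.
move=> h0 mh; rewrite nunE//; apply: eq_integral => x _ /=.
by rewrite integral_dirac// diracT mul1e.
Qed.

Let nunS n h : (forall y, 0 <= h y) -> measurable_fun setT h ->
  \int[nun n.+1]_y h y = \int[nun n]_y \int[resk y]_z h z.
Proof.
move=> h0 mh; rewrite !nunE//; last 2 first.
- by move=> y; by apply: integral_ge0.
- exact: mres_int.
by apply: eq_integral => x _; exact: resitS.
Qed.

Let ms' : measurable_fun setT (fun x => (s x)%:E).
Proof. exact/measurable_EFinP. Qed.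

Let s0' x : 0 <= (s x)%:E. Proof. by rewrite lee_fin. Qed.

(* Both iterations (from a point and from nu) are sequences of measures m with
   m (n+1) h = m n (res h), so the bounds are proved once for such sequences. *)
Let chain (m : nat -> {measure set X -> \bar R}) := forall n h,
  (forall y, 0 <= h y) -> measurable_fun setT h ->
  \int[m n.+1]_y h y = \int[m n]_y \int[resk y]_z h z.

(** [P] has mass 1, so the mass that disappears in one step is the mass that regenerates, the
    integral of [s]. *)
Let chain_mass m n : chain m ->
  m n.+1 setT + \int[m n]_y (s y)%:E = m n setT.
Proof.
move=> mc; have := mc n (cst 1) (fun _ => lee01) (measurable_cst _).
rewrite integral_cst// mul1e => ->; rewrite -ge0_integralD//; last 2 first.
- by move=> x _; by apply: integral_ge0.
- by apply: mres_int.
rewrite -[RHS]mul1e -integral_cst//; apply: eq_integral => y _.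
rewrite integral_cst// mul1e /resk/= resE// prob_kernel probability_setT mule1.
by rewrite subeK.
Qed.

Let chain_mass_sum m n : chain m -> m 0%N setT = 1 ->
  \sum_(0 <= k < n) \int[m k]_y (s y)%:E + m n setT = 1.
Proof.
move=> mc m1; elim: n => [|n IH]; first by rewrite big_geq// add0e.
by rewrite big_nat_recr//= -addeA (addeC (integral _ _ _)) chain_mass.
Qed.

Section drift.
Variables (V f : X -> R) (b : R) (x0 : X).
Hypotheses (V0 : forall x, (0 <= V x)%R) (f1 : forall x, (1 <= f x)%R).
Hypotheses (mV : measurable_fun setT V) (mf : measurable_fun setT f).
Hypothesis b0 : (0 <= b)%R.
Hypothesis drift : forall x,
  \int[P x]_y (V y)%:E + (f x)%:E <= (V x + b * \1_C x)%:E.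
Hypothesis Cx0 : C x0.

Let f0 x : (0 <= f x)%R. Proof. exact: le_trans (f1 x). Qed.

Let mV' : measurable_fun setT (fun x => (V x)%:E). Proof. exact/measurable_EFinP. Qed.
Let mf' : measurable_fun setT (fun x => (f x)%:E). Proof. exact/measurable_EFinP. Qed.
Let V0' x : 0 <= (V x)%:E. Proof. by rewrite lee_fin. Qed.
Let f0' x : 0 <= (f x)%:E. Proof. by rewrite lee_fin. Qed.

(** At [x0] in [C] the drift inequality bounds the integral of [V] under [P x0], which contains the
    share [c] times that under [nu]. *)
Let nuV : \int[nu]_y (V y)%:E < +oo.
Proof.
have := drift x0; rewrite Psplit// /s indicE mem_set//= mulr1.
set I := integral _ _ _ => H; have cI : c%:E * \int[nu]_y (V y)%:E < +oo.
  apply: (@le_lt_trans _ _ (V x0 + b * 1)%:E); last exact: ltry.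
  apply: le_trans H; rewrite -[leLHS]adde0; apply: leeD => //.
  by rewrite -[leLHS]add0e; apply: leeD => //; by apply: integral_ge0.
move: cI; case: (\int[nu]_y (V y)%:E) => [r||] //; rewrite ?ltry//.
by rewrite gt0_muley ?lte_fin.
Qed.

(** The indicator of [C] is [s / c], so the constant [b] of the drift is charged to regenerations;
    the share of the integral of [V] drawn from [nu] is discarded. *)
Let chain_drift m n : chain m ->
  \int[m n.+1]_y (V y)%:E + \int[m n]_y (f y)%:E <=
  \int[m n]_y (V y)%:E + (b / c)%:E * \int[m n]_y (s y)%:E.
Proof.
move=> mc; rewrite mc// -ge0_integralD//; last 2 first.
- by move=> y _; by apply: integral_ge0.
- exact: mres_int.
have bc : (0 <= b / c)%R by rewrite divr_ge0// ltW.
rewrite -ge0_integralZl_EFin// -ge0_integralD//; last 2 first.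
- by move=> y _; rewrite mule_ge0.
- by apply: emeasurable_funM => //; exact: measurable_cst.
apply: ge0_le_integral => //.
- by move=> y _; rewrite adde_ge0//; by apply: integral_ge0.
- by apply: emeasurable_funD => //; exact: mres_int.
- apply: emeasurable_funD => //; apply: emeasurable_funM => //.
move=> y _; have := drift y; rewrite Psplit//.
rewrite -EFinM /s mulrA divfK ?gt_eqF// -EFinD; apply: le_trans.
apply: leeD => //; apply: leeDl; apply: mule_ge0; [exact: s0'|by apply: integral_ge0].
Qed.

(** The drift inequality telescopes, and the integrals of [s] add up to at most 1 because they are
    the mass lost by a chain of initial mass 1. *)
Let chain_f m n : chain m -> m 0%N setT = 1 ->
  \sum_(0 <= k < n) \int[m k]_y (f y)%:E <= \int[m 0%N]_y (V y)%:E + (b / c)%:E.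
Proof.
move=> mc m1; have bc : (0 <= b / c)%R by rewrite divr_ge0// ltW.
have H : \int[m n]_y (V y)%:E + \sum_(0 <= k < n) \int[m k]_y (f y)%:E <=
  \int[m 0%N]_y (V y)%:E + (b / c)%:E * \sum_(0 <= k < n) \int[m k]_y (s y)%:E.
  elim: n => [|n IH]; first by rewrite !big_geq// mule0.
  rewrite !big_nat_recr//= ge0_muleDr; last 2 first.
  - by apply: sume_ge0 => k _; by apply: integral_ge0.
  - by apply: integral_ge0.
  rewrite addeCA; apply: (le_trans (leeD2l _ (chain_drift n mc))).
  have gen (F a k v S : \bar R) : a + F <= v + S -> F + (a + k) <= v + (S + k).
    by move=> ?; rewrite !addeA (addeC F); apply: leeD2r.
  exact: gen.
apply: (@le_trans _ _ (\int[m n]_y (V y)%:E + \sum_(0 <= k < n) \int[m k]_y (f y)%:E)).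
  by rewrite -[leLHS]add0e leeD2r//; by apply: integral_ge0.
apply: (le_trans H); rewrite leeD2l// -[leRHS]mule1 lee_wpmul2l//.
by rewrite -(chain_mass_sum n mc m1) -[leLHS]adde0 leeD2l.
Qed.

Let chain_mass_le (m : nat -> {measure set X -> \bar R}) n : m n setT <= \int[m n]_y (f y)%:E.
Proof.
rewrite -[leLHS]mul1e -integral_cst//; apply: ge0_le_integral => //.
by move=> y _; rewrite lee_fin.
Qed.

(** As [f >= 1], the masses are summable; they are also nonincreasing, so n times the n-th mass is
    at most the sum of the series. *)
Let chain_to0 m : chain m -> m 0%N setT = 1 -> \int[m 0%N]_y (V y)%:E < +oo ->
  m n setT @[n --> \oo] --> 0.
Proof.
move=> mc m1 Voo.
have : \sum_(0 <= k <oo) m k setT < +oo.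
  apply: (@le_lt_trans _ _ (\int[m 0%N]_y (V y)%:E + (b / c)%:E)); last first.
    by rewrite lte_add_pinfty// ltry.
  apply: lime_le; first by apply: is_cvg_nneseries => n _ _.
  apply: nearW => n; apply: le_trans (chain_f n mc m1).
  by apply: lee_sum => k _; exact: chain_mass_le.

set S := limn _ => Soo.
have mfin n : m n setT \is a fin_num.
  rewrite ge0_fin_numE// (@le_lt_trans _ _ 1)// ?ltry//.
  rewrite -(chain_mass_sum n mc m1) -[leLHS]add0e leeD2r//.
  by apply: sume_ge0 => k _; by apply: integral_ge0.
have S0 : 0 <= S by apply: nneseries_ge0 => k _ _.
have Sfin : S \is a fin_num by rewrite ge0_fin_numE.
have mono n : m n.+1 setT <= m n setT.
  by rewrite -(chain_mass n mc) leeDl//; apply: integral_ge0.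
have bnd n : (n%:R * fine (m n setT) <= fine S)%R.
  rewrite -lee_fin fineK// EFinM fineK//.
  apply: (@le_trans _ _ (\sum_(0 <= k < n) m k setT)); last first.
    by rewrite /S; apply: nneseries_lim_ge.
  elim: n => [|n IH]; first by rewrite mul0e big_geq.
  rewrite big_nat_recr//= -natr1 EFinD muleDl// mul1e; apply: leeD; last exact: mono.
  by apply: le_trans IH; apply: lee_wpmul2l.
have -> : (fun n => m n setT) = (fun n => (fine (m n setT))%:E).
  by apply/funext => n; rewrite fineK.
apply: cvg_EFin; first exact: nearW.
rewrite /= -(cvg_shiftS (fun n => fine (m n setT))).
apply: (@squeeze_cvgr _ _ _ _ (fun=> 0%R) (fun n => fine S * harmonic n)%R).
- apply: nearW => n; rewrite fine_ge0//= /harmonic.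
  by rewrite ler_pdivlMr// mulrC; exact: bnd.
- exact: cvg_cst.
- by rewrite -[X in _ --> X](mulr0 (fine S)); apply: cvgMr; exact: cvg_harmonic.
Qed.

Let chain_nun : chain nun. Proof. by move=> n h; exact: nunS. Qed.

Let chain_resit x : chain (fun n => resit n x).
Proof. by move=> n h; exact: resitS. Qed.

Let nun01 : nun 0%N setT = 1.
Proof.
have := nun0 (fun _ => lee01) (measurable_cst _ : measurable_fun setT (cst 1)).
by rewrite !integral_cst// !mul1e => ->; exact: probability_setT.
Qed.

Let resit01 x : resit 0%N x setT = 1.
Proof. by rewrite /= diracT. Qed.

(** The occupation measure of an excursion started from [nu] and run until the next regeneration;
    normalized, it is the invariant measure. *)
Let msum : {measure set X -> \bar R} := mseries nun 0.

Let msum_int h : (forall y, 0 <= h y) -> measurable_fun setT h ->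
  \int[msum]_y h y = \sum_(0 <= n <oo) \int[nun n]_y h y.
Proof. by move=> h0 mh; rewrite ge0_integral_measure_series. Qed.

Let Voo : \int[nun 0]_y (V y)%:E < +oo.
Proof. by rewrite nun0. Qed.

(** Regeneration is certain: the surviving mass tends to 0, so the killed mass adds up to 1. *)
Let msum_s : \int[msum]_y (s y)%:E = 1.
Proof.
rewrite msum_int//; apply/cvg_lim => //.
have -> : (fun n => \sum_(0 <= i < n) \int[nun i]_y (s y)%:E) = (fun n => 1 - nun n setT).
  apply/funext => n; rewrite -(chain_mass_sum n chain_nun nun01) addeK//.
  rewrite ge0_fin_numE// (@le_lt_trans _ _ 1)// ?ltry//.
  rewrite -(chain_mass_sum n chain_nun nun01) -[leLHS]add0e leeD2r//.
  by apply: sume_ge0 => k _; by apply: integral_ge0.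
rewrite -[X in _ --> X]sube0; apply: cvgeB => //; first exact: cvg_cst.
exact: chain_to0 chain_nun nun01 Voo.
Qed.

Let msum_f : \int[msum]_y (f y)%:E < +oo.
Proof.
apply: (@le_lt_trans _ _ (\int[nun 0%N]_y (V y)%:E + (b / c)%:E)); last first.
  by rewrite lte_add_pinfty// ltry.
rewrite msum_int//; apply: lime_le.
  by apply: is_cvg_nneseries => n _ _; by apply: integral_ge0.
by apply: nearW => n; exact: (chain_f n chain_nun nun01).
Qed.

Let msumT_lty : msum setT < +oo.
Proof.
apply: le_lt_trans msum_f; rewrite -[leLHS]mul1e -integral_cst//.
by apply: ge0_le_integral => // y _; rewrite lee_fin.
Qed.

Let msumT_gt0 : 0 < msum setT.
Proof.
apply: (@lt_le_trans _ _ 1); first exact: lte01.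
have := @nneseries_lim_ge R (fun n => nun n setT) xpredT 0 1 (fun _ _ _ => measure_ge0 _ _).
by rewrite big_nat1 nun01.
Qed.

(** Applying the residual kernel to the series shifts it by one term, and the missing term [nu] is
    restored by the regenerations, whose total mass is 1 by [msum_s]. *)
Let msum_inv B : measurable B -> \int[msum]_x P x B = msum B.
Proof.
move=> mB.
have mI : measurable_fun setT (fun x => (\1_B x)%:E : \bar R).
  by apply/measurable_EFinP; exact: measurable_indic.
have I0 x : 0 <= (\1_B x)%:E :> \bar R by rewrite lee_fin.
have PE x : P x B = \int[resk x]_y (\1_B y)%:E + (s x)%:E * nu B.
  by have := Psplit x I0 mI; rewrite !integral_indic// !setIT.
under eq_integral do rewrite PE.
rewrite ge0_integralD//; last 4 first.
- by move=> y _; by apply: integral_ge0.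
- exact: mres_int.
- by move=> y _; rewrite mule_ge0.
- by apply: emeasurable_funM.
rewrite ge0_integralZr// msum_s mul1e msum_int//; last 2 first.
- by move=> y; by apply: integral_ge0.
- exact: mres_int.
have nunB n : \int[nun n]_y (\1_B y)%:E = nun n B by rewrite integral_indic// setIT.
transitivity (\sum_(0 <= n <oo) nun n.+1 B + nu B).
  by congr (_ + _); apply: eq_eseriesr => n _; rewrite -nunB nunS.
have <- : nun 0%N B = nu B by rewrite -nunB nun0// integral_indic// setIT.
rewrite addeC /msum/= /mseries [RHS]nneseries_recl//; congr (_ + _).
by rewrite -[RHS](@nneseries_addn R (fun n => nun n B) 1)//; apply: eq_eseriesr => i _; rewrite addn1.
Qed.

(** Iterates the decomposition of an invariant [mu] into its residual image and [mu(s)] times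
    [nu]. *)
Let inv_split (mu : probability X R) n h :
  (forall B, measurable B -> \int[mu]_x P x B = mu B) ->
  (forall y, 0 <= h y) -> measurable_fun setT h ->
  \int[mu]_x \int[resit n x]_y h y +
  (\int[mu]_x (s x)%:E) * \sum_(0 <= k < n) \int[nun k]_y h y = \int[mu]_x h x.
Proof.
move=> mui; elim: n h => [|n IH] h h0 mh.
  rewrite big_geq// mule0 adde0; apply: eq_integral => x _ /=.
  by rewrite integral_dirac// diracT mul1e.
have h'0 y : 0 <= \int[resk y]_z h z by apply: integral_ge0.
have := IH _ h'0 (mres_int h0 mh).
rewrite -(invariant_integral mui h0 mh) => IH'.
under [RHS]eq_integral do rewrite Psplit//.
rewrite [RHS]ge0_integralD//; last 3 first.
- exact: mres_int.
- by move=> y _; rewrite mule_ge0//; apply: integral_ge0.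
- by apply: emeasurable_funM.
rewrite -IH' ge0_integralZr//; last by apply: integral_ge0.
rewrite -addeA; congr (_ + _).
  by apply: eq_integral => x _; rewrite -resitS.
rewrite -ge0_muleDr; last 2 first.
- by apply: sume_ge0 => k _; apply: integral_ge0.
- by apply: integral_ge0.
congr (_ * _); rewrite big_nat_recl//= nun0// addeC; congr (_ + _).
by apply: eq_bigr => k _; exact: nunS.
Qed.

(** In [inv_split] the integral of [resit n x B] tends to 0 by dominated convergence, since each
    [resit n x] loses all its mass. What remains is a multiple of [msum]. *)
Let inv_unique (mu : probability X R) B :
  (forall B, measurable B -> \int[mu]_x P x B = mu B) -> measurable B ->
  mu B = (\int[mu]_x (s x)%:E) * msum B.
Proof.
move=> mui mB.
have mI : measurable_fun setT (fun x => (\1_B x)%:E : \bar R).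
  by apply/measurable_EFinP; exact: measurable_indic.
have I0 x : 0 <= (\1_B x)%:E :> \bar R by rewrite lee_fin.
have H n : \int[mu]_x resit n x B + (\int[mu]_x (s x)%:E) * \sum_(0 <= k < n) nun k B = mu B.
  have := inv_split n mui I0 mI; rewrite integral_indic// setIT => <-; congr (_ + _ * _).
    by apply: eq_integral => x _; rewrite integral_indic// setIT.
  by apply: eq_bigr => k _; rewrite integral_indic// setIT.
have mr n : measurable_fun setT (fun x => resit n x B).
  exact: (measurable_kernel (resit n)).
have r1 n x : resit n x setT <= 1.
  rewrite -(chain_mass_sum n (chain_resit x) (resit01 x)) -[leLHS]add0e leeD2r//.
  by apply: sume_ge0 => k _; apply: integral_ge0.
have rB1 n x : resit n x B <= resit n x setT by apply: le_measure; rewrite ?inE.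
have lim0 : \int[mu]_x resit n x B @[n --> \oo] --> 0.
  rewrite -[X in _ --> X](integral0 mu setT).
  apply: (@dominated_cvg _ _ _ mu setT measurableT (fun n x => resit n x B) (cst 0) (cst 1)) => //.
  - move=> x _; apply: (squeeze_cvge (f := fun=> 0) (h := fun n => resit n x setT)).
    + by apply: nearW => n; rewrite measure_ge0/=; exact: rB1.
    + exact: cvg_cst.
    + apply: (chain_to0 (chain_resit x) (resit01 x)).
      by rewrite /= integral_dirac// diracT mul1e ltry.
  - exact: finite_measure_integrable_cst.
  - by move=> n x _; rewrite gee0_abs//; exact: le_trans (r1 n x).
have kfin : \int[mu]_x (s x)%:E \is a fin_num.
  rewrite ge0_fin_numE//; last by apply: integral_ge0.
  apply: (@le_lt_trans _ _ (\int[mu]_x (cst c%:E x))).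
    apply: ge0_le_integral => //.
    by move=> x _; rewrite lee_fin /s indicE; case: (_ \in _); rewrite ?mulr1 ?mulr0// ltW.
  have mu1 : mu setT = 1 := probability_setT mu.
  have -> : \int[mu]_x cst c%:E x = c%:E.
    by rewrite -[RHS]mule1 -mu1; exact: integral_cst.
  exact: ltry.
have : \int[mu]_x resit n x B + (\int[mu]_x (s x)%:E) * (\sum_(0 <= k < n) nun k B)
    @[n --> \oo] --> 0 + (\int[mu]_x (s x)%:E) * msum B.
  apply: cvgeD => //; apply: cvgeZl => //.
  by apply: is_cvg_nneseries => n _ _.
under eq_cvg do rewrite H.
by rewrite add0e; apply: cvg_unique => //; exact: cvg_cst.
Qed.

Theorem harris : exists mu : probability X R,
  [/\ forall B, measurable B -> \int[mu]_x P x B = mu B,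
      forall mu' : probability X R,
        (forall B, measurable B -> \int[mu']_x P x B = mu' B) ->
        forall B, measurable B -> mu' B = mu B
    & \int[mu]_x (f x)%:E < +oo].
Proof.
pose r := (fine (msum setT))^-1%R.
have Tfin : msum setT \is a fin_num by rewrite ge0_fin_numE.
have T0 : (0 < fine (msum setT))%R by rewrite fine_gt0// msumT_gt0 ltey_eq Tfin.
have r0 : (0 <= r)%R by rewrite invr_ge0 ltW.
have muE B : mnormalize msum nu B = r%:E * msum B.
  by rewrite /mnormalize gt_eqF//= lt_eqF//= muleC.
have muI h : (forall y, 0 <= h y) -> measurable_fun setT h ->
    \int[mnormalize msum nu]_x h x = r%:E * \int[msum]_x h x.
  move=> h0 mh; rewrite -(ge0_integral_mscale msum measurableT (NngNum r0))//.
  by apply: eq_measure_integral => A mA _; rewrite -[LHS]/(mnormalize msum nu A) muE.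
exists (mnormalize msum nu); split.
- move=> B mB; rewrite muI//; last exact: measurable_kernel.
  by rewrite msum_inv// -muE.
- move=> mu' mui B mB; rewrite -[RHS]/(mnormalize msum nu B) muE (inv_unique mui mB); congr (_ * _).
  have := inv_unique mui measurableT; rewrite probability_setT -(fineK Tfin).
  set k := integral _ _ _ => H.
  have -> : k = k * ((fine (msum setT))%:E * r%:E).
    by rewrite -EFinM mulfV ?gt_eqF// mule1.
  by rewrite muleA -H mul1e.
- by rewrite muI// lte_mul_pinfty ?lee_fin.
Qed.
End drift.
End Residual.

(** * Brownian increments and Gaussian vectors *)

(** Rows with their Borel sets; [borel_state] is an instance. *)
Definition brv (R : realType) (n : nat) : measurableType _ :=
  g_sigma_algebraType (@open 'rV[R]_n).

Definition rbox {R : realType} {n : nat} (C : 'I_n -> set R) : set 'rV[R]_n :=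
  [set x | forall i, C i (x 0 i)].

Section BorelRow.
Context {R : realType} {n : nat}.

Lemma open_brv (U : set 'rV[R]_n) : open U -> measurable (U : set (brv R n)).
Proof. by move=> oU; exact: sub_sigma_algebra. Qed.

Lemma continuous_brv (f : 'rV[R]_n -> R) :
  continuous f -> measurable_fun setT (f : brv R n -> R).
Proof.
move=> cf; apply: (measurability _ (RGenOpens.measurableE R)).
move=> _ [_ [a [b ->]] <-]; rewrite setTI; apply: open_brv.
by apply: open_comp => // x _; exact: cf.
Qed.

Lemma coord_brv i : measurable_fun setT (fun x : brv R n => (x : 'rV[R]_n) 0 i).
Proof. apply: continuous_brv; exact: coord_continuous. Qed.

Lemma rbox_measurable (C : 'I_n -> set R) :
  (forall i, measurable (C i)) -> measurable (rbox C : set (brv R n)).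
Proof.
move=> mC; have -> : rbox C = \bigcap_(i in [set: 'I_n]) [set x | C i (x 0 i)].
  by apply/seteqP; split=> [x Cx i _|x Cx i]; [exact: Cx|exact: (Cx i)].
apply: fin_bigcap_measurable => // i _.
by rewrite -[X in measurable X]setTI; exact: (coord_brv i measurableT (mC i)).
Qed.

Let qbox (ab : 'rV[rat]_n * 'rV[rat]_n) : set 'rV[R]_n :=
  rbox (fun i => `]ratr (ab.1 0 i), ratr (ab.2 0 i)[%classic).

Lemma open_brvE (U : set 'rV[R]_n) : open U ->
  U = \bigcup_(ab in [set ab | qbox ab `<=` U]) qbox ab.
Proof.
move=> oU; apply/seteqP; split; last by move=> x [ab /= abU]; exact: abU.
move=> x Ux; have /nbhs_ballP[e /= e0 xeU] : nbhs x U by exact: open_nbhs_nbhs.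
have H (i : 'I_n) : exists ab : rat * rat,
    (x 0 i - e < ratr ab.1 < x 0 i) /\ (x 0 i < ratr ab.2 < x 0 i + e).
  have [a] := @rat_in_itvoo R (x 0 i - e) (x 0 i) ltac:(by rewrite ltrBlDr ltrDl).
  rewrite in_itv/= => ax.
  have [b] := @rat_in_itvoo R (x 0 i) (x 0 i + e) ltac:(by rewrite ltrDl).
  by rewrite in_itv/= => bx; exists (a, b).
have {H}[f fP] := choice H.
exists (\row_i (f i).1, \row_i (f i).2); last first.
  by move=> i /=; rewrite in_itv/= !mxE; have [/andP[_ ->] /andP[->]] := fP i.
move=> y yb; apply: xeU; split=> // i j; rewrite ord1.
have := yb j; rewrite /= in_itv/= !mxE => /andP[y1 y2].
have [/andP[f1 _] /andP[_ f2]] := fP j.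
rewrite /ball/= ltr_distlC; apply/andP; split.
  exact: lt_trans y1.
exact: lt_trans f2.
Qed.

(** Rational boxes are a countable base of the topology, so the Borel sets form the product
    sigma-algebra. Laws and independence can then be tested on boxes, and measurability on
    coordinates. *)
Lemma brvE : @measurable _ (brv R n) =
  <<s [set rbox C | C in [set C : 'I_n -> set R | forall i, measurable (C i)]] >>.
Proof.
apply/seteqP; split.
  apply: smallest_sub; first exact: smallest_sigma_algebra.
  move=> U oU; rewrite (open_brvE oU) bigcup_mkcond.
  set G := (X in <<s X >>).
  apply: (@countable_bigcupT_measurable _ (g_sigma_algebraType G)).
    exact: countableP.
  move=> ab; case: ifPn => _; last exact: (@measurable0 _ (g_sigma_algebraType G)).
  apply: sub_sigma_algebra; eexists; last reflexivity.
  by move=> i /=; exact: measurable_itv.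
apply: smallest_sub; first exact: sigma_algebra_measurable.
by move=> _ [C mC <-]; exact: rbox_measurable.
Qed.

Lemma rboxI (C D : 'I_n -> set R) : rbox C `&` rbox D = rbox (fun i => C i `&` D i).
Proof.
apply/seteqP; split=> [x [Cx Dx] i|x CDx]; first by split; [exact: Cx|exact: Dx].
by split=> i; case: (CDx i).
Qed.

Lemma rboxT : rbox (fun _ : 'I_n => setT) = [set: 'rV[R]_n].
Proof. by apply/seteqP; split. Qed.

Lemma rbox_setI_closed :
  setI_closed [set rbox C | C in [set C : 'I_n -> set R | forall i, measurable (C i)]].
Proof.
move=> _ _ [C mC <-] [D mD <-]; rewrite rboxI; eexists; last reflexivity.
by move=> i /=; exact: measurableI.
Qed.

Lemma brv_measurable_fun {d} {T : measurableType d} (f : T -> 'rV[R]_n) :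
  (forall i, measurable_fun setT (fun x => f x 0 i)) ->
  measurable_fun setT (f : T -> brv R n).
Proof.
move=> mf; apply: (measurability _ brvE) => _ [_ [C mC <-] <-]; rewrite setTI.
have -> : f @^-1` rbox C = \bigcap_(i in [set: 'I_n]) ((fun x => f x 0 i) @^-1` C i).
  by apply/seteqP; split=> [x Cx i _|x Cx i]; [exact: Cx|exact: (Cx i)].
apply: fin_bigcap_measurable => // i _.
by rewrite -[X in measurable X]setTI; exact: mf.
Qed.

Lemma brv_coord {d} {T : measurableType d} (f : T -> 'rV[R]_n) i :
  measurable_fun setT (f : T -> brv R n) -> measurable_fun setT (fun x => f x 0 i).
Proof. by move=> mf; apply: (measurableT_comp (coord_brv i) mf). Qed.

Lemma brv_measure_eq (m1 m2 : {measure set (brv R n) -> \bar R}) :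
  (m1 setT < +oo)%E ->
  (forall C : 'I_n -> set R, (forall i, measurable (C i)) -> m1 (rbox C) = m2 (rbox C)) ->
  forall B : set (brv R n), measurable B -> m1 B = m2 B.
Proof.
move=> m1oo m12 B mB.
apply: (@measure_unique _ R (brv R n)
  [set rbox C | C in [set C : 'I_n -> set R | forall i, measurable (C i)]] (fun=> setT)) => //.
- exact: brvE.
- exact: rbox_setI_closed.
- by move=> _; exists (fun=> setT); [move=> i /=; exact: measurableT|exact: rboxT].
- by rewrite bigcup_const//; exists 0%N.
- by move=> _ [C mC <-]; exact: m12.
Qed.

End BorelRow.

Section Law.
Local Open Scope ereal_scope.
Context {R : realType} {d d1 : measure_display} {Omega : measurableType d}.
Variable P : probability Omega R.

Definition mfun_of {T : measurableType d1} (X : Omega -> T)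
  (mX : measurable_fun setT X) : {mfun Omega >-> T} :=
  HB.pack X (isMeasurableFun.Build _ _ _ _ X mX).

Definition law {T : measurableType d1} (X : Omega -> T)
  (mX : measurable_fun setT X) : probability T R := distribution P (mfun_of mX).

Lemma ge0_integral_law {T : measurableType d1} (X : Omega -> T)
    (mX : measurable_fun setT X) (f : T -> \bar R) :
  measurable_fun setT f -> (forall x, 0 <= f x) ->
  \int[law mX]_x f x = \int[P]_om f (X om).
Proof. by move=> mf f0; rewrite /law ge0_integral_distribution. Qed.

End Law.

Section ImageMeasure.
Local Open Scope ereal_scope.
Context {R : realType} {d d1 : measure_display} {T : measurableType d}
  {T1 : measurableType d1}.
Variables (m : {measure set T -> \bar R}) (X : T -> T1) (mX : measurable_fun setT X).

Definition image_measure (B : set T1) : \bar R := m (X @^-1` B).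

Let im0 : image_measure set0 = 0.
Proof. by rewrite /image_measure preimage_set0 measure0. Qed.

Let im_ge0 B : 0 <= image_measure B.
Proof. exact: measure_ge0. Qed.

Let im_sigma : semi_sigma_additive image_measure.
Proof.
move=> F mF tF mU; rewrite /image_measure preimage_bigcup.
have mFi U : measurable U -> measurable (X @^-1` U).
  by move=> ?; rewrite -[X in measurable X]setTI; exact: mX.
apply: measure_semi_sigma_additive => [i||]; first exact: mFi.
- apply/trivIsetP => i j _ _ ij; rewrite -preimage_setI.
  by move/trivIsetP : tF => /(_ _ _ _ _ ij) ->//; rewrite preimage_set0.
- by rewrite -preimage_bigcup; exact: mFi.
Qed.

HB.instance Definition _ := isMeasure.Build _ _ _ image_measure im0 im_ge0 im_sigma.

Definition imagem : {measure set T1 -> \bar R} := image_measure.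

End ImageMeasure.

Lemma integral_prob_cst {R : realType} {d} {T : measurableType d}
  (P : probability T R) (c : \bar R) : (\int[P]_x c = c)%E.
Proof. by rewrite -[RHS]mule1 -(probability_setT P); exact: integral_cst. Qed.

Section Independence.
Local Open Scope ereal_scope.
Context {R : realType} {d d1 d2 : measure_display} {Omega : measurableType d}.
Variable P : probability Omega R.

Definition indep {T1 : measurableType d1} {T2 : measurableType d2}
    (X : Omega -> T1) (Y : Omega -> T2) := forall A B, measurable A -> measurable B ->
  P (X @^-1` A `&` Y @^-1` B) = P (X @^-1` A) * P (Y @^-1` B).

(** The joint law is the product law, so Tonelli's theorem freezes [X] while [Y] is averaged over an
    independent copy. *)
Lemma indep_integral {T1 : measurableType d1} {T2 : measurableType d2}
    (X : Omega -> T1) (Y : Omega -> T2) (phi : T1 * T2 -> \bar R) :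
  measurable_fun setT X -> measurable_fun setT Y -> indep X Y ->
  measurable_fun setT phi -> (forall z, 0 <= phi z) ->
  \int[P]_om phi (X om, Y om) = \int[P]_om \int[P]_om' phi (X om, Y om').
Proof.
move=> mX mY iXY mphi phi0.
have mXY : measurable_fun setT (fun om => (X om, Y om)) by exact: measurable_fun_pair.
rewrite -(ge0_integral_law P mXY)//.
transitivity (\int[law P mX \x law P mY]_z phi z).
  apply: eq_measure_integral => A mA _; apply/esym/product_measure_unique => // B C mB mC.
rewrite fubini_tonelli1//.
rewrite (ge0_integral_law P mX); last 2 first.
- apply: (measurable_fun_fubini_tonelli_F (m2 := law P mY)) => //.
- by move=> x; apply: integral_ge0.
apply: eq_integral => om _; rewrite /fubini_F (ge0_integral_law P mY)//.
exact: measurableT_comp.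
Qed.

End Independence.

Section RowIndependence.
Local Open Scope ereal_scope.
Context {R : realType} {d : measure_display} {Omega : measurableType d}.
Variable P : probability Omega R.

(** For fixed [E] both sides are finite measures in [A]: the law of [Z] under [P] restricted to [E],
    and a multiple of the law of [Z]. They agree on boxes. *)
Lemma indep_event_rbox (E : set Omega) k (Z : Omega -> brv R k) :
  measurable E -> measurable_fun setT Z ->
  (forall C, (forall i, measurable (C i)) ->
      P (E `&` Z @^-1` rbox C) = P E * P (Z @^-1` rbox C)) ->
  forall A, measurable A -> P (E `&` Z @^-1` A) = P E * P (Z @^-1` A).
Proof.
move=> mE mZ H A mA.
have nn : (0 <= fine (P E))%R by rewrite fine_ge0.
have fE : (fine (P E))%:E = P E by rewrite fineK// fin_num_measure.
pose m2 : {measure set (brv R k) -> \bar R} := mscale (NngNum nn) (law P mZ).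
have m2E S : m2 S = P E * P (Z @^-1` S) by rewrite -[in RHS]fE.
have := @brv_measure_eq R k (imagem (mrestr P mE) mZ) m2 _ _ A mA.
rewrite m2E => <-; first by rewrite setIC.
  apply: (@le_lt_trans _ _ 1); last exact: ltry.
  rewrite -[leLHS]/(P (Z @^-1` setT `&` E)) probability_le1//.
  by apply: measurableI => //; rewrite preimage_setT.
by move=> C mC; rewrite m2E -H//= /image_measure /mrestr setIC.
Qed.

Lemma indep_rbox a b (X : Omega -> brv R a) (Y : Omega -> brv R b) :
  measurable_fun setT X -> measurable_fun setT Y ->
  (forall C D, (forall i, measurable (C i)) -> (forall i, measurable (D i)) ->
   P (X @^-1` rbox C `&` Y @^-1` rbox D) = P (X @^-1` rbox C) * P (Y @^-1` rbox D)) ->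
  indep P X Y.
Proof.
move=> mX mY XY A B mA mB.
have mXi U : measurable U -> measurable (X @^-1` U).
  by move=> mU; rewrite -[X in measurable X]setTI; exact: mX.
have mYi U : measurable U -> measurable (Y @^-1` U).
  by move=> mU; rewrite -[X in measurable X]setTI; exact: mY.
apply: indep_event_rbox => //; first exact: mXi.
move=> D mD; rewrite setIC muleC; apply: indep_event_rbox => //.
  by apply: mYi; exact: rbox_measurable.
by move=> C mC; rewrite setIC muleC XY.
Qed.

End RowIndependence.

Section Increments.
Context {R : realType} {d : measure_display} {Omega : measurableType d}.
Variable P : probability Omega R.
Context {I : finType}.
Variable W : I -> R -> Omega -> R.
Hypothesis hW : forall i, brownian P (W i).
Hypothesis hWind : independent_processes P W.

(** The times go on indefinitely, so that blocks of any length can be cut from a grid and a grid can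
    be shifted. *)
Definition grid (t : nat -> R) := (0 <= t 0%N)%R /\ forall j, (t j < t j.+1)%R.

Lemma grid_mono t : grid t -> forall j k, (j <= k)%N -> (t j <= t k)%R.
Proof.
move=> [_ ti] j k; elim: k => [|k IH]; first by rewrite leqn0 => /eqP ->.
rewrite leq_eqVlt => /orP[/eqP -> //|]; rewrite ltnS => /IH jk.
exact: le_trans (ltW (ti k)).
Qed.

Lemma grid_ge0 t : grid t -> forall j, (0 <= t j)%R.
Proof. by move=> gt j; apply: le_trans (grid_mono gt (leq0n j)); case: gt. Qed.

Lemma grid_shift t a : grid t -> grid (fun j => t (a + j)%N).
Proof. by move=> gt; split=> [|j]; [exact: grid_ge0|rewrite addnS; exact: gt.2]. Qed.

Definition incr (t : nat -> R) (j : nat) (i : I) (om : Omega) : R :=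
  (W i (t j.+1) om - W i (t j) om)%R.

Definition step_law (t : nat -> R) (j : nat) : set R -> \bar R :=
  normal_prob 0 (Num.sqrt (t j.+1 - t j)).

Let incr_event t m (C : nat -> set R) i : set Omega :=
  [set om | forall j, (j < m)%N -> C j (incr t j i om)].

Let sigma_W i D s : D s ->
  measurable_fun setT (W i s : g_sigma_algebraType
    [set E | exists2 t, D t & exists2 C, measurable C & E = W i t @^-1` C] -> R).
Proof.
move=> Ds _ C mC; rewrite setTI; apply: sub_sigma_algebra.
by exists s => //; exists C.
Qed.

Let incr_eventS t m C i :
  incr_event t m.+1 C i = incr_event t m C i `&` incr t m i @^-1` C m.
Proof.
apply/seteqP; split=> [om H|om [H Hm] j].
  by split=> [j jm|]; apply: H => //; exact: ltnW.
by rewrite ltnS leq_eqVlt => /orP[/eqP -> //|]; exact: H.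
Qed.

Let incr_event0 t C i : incr_event t 0 C i = setT.
Proof. by apply/seteqP; split. Qed.

Lemma sigma_process_event t m C i : grid t -> (forall j, measurable (C j)) ->
  sigma_process `[0, t m]%classic (W i) (incr_event t m C i).
Proof.
move=> gt mC.
set G := [set E | exists2 s, `[0, t m]%classic s &
  exists2 C, measurable C & E = W i s @^-1` C].
suff H k : (k <= m)%N -> @measurable _ (g_sigma_algebraType G) (incr_event t k C i) by exact: H.
elim: k => [_|k IH km]; first by rewrite incr_event0; exact: (@measurableT _ (g_sigma_algebraType G)).
rewrite incr_eventS; apply: measurableI; first by apply: IH; exact: ltnW.
have mi : measurable_fun setT (incr t k i : g_sigma_algebraType G -> R).
  apply: measurable_funB; apply: sigma_W; rewrite /= in_itv/= grid_ge0//=.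
    exact: grid_mono.
  by apply: grid_mono => //; exact: ltnW.
by rewrite -[X in measurable X]setTI; exact: mi.
Qed.

Lemma sigma_process_sub i (D D' : set R) : D `<=` D' ->
  sigma_process D (W i) `<=` sigma_process D' (W i).
Proof.
move=> DD'; apply: sub_sigma_algebra2 => E [s Ds HE]; exists s => //; exact: DD'.
Qed.

Lemma incr_measurable t j i : grid t -> measurable_fun setT (incr t j i).
Proof.
by move=> gt; apply: measurable_funB; apply: (brownian_meas (hW i)); exact: grid_ge0.
Qed.

Let prob_event t m C i : grid t -> (forall j, measurable (C j)) ->
  P (incr_event t m C i) = (\prod_(j < m) step_law t j (C j))%E.
Proof.
move=> gt mC; elim: m => [|m IH].
  by rewrite incr_event0 big_ord0 probability_setT.
rewrite incr_eventS big_ord_recr/= -IH.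
rewrite (brownian_indep (hW i))//; last 3 first.
- exact: grid_ge0.
- exact: gt.2.
- exact: sigma_process_event.
by congr (_ * _)%E; apply: (brownian_law (hW i)) => //; [exact: grid_ge0|exact: gt.2].
Qed.

(** Independence of the motions factors the event over [i]; within one motion [brownian_indep]
    splits off the last increment, by induction on [m]. *)
Lemma incr_product t m (C : I -> nat -> set R) : grid t ->
  (forall i j, measurable (C i j)) ->
  P [set om | forall i j, (j < m)%N -> C i j (incr t j i om)] =
  (\prod_(i : I) \prod_(j < m) step_law t j (C i j))%E.
Proof.
move=> gt mC; rewrite -(eq_bigr _ (fun i _ => prob_event m i gt (mC i))) -hWind.
  congr (P _); apply/seteqP; split=> [om H i _ j jm|om H i j jm]; first exact: H.
  exact: (H i).
move=> i; have S : sigma_process `[0%R, t m]%classic (W i) `<=`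
    sigma_process `[0%R, +oo[%classic (W i).
  by apply: sigma_process_sub => x /=; rewrite !in_itv/= andbT => /andP[].
exact: (S _ (sigma_process_event gt (mC i))).
Qed.

(** All increments are flattened into one row because laws and independence are compared on boxes of
    rows. *)
Definition incr_row (t : nat -> R) (m : nat) (om : Omega) :
    'rV[R]_#|{: I * 'I_m}| :=
  \row_k (let ij : I * 'I_m := enum_val k in incr t ij.2 ij.1 om).

Lemma incr_row_measurable t m : grid t ->
  measurable_fun setT (incr_row t m : Omega -> brv R _).
Proof.
move=> gt; apply: brv_measurable_fun => k; under eq_fun do rewrite mxE.
exact: incr_measurable.
Qed.

Let fam m (C : 'I_#|{: I * 'I_m}| -> set R) (i : I) (j : nat) : set R :=
  if insub j is Some j' then C (enum_rank (i, j')) else setT.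

Let fam_measurable m C : (forall k, measurable (C k)) -> forall i j, measurable (@fam m C i j).
Proof. by move=> mC i j; rewrite /fam; case: insub => [j'|]. Qed.

Let incr_row_event t m C : incr_row t m @^-1` rbox C =
  [set om | forall i j, (j < m)%N -> fam C i j (incr t j i om)].
Proof.
apply/seteqP; split=> om H.
  move=> i j jm; rewrite /fam insubT//=.
  by have := H (enum_rank (i, Ordinal jm)); rewrite mxE enum_rankK.
move=> k; rewrite mxE; have := H (enum_val k : I * 'I_m).1 (enum_val k : I * 'I_m).2 (ltn_ord _).
by rewrite /fam valK -surjective_pairing enum_valK.
Qed.

Lemma incr_row_prob t m C : grid t -> (forall k, measurable (C k)) ->
  P (incr_row t m @^-1` rbox C) =
  (\prod_(i : I) \prod_(j < m) step_law t j (C (enum_rank (i, j))))%E.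
Proof.
move=> gt mC; rewrite incr_row_event incr_product//; last exact: fam_measurable.
by apply: eq_bigr => i _; apply: eq_bigr => j _; rewrite /fam valK.
Qed.

Lemma incr_row_probE t m C : grid t -> (forall k, measurable (C k)) ->
  P (incr_row t m @^-1` rbox C) =
  (\prod_(k < #|{: I * 'I_m}|) step_law t (enum_val k : I * 'I_m).2 (C k))%E.
Proof.
move=> gt mC; rewrite incr_row_prob// pair_big/=.
rewrite (reindex (@enum_val _ [pred x : I * 'I_m | true]))/=; last first.
  by apply: onW_bij; exact: enum_val_bij.
by apply: eq_bigr => k _; rewrite -surjective_pairing enum_valK.
Qed.

(** Stationarity: on boxes the law is a product of Gaussians whose variances are the step
    lengths. *)
Lemma incr_row_law t t' m : grid t -> grid t' ->
  (forall j, (j < m)%N -> (t j.+1 - t j = t' j.+1 - t' j)%R) ->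
  forall B, measurable (B : set (brv R _)) ->
    P (incr_row t m @^-1` B) = P (incr_row t' m @^-1` B).
Proof.
move=> gt gt' tt' B mB.
have E u (gu : grid u) C : (forall k, measurable (C k)) ->
    imagem P (@incr_row_measurable u m gu) (rbox C) =
    (\prod_(i : I) \prod_(j < m) step_law u j (C (enum_rank (i, j))))%E.
  by move=> mC; exact: incr_row_prob.
have := @brv_measure_eq R _ (imagem P (@incr_row_measurable t m gt))
  (imagem P (@incr_row_measurable t' m gt')) _ _ B mB; apply.
  by rewrite (le_lt_trans (probability_le1 _ _)) ?ltry// preimage_setT.
move=> C mC; apply: (etrans (E t gt C mC)); apply: (etrans _ (esym (E t' gt' C mC))).
apply: eq_bigr => i _; apply: eq_bigr => j _.
by rewrite /step_law tt'.
Qed.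

(** Both blocks belong to a single block of m + m' increments, whose product formula splits. *)
Lemma incr_row_indep t m m' : grid t ->
  indep P (incr_row t m : _ -> brv R _)
    (incr_row (fun j => t (m + j)%N) m' : _ -> brv R _).
Proof.
move=> gt; have gt' := grid_shift m gt.
apply: indep_rbox; [exact: incr_row_measurable|exact: incr_row_measurable|].
move=> C D mC mD.
pose F i j := if (j < m)%N then fam C i j else fam D i (j - m)%N.
have mF i j : measurable (F i j) by rewrite /F; case: ifP => _; exact: fam_measurable.
have -> : incr_row t m @^-1` rbox C `&` incr_row (fun j => t (m + j)%N) m' @^-1` rbox D =
    [set om | forall i j, (j < m + m')%N -> F i j (incr t j i om)].
  rewrite !incr_row_event; apply/seteqP; split=> om.
    move=> [H1 H2] i j jm; rewrite /F; case: ltnP => jm1; first exact: H1.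
    have := H2 i (j - m)%N; rewrite /incr addnS subnKC//; apply.
    by rewrite ltn_subLR.
  move=> H; split=> i j jm.
    by have := H i j (ltn_addr _ jm); rewrite /F jm.
  have := H i (m + j)%N; rewrite ltn_add2l jm /F ltnNge leq_addr/= addKn.
  by rewrite /incr addnS; apply.
rewrite incr_product// !incr_row_prob// -big_split/=; apply: eq_bigr => i _.
rewrite big_split_ord; apply: congr2; apply: eq_bigr => j _.
  have -> : (lshift m' j : nat) = j by [].
  by rewrite /F ltn_ord /fam valK.
have -> : (rshift m j : nat) = (m + j)%N by [].
by rewrite /F ltnNge leq_addr addKn /fam valK /step_law addnS.
Qed.

End Increments.

(** * Densities, Gaussian estimates and the Cameron-Martin shift *)

Section Density.
Local Open Scope ereal_scope.
Context {R : realType} {d : measure_display} {T : measurableType d}.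
Variables (mu : {measure set T -> \bar R}) (g : T -> R).
Hypotheses (g0 : forall x, (0 <= g x)%R) (mg : measurable_fun setT g).

Let g0' x : 0 <= (g x)%:E. Proof. by rewrite lee_fin. Qed.
Let mg' : measurable_fun setT (fun x => (g x)%:E). Proof. exact/measurable_EFinP. Qed.

Definition density_of (A : set T) : \bar R := \int[mu]_(x in A) (g x)%:E.

Let den0 : density_of set0 = 0.
Proof. by rewrite /density_of integral_set0. Qed.

Let den_ge0 A : 0 <= density_of A.
Proof. by apply: integral_ge0. Qed.

Let den_sigma : semi_sigma_additive density_of.
Proof.
move=> F mF tF mU; rewrite /density_of ge0_integral_bigcup//; last first.
  by apply: measurable_funTS.
by apply: is_cvg_nneseries => n _ _; exact: integral_ge0.
Qed.

HB.instance Definition _ := isMeasure.Build _ _ _ density_of den0 den_ge0 den_sigma.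

Definition density : {measure set T -> \bar R} := density_of.

Import HBNNSimple.

(** [m] is any measure that has density [g] on measurable sets, so that the lemma also covers
    [normal_prob]. The identity is checked on simple functions and passes to monotone limits. *)
Lemma integral_density (f : T -> \bar R) (m : {measure set T -> \bar R}) :
  (forall A, measurable A -> m A = \int[mu]_(x in A) (g x)%:E) ->
  (forall x, 0 <= f x) -> measurable_fun setT f ->
  \int[m]_x f x = \int[mu]_x (f x * (g x)%:E).
Proof.
move=> mE f0 mf; pose h := nnsfun_approx measurableT mf.
have -> : \int[m]_x f x = lim (\int[m]_x (h n x)%:E @[n --> \oo]).
  have fE x : f x = lim ((h n x)%:E @[n --> \oo]).
    by apply/esym/cvg_lim => //; exact: cvg_nnsfun_approx.
  under eq_integral do rewrite fE.
  apply: monotone_convergence => //.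
  - by move=> n; exact/measurable_EFinP.
  - by move=> n x _; rewrite lee_fin.
  - by move=> x _ a b ab; rewrite lee_fin; exact/lefP/nd_nnsfun_approx.
have cv x : (h n x)%:E * (g x)%:E @[n --> \oo] --> f x * (g x)%:E.
  by apply: cvgeZr => //; exact: cvg_nnsfun_approx.
have -> : \int[mu]_x (f x * (g x)%:E) = lim (\int[mu]_x ((h n x)%:E * (g x)%:E) @[n --> \oo]).
  have fgE x : f x * (g x)%:E = lim ((h n x)%:E * (g x)%:E @[n --> \oo]).
    by apply/esym/cvg_lim => //; exact: cv.
  under eq_integral do rewrite fgE.
  apply: monotone_convergence => //.
  - by move=> n; apply: emeasurable_funM => //; exact/measurable_EFinP.
  - by move=> n x _; rewrite mule_ge0// lee_fin.
  - move=> x _ a b ab; rewrite lee_wpmul2r// lee_fin.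
    exact/lefP/nd_nnsfun_approx.
congr (limn _); apply/funext => n.
transitivity (\int[m]_x (\sum_(y \in range (h n)) (y * \1_(h n @^-1` [set y]) x)%:E)).
  by apply: eq_integral => t _; rewrite (fimfunE (h n)) -fsumEFin.
have indich r : measurable_fun setT (fun x => (r * \1_(h n @^-1` [set r]) x)%:E).
  by apply/measurable_EFinP; exact: measurable_funM.
rewrite ge0_integral_fsum//; last by move=> y x _; exact: nnfun_muleindic_ge0.
transitivity (\int[mu]_x (\sum_(y \in range (h n))
    (y * \1_(h n @^-1` [set y]) x)%:E * (g x)%:E)); last first.
  apply: eq_integral => x _; rewrite -ge0_mule_fsuml => [|y]; last exact: nnfun_muleindic_ge0.
  by rewrite fsumEFin // -(fimfunE (h n) x).
rewrite ge0_integral_fsum//; last 2 first.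
  - by move=> y; exact: emeasurable_funM.
  - by move=> y x _; rewrite mule_ge0// nnfun_muleindic_ge0.
apply: eq_fsbigr => r rhn.
have [x _ xr] := set_mem rhn; have r0 : (0 <= r)%R by rewrite -xr.
under [RHS]eq_integral do rewrite EFinM -muleA.
rewrite [RHS]ge0_integralZl//; last 2 first.
- by apply: emeasurable_funM => //; exact/measurable_EFinP.
- by move=> y _; rewrite mule_ge0// lee_fin.
under [LHS]eq_integral do rewrite EFinM.
rewrite [LHS]ge0_integralZl//; last by apply/measurable_EFinP; exact: measurable_indic.
congr (_ * _); rewrite integral_indic// setIT mE//.
rewrite [LHS]integral_mkcond; apply: eq_integral => y _.
rewrite patchE indicE; case: ifP => _; first by rewrite mul1e.
by rewrite mul0e.
Qed.

End Density.

Section Normal.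
Local Open Scope ereal_scope.
Context {R : realType}.
Implicit Types (s a x : R).

Lemma lebesgue_translation a (A : set (measurableTypeR R)) : measurable A ->
  lebesgue_measure ((fun x => x + a)%R @^-1` A) = lebesgue_measure A.
Proof.
have mt : measurable_fun setT ((fun x => x + a)%R : measurableTypeR R -> measurableTypeR R).
  by apply: measurable_funD.
move=> mA; apply/esym; pose m : {measure set (measurableTypeR R) -> \bar R} :=
  imagem (@lebesgue_measure R) mt.
rewrite -[RHS]/(m A); apply: lebesgue_measure_unique => // _ [[u v] _ <-].
rewrite -[RHS]/(lebesgue_measure ((fun x => x + a)%R @^-1` `]u, v]%classic)).
have -> : (fun x => x + a)%R @^-1` `]u, v]%classic = `](u - a)%R, (v - a)%R]%classic.
  by apply/seteqP; split => x /=; rewrite !in_itv/= ltrBlDr lerBrDr.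
by rewrite !lebesgue_measure_itv/= !lte_fin ltrD2r -!EFinB; case: ifP => // _; congr EFin; ring.
Qed.

Lemma integral_translation a (f : R -> \bar R) : (forall x, 0 <= f x) ->
  measurable_fun setT f ->
  \int[lebesgue_measure]_x f (x + a)%R = \int[lebesgue_measure]_x f x.
Proof.
have mt : measurable_fun setT ((fun x => x + a)%R : measurableTypeR R -> measurableTypeR R).
  by apply: measurable_funD.
move=> f0 mf; rewrite -[LHS](ge0_integral_pushforward mt lebesgue_measure measurableT mf) => //.
by apply: eq_measure_integral => A mA _; exact: lebesgue_translation.
Qed.

Lemma integral_opp (f : R -> \bar R) : (forall x, 0 <= f x) ->
  measurable_fun setT f ->
  \int[lebesgue_measure]_x f (- x)%R = \int[lebesgue_measure]_x f x.
Proof.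
have mo : measurable_fun setT (-%R : measurableTypeR R -> measurableTypeR R).
  exact: oppr_measurable.
move=> f0 mf; rewrite -[LHS](ge0_integral_pushforward mo lebesgue_measure measurableT mf) => //.
by apply: eq_measure_integral => A mA _; exact: lebesgue_measureN.
Qed.

Lemma integral_normal s (f : R -> \bar R) : (forall x, 0 <= f x) ->
  measurable_fun setT f ->
  \int[normal_prob 0%R s]_x f x = \int[lebesgue_measure]_x (f x * (normal_pdf 0%R s x)%:E).
Proof.
move=> f0 mf; apply: integral_density => //.
- by move=> x; rewrite normal_pdf_ge0.
- exact: measurable_normal_pdf.
Qed.

(** The density of N(-a, s^2) with respect to N(0, s^2). *)
Definition shift_density a s x : R := expR (- (a * x) / s ^+ 2 - a ^+ 2 / (s ^+ 2 *+ 2)).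

Lemma measurable_shift_density a s : measurable_fun setT (shift_density a s).
Proof.
apply: measurableT_comp => //; apply: measurable_funB => //.
by apply: measurable_funM => //; apply: measurableT_comp => //; apply: measurable_funM.
Qed.

Lemma normal_pdf_shift a s x : (s != 0)%R ->
  (shift_density a s x * normal_pdf 0 s x = normal_pdf 0 s (x + a))%R.
Proof.
move=> s0; rewrite normal_pdfE// /shift_density mulrCA -expRD; congr (_ * expR _)%R.
by field.
Qed.

Lemma normal_shift a s (C : set R) : (s != 0)%R -> measurable C ->
  \int[normal_prob 0%R s]_x ((\1_C (x + a))%:E * (shift_density a s x)%:E) = normal_prob 0%R s C.
Proof.
move=> s0 mC.
have mt : measurable_fun setT ((fun x => x + a)%R : R -> R) by apply: measurable_funD.
rewrite integral_normal; last 2 first.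
- by move=> x; rewrite mule_ge0// lee_fin// expR_ge0.
- apply: emeasurable_funM; apply/measurable_EFinP; last exact: measurable_shift_density.
  by apply: measurableT_comp => //; exact: measurable_indic.
pose F x : \bar R := (\1_C x)%:E * (normal_pdf 0 s x)%:E.
transitivity (\int[lebesgue_measure]_x F (x + a)%R).
  by apply: eq_integral => x _; rewrite /F -muleA -EFinM normal_pdf_shift.
rewrite integral_translation; last 2 first.
- by move=> x; rewrite mule_ge0// lee_fin// normal_pdf_ge0.
- apply: emeasurable_funM; apply/measurable_EFinP; first exact: measurable_indic.
  exact: measurable_normal_pdf.
rewrite /normal_prob [RHS]integral_mkcond; apply: eq_integral => x _.
by rewrite patchE /F indicE; case: ifP => _; rewrite ?mul1e ?mul0e.
Qed.

Lemma normal_sym s (C : set R) : (s != 0)%R -> measurable C ->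
  normal_prob 0%R s ((fun x => - x)%R @^-1` C) = normal_prob 0%R s C.
Proof.
move=> s0 mC; pose F x : \bar R := (\1_C x)%:E * (normal_pdf 0 s x)%:E.
have FE (D : set R) : normal_prob 0%R s D =
    \int[lebesgue_measure]_x ((\1_D x)%:E * (normal_pdf 0 s x)%:E).
  rewrite /normal_prob integral_mkcond; apply: eq_integral => x _.
  by rewrite patchE indicE; case: ifP => _; rewrite ?mul1e ?mul0e.
rewrite !FE -[RHS]integral_opp; last 2 first.
- by move=> x; rewrite mule_ge0// lee_fin// normal_pdf_ge0.
- apply: emeasurable_funM; apply/measurable_EFinP; first exact: measurable_indic.
  exact: measurable_normal_pdf.
apply: eq_integral => x _; rewrite !indicE.
rewrite (_ : (x \in _) = (- x \in C)%R); last by apply/idP/idP; rewrite !inE.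
by rewrite !normal_pdfE// /normal_fun !subr0 sqrrN.
Qed.

Let normal_peakE s : (0 < s)%R -> normal_peak s = (s^-1 * normal_peak 1)%R.
Proof.
move=> s0; rewrite /normal_peak expr1n mul1r -mulrnAr sqrtrM ?sqr_ge0// sqrtr_sqr.
by rewrite ger0_norm ?ltW// invfM.
Qed.

Let normal_peak1 : (normal_peak 1 <= 1 :> R)%R.
Proof.
have p2 := pi_ge2 R; rewrite /normal_peak expr1n mul1r invf_le1.
  by rewrite -[leLHS]sqrtr1 ler_wsqrtr// mulr2n; lra.
by rewrite sqrtr_gt0 mulr2n; lra.
Qed.

(** Only the order s^2 matters. Half of the exponent absorbs the square, by y exp(-y) <= 1 with y =
    x^2 / (4 s^2); the other half is a Gaussian density of variance 2 s^2. *)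
Lemma normal_second_moment s : (0 < s)%R ->
  \int[normal_prob 0%R s]_x (x ^+ 2)%:E <= (8 * s ^+ 2)%:E.
Proof.
move=> s0; have sq2 : (0 < Num.sqrt 2 :> R)%R by rewrite sqrtr_gt0.
pose s' : R := (Num.sqrt 2 * s)%R; have s'0 : (0 < s')%R by rewrite mulr_gt0.
rewrite integral_normal//; last 2 first.
- by move=> x; rewrite lee_fin sqr_ge0.
- by apply/measurable_EFinP; exact: exprn_measurable.
rewrite -[leRHS]mule1 -(integral_normal_pdf 0 s').
rewrite -ge0_integralZl_EFin//; last 3 first.
- by move=> x _; rewrite lee_fin normal_pdf_ge0.
- by apply/measurable_EFinP; exact: measurable_normal_pdf.
- by rewrite mulr_ge0// sqr_ge0.
apply: ge0_le_integral => //.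
- by move=> x _; rewrite mule_ge0// lee_fin ?sqr_ge0// normal_pdf_ge0.
- apply: emeasurable_funM; apply/measurable_EFinP; first exact: exprn_measurable.
  exact: measurable_normal_pdf.
- apply: emeasurable_funM => //; apply/measurable_EFinP; exact: measurable_normal_pdf.
move=> x _; rewrite -!EFinM lee_fin !normal_pdfE ?gt_eqF//.
rewrite (normal_peakE s0) (normal_peakE s'0) /normal_fun !subr0.
set p := normal_peak 1; have p0 : (0 <= p)%R by rewrite normal_peak_ge0.
pose y : R := (x ^+ 2 / (4 * s ^+ 2))%R.
have y0 : (0 <= y)%R by rewrite divr_ge0 ?sqr_ge0// mulr_ge0// sqr_ge0.
have -> : (- x ^+ 2 / (s ^+ 2 *+ 2) = - y - y)%R by rewrite /y; field; rewrite gt_eqF.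
have -> : (- x ^+ 2 / (s' ^+ 2 *+ 2) = - y)%R.
  by rewrite /y /s' exprMn sqr_sqrtr//; field; rewrite gt_eqF.
have -> : (x ^+ 2 = 4 * s ^+ 2 * y)%R by rewrite /y; field; rewrite gt_eqF.
rewrite expRD; set e := expR (- y); have e0 : (0 <= e)%R by rewrite expR_ge0.
have ye : (y * e <= 1)%R.
  rewrite /e expRN ler_pdivrMr ?expR_gt0// mul1r.
  by apply: le_trans (expR_ge1Dx y); rewrite lerDr.
have is0 : (0 <= s^-1)%R by rewrite invr_ge0 ltW.
have s'E : (s'^-1 * Num.sqrt 2 = s^-1)%R.
  by rewrite /s'; field; rewrite !gt_eqF.
have sq22 : (Num.sqrt 2 <= 2 :> R)%R.
  by rewrite -[leRHS](ger0_norm (ler0n R 2)) -sqrtr_sqr ler_wsqrtr//; lra.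
have is'0 : (0 <= s'^-1)%R by rewrite invr_ge0 ltW.
rewrite -s'E.
have -> : (4 * s ^+ 2 * y * (s'^-1 * Num.sqrt 2 * p * (e * e)) =
  4 * s ^+ 2 * (s'^-1 * p * e) * (Num.sqrt 2 * (y * e)))%R by ring.
have -> : (8 * s ^+ 2 * (s'^-1 * p * e) = 4 * s ^+ 2 * (s'^-1 * p * e) * 2)%R by ring.
apply: ler_wpM2l.
  apply: mulr_ge0; first by apply: mulr_ge0 => //; exact: sqr_ge0.
  by apply: mulr_ge0 => //; exact: mulr_ge0.
apply: le_trans sq22; rewrite -[leRHS]mulr1.
by apply: ler_wpM2l => //; exact: ltW.
Qed.

(** The constant is independent of [s]: after scaling, the density on the interval is at least its
    peak times exp(-(u^2 + v^2)), and the length s (v - u) cancels the factor 1/s of the peak. *)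
Lemma normal_itv_ge (u v : R) : (u < v)%R -> exists2 c : R, (0 < c)%R & forall s, (0 < s)%R ->
  c%:E <= normal_prob 0%R s `](s * u)%R, (s * v)%R[%classic.
Proof.
move=> uv; pose M : R := (u ^+ 2 + v ^+ 2)%R; pose q : R := (normal_peak 1 * expR (- M))%R.
have p0 : (0 < normal_peak 1 :> R)%R by rewrite normal_peak_gt0.
have q0 : (0 < q)%R by rewrite mulr_gt0 ?expR_gt0.
exists (q * (v - u))%R; first by rewrite mulr_gt0// subr_gt0.
move=> s s0; rewrite /normal_prob.
apply: (@le_trans _ _ (\int[lebesgue_measure]_(x in `](s * u)%R, (s * v)%R[) (cst (s^-1 * q)%:E x))).
  rewrite integral_cst//= lebesgue_measure_itv/= lte_fin ltr_pM2l// uv -EFinB -EFinM lee_fin.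
  by rewrite le_eqVlt; apply/orP; left; apply/eqP; field; rewrite gt_eqF.
apply: ge0_le_integral => //.
- by move=> x _; rewrite lee_fin mulr_ge0 ?invr_ge0 ?ltW.
- by apply: measurable_funTS; apply/measurable_EFinP; exact: measurable_normal_pdf.
move=> x /=; rewrite in_itv/= => /andP[xu xv]; rewrite lee_fin normal_pdfE ?gt_eqF//.
rewrite normal_peakE// /q -mulrA ler_pM2l ?invr_gt0// ler_pM2l// /normal_fun subr0.
rewrite ler_expR mulNr lerN2 ler_pdivrMr ?pmulrn_lgt0 ?exprn_gt0//.
pose z := (x / s)%R; have xz : x = (s * z)%R by rewrite /z mulrC divfK ?gt_eqF.
move: xu xv; rewrite xz !ltr_pM2l// => zu zv.
rewrite exprMn [leRHS](_ : _ = s ^+ 2 * (M *+ 2))%R; last by rewrite mulrnAr mulrnAr mulrC.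
rewrite ler_pM2l ?exprn_gt0// /M mulr2n.
have h1 : (0 <= (z - u) * (v - z))%R by rewrite mulr_ge0// subr_ge0 ltW.
have h2 := sqr_ge0 (z - u - v)%R.
have h3 := sqr_ge0 u; have h4 := sqr_ge0 v; nra.
Qed.

Lemma normal_itv_le s (u v : R) : (0 < s)%R -> (u <= v)%R ->
  normal_prob 0%R s `]u, v[%classic <= ((v - u) / s)%:E.
Proof.
move=> s0 uv; rewrite /normal_prob.
apply: (@le_trans _ _ (\int[lebesgue_measure]_(x in `]u, v[) (cst (s^-1)%:E x))).
  apply: ge0_le_integral => //.
  - by move=> x _; rewrite lee_fin normal_pdf_ge0.
  - by apply: measurable_funTS; apply/measurable_EFinP; exact: measurable_normal_pdf.
  - move=> x _; rewrite lee_fin (le_trans (normal_pdf_ub _ _ _)) ?gt_eqF//.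
    by rewrite normal_peakE// -[leRHS]mulr1 ler_wpM2l ?invr_ge0 ?(ltW s0)//.
rewrite integral_cst//= lebesgue_measure_itv/= lte_fin.
case: ifP => _; first by rewrite -EFinD -EFinM lee_fin mulrC.
by rewrite mule0 lee_fin divr_ge0 ?subr_ge0 ?(ltW s0).
Qed.

End Normal.

Section GaussianRow.
Local Open Scope ereal_scope.
Context {R : realType} {d : measure_display} {Omega : measurableType d}.
Variable P : probability Omega R.
Context {K : nat}.
Variables (xi : Omega -> 'rV[R]_K) (s : 'I_K -> R).
Hypothesis s0 : forall k, s k != 0%R.
Hypothesis mxi : measurable_fun setT (xi : Omega -> brv R K).
Hypothesis xi_law : forall C, (forall k, measurable (C k)) ->
  P (xi @^-1` rbox C) = \prod_(k < K) normal_prob 0%R (s k) (C k).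

Let mxik k : measurable_fun setT (fun om => xi om 0%R k).
Proof. exact: brv_coord. Qed.

Let xi_law_seq (r : seq 'I_K) C : uniq r -> (forall k, measurable (C k)) ->
  P [set om | forall k, k \in r -> C k (xi om 0%R k)] =
  \prod_(k <- r) normal_prob 0%R (s k) (C k).
Proof.
move=> ur mC; pose D k := if k \in r then C k else setT.
have mD k : measurable (D k) by rewrite /D; case: ifP.
have -> : [set om | forall k, k \in r -> C k (xi om 0%R k)] = xi @^-1` rbox D.
  apply/seteqP; split=> om H k /=; rewrite ?/D.
    by case: ifP => [/H|].
  by move=> kr; have := H k; rewrite /D kr.
rewrite xi_law// (bigID (mem r))/= [X in _ * X]big1 ?mule1; last first.
  by move=> k /negbTE kr; rewrite /D kr; exact: probability_setT.
by rewrite -big_uniq//=; apply: eq_big_seq => k kr; rewrite /D kr.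
Qed.

Let xi_law1 k (C : set R) : measurable C ->
  P ((fun om => xi om 0%R k) @^-1` C) = normal_prob 0%R (s k) C.
Proof.
move=> mC; have := @xi_law_seq [:: k] (fun _ => C) isT (fun _ => mC).
rewrite big_seq1 => <-; congr (P _); apply/seteqP; split=> om /=.
  by move=> H k'; rewrite inE => /eqP ->.
by apply; rewrite inE.
Qed.

Let xi_integral1 k (f : R -> \bar R) : (forall x, 0 <= f x) -> measurable_fun setT f ->
  \int[P]_om f (xi om 0%R k) = \int[normal_prob 0%R (s k)]_x f x.
Proof.
have mx : measurable_fun setT ((fun om => xi om 0%R k) : Omega -> measurableTypeR R).
  exact: mxik.
move=> f0 mf; rewrite -(ge0_integral_law P mx)//.
by apply: eq_measure_integral => A mA _; exact: xi_law1.
Qed.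

(** Coordinates outside [r] are set to 0, so that every group of coordinates is a row of the same
    dimension [K]. *)
Let mask (r : seq 'I_K) (om : Omega) : 'rV[R]_K := \row_k (if k \in r then xi om 0%R k else 0%R).

Let mmask r : measurable_fun setT (mask r : Omega -> brv R K).
Proof.
apply: brv_measurable_fun => k; under eq_fun do rewrite mxE.
by case: (k \in r); [exact: mxik|exact: measurable_cst].
Qed.

Let mask_indep k r : uniq (k :: r) ->
  indep P (fun om => xi om 0%R k) (mask r : Omega -> brv R K).
Proof.
move=> /= /andP[kr ur] A B mA mB.
have mE : measurable ((fun om => xi om 0%R k) @^-1` A).
  by rewrite -[X in measurable X]setTI; exact: mxik.
apply: indep_event_rbox => //.
(* A masked coordinate is the constant 0: if a side of the box outside [r] misses 0, the event is
   empty. *)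
move=> C mC; have [Z|Z] := pselect (forall j, j \notin r -> C j 0%R); last first.
  have -> : mask r @^-1` rbox C = set0.
    apply/seteqP; split=> // om H; apply: Z => j jr.
    by have := H j; rewrite mxE (negbTE jr).
  by rewrite setI0 measure0 mule0.
have -> : mask r @^-1` rbox C = [set om | forall j, j \in r -> C j (xi om 0%R j)].
  apply/seteqP; split=> om H j.
    by move=> jr; have := H j; rewrite mxE jr.
  by rewrite mxE; case: ifPn => [/H//|/Z].
rewrite xi_law_seq// xi_law1//.
pose D j := if j == k then A else C j.
have mD j : measurable (D j) by rewrite /D; case: ifP.
have := @xi_law_seq (k :: r) D _ mD; rewrite /= kr => /(_ ur).
have DE : D k = A by rewrite /D eqxx.
rewrite big_cons DE => H.
transitivity (P [set om | forall k0, k0 \in k :: r -> D k0 (xi om 0%R k0)]).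
  congr (P _); apply/seteqP; split=> om /=.
    move=> [H1 H2] j; rewrite inE /D => /orP[/eqP ->|jr]; first by rewrite eqxx.
    by case: eqP => [jk|_]; [move: kr; rewrite -jk jr|exact: H2].
  move=> H1; split; first by have := H1 k; rewrite inE eqxx /D eqxx; apply.
  move=> j jr; have := H1 j; rewrite inE jr orbT /D.
  by case: eqP => [jk|_]; [move: kr; rewrite -jk jr|apply].
rewrite H; congr (_ * _); apply: eq_big_seq => j jr; rewrite /D.
by case: eqP => [jk|//]; move: kr; rewrite -jk jr.
Qed.

(** The coordinates are split off one at a time, each being independent of the [mask] of the
    remaining ones. *)
Lemma gaussian_row_prod (f : 'I_K -> R -> R) :
  (forall k x, (0 <= f k x)%R) -> (forall k, measurable_fun setT (f k)) ->
  \int[P]_om (\prod_(k < K) f k (xi om 0%R k))%:E =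
  \prod_(k < K) \int[normal_prob 0%R (s k)]_x (f k x)%:E.
Proof.
move=> f0 mf.
suff H (r : seq 'I_K) : uniq r -> \int[P]_om (\prod_(k <- r) f k (xi om 0%R k))%:E =
    \prod_(k <- r) \int[normal_prob 0%R (s k)]_x (f k x)%:E.
  by have := H (index_enum 'I_K) (index_enum_uniq _).
elim: r => [_|k r IH /[dup] ukr /= /andP[kr ur]].
  by under eq_integral do rewrite big_nil; rewrite big_nil integral_prob_cst.
pose G (x : brv R K) : R := (\prod_(j <- r) f j ((x : 'rV[R]_K) 0 j))%R.
have mG : measurable_fun setT G.
  rewrite /G; elim: (r) => [|j r' IH'].
    by under eq_fun do rewrite big_nil; exact: measurable_cst.
  under eq_fun do rewrite big_cons; apply: measurable_funM => //.
  by apply: measurableT_comp => //; exact: coord_brv.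
have G0 x : (0 <= G x)%R by apply: prodr_ge0.
have GE om : G (mask r om) = (\prod_(j <- r) f j (xi om 0 j))%R.
  by apply: eq_big_seq => j jr; rewrite mxE jr.
rewrite big_cons -IH//.
pose phi (z : R * brv R K) := (f k z.1)%:E * (G z.2)%:E.
transitivity (\int[P]_om phi (xi om 0%R k, mask r om : brv R K)).
  by apply: eq_integral => om _; rewrite big_cons /phi GE EFinM.
rewrite (indep_integral (phi := phi) (mxik k) (mmask r) (mask_indep ukr)); last 2 first.
- apply: emeasurable_funM; apply/measurable_EFinP.
    by apply: measurableT_comp => //; exact: measurable_fst.
  by apply: measurableT_comp => //; exact: measurable_snd.
- by move=> z; rewrite mule_ge0// lee_fin.
have mGm : measurable_fun setT (fun om => (G (mask r om))%:E).
  by apply/measurable_EFinP; apply: (measurableT_comp mG (mmask r)).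
under eq_integral => om _.
  rewrite /phi/= ge0_integralZl//; last 2 first.
  - by move=> om' _; rewrite lee_fin.
  - by rewrite lee_fin.
  over.
rewrite ge0_integralZr//; last 3 first.
- by apply/measurable_EFinP; exact: measurableT_comp.
- by move=> om _; rewrite lee_fin.
- by apply: integral_ge0 => om _; rewrite lee_fin.
congr (_ * _); last by apply: eq_integral => om _; rewrite GE.
apply: (@xi_integral1 k (fun x => (f k x)%:E)); last exact/measurable_EFinP.
by move=> x; rewrite lee_fin.
Qed.

Lemma gaussian_row_sym (B : set (brv R K)) : measurable B ->
  P ((fun om => - xi om)%R @^-1` B) = P (xi @^-1` B).
Proof.
have mN : measurable_fun setT ((fun om => - xi om)%R : Omega -> brv R K).
  apply: brv_measurable_fun => k; under eq_fun do rewrite mxE.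
  by apply: measurableT_comp => //; exact: mxik.
move=> mB.
apply: (brv_measure_eq (m1 := imagem P mN) (m2 := imagem P mxi)) mB.
  by rewrite (le_lt_trans (probability_le1 _ _)) ?ltry// preimage_setT.
move=> C mC; transitivity (P (xi @^-1` rbox (fun k => (fun x => - x)%R @^-1` C k))).
  by congr (P _); apply/seteqP; split=> om H k; have := H k; rewrite /= mxE.
apply: etrans (xi_law _) _.
  move=> k; rewrite -[X in measurable X]setTI; exact: oppr_measurable.
apply: (etrans _ (esym (xi_law mC))).
by apply: eq_bigr => k _; exact: normal_sym.
Qed.

Definition row_density (a : 'rV[R]_K) (x : brv R K) : R :=
  (\prod_(k < K) shift_density (a 0 k) (s k) ((x : 'rV[R]_K) 0 k))%R.

Lemma row_density_ge0 a x : (0 <= row_density a x)%R.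
Proof. by apply: prodr_ge0 => k _; exact: expR_ge0. Qed.

Lemma measurable_prod_row (f : 'I_K -> R -> R) : (forall k, measurable_fun setT (f k)) ->
  measurable_fun setT (fun x : brv R K => (\prod_(k < K) f k ((x : 'rV[R]_K) 0 k))%R).
Proof.
move=> mf; elim: (index_enum 'I_K) => [|j r' IH'].
  by under eq_fun do rewrite big_nil; exact: measurable_cst.
under eq_fun do rewrite big_cons; apply: measurable_funM => //.
by apply: measurableT_comp => //; exact: coord_brv.
Qed.

Lemma row_density_measurable a : measurable_fun setT (row_density a).
Proof.
exact: (measurable_prod_row (f := fun k => shift_density (a 0%R k) (s k)))
  (fun k => measurable_shift_density _ _).
Qed.

(** On boxes the integral factors into the one-dimensional identities [normal_shift], and a finite
    measure on rows is determined by boxes. *)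
Lemma cameron_martin (a : 'rV[R]_K) (E : set (brv R K)) : measurable E ->
  \int[P]_(om in (fun om => xi om + a)%R @^-1` E) (row_density a (xi om))%:E = P (xi @^-1` E).
Proof.
have mD : measurable_fun setT (fun om => row_density a (xi om)).
  by apply: (measurableT_comp (row_density_measurable a) mxi).
have mS : measurable_fun setT ((fun om => xi om + a)%R : Omega -> brv R K).
  apply: brv_measurable_fun => k; under eq_fun do rewrite mxE.
  by apply: measurable_funD => //; exact: mxik.
have D0 om : (0 <= row_density a (xi om))%R by exact: row_density_ge0.
pose m := density P D0 mD.
have box C : (forall k, measurable (C k)) -> imagem m mS (rbox C) = imagem P mxi (rbox C).
  move=> mC; apply: (etrans _ (esym (xi_law mC))).
  transitivity (\int[P]_om (\prod_(k < K) (fun k x => \1_(C k) (x + a 0 k) *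
      shift_density (a 0 k) (s k) x)%R k (xi om 0%R k))%:E).
    apply: etrans (integral_mkcond _ _) _; apply: eq_integral => om _; rewrite patchE.
    rewrite big_split/=; case: ifPn => [|].
      rewrite inE => H; rewrite [X in (X * _)%R]big1 ?mul1r// => k _.
      by rewrite indicE mem_set//; have := H k; rewrite mxE.
    move=> /negP H; have [k Ck] : exists k, ~ C k (xi om 0 k + a 0 k)%R.
      apply/not_existsP => H2; apply: H; rewrite inE => k; rewrite mxE.
      exact: contrapT (H2 k).
    by rewrite (bigD1 k)//= indicE memNset// !mul0r.
  rewrite (gaussian_row_prod (f := fun k x => \1_(C k) (x + a 0 k) *
      shift_density (a 0 k) (s k) x)%R).
  - by apply: eq_bigr => k _; rewrite -(normal_shift (a 0%R k) (s0 k) (mC k)).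
  - by move=> k x; rewrite mulr_ge0// expR_ge0.
  - move=> k; apply: measurable_funM; last exact: measurable_shift_density.
    apply: measurableT_comp; first exact: measurable_indic.
    by apply: measurable_funD.
move=> mE; apply: (brv_measure_eq (m1 := imagem m mS) (m2 := imagem P mxi) _ box mE).
by rewrite -rboxT box// (le_lt_trans (probability_le1 _ _)) ?ltry// rboxT preimage_setT.
Qed.

(** The form in which the shift is used: reaching [E] after adding [a] to the noise bounds the
    probability of [E] from below, at the price of a lower bound for the density on [G]. *)
Lemma cameron_martin_le (a : 'rV[R]_K) (c : R) (G : set Omega) (E : set (brv R K)) :
  measurable G -> measurable E -> (forall om, G om -> (c <= row_density a (xi om))%R) ->
  c%:E * P (G `&` (fun om => xi om + a)%R @^-1` E) <= P (xi @^-1` E).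
Proof.
move=> mG mE Gc; rewrite -(cameron_martin a mE).
have mD : measurable_fun setT (fun om => (row_density a (xi om))%:E).
  by apply/measurable_EFinP; apply: (measurableT_comp (row_density_measurable a) mxi).
have mS : measurable_fun setT ((fun om => xi om + a)%R : Omega -> brv R K).
  apply: brv_measurable_fun => k; under eq_fun do rewrite mxE.
  by apply: measurable_funD => //; exact: mxik.
have mSE : measurable ((fun om => xi om + a)%R @^-1` E).
  by rewrite -[X in measurable X]setTI; exact: mS.
apply: (@le_trans _ _ (\int[P]_(om in G `&` (fun om => xi om + a)%R @^-1` E)
    (row_density a (xi om))%:E)); last first.
  apply: ge0_subset_integral => //.
  - exact: measurableI.
  - exact: measurable_funTS.
  - by move=> om _; rewrite lee_fin row_density_ge0.
rewrite -integral_cst; last exact: measurableI.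
have [c0|c0] := leP 0%R c.
  apply: ge0_le_integral => //; first exact: measurableI.
  - exact: measurable_funTS.
  - by move=> om [Gom _]; rewrite lee_fin Gc.
rewrite integral_cst; last exact: measurableI.
apply: (@le_trans _ _ 0); first by rewrite mule_le0_ge0// lee_fin ltW.
by apply: integral_ge0 => om _; rewrite lee_fin row_density_ge0.
Qed.

End GaussianRow.

(** * Integral equations and the Euler scheme *)

Section Rows.
Context {R : realType} {n : nat}.
Implicit Types x y : 'rV[R]_n.

Lemma rv_coord_le x i : `|x 0 i| <= `|x|.
Proof. by rewrite [leRHS]/Num.Def.normr /= mx_normrE; apply/bigmax_geP; right; exists (0, i). Qed.

Lemma rv_norm_le x (M : R) : 0 <= M -> (forall i, `|x 0 i| <= M) -> `|x| <= M.
Proof.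
move=> M0 H; rewrite [leLHS]/Num.Def.normr/= mx_normrE (bigmax_le _ M0)//= => -[i j] _ /=.
by rewrite ord1.
Qed.

(** The norm of rows is the maximum norm; [dot] is the Euclidean product, compared with it by
    [dot_lower] and [dot_upper]. *)
Definition dot x y : R := \sum_i x 0 i * y 0 i.

Lemma dotC x y : dot x y = dot y x.
Proof. by apply: eq_bigr => i _; rewrite mulrC. Qed.

Lemma dotDl x y z : dot (x + y) z = dot x z + dot y z.
Proof. by rewrite -big_split; apply: eq_bigr => i _; rewrite mxE mulrDl. Qed.

Lemma dotZl a x z : dot (a *: x) z = a * dot x z.
Proof. by rewrite mulr_sumr; apply: eq_bigr => i _; rewrite mxE mulrA. Qed.

Lemma dotNl x z : dot (- x) z = - dot x z.
Proof. by rewrite -scaleN1r dotZl mulN1r. Qed.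

Lemma dotBl x y z : dot (x - y) z = dot x z - dot y z.
Proof. by rewrite dotDl dotNl. Qed.

Lemma dotDr x y z : dot z (x + y) = dot z x + dot z y.
Proof. by rewrite ![dot z _]dotC dotDl. Qed.

Lemma dotZr a x z : dot z (a *: x) = a * dot z x.
Proof. by rewrite ![dot z _]dotC dotZl. Qed.

Lemma dotNr x z : dot z (- x) = - dot z x.
Proof. by rewrite ![dot z _]dotC dotNl. Qed.

Lemma dotBr x y z : dot z (x - y) = dot z x - dot z y.
Proof. by rewrite dotDr dotNr. Qed.

Lemma dot_ge0 x : 0 <= dot x x.
Proof. by apply: sumr_ge0 => i _; rewrite -expr2 sqr_ge0. Qed.

Lemma dot_le x y : `|dot x y| <= n%:R * (`|x| * `|y|).
Proof.
have -> : n%:R * (`|x| * `|y|) = \sum_(i < n) `|x| * `|y|.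
  by rewrite sumr_const card_ord mulr_natl.
rewrite (le_trans (ler_norm_sum _ _ _))//.
by apply: ler_sum => i _; rewrite normrM ler_pM// rv_coord_le.
Qed.

Lemma dot_upper x : dot x x <= n%:R * `|x| ^+ 2.
Proof. by rewrite expr2; apply: le_trans (ler_norm _) _; exact: dot_le. Qed.

Lemma dot_coord x i : x 0 i ^+ 2 <= dot x x.
Proof.
rewrite /dot (bigD1 i)//= -expr2 lerDl.
by apply: sumr_ge0 => j _; rewrite -expr2 sqr_ge0.
Qed.

Lemma dot_lower x : `|x| ^+ 2 <= dot x x.
Proof.
rewrite -[leRHS]sqr_sqrtr ?dot_ge0// ler_pXn2r ?nnegrE ?sqrtr_ge0//.
apply: rv_norm_le => [|i]; first exact: sqrtr_ge0.
by rewrite -sqrtr_sqr ler_wsqrtr// dot_coord.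
Qed.

Lemma dot_eq0 x : dot x x = 0 -> x = 0.
Proof.
move=> x0; apply/eqP; rewrite -normr_eq0 -sqrf_eq0; apply/eqP/le_anti.
by rewrite sqr_ge0 andbT -x0 dot_lower.
Qed.

End Rows.

Section VectorIntegral.
Context {R : realType} {n : nat}.
Implicit Types (f : R -> 'rV[R]_n) (a b c : R).

Definition vint f a b : 'rV[R]_n := \row_i (\int[lebesgue_measure]_(s in `[a, b]) f s 0 i).

Lemma coord_path f i : continuous f -> continuous (fun s => f s 0 i).
Proof.
by move=> cf s; apply: (@continuous_comp _ _ _ f (fun M : 'rV_n => M 0 i)); [exact: cf|exact: coord_continuous].
Qed.

Lemma path_integrable (f : R -> R) a b : continuous f ->
  lebesgue_measure.-integrable `[a, b] (EFin \o f).
Proof.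
move=> cf; apply: continuous_compact_integrable; first exact: segment_compact.
exact: continuous_subspaceT.
Qed.

Lemma vint_coord_le f a b M i : continuous f -> a <= b ->
  (forall s, a <= s <= b -> `|f s 0 i| <= M) -> `|vint f a b 0 i| <= M * (b - a).
Proof.
move=> cf ab H; have ci := coord_path (i := i) cf; rewrite mxE.
apply: le_trans (le_normr_Rintegral _ _) _; [by []|exact: path_integrable|].
apply: (@le_trans _ _ (\int[lebesgue_measure]_(s in `[a, b]) M)).
  apply: le_Rintegral => //.
  - apply: path_integrable => s; apply: continuous_comp; first exact: ci.
    exact: norm_continuous.
  - by apply: path_integrable => s; exact: cst_continuous.
have -> : (fun _ : R => M) = cst M by [].
rewrite Rintegral_cst//= lebesgue_measure_itv/= lte_fin.
by move: ab; rewrite le_eqVlt => /orP[/eqP ->|->//]; rewrite ltxx mulr0 subrr mulr0.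
Qed.

Lemma vint_le f a b M : continuous f -> a <= b ->
  (forall s, a <= s <= b -> `|f s| <= M) -> `|vint f a b| <= M * (b - a).
Proof.
move=> cf ab H; have M0 : 0 <= M by apply: le_trans (H a _); rewrite ?lexx.
apply: rv_norm_le => [|i]; first by rewrite mulr_ge0// subr_ge0.
apply: vint_coord_le => // s /H; apply: le_trans; exact: rv_coord_le.
Qed.

Lemma vint_add f a b c : continuous f -> a <= b -> b <= c ->
  vint f a c = vint f a b + vint f b c.
Proof.
move=> cf ab bc; apply/rowP => i; rewrite !mxE.
have ci := coord_path (i := i) cf.
have := @Rintegral_itvB R (fun s => f s 0 i) (BLeft a) (BRight c) b.
rewrite !bnd_simp => /(_ (path_integrable _ _ ci) ab bc) E.
rewrite -[X in _ + X]Rintegral_itv_obnd_cbnd; last first.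
  apply: integrableS (path_integrable b c ci) => //.
  by apply: subset_itvr; rewrite bnd_simp.
by rewrite -E addrC subrK.
Qed.

Lemma vint0 f a : vint f a a = 0.
Proof. by apply/rowP => i; rewrite !mxE set_itv1 Rintegral_set1. Qed.

Lemma vintB f f' a b : continuous f -> continuous f' ->
  vint f a b - vint f' a b = vint (fun s => f s - f' s) a b.
Proof.
move=> cf cf'; apply/rowP => i; rewrite !mxE -RintegralB//; last 2 first.
- exact/path_integrable/coord_path.
- exact/path_integrable/coord_path.
by apply: eq_Rintegral => s _; rewrite !mxE.
Qed.

Lemma vint_cst (v : 'rV[R]_n) a b : a <= b -> vint (fun=> v) a b = (b - a) *: v.
Proof.
move=> ab; apply/rowP => i; rewrite !mxE; have -> : (fun _ : R => v 0 i) = cst (v 0 i) by [].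
rewrite Rintegral_cst//= lebesgue_measure_itv/= lte_fin mulrC.
by move: ab; rewrite le_eqVlt => /orP[/eqP ->|->//]; rewrite ltxx subrr.
Qed.

Lemma vint_derive f i (t : R) : continuous f -> 0 < t ->
  is_derive t 1 (fun t => vint f 0 t 0 i) (f t 0 i).
Proof.
move=> cf t0; have ci := coord_path (i := i) cf.
have := @continuous_FTC1_closed R (fun s => f s 0 i) 0 t (t + 1) _ (path_integrable _ _ ci) t0 (ci t).
rewrite ltrDl => /(_ ltr01) [dF FE].
have -> : (fun t => vint f 0 t 0 i) = (fun t => \int[lebesgue_measure]_(s in `[0, t]) f s 0 i).
  by apply/funext => s; rewrite mxE.
exact: DeriveDef dF (etrans (esym (derive1E _ _)) FE).
Qed.

Lemma path_bounded f a b : continuous f -> exists2 M : R, 0 <= M & forall s, a <= s <= b -> `|f s| <= M.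
Proof.
move=> cf; have [ab|ba] := leP a b; last first.
  by exists 0 => // s /andP[sa sb]; have := le_lt_trans (le_trans sa sb) ba; rewrite ltxx.
have [|c _ H] := @EVT_max R (fun s => `|f s|) a b ab.
  apply: continuous_subspaceT => s; apply: continuous_comp; first exact: cf.
  exact: norm_continuous.
by exists `|f c| => // s sab; apply: H; rewrite in_itv.
Qed.

Lemma path_unif f a b (e : R) : continuous f -> 0 < e -> exists2 del : R, 0 < del &
  forall s t, a <= s <= b -> a <= t <= b -> `|s - t| <= del -> `|f s - f t| <= e.
Proof.
move=> cf e0.
have := (compact_near_coveringP _).1 (@segment_compact R a b) R (0^'+)
  (fun del s => forall t, `|s - t| <= del -> `|f s - f t| <= e) _.
case.
  move=> x _; have /cvgrPdist_le /(_ (e / 2)) := cf x.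
  rewrite divr_gt0// => /(_ isT) /nbhs_ballP[r /= r0 H].
  exists (ball x (r / 2), [set del | del < r / 2]).
    split; first by apply/nbhs_ballP; exists (r / 2) => //=; rewrite divr_gt0.
    by apply: nbhs_right_lt; rewrite divr_gt0.
  move=> [s del] [/= xs dr] t st.
  have h1 : `|f x - f s| <= e / 2.
    by apply: H; apply: le_ball xs; rewrite ler_pdivrMr// ler_peMr// ?ler1n// ltW.
  have h2 : `|f x - f t| <= e / 2.
    apply: H; rewrite /ball/= [r]splitr (_ : x - t = (x - s) + (s - t)); last by ring.
    by apply: le_lt_trans (ler_normD _ _) _; apply: ltrD => //; exact: le_lt_trans dr.
  rewrite (_ : f s - f t = (f x - f t) - (f x - f s)); last first.
    by apply/rowP => i; rewrite !mxE; ring.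
  by rewrite [e]splitr; apply: le_trans (ler_normB _ _) _; exact: lerD.
move=> r /= r0 H; exists (r / 2) => //; first by rewrite divr_gt0.
move=> s t sab _ st; apply: (H (r / 2) _ _ s) => //=.
- by rewrite /ball/= sub0r normrN gtr0_norm ?divr_gt0// ltr_pdivrMr// ltr_pMr// ltr1n.
- by rewrite divr_gt0.
Qed.

End VectorIntegral.

Section Gronwall.
Context {R : realType}.

Lemma gronwall_ge (f df : R -> R) (lam T : R) : 0 <= T -> continuous f ->
  (forall t : R, 0 < t < T -> is_derive t 1 f (df t)) ->
  (forall t : R, 0 < t < T -> lam * f t <= df t) ->
  expR (lam * T) * f 0 <= f T.
Proof.
move=> T0 cf fd dfl; pose g (t : R) := expR (- lam * t) * f t.
have ed (t : R) : is_derive t 1 (fun t => expR (- lam * t)) (- lam * expR (- lam * t)).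
  have h : is_derive t 1 (fun t => - lam * t) (- lam).
    by have := is_deriveZ (- lam) (is_derive_id t (1 : R)); rewrite /GRing.scale/= mulr1.
  by apply: is_derive_eq; rewrite [LHS]mulrC.
have gd (t : R) : 0 < t < T -> is_derive t 1 g (expR (- lam * t) * (df t - lam * f t)).
  move=> /[dup] tT /fd ft; rewrite /g; have et := ed t.
  apply: is_derive_eq; rewrite /GRing.scale/=; ring.
have gT : g 0 <= g T.
  apply: (@ger0_derive1_ndecr R g 0 T) => //.
  - by move=> x; rewrite in_itv/= => /gd [].
  - move=> x; rewrite in_itv/= => /[dup] xT /gd gx; rewrite derive1E derive_val.
    by rewrite mulr_ge0 ?expR_ge0// subr_ge0 dfl.
  - apply: continuous_subspaceT => x; apply: cvgM; last exact: cf.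
    by apply: (continuous_comp (f := *%R (- lam)) (g := @expR R)); [exact: mulrl_continuous|exact: continuous_expR].
have : expR (lam * T) * g 0 <= expR (lam * T) * g T by rewrite ler_pM2l ?expR_gt0.
by rewrite /g mulr0 expR0 mul1r mulrA -expRD mulNr addrN expR0 mul1r.
Qed.

Lemma gronwall_le (f df : R -> R) (lam T : R) : 0 <= T -> continuous f ->
  (forall t : R, 0 < t < T -> is_derive t 1 f (df t)) ->
  (forall t : R, 0 < t < T -> df t <= lam * f t) ->
  f T <= expR (lam * T) * f 0.
Proof.
move=> T0 cf fd dfl.
have := @gronwall_ge (- f) (fun t => - df t) lam T T0.
rewrite /= mulrN lerN2; apply.
- by move=> x; apply: cvgN; exact: cf.
- by move=> t tT; have := fd _ tT => ft; apply: is_deriveN.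
- by move=> t tT; rewrite mulrN lerN2 dfl.
Qed.

End Gronwall.

Section Paths.
Context {R : realType} {n : nat}.
Variable b : 'rV[R]_n -> 'rV[R]_n.

Definition loclip := forall r : R, exists2 L : R, 0 <= L &
  forall x y, `|x| <= r -> `|y| <= r -> `|b x - b y| <= L * `|x - y|.

Hypothesis bL : loclip.

Lemma loclip_continuous : continuous b.
Proof.
move=> x; apply/(@cvgrPdist_le _ _ _ (nbhs x) (nbhs_filter x)) => e e0.
have [L L0 H] := bL (`|x| + 1).
near=> y.
have xy : `|x - y| <= Num.min 1 (e / (L + 1)).
  have : ball x (Num.min 1 (e / (L + 1))) y.
    by near: y; apply: nbhsx_ballx; rewrite lt_min ltr01 divr_gt0 ?ltr_wpDl.
  by rewrite mx_norm_ball /ball_/= => /ltW.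
move: xy; rewrite le_min => /andP[xy1 xy2].
have ny : `|y| <= `|x| + 1.
  rewrite (_ : y = x - (x - y)); last by rewrite opprB addrC subrK.
  by apply: le_trans (ler_normB _ _) _; rewrite lerD2l.
apply: le_trans (H _ _ _ ny) _; first by rewrite lerDl.
apply: (@le_trans _ _ ((L + 1) * (e / (L + 1)))).
  by apply: ler_pM => //; rewrite lerDl.
by rewrite mulrC divfK ?gt_eqF ?ltr_wpDl.
Unshelve. all: by end_near. Qed.

(** The noise [g] enters through its increments only, so the equation is meaningful path by path.
    Paths are continuous on all of R; a solution given for t >= 0 will be extended by its initial
    value. *)
Definition path_sol (g u : R -> 'rV[R]_n) := continuous u /\
  forall s t, 0 <= s -> s <= t -> u t = u s - vint (b \o u) s t + (g t - g s).

(* Without the truncation the explicit Euler scheme of a quadratic drift has no moment bounds. *)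
Definition cutoff (c : R) (y : 'rV[R]_n) := if `|b y| <= c then b y else 0.

Fixpoint euler (h c : R) (Z : nat -> 'rV[R]_n) (y : 'rV[R]_n) (j : nat) : 'rV[R]_n :=
  if j is j'.+1 then
    euler h c Z y j' - h *: cutoff c (euler h c Z y j') + Z j'
  else y.

Lemma cutoff_le c y : 0 <= c -> `|cutoff c y| <= c.
Proof. by move=> c0; rewrite /cutoff; case: ifP => //; rewrite normr0. Qed.

Lemma path_comp_continuous (u : R -> 'rV[R]_n) : continuous u -> continuous (b \o u).
Proof. by move=> cu s; apply: continuous_comp; [exact: cu|exact: loclip_continuous]. Qed.

(** The solution is bounded by [r] on the time interval and the scheme stays within 1 of it, so only
    the Lipschitz constant on the ball of radius r + 1 matters, and the cutoff is inactive there
    once [c m >= M]. As the scheme depends only on the initial value and the noise, so does the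
    solution. *)
Lemma euler_cvg g u (t0 T : R) (c : nat -> R) (e : R) : path_sol g u -> 0 <= t0 -> 0 < T ->
  (forall M, exists m0, forall m, (m0 <= m)%N -> M <= c m) -> 0 < e ->
  exists m0, forall m, (m0 <= m)%N -> forall j, (j <= m.+1)%N ->
  `|euler (T / m.+1%:R) (c m) (fun j => g (t0 + j.+1%:R * (T / m.+1%:R)) -
       g (t0 + j%:R * (T / m.+1%:R))) (u t0) j - u (t0 + j%:R * (T / m.+1%:R))| <= e.
Proof.
move=> [cu ug] t00 T0 cM e0.
wlog e1 : e e0 / e <= 1.
  move=> H; have [||m0 Hm0] := H (Num.min e 1).
  - by rewrite lt_min e0 ltr01.
  - by rewrite ge_min lexx orbT.
  by exists m0 => m mm j jm; apply: le_trans (Hm0 m mm j jm) _; rewrite ge_min lexx.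
have [r r0 ur] := path_bounded t0 (t0 + T) cu.
have [L L0 HL] := bL (r + 1).
pose M : R := `|b 0| + L * (r + 1).
have HM y : `|y| <= r + 1 -> `|b y| <= M.
  move=> yr; rewrite (_ : b y = b 0 + (b y - b 0)); last by rewrite addrC subrK.
  apply: le_trans (ler_normD _ _) _; rewrite lerD2l.
  apply: le_trans (HL _ _ yr _) _; first by rewrite normr0 addr_ge0.
  by rewrite subr0 ler_wpM2l.
(* With steps over which [u] varies by at most [eta], the error satisfies e' <= (1 + L h) e + L h
   eta, so it stays below eta exp(L T). *)
pose eta : R := e / expR (L * T); have eta0 : 0 < eta by rewrite divr_gt0 ?expR_gt0.
have [del del0 Hdel] := path_unif t0 (t0 + T) cu eta0.
have [m1 Hm1] := cM M.
exists (maxn m1 (Num.truncn (T / del))) => m; rewrite geq_max => /andP[mm1 mm2].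
set h := T / m.+1%:R; have h0 : 0 < h by rewrite divr_gt0.
have hdel : h <= del.
  rewrite /h ler_pdivrMr// mulrC -ler_pdivrMr//.
  apply: le_trans (ltW (truncnS_gt _)) _; by rewrite ler_nat ltnS.
set E := euler _ _ _ _.
have tj j : (j <= m.+1)%N -> t0 <= t0 + j%:R * h <= t0 + T.
  move=> jm; rewrite lerDl mulr_ge0 ?(ltW h0)//= lerD2l /h mulrCA ger_pMr//.
  by rewrite ler_pdivrMr// mul1r ler_nat.
have Lh0 : 0 <= 1 + L * h by rewrite addr_ge0// mulr_ge0// ltW.
have qE j : (j <= m.+1)%N -> eta * ((1 + L * h) ^+ j - 1) <= e.
  move=> jm; apply: (@le_trans _ _ (eta * expR (L * T))); last by rewrite /eta divfK ?gt_eqF ?expR_gt0.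
  rewrite ler_pM2l//; apply: (@le_trans _ _ ((1 + L * h) ^+ m.+1)).
    rewrite lerBlDr; apply: ler_wpDr => //; apply: ler_weXn2l => //.
    by rewrite lerDl mulr_ge0 ?(ltW h0).
  have -> : L * T = m.+1%:R * (L * h) by rewrite /h; field; rewrite nat1r pnatr_eq0.
  rewrite expRM_natl; apply: lerXn2r; rewrite ?nnegrE ?expR_ge0//.
  exact: expR_ge1Dx.
suff H j : (j <= m.+1)%N -> `|E j - u (t0 + j%:R * h)| <= eta * ((1 + L * h) ^+ j - 1).
  by move=> j jm; apply: le_trans (H j jm) _; exact: qE.
elim: j => [_|j IH jm]; first by rewrite /E/= mul0r addr0 subrr normr0 expr0 subrr mulr0.
have {IH} := IH (ltnW jm); set t := t0 + j%:R * h; set er := `|_ - _| => IH.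
have erE : er <= e by apply: le_trans IH _; apply: qE; exact: ltnW.
have [tj1 tj2] := (tj _ (ltnW jm), tj _ jm).
have Ejr : `|E j| <= r + 1.
  rewrite (_ : E j = u t + (E j - u t)); last by rewrite addrC subrK.
  by apply: le_trans (ler_normD _ _) _; apply: lerD; [exact: ur|exact: le_trans erE e1].
have t1E : t0 + j.+1%:R * h = t + h by rewrite /t -natr1 mulrDl mul1r addrA.
have t0' : 0 <= t by rewrite addr_ge0// mulr_ge0// ltW.
have tth : t <= t + h by rewrite lerDl ltW.
have -> : E j.+1 = E j - h *: b (E j) + (g (t + h) - g t).
  by rewrite /E/= -/(E j) /cutoff (le_trans (HM _ Ejr) (Hm1 _ mm1)) -t1E.
rewrite t1E (ug t (t + h))//.
have -> : h *: b (E j) = vint (fun=> b (E j)) t (t + h).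
  by rewrite vint_cst// addrAC subrr add0r.
have -> : E j - vint (fun=> b (E j)) t (t + h) + (g (t + h) - g t) -
    (u t - vint (b \o u) t (t + h) + (g (t + h) - g t)) =
    (E j - u t) + (vint (b \o u) t (t + h) - vint (fun=> b (E j)) t (t + h)).
  by apply/rowP => i; rewrite !mxE; ring.
rewrite vintB; [|exact: path_comp_continuous|exact: cst_continuous].
apply: le_trans (ler_normD _ _) _.
apply: (@le_trans _ _ (er + L * (er + eta) * (t + h - t))).
  rewrite lerD2l; apply: vint_le => //.
    by move=> s; apply: cvgB; [exact: path_comp_continuous|exact: cvg_cst].
  move=> s /andP[ts sh] /=.
  have sT : t0 <= s <= t0 + T.
    case/andP: tj1 => h1 _; case/andP: tj2; rewrite t1E => _ h2.
    by rewrite (le_trans h1)// (le_trans sh).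
  apply: le_trans (HL _ _ _ Ejr) _; first by apply: le_trans (ur _ sT) _; rewrite lerDl.
  rewrite ler_wpM2l// (_ : u s - E j = (u s - u t) - (E j - u t)); last first.
    by apply/rowP => i; rewrite !mxE; ring.
  rewrite [leRHS]addrC; apply: le_trans (ler_normB _ _) _; rewrite lerD2r; apply: Hdel => //.
  rewrite ger0_norm ?subr_ge0// lerBlDr; apply: le_trans sh _; rewrite addrC lerD2r.
  exact: hdel.
rewrite (_ : t + h - t = h); last by ring.
rewrite exprS.
set q := _ ^+ j in IH *.
have -> : er + L * (er + eta) * h = (1 + L * h) * er + L * h * eta by ring.
have -> : eta * ((1 + L * h) * q - 1) = (1 + L * h) * (eta * (q - 1)) + L * h * eta by ring.
by rewrite lerD2r ler_wpM2l// addr_ge0// mulr_ge0// ltW.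
Qed.

End Paths.

(** * Continuous functions determine measures on rows *)

Section Hat.
Context {R : realType}.

(** Continuous functions with values in [0, 1] that converge to the indicator of the open
    interval. *)
Definition hat1 (a b : R) (k : nat) (x : R) : R :=
  Num.max 0 (Num.min 1 (k%:R * Num.min (x - a) (b - x))).

Lemma hat1_ge0 a b k x : 0 <= hat1 a b k x.
Proof. by rewrite le_max lexx. Qed.

Lemma hat1_le1 a b k x : hat1 a b k x <= 1.
Proof. by rewrite ge_max ler01/= ge_min lexx. Qed.

Lemma hat1_continuous a b k : continuous (hat1 a b k).
Proof.
move=> x; pose h y : R^o := Num.min (y - a) (b - y).
have ch : {for x, continuous h}.
  apply: (continuous_min (f := fun y => y - a) (g := fun y => b - y)).
    by apply: cvgB; [exact: cvg_id|exact: cvg_cst].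
  by apply: cvgB; [exact: cvg_cst|exact: cvg_id].
apply: (continuous_max (f := fun=> 0) (g := fun y => Num.min 1 (k%:R * h y))); first exact: cvg_cst.
apply: (continuous_min (f := fun=> 1) (g := fun y => k%:R * h y)); first exact: cvg_cst.
by apply: cvgM; [exact: cvg_cst|exact: ch].
Qed.

Lemma hat1_cvg a b x : hat1 a b k x @[k --> \oo] --> (\1_(`]a, b[%classic) x : R).
Proof.
set m := Num.min (x - a) (b - x); rewrite indicE.
have [|/negP] := boolP (x \in _); rewrite inE/= in_itv/=.
  move=> /andP[ax xb]; have m0 : 0 < m by rewrite lt_min !subr_gt0 ax.
  apply: cvg_near_cst; exists (Num.truncn m^-1).+1 => // k /= km.
  rewrite /hat1 -/m; have k1 : 1 <= k%:R * m.
    rewrite -ler_pdivrMr// mul1r; apply: le_trans (ltW (truncnS_gt _)) _.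
    by rewrite ler_nat.
  by rewrite (min_idPl k1); exact/max_idPr.
move=> nab; have m0 : m <= 0.
  rewrite ge_min !subr_le0; apply/negPn/negP; rewrite negb_or -!ltNge => H; exact: nab.
apply: cvg_near_cst; exists 0%N => // k _; rewrite /hat1 -/m; apply/max_idPl.
by rewrite ge_min (mulr_ge0_le0 _ m0)// orbT.
Qed.

Context {n : nat}.

Definition hat (a b : 'I_n -> R) (k : nat) (x : 'rV[R]_n) : R :=
  \prod_i hat1 (a i) (b i) k (x 0 i).

Lemma hat_ge0 a b k x : 0 <= hat a b k x.
Proof. by apply: prodr_ge0 => i _; exact: hat1_ge0. Qed.

Lemma hat_le1 a b k x : hat a b k x <= 1.
Proof. by apply: prodr_ile1 => i _; rewrite hat1_ge0 hat1_le1. Qed.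

Lemma hat_continuous a b k : continuous (hat a b k).
Proof.
rewrite /hat; elim: (index_enum _) => [|i r IH] x.
  have -> : (fun x : 'rV_n => \prod_(i <- [::]) hat1 (a i) (b i) k (x 0 i)) = cst 1.
    by apply/funext => y; rewrite big_nil.
  exact: cst_continuous.
have -> : (fun x : 'rV_n => \prod_(i <- i :: r) hat1 (a i) (b i) k (x 0 i)) =
    (fun x : 'rV_n => hat1 (a i) (b i) k (x 0 i) * \prod_(i <- r) hat1 (a i) (b i) k (x 0 i)).
  by apply/funext => y; rewrite big_cons.
apply: (continuousM (s := fun x : 'rV_n => hat1 (a i) (b i) k (x 0 i))
  (t := fun x : 'rV_n => \prod_(i <- r) hat1 (a i) (b i) k (x 0 i))); last exact: IH.
apply: (@continuous_comp _ _ _ (fun x : 'rV_n => x 0 i)); first exact: coord_continuous.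
exact: hat1_continuous.
Qed.

Definition obox (a b : 'I_n -> R) : set 'rV[R]_n := rbox (fun i => `]a i, b i[%classic).

Lemma hat_cvg a b x : hat a b k x @[k --> \oo] --> (\1_(obox a b) x : R).
Proof.
have -> : (\1_(obox a b) x : R) = \prod_i \1_(`]a i, b i[%classic) (x 0 i).
  rewrite indicE; have [|/negP H] := boolP (x \in _).
    rewrite inE => H; rewrite big1// => i _; rewrite indicE mem_set//; exact: H.
  have [i xi] : exists i, ~ `]a i, b i[%classic (x 0 i).
    by apply/not_existsP => H2; apply: H; rewrite inE => i; exact: contrapT (H2 i).
  by rewrite (bigD1 i)//= indicE memNset// mul0r.
rewrite /hat; elim: (index_enum _) => [|i r IH].
  under eq_fun do rewrite big_nil; rewrite big_nil; exact: cvg_cst.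
under eq_fun do rewrite big_cons; rewrite big_cons; apply: cvgM; last exact: IH.
exact: hat1_cvg.
Qed.

Lemma brv_openE : @measurable _ (brv R n) =
  <<s [set C | exists a b, C = obox a b] >>.
Proof.
apply/seteqP; split.
  apply: smallest_sub; first exact: smallest_sigma_algebra.
  move=> U oU; rewrite (open_brvE oU) bigcup_mkcond.
  set G := (X in <<s X >>).
  apply: (@countable_bigcupT_measurable _ (g_sigma_algebraType G)).
    exact: countableP.
  move=> ab; case: ifPn => _; last exact: (@measurable0 _ (g_sigma_algebraType G)).
  by apply: sub_sigma_algebra; exists (fun i => ratr (ab.1 0 i)), (fun i => ratr (ab.2 0 i)).
apply: smallest_sub; first exact: sigma_algebra_measurable.
by move=> _ [a [b ->]]; apply: rbox_measurable => i; exact: measurable_itv.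
Qed.

Lemma oboxI : setI_closed [set C | exists a b : 'I_n -> R, C = obox a b].
Proof.
move=> _ _ [a [b ->]] [a' [b' ->]]; rewrite rboxI.
exists (fun i => Num.max (a i) (a' i)), (fun i => Num.min (b i) (b' i)).
apply/seteqP; split=> x /= H i; have := H i; rewrite /= !in_itv/= gt_max lt_min.
  by move=> [/andP[-> ->] /andP[-> ->]].
by move=> /andP[/andP[-> ->] /andP[-> ->]].
Qed.

Lemma hat_integral_cvg (m : {measure set (brv R n) -> \bar R}) a b : (m setT < +oo)%E ->
  (\int[m]_x (hat a b k x)%:E @[k --> \oo] --> m (obox a b))%E.
Proof.
move=> moo; have mB : measurable (obox a b : set (brv R n)).
  by apply: rbox_measurable => i; exact: measurable_itv.
rewrite -[X in _ --> m X]setIT -integral_indic//.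
apply: (@dominated_cvg _ _ _ m setT measurableT (fun k x => (hat a b k x)%:E)
  (fun x => (\1_(obox a b) x)%:E) (cst 1%E)) => //.
- by move=> k; apply/measurable_EFinP; apply: (@continuous_brv R n (hat a b k)); have := @hat_continuous a b k.
- by move=> x _; apply: cvg_EFin; [exact: nearW|exact: hat_cvg].
- apply/integrableP; split; first exact: measurable_cst.
  rewrite (eq_integral (cst 1%E)); first by rewrite integral_cst// mul1e.
  by move=> x _; exact: gee0_abs.
- by move=> k x _ /=; rewrite lee_fin ger0_norm ?hat_le1 ?hat_ge0.
Qed.

Lemma brv_cont_eq (m1 m2 : {measure set (brv R n) -> \bar R}) :
  (m1 setT < +oo)%E -> (m2 setT < +oo)%E ->
  (forall f : 'rV[R]_n -> R, continuous f -> (forall x, 0 <= f x <= 1) ->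
     (\int[m1]_x (f x)%:E = \int[m2]_x (f x)%:E)%E) ->
  forall B : set (brv R n), measurable B -> m1 B = m2 B.
Proof.
move=> m1oo m2oo m12 B mB.
apply: (@measure_unique _ R (brv R n) [set C | exists a b, C = obox a b]
  (fun k => obox (fun=> - k%:R) (fun=> k%:R))) => //.
- exact: brv_openE.
- exact: oboxI.
- by move=> k; exists (fun=> - k%:R), (fun=> k%:R).
- apply/seteqP; split=> // x _; exists (Num.truncn `|x|).+1 => // i /=.
  rewrite in_itv/= -ltr_norml; apply: le_lt_trans (rv_coord_le _ _) _.
  exact: truncnS_gt.
- move=> _ [a [b ->]]; have H1 := @hat_integral_cvg m1 a b m1oo.
  have H2 := @hat_integral_cvg m2 a b m2oo.
  apply: cvg_unique H1 _ => //; apply: cvg_trans H2; apply: near_eq_cvg; apply: nearW => k.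
  by rewrite m12//; [exact: hat_continuous|move=> x; rewrite hat_ge0 hat_le1].
- move=> k; apply: le_lt_trans m1oo; apply: le_measure; rewrite ?inE//.
  by apply: rbox_measurable => i; exact: measurable_itv.
Qed.

(** Indicators of open boxes are limits of continuous functions, and the sets [B] for which the mass
    is measurable in [y] form a Dynkin system. *)
Lemma brv_measurable_prob {d} {Y : measurableType d}
    (m : Y -> {measure set (brv R n) -> \bar R}) :
  (forall y, m y setT = 1%E) ->
  (forall f : 'rV[R]_n -> R, continuous f -> (forall x, 0 <= f x <= 1) ->
     measurable_fun setT (fun y => (\int[m y]_x (f x)%:E)%E)) ->
  forall B : set (brv R n), measurable B -> measurable_fun setT (fun y => m y B).
Proof.
move=> m1 mf B; rewrite brv_openE.
have moo y : (m y setT < +oo)%E by rewrite m1 ltry.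
apply: (@dynkin_induction _ (brv R n) _ (fun B => measurable_fun setT (fun y => m y B))).
- exact: brv_openE.
- exact: oboxI.
- by under eq_fun do rewrite m1; exact: measurable_cst.
- move=> _ [a [b ->]].
  apply: (emeasurable_fun_cvg (fun k y => \int[m y]_x (hat a b k x)%:E)%E).
    move=> k; apply: mf; first exact: hat_continuous.
    by move=> x; rewrite hat_ge0 hat_le1.
  by move=> y _; exact: hat_integral_cvg.
- move=> S mS mmS.
  have -> : (fun y => m y (~` S)) = (fun y => 1 - m y S)%E.
    apply/funext => y; rewrite -(m1 y) -[in RHS](setUv S) measureU//; last 2 first.
    - exact: measurableC.
    - by rewrite setICr.
    rewrite addeAC subee ?add0e// ge0_fin_numE// (le_lt_trans _ (moo y))//.
    by apply: le_measure; rewrite ?inE.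
  by apply: emeasurable_funB.
- move=> F mF tF mFF.
  have -> : (fun y => m y (\bigcup_k F k)) = (fun y => \sum_(0 <= k <oo) m y (F k))%E.
    by apply/funext => y; rewrite measure_semi_bigcup//; exact: bigcup_measurable.
  exact: ge0_emeasurable_sum.
Qed.

End Hat.

(** * The Markov property and the energy balance *)

Section AlmostSure.
Context {R : realType} {d : measure_display} {Omega : measurableType d}.
Variable P : probability Omega R.

Lemma as_integral_cvg (X_ : nat -> Omega -> R) (X : Omega -> R) :
  (forall m, measurable_fun setT (X_ m)) -> measurable_fun setT X ->
  (forall m om, 0 <= X_ m om <= 1) ->
  {ae P, forall om, X_ m om @[m --> \oo] --> X om} ->
  (\int[P]_om (X_ m om)%:E @[m --> \oo] --> \int[P]_om (X om)%:E)%E.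
Proof.
move=> mX_ mX X01 cX.
have h1 m : measurable_fun setT (fun om => (X_ m om)%:E) by exact/measurable_EFinP.
have h2 : measurable_fun setT (fun om => (X om)%:E) by exact/measurable_EFinP.
have h3 : {ae P, forall om, setT om -> (X_ m om)%:E @[m --> \oo] --> (X om)%:E}.
  by apply: filterS cX => om H _; apply: cvg_EFin => //; exact: nearW.
have h4 : P.-integrable setT (cst 1%E : Omega -> \bar R) by exact: finite_measure_integrable_cst.
have h5 : {ae P, forall om m, setT om -> (`|(X_ m om)%:E| <= cst 1%E om)%E}.
  by apply: aeW => om m _ /=; have /andP[x0 x1] := X01 m om; rewrite lee_fin ger0_norm.
by have [_ _] := dominated_convergence measurableT h1 h2 h3 h4 h5.
Qed.

Lemma as_prob_le (E F : set Omega) : measurable E -> measurable F ->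
  {ae P, forall om, E om -> F om} -> (P E <= P F)%E.
Proof.
move=> mE mF [N [mN PN EF]].
apply: (@le_trans _ _ (P (F `|` N))); last first.
  by apply: le_trans (measureU2 _ _ _) _ => //; rewrite [X in (_ + X)%E]PN adde0.
apply: le_measure; rewrite ?inE//; first exact: measurableU.
move=> om Eom; have [|nF] := pselect (F om); first by left.
by right; apply: EF => /= H; exact/nF/H.
Qed.

Lemma as_prob_eq (E F : set Omega) : measurable E -> measurable F ->
  {ae P, forall om, E om <-> F om} -> P E = P F.
Proof.
move=> mE mF EF; apply/le_anti/andP; split; apply: as_prob_le => //.
  by apply: filterS EF => om [].
by apply: filterS EF => om [].
Qed.

End AlmostSure.

Section Cut.
Context {R : realType}.

(** The threshold (m+1)^(1/4) tends to infinity, as convergence of the scheme requires, but so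
    slowly that m+1 explicit steps of length h = T/(m+1) add only (m+1) (h cut)^2 = T^2 / cut^2,
    which tends to 0, to the energy. *)
Definition cut (m : nat) : R := Num.sqrt (Num.sqrt m.+1%:R).

Lemma cut_ge0 m : 0 <= cut m.
Proof. exact: sqrtr_ge0. Qed.

Lemma cut_large M : exists m0, forall m, (m0 <= m)%N -> M <= cut m.
Proof.
exists (Num.truncn (M ^+ 4)) => m mM; apply: le_trans (ler_norm _) _.
rewrite -sqrtr_sqr /cut ler_wsqrtr// -[leLHS]ger0_norm ?sqr_ge0// -sqrtr_sqr ler_wsqrtr//.
rewrite -exprM; apply: le_trans (ltW (truncnS_gt _)) _; by rewrite ler_nat ltnS.
Qed.

Definition ugrid (t h : R) (j : nat) : R := t + j%:R * h.

Lemma ugrid_grid t h : 0 <= t -> 0 < h -> grid (ugrid t h).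
Proof.
move=> t0 h0; split=> [|j]; rewrite /ugrid ?mul0r ?addr0// ltrD2l ltr_pM2r// ltr_nat.
exact: ltnSn.
Qed.

End Cut.

(** * The Markov property *)

Section Flow.
Context {R : realType} {d : measure_display} {Omega : measurableType d}.
Variable P : probability Omega R.
Context {I : finType}.
Variable W : I -> R -> Omega -> R.
Hypothesis hW : forall i, brownian P (W i).
Hypothesis hWind : independent_processes P W.
Context {n : nat}.
Variables (b : 'rV[R]_n -> 'rV[R]_n) (S : I -> 'rV[R]_n).
Variable u : 'rV[R]_n -> R -> Omega -> 'rV[R]_n.

Definition noise (t : R) (om : Omega) : 'rV[R]_n := \sum_i W i t om *: S i.

(** The exceptional null set may depend on [x], so a random initial state cannot be substituted
    pathwise; this is why the Markov property is obtained through the Euler scheme. *)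
Record flow : Prop := Flow {
  flow_meas : forall x t, 0 <= t -> measurable_fun setT (u x t : Omega -> brv R n);
  flow_sol : forall x, {ae P, forall om, exists v,
    [/\ path_sol b (noise ^~ om) v, v 0 = x & forall t, 0 <= t -> v t = u x t om]} }.

Hypotheses (bL : loclip b) (hu : flow).

(** Turns a row of scalar increments into the driving increments of the scheme, with the value 0
    beyond the last step. *)
Definition Zof m (xi : 'rV[R]_#|{: I * 'I_m}|) (j : nat) : 'rV[R]_n :=
  \sum_i (if insub j is Some j' then xi 0 (enum_rank (i, j')) else 0) *: S i.

Lemma noise_incr t j om : noise (t j.+1) om - noise (t j) om = \sum_i incr W t j i om *: S i.
Proof. by rewrite -sumrB; apply: eq_bigr => i _; rewrite /incr scalerBl. Qed.

Lemma Zof_incr t m j om : (j < m)%N ->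
  Zof (incr_row W t m om) j = noise (t j.+1) om - noise (t j) om.
Proof.
by move=> jm; rewrite noise_incr; apply: eq_bigr => i _; rewrite insubT mxE enum_rankK.
Qed.

Lemma euler_ext h c Z Z' y j : (forall i, (i < j)%N -> Z i = Z' i) ->
  euler b h c Z y j = euler b h c Z' y j.
Proof.
elim: j => //= j IH H; rewrite IH; last by move=> i ij; apply: H; exact: ltnW.
by rewrite H.
Qed.

Lemma cutoff_measurable c : measurable_fun setT (cutoff b c : brv R n -> brv R n).
Proof.
have cb := loclip_continuous bL.
apply: brv_measurable_fun => i; rewrite /cutoff.
have -> : (fun x => (if `|b x| <= c then b x else 0) 0 i) =
    (fun x => if `|b x| <= c then b x 0 i else 0).
  by apply/funext => x; case: ifP => // _; rewrite mxE.
apply: measurable_fun_ifT; last exact: measurable_cst.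
  apply: (measurable_fun_ler (f := fun x : brv R n => `|b x|)); last exact: measurable_cst.
  apply: (continuous_brv (f := fun x => `|b x|)) => x; apply: continuous_comp; first exact: cb.
  exact: norm_continuous.
apply: (continuous_brv (f := fun x => b x 0 i)) => x.
apply: (@continuous_comp _ _ _ b (fun M : 'rV_n => M 0 i)); first exact: cb.
exact: coord_continuous.
Qed.

Lemma euler_measurable m h c j : measurable_fun setT
  (fun z : brv R n * brv R #|{: I * 'I_m}| => euler b h c (@Zof m z.2) z.1 j : brv R n).
Proof.
elim: j => [|j IH] /=; first exact: measurable_fst.
apply: brv_measurable_fun => i.
under eq_fun do rewrite !mxE /Zof summxE.
apply: measurable_funD.
  apply: measurable_funB; first exact: (brv_coord i IH).
  apply: measurable_funM; first exact: measurable_cst.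
  exact: (brv_coord i (measurableT_comp (cutoff_measurable c) IH)).
apply: measurable_sum => k; under eq_fun do rewrite !mxE.
apply: measurable_funM; last exact: measurable_cst.
case: insub => [j'|]; last exact: measurable_cst.
by apply: (measurableT_comp (coord_brv _)); exact: measurable_snd.
Qed.

Definition eulr (t h c : R) (y : 'rV[R]_n) (j : nat) (om : Omega) : 'rV[R]_n :=
  euler b h c (fun j => noise (ugrid t h j.+1) om - noise (ugrid t h j) om) y j.

Lemma eulrE t h c y m j om : (j <= m)%N ->
  eulr t h c y j om = euler b h c (Zof (incr_row W (ugrid t h) m om)) y j.
Proof.
by move=> jm; apply: euler_ext => i ij; rewrite Zof_incr// (leq_trans ij).
Qed.

Lemma eulr_measurable t h c (Y : Omega -> brv R n) j : 0 <= t -> 0 < h ->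
  measurable_fun setT Y ->
  measurable_fun setT (fun om => eulr t h c (Y om) j om : brv R n).
Proof.
move=> t0 h0 mY; under eq_fun do rewrite (eulrE _ _ _ _ _ (leqnn j)).
have mx := @incr_row_measurable _ _ _ P I W hW _ j (ugrid_grid t0 h0).
exact: (measurableT_comp (@euler_measurable j h c j) (measurable_fun_pair mY mx)).
Qed.

Lemma eulr_cvg x (t T : R) : 0 <= t -> 0 < T ->
  {ae P, forall om, forall e : R, 0 < e -> exists m0, forall m, (m0 <= m)%N ->
    forall j, (j <= m.+1)%N ->
    `|eulr t (T / m.+1%:R) (cut m) (u x t om) j om - u x (ugrid t (T / m.+1%:R) j) om| <= e}.
Proof.
move=> t0 T0; apply: filterS (flow_sol hu x) => om [v [vs _ vu]] e e0.
have [m0 H] := euler_cvg bL vs t0 T0 cut_large e0.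
exists m0 => m mm j jm; have := H m mm j jm; rewrite !vu//.
by rewrite addr_ge0// mulr_ge0// divr_ge0// ltW.
Qed.

Lemma eulr_cvg_end x (t T : R) : 0 <= t -> 0 < T ->
  {ae P, forall om, eulr t (T / m.+1%:R) (cut m) (u x t om) m.+1 om @[m --> \oo] -->
    u x (t + T) om}.
Proof.
move=> t0 T0; apply: filterS (eulr_cvg x t0 T0) => om H.
apply/cvgrPdist_le => e e0; have [m0 Hm] := H e e0; exists m0 => // m /= mm.
have := Hm m mm m.+1 (leqnn _); rewrite distrC /ugrid.
by rewrite mulrC divfK ?pnatr_eq0.
Qed.

Lemma flow_init x : {ae P, forall om, u x 0 om = x}.
Proof. by apply: filterS (flow_sol hu x) => om [v [_ v0 vu]]; rewrite -vu. Qed.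

Lemma eulr_cvg0 x (T : R) : 0 < T ->
  {ae P, forall om, eulr 0 (T / m.+1%:R) (cut m) x m.+1 om @[m --> \oo] --> u x T om}.
Proof.
move=> T0; apply: filterS2 (flow_init x) (eulr_cvg_end x (lexx _) T0) => om.
by move=> ->; rewrite add0r.
Qed.

Let test (f : 'rV[R]_n -> R) := continuous f /\ forall x, 0 <= f x <= 1.

Let test_meas f : test f -> measurable_fun setT (f : brv R n -> R).
Proof. by move=> [cf _]; exact: continuous_brv. Qed.

Lemma flow_test_cvg f x (T : R) : test f -> 0 < T ->
  (\int[P]_om (f (eulr 0 (T / m.+1%:R) (cut m) x m.+1 om))%:E @[m --> \oo] -->
   \int[P]_om (f (u x T om))%:E)%E.
Proof.
move=> ft T0; have mf := test_meas ft.
apply: as_integral_cvg.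
- move=> m; apply: (measurableT_comp mf); apply: eulr_measurable => //.
  by rewrite divr_gt0.
- by apply: (measurableT_comp mf); apply: flow_meas => //; exact: ltW.
- by move=> m om; exact: ft.2.
- by apply: filterS (eulr_cvg0 x T0) => om; apply: continuous_cvg; exact: ft.1.
Qed.

Lemma flow_test_cvg_shift f x (t T : R) : test f -> 0 <= t -> 0 < T ->
  (\int[P]_om (f (eulr t (T / m.+1%:R) (cut m) (u x t om) m.+1 om))%:E @[m --> \oo] -->
   \int[P]_om (f (u x (t + T) om))%:E)%E.
Proof.
move=> ft t0 T0; have mf := test_meas ft.
apply: as_integral_cvg.
- move=> m; apply: (measurableT_comp mf); apply: eulr_measurable => //; last exact: flow_meas.
  by rewrite divr_gt0.
- by apply: (measurableT_comp mf); apply: flow_meas => //; rewrite addr_ge0// ltW.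
- by move=> m om; exact: ft.2.
- by apply: filterS (eulr_cvg_end x t0 T0) => om; apply: continuous_cvg; exact: ft.1.
Qed.

(** The transition operator of the Euler scheme applied to [f]. It is measurable in [y] because the
    scheme is jointly measurable in the initial state and the increments; its limit gives the same
    for the flow. *)
Let Em f m h c y : \bar R :=
  (\int[P]_om (f (euler b h c (Zof (incr_row W (ugrid 0 h) m om)) y m))%:E)%E.

Let Em_measurable f m h c : test f -> 0 < h -> measurable_fun setT (Em f m h c : brv R n -> \bar R).
Proof.
move=> ft h0; have mx := @incr_row_measurable _ _ _ P I W hW _ m (ugrid_grid (lexx 0) h0).
pose phi (z : brv R n * brv R #|{: I * 'I_m}|) : \bar R :=
  (f (euler b h c (@Zof m z.2) z.1 m))%:E.
have mphi : measurable_fun setT phi.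
  apply/measurable_EFinP; exact: (measurableT_comp (test_meas ft) (@euler_measurable m h c m)).
have phi0 z : (0 <= phi z)%E by rewrite lee_fin; case/andP: (ft.2 (euler b h c (@Zof m z.2) z.1 m)).
have -> : (Em f m h c : brv R n -> \bar R) = fubini_F (law P mx) phi.
  apply/funext => y; rewrite /fubini_F ge0_integral_law//.
  by apply: measurableT_comp.
exact: measurable_fun_fubini_tonelli_F.
Qed.

Lemma flow_test_measurable f (T : R) : test f -> 0 < T ->
  measurable_fun setT (fun y : brv R n => \int[P]_om (f (u y T om))%:E)%E.
Proof.
move=> ft T0.
apply: (emeasurable_fun_cvg (fun m => Em f m.+1 (T / m.+1%:R) (cut m) : brv R n -> \bar R)).
  by move=> m; apply: Em_measurable => //; rewrite divr_gt0.
move=> y _; have -> : (fun m => Em f m.+1 (T / m.+1%:R) (cut m) y) = (fun m =>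
    \int[P]_om (f (eulr 0 (T / m.+1%:R) (cut m) y m.+1 om))%:E)%E.
  apply/funext => m; apply: eq_integral => om _.
  by rewrite (eulrE _ _ _ _ _ (leqnn _)).
exact: flow_test_cvg.
Qed.

(** A single grid with [k] steps up to time [t] followed by steps s/m: the approximation of [u x t]
    and the later increments are then functions of disjoint blocks of increments. *)
Definition cgrid (t s : R) (k m : nat) (j : nat) : R :=
  if (j <= k)%N then j%:R * (t / k%:R) else t + (j - k)%:R * (s / m%:R).

Lemma cgrid_grid t s k m : 0 < t -> 0 < s -> (0 < k)%N -> (0 < m)%N -> grid (cgrid t s k m).
Proof.
move=> t0 s0 k0 m0; split=> [|j]; first by rewrite /cgrid mul0r.
have tk : 0 < t / k%:R by rewrite divr_gt0// ltr0n.
have sm : 0 < s / m%:R by rewrite divr_gt0// ltr0n.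
rewrite /cgrid; case: (ltngtP j k) => jk.
- by rewrite ltr_pM2r// ltr_nat.
- by rewrite ltrD2l ltr_pM2r// ltr_nat subSn// ltnW.
- by rewrite jk subSnn mul1r mulrC divfK ?gt_eqF ?ltr0n// ltrDl.
Qed.

Lemma incr_row_ext t t' m : (forall j, (j <= m)%N -> t j = t' j) ->
  incr_row W t m = incr_row W t' m.
Proof.
move=> H; apply/funext => om; apply/rowP => k; rewrite !mxE /incr !H//.
exact: ltnW.
Qed.

(** [u x t] is a limit of Euler schemes, which depend only on increments before [t]. The
    factorization passes to the limit for continuous functions of [u x t], and these determine its
    law on the event that the increments lie in [B]. *)
Lemma flow_indep x (t s : R) (m : nat) : 0 < t -> 0 < s -> (0 < m)%N ->
  indep P (u x t : Omega -> brv R n) (incr_row W (ugrid t (s / m%:R)) m : Omega -> brv R _).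
Proof.
move=> t0 s0 m0; set xi := incr_row _ _ _.
have sm : 0 < s / m%:R by rewrite divr_gt0// ltr0n.
have mxi : measurable_fun setT (xi : Omega -> brv R _).
  exact: (@incr_row_measurable _ _ _ P I W hW _ m (ugrid_grid (ltW t0) sm)).
have mu := flow_meas hu x (ltW t0).
move=> A B mA mB.
have mE : measurable (xi @^-1` B) by rewrite -[X in measurable X]setTI; exact: mxi.
have nn : 0 <= fine (P (xi @^-1` B)) by rewrite fine_ge0.
have fE : (fine (P (xi @^-1` B)))%:E = P (xi @^-1` B) by rewrite fineK// fin_num_measure.
have E0 om : 0 <= (\1_(xi @^-1` B) om : R) by [].
have mEi : measurable_fun setT (\1_(xi @^-1` B) : Omega -> R) by exact: measurable_indic.
pose dP := density P E0 mEi.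
pose m1 := imagem dP mu.
have m1E C : measurable C -> m1 C = P (u x t @^-1` C `&` xi @^-1` B).
  move=> mC; rewrite setIC -[LHS]/(\int[P]_(om in u x t @^-1` C) (\1_(xi @^-1` B) om)%:E)%E.
  rewrite integral_indic// -[X in measurable X]setTI.
  exact (mu measurableT C mC).
pose m2 : {measure set (brv R n) -> \bar R} := mscale (NngNum nn) (law P mu).
have mg (f : 'rV[R]_n -> R) : continuous f -> (forall x, 0 <= f x) ->
    (\int[m1]_y (f y)%:E = \int[P]_om (f (u x t om) * \1_B (xi om))%:E)%E.
  move=> cf f0; have mf : measurable_fun setT (f : brv R n -> R) by exact: continuous_brv.
  transitivity (\int[dP]_om (f (u x t om))%:E)%E.
    apply: (ge0_integral_pushforward mu dP measurableT (f := fun y => (f y)%:E)).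
    - exact/measurable_EFinP.
    - by move=> y _; rewrite lee_fin.
  rewrite (integral_density E0 mEi (mu := P))//.
  - by move=> om; rewrite lee_fin.
  - by apply/measurable_EFinP; exact: (measurableT_comp mf mu).
rewrite -m1E// -[RHS](_ : m2 A = _); last by rewrite -[LHS]/((fine (P (xi @^-1` B)))%:E * P (u x t @^-1` A))%E fE muleC.
apply: brv_cont_eq mA.
- by rewrite m1E// preimage_setT setTI; apply: le_lt_trans (probability_le1 _ mE) (ltry 1).
- by rewrite -[ltLHS]/((fine (P (xi @^-1` B)))%:E * law P mu setT)%E probability_setT mule1 ltry.
move=> f cf f01; have f0 y : 0 <= f y by case/andP: (f01 y).
have ft : test f by [].
have mf := test_meas ft.
rewrite mg//.
have -> : (\int[m2]_y (f y)%:E = P (xi @^-1` B) * \int[P]_om (f (u x t om))%:E)%E.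
  rewrite ge0_integral_mscale//; last 2 first.
  - exact/measurable_EFinP.
  - by move=> y _; rewrite lee_fin.
  rewrite /= fE; congr (_ * _)%E; rewrite ge0_integral_law//.
  exact/measurable_EFinP.
have mB1 : measurable_fun setT (fun om => \1_B (xi om) : R).
  by apply: (measurableT_comp _ mxi); exact: measurable_indic.
have L1 : (\int[P]_om (f (eulr 0 (t / k.+1%:R) (cut k) x k.+1 om) * \1_B (xi om))%:E
    @[k --> \oo] --> \int[P]_om (f (u x t om) * \1_B (xi om))%:E)%E.
  apply: as_integral_cvg.
  - move=> k; apply: measurable_funM => //.
    by apply: (measurableT_comp mf); apply: eulr_measurable => //; rewrite divr_gt0.
  - by apply: measurable_funM => //; exact: (measurableT_comp mf mu).
  - move=> k om; rewrite indicE; case: (_ \in _); rewrite ?mulr1 ?mulr0 ?lexx ?ler01//.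
  - apply: filterS (eulr_cvg0 x t0) => om H; apply: cvgM; last exact: cvg_cst.
    by apply: continuous_cvg => //; exact: cf.
apply: cvg_unique L1 _ => //.
have -> : (fun k => \int[P]_om (f (eulr 0 (t / k.+1%:R) (cut k) x k.+1 om) * \1_B (xi om))%:E)%E =
  (fun k => P (xi @^-1` B) * \int[P]_om (f (eulr 0 (t / k.+1%:R) (cut k) x k.+1 om))%:E)%E.
  apply/funext => k; pose g := cgrid t s k.+1 m.
  have gg : grid g by exact: cgrid_grid.
  have xE : xi = incr_row W (fun j => g (k.+1 + j)%N) m.
    apply: incr_row_ext => j _; rewrite /g /cgrid /ugrid; case: j => [|j].
      by rewrite addn0 leqnn mul0r addr0 mulrC divfK ?pnatr_eq0.
    by rewrite leqNgt addnS ltnS leq_addr/= subSn ?leq_addr// addKn.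
  have eE om : eulr 0 (t / k.+1%:R) (cut k) x k.+1 om =
      euler b (t / k.+1%:R) (cut k) (Zof (incr_row W g k.+1 om)) x k.+1.
    rewrite (eulrE _ _ _ _ _ (leqnn _)) (@incr_row_ext _ g)// => j jk.
    by rewrite /g /cgrid jk /ugrid add0r.
  have mek := @incr_row_measurable _ _ _ P I W hW _ k.+1 gg.
  pose F (z : brv R #|{: I * 'I_k.+1}|) : R :=
    f (euler b (t / k.+1%:R) (cut k) (@Zof k.+1 z) x k.+1).
  have mF : measurable_fun setT F.
    apply: (measurableT_comp mf).
    exact: (measurableT_comp (@euler_measurable k.+1 (t / k.+1%:R) (cut k) k.+1)
      (measurable_fun_pair (measurable_cst (x : brv R n)) (@measurable_id _ _ setT))).
  pose phi (z : brv R #|{: I * 'I_k.+1}| * brv R #|{: I * 'I_m}|) : \bar R :=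
    ((F z.1)%:E * (\1_B z.2)%:E)%E.
  transitivity (\int[P]_om phi (incr_row W g k.+1 om, xi om))%E.
    by apply: eq_integral => om _; rewrite /phi /F -eE EFinM.
  have iI : indep P (incr_row W g k.+1 : Omega -> brv R _) (xi : Omega -> brv R _).
    by rewrite xE; exact: (@incr_row_indep _ _ _ P I W hW hWind g k.+1 m gg).
  have F0 z : 0 <= F z by exact: f0.
  have mphi : measurable_fun setT phi.
    apply: emeasurable_funM; apply/measurable_EFinP.
      by apply: (measurableT_comp mF); exact: measurable_fst.
    by apply: (measurableT_comp (measurable_indic mB)); exact: measurable_snd.
  have phi0 z : (0 <= phi z)%E by rewrite mule_ge0// lee_fin.
  apply: (etrans (indep_integral mek mxi iI mphi phi0)).
  have iB : (\int[P]_om (\1_B (xi om))%:E = P (xi @^-1` B))%E.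
    by rewrite -[in RHS](setIT (xi @^-1` B)) -integral_indic.
  transitivity (\int[P]_om ((F (incr_row W g k.+1 om))%:E * P (xi @^-1` B)))%E.
    apply: eq_integral => om _; rewrite /phi/= ge0_integralZl ?iB// ?lee_fin//.
    exact/measurable_EFinP.
  rewrite ge0_integralZr//; last 2 first.
  - by apply/measurable_EFinP; exact: (measurableT_comp mF mek).
  - by move=> om _; rewrite lee_fin.
  by rewrite muleC; congr (_ * _)%E; apply: eq_integral => om _; rewrite eE.
by apply: cvgeZl; [rewrite fin_num_measure|exact: flow_test_cvg].
Qed.

(** The scheme started at time [t] from [u x t] converges to [u x (t + s)]. Its increments are
    independent of [u x t] and distributed as those from time 0, so its mean is [Em] averaged over
    [u x t]. *)
Lemma flow_test_markov f x (t s : R) : test f -> 0 < t -> 0 < s ->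
  (\int[P]_om (f (u x (t + s) om))%:E =
   \int[P]_om \int[P]_om' (f (u (u x t om) s om'))%:E)%E.
Proof.
move=> ft t0 s0; have mf := test_meas ft; have mu := flow_meas hu x (ltW t0).
have L1 := @flow_test_cvg_shift f x t s ft (ltW t0) s0.
apply: cvg_unique L1 _ => //.
have h0 m : 0 < s / m.+1%:R by rewrite divr_gt0.
have E1 m : (\int[P]_om (f (eulr t (s / m.+1%:R) (cut m) (u x t om) m.+1 om))%:E =
    \int[P]_om Em f m.+1 (s / m.+1%:R) (cut m) (u x t om))%E.
  have gg := ugrid_grid (ltW t0) (h0 m); have g0 := ugrid_grid (lexx 0) (h0 m).
  have mx := @incr_row_measurable _ _ _ P I W hW _ m.+1 gg.
  have mx0 := @incr_row_measurable _ _ _ P I W hW _ m.+1 g0.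
  pose phi (z : brv R n * brv R #|{: I * 'I_m.+1}|) : \bar R :=
    (f (euler b (s / m.+1%:R) (cut m) (@Zof m.+1 z.2) z.1 m.+1))%:E.
  have mphi : measurable_fun setT phi.
    apply/measurable_EFinP.
    exact: (measurableT_comp mf (@euler_measurable m.+1 (s / m.+1%:R) (cut m) m.+1)).
  have phi0 z : (0 <= phi z)%E.
    by rewrite lee_fin; case/andP: (ft.2 (euler b (s / m.+1%:R) (cut m) (@Zof m.+1 z.2) z.1 m.+1)).
  transitivity (\int[P]_om phi (u x t om, incr_row W (ugrid t (s / m.+1%:R)) m.+1 om))%E.
    by apply: eq_integral => om _; rewrite (eulrE _ _ _ _ _ (leqnn _)).
  apply: (etrans (indep_integral (phi := phi) mu mx (flow_indep x t0 s0 (ltn0Sn m)) mphi phi0)).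
  apply: eq_integral => om _.
  have mphiy : measurable_fun setT (fun z => phi (u x t om, z)).
    exact: (measurableT_comp mphi (measurable_fun_pair (measurable_cst (u x t om : brv R n))
      (@measurable_id _ _ setT))).
  rewrite -(ge0_integral_law P mx (f := fun z => phi (u x t om, z)))//.
  rewrite /Em -(ge0_integral_law P mx0 (f := fun z => phi (u x t om, z)))//.
  apply: eq_measure_integral => B mB _; apply: (incr_row_law hW hWind gg g0) => // j _.
  by rewrite /ugrid -!natr1 !mulrDl !mul1r; ring.
have -> : (fun m => \int[P]_om (f (eulr t (s / m.+1%:R) (cut m) (u x t om) m.+1 om))%:E)%E =
  (fun m => \int[P]_om Em f m.+1 (s / m.+1%:R) (cut m) (u x t om))%E.
  by apply/funext.
have m1 m : measurable_fun setT (fun om => Em f m.+1 (s / m.+1%:R) (cut m) (u x t om)).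
  exact: (measurableT_comp (Em_measurable _ _ ft (h0 m)) mu).
have m2 : measurable_fun setT (fun om => \int[P]_om' (f (u (u x t om) s om'))%:E)%E.
  exact: (measurableT_comp (flow_test_measurable ft s0) mu).
apply: (@dominated_cvg _ _ _ P setT measurableT (fun m om => Em f m.+1 (s / m.+1%:R) (cut m) (u x t om))
  (fun om => \int[P]_om' (f (u (u x t om) s om'))%:E)%E (cst 1%E)) => //.
- move=> om _ /=.
  have -> : (fun m => Em f m.+1 (s / m.+1%:R) (cut m) (u x t om)) = (fun m =>
      \int[P]_om' (f (eulr 0 (s / m.+1%:R) (cut m) (u x t om) m.+1 om'))%:E)%E.
    apply/funext => m; apply: eq_integral => om' _.
    by rewrite (eulrE _ _ _ _ _ (leqnn _)).
  exact: flow_test_cvg.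
- exact: finite_measure_integrable_cst.
- move=> m om _ /=; rewrite gee0_abs; last first.
    by apply: integral_ge0 => om' _; rewrite lee_fin; case/andP: (ft.2 (euler b (s / m.+1%:R) (cut m)
      (Zof (incr_row W (ugrid 0 (s / m.+1%:R)) m.+1 om')) (u x t om) m.+1)).
  rewrite -[leRHS](integral_prob_cst P); apply: ge0_le_integral => //.
  - by move=> om' _; rewrite lee_fin; case/andP: (ft.2 (euler b (s / m.+1%:R) (cut m)
      (Zof (incr_row W (ugrid 0 (s / m.+1%:R)) m.+1 om')) (u x t om) m.+1)).
  - apply/measurable_EFinP; under eq_fun do rewrite -(eulrE _ _ _ _ _ (leqnn _)).
    by apply: (measurableT_comp mf); apply: eulr_measurable.
  - by move=> om' _; rewrite lee_fin; case/andP: (ft.2 (euler b (s / m.+1%:R) (cut m)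
      (Zof (incr_row W (ugrid 0 (s / m.+1%:R)) m.+1 om')) (u x t om) m.+1)).
Qed.

Section TransitionKernel.
Variables (t : R) (t0 : 0 < t).

Definition trk (y : brv R n) : {measure set (brv R n) -> \bar R} :=
  law P (flow_meas hu y (ltW t0)).

Let trk_measurable B : measurable B -> measurable_fun setT (trk ^~ B).
Proof.
apply: brv_measurable_prob => [y|f cf f01]; first exact: probability_setT.
have mf : measurable_fun setT (f : brv R n -> R) by exact: continuous_brv.
have -> : (fun y => \int[trk y]_z (f z)%:E)%E = (fun y => \int[P]_om (f (u y t om))%:E)%E.
  apply/funext => y; rewrite ge0_integral_law//; first exact/measurable_EFinP.
  by move=> z; rewrite lee_fin; case/andP: (f01 z).
exact: flow_test_measurable.
Qed.

HB.instance Definition _ := isKernel.Build _ _ (brv R n) (brv R n) R trk trk_measurable.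

Let trk1 y : trk y setT = 1%E.
Proof. exact: probability_setT. Qed.

HB.instance Definition _ := Kernel_isProbability.Build _ _ (brv R n) (brv R n) R trk trk1.

Definition transk : R.-pker (brv R n) ~> (brv R n) := trk.

Lemma transkE y B : transk y B = P (u y t @^-1` B).
Proof. by []. Qed.

Lemma integral_transk y (f : brv R n -> \bar R) : (forall z, 0 <= f z)%E ->
  measurable_fun setT f -> (\int[transk y]_z f z = \int[P]_om f (u y t om))%E.
Proof. by move=> f0 mf; rewrite ge0_integral_law. Qed.

End TransitionKernel.

End Flow.

Section ChapmanKolmogorov.
Context {R : realType} {d : measure_display} {Omega : measurableType d}.
Variable P : probability Omega R.
Context {I : finType}.
Variable W : I -> R -> Omega -> R.
Hypothesis hW : forall i, brownian P (W i).
Hypothesis hWind : independent_processes P W.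
Context {n : nat}.
Variables (b : 'rV[R]_n -> 'rV[R]_n) (S : I -> 'rV[R]_n).
Variable u : 'rV[R]_n -> R -> Omega -> 'rV[R]_n.
Hypotheses (bL : loclip b) (hu : flow P W b S u).

Local Notation K := (transk hW bL hu).

Lemma transk_comp (t s : R) (t0 : 0 < t) (s0 : 0 < s) (ts0 : 0 < t + s) x (B : set (brv R n)) :
  measurable B -> (K ts0 x B = \int[K t0 x]_y K s0 y B)%E.
Proof.
move=> mB; rewrite -[RHS]/(mkcomp_noparam (K t0) (K s0) x B).
apply: brv_cont_eq mB.
- by rewrite prob_kernel ltry.
- rewrite -[ltLHS]/(\int[K t0 x]_y K s0 y setT)%E (eq_integral (cst 1%E)).
    by rewrite integral_cst// mul1e prob_kernel ltry.
  by move=> y _; rewrite prob_kernel.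
move=> f cf f01.
have mf : measurable_fun setT (f : brv R n -> R) by exact: continuous_brv.
have mf' : measurable_fun setT (fun y : brv R n => (f y)%:E) by exact/measurable_EFinP.
have f0 y : (0 <= (f y)%:E)%E by rewrite lee_fin; case/andP: (f01 y).
have ft : continuous f /\ forall x, 0 <= f x <= 1 by [].
rewrite integral_kcomp_noparam// (integral_transk hW bL hu ts0)//.
rewrite (integral_transk hW bL hu t0)//; last 2 first.
- by move=> z; apply: integral_ge0.
- by apply: measurable_fun_integral_kernel => // U mU; exact: measurable_kernel.
rewrite (flow_test_markov hW hWind bL hu x ft t0 s0); apply: eq_integral => om _.
by rewrite (integral_transk hW bL hu s0).
Qed.

Lemma transk_comp_integral (t s : R) (t0 : 0 < t) (s0 : 0 < s) x (f : brv R n -> \bar R) :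
  measurable_fun setT f -> (forall y, 0 <= f y)%E ->
  (\int[P]_om f (u x (t + s) om) = \int[P]_om \int[P]_om' f (u (u x t om) s om'))%E.
Proof.
move=> mf f0; have ts0 : 0 < t + s by rewrite addr_gt0.
rewrite -(integral_transk hW bL hu ts0)//.
transitivity (\int[mkcomp_noparam (K t0) (K s0) x]_y f y)%E.
  by apply: eq_measure_integral => A mA _; exact: transk_comp.
rewrite integral_kcomp_noparam// (integral_transk hW bL hu t0)//; last 2 first.
- by move=> z; apply: integral_ge0.
- by apply: measurable_fun_integral_kernel => // U mU; exact: measurable_kernel.
by apply: eq_integral => om _; rewrite (integral_transk hW bL hu s0).
Qed.

End ChapmanKolmogorov.

(** * The energy balance *)

Section NoiseMoments.
Context {R : realType} {d : measure_display} {Omega : measurableType d}.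
Variable P : probability Omega R.
Context {I : finType}.
Variable W : I -> R -> Omega -> R.
Hypothesis hW : forall i, brownian P (W i).
Hypothesis hWind : independent_processes P W.
Context {n : nat}.
Variable S : I -> 'rV[R]_n.

Lemma sqr_sum_le (J : finType) (a : J -> R) : (\sum_i a i) ^+ 2 <= #|J|%:R * \sum_i a i ^+ 2.
Proof.
have -> : #|J|%:R * \sum_i a i ^+ 2 = \sum_i \sum_j (a i ^+ 2 + a j ^+ 2) / 2.
  under [RHS]eq_bigr do rewrite -mulr_suml big_split/= sumr_const.
  rewrite -mulr_suml big_split/= sumrMnl sumr_const -mulr_natl -[X in _ + X]mulr_natl.
  by field.
rewrite expr2 mulr_suml; apply: ler_sum => i _; rewrite mulr_sumr; apply: ler_sum => j _.
by have := sqr_ge0 (a i - a j); nra.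
Qed.

(** An upper bound for the variance of the noise per unit time: [#|I|] comes from Cauchy-Schwarz
    over the motions and 8 from [normal_second_moment]. *)
Definition noise_var : R := #|I|%:R * (8 * \sum_i dot (S i) (S i)).

Lemma noise_var_ge0 : 0 <= noise_var.
Proof. by rewrite mulr_ge0// mulr_ge0// sumr_ge0// => i _; exact: dot_ge0. Qed.

Definition jump (t : nat -> R) (j : nat) (om : Omega) : 'rV[R]_n :=
  \sum_i incr W t j i om *: S i.

Lemma dot_jump_le t j om :
  dot (jump t j om) (jump t j om) <= #|I|%:R * \sum_i incr W t j i om ^+ 2 * dot (S i) (S i).
Proof.
rewrite /dot mulr_sumr.
under [leRHS]eq_bigr do rewrite mulr_sumr mulr_sumr.
rewrite exchange_big; apply: ler_sum => k _; rewrite -expr2 summxE.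
rewrite -mulr_sumr; apply: le_trans (sqr_sum_le _) _; rewrite ler_wpM2l//.
by apply: ler_sum => i _; rewrite mxE exprMn expr2.
Qed.

Lemma jump_measurable t j : grid t -> measurable_fun setT (jump t j : Omega -> brv R n).
Proof.
move=> gt; apply: brv_measurable_fun => k; under eq_fun do rewrite summxE.
apply: measurable_sum => i; under eq_fun do rewrite mxE.
by apply: measurable_funM; [exact: (incr_measurable hW j i gt)|exact: measurable_cst].
Qed.

Lemma dot_measurable {d'} {T : measurableType d'} (X : T -> 'rV[R]_n) :
  measurable_fun setT (X : T -> brv R n) -> measurable_fun setT (fun z => dot (X z) (X z)).
Proof.
move=> mX; apply: measurable_sum => k; apply: measurable_funM; exact: brv_coord.
Qed.

Lemma incr_second_moment t j i : grid t ->
  (\int[P]_om (incr W t j i om ^+ 2)%:E <= (8 * (t j.+1 - t j))%:E)%E.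
Proof.
move=> gt; have mi : measurable_fun setT (incr W t j i : Omega -> measurableTypeR R).
  exact: (incr_measurable hW j i gt).
have h0 : 0 < t j.+1 - t j by rewrite subr_gt0; exact: gt.2.
have := @normal_second_moment R (Num.sqrt (t j.+1 - t j)); rewrite sqrtr_gt0 => /(_ h0).
rewrite sqr_sqrtr ?(ltW h0)//; apply: le_trans.
rewrite -(ge0_integral_law P mi (f := fun x => (x ^+ 2)%:E)); last 2 first.
- by apply/measurable_EFinP; exact: exprn_measurable.
- by move=> x; rewrite lee_fin sqr_ge0.
rewrite le_eqVlt; apply/orP; left; apply/eqP; apply: eq_measure_integral => A mA _.
by apply: (brownian_law (hW i)) => //; [exact: grid_ge0|exact: gt.2].
Qed.

Lemma jump_second_moment t j : grid t ->
  (\int[P]_om (dot (jump t j om) (jump t j om))%:E <= (noise_var * (t j.+1 - t j))%:E)%E.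
Proof.
move=> gt; have mi i : measurable_fun setT (incr W t j i) by exact: (incr_measurable hW j i gt).
have mi2 i : measurable_fun setT (fun om => (incr W t j i om ^+ 2)%:E).
  by apply/measurable_EFinP; apply: measurable_funX.
have dS i : 0 <= dot (S i) (S i) by exact: dot_ge0.
apply: (@le_trans _ _ (\int[P]_om (#|I|%:R%:E *
    \sum_i ((dot (S i) (S i))%:E * (incr W t j i om ^+ 2)%:E)))%E).
  apply: ge0_le_integral => //.
  - by move=> om _; rewrite lee_fin dot_ge0.
  - by apply/measurable_EFinP; apply: dot_measurable; exact: jump_measurable.
  - by apply: emeasurable_funM => //; apply: emeasurable_sum => i; apply: emeasurable_funM.
  - move=> om _; under eq_bigr do rewrite -EFinM mulrC.
    by rewrite sumEFin -EFinM lee_fin dot_jump_le.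
rewrite ge0_integralZl//; last 2 first.
- by apply: emeasurable_sum => i; apply: emeasurable_funM.
- by move=> om _; apply: sume_ge0 => i _; rewrite mule_ge0// lee_fin ?sqr_ge0.
rewrite /noise_var -mulrA EFinM; apply: lee_wpmul2l; first by rewrite lee_fin.
rewrite ge0_integral_sum//; last 2 first.
- by move=> i; apply: emeasurable_funM.
- by move=> i om _; rewrite mule_ge0// lee_fin ?sqr_ge0.
rewrite -mulrA mulr_suml mulr_sumr -sumEFin; apply: lee_sum => i _.
rewrite ge0_integralZl//; last 2 first.
- by move=> om _; rewrite lee_fin sqr_ge0.
- by rewrite lee_fin.
rewrite mulrCA EFinM; apply: lee_wpmul2l; first by rewrite lee_fin.
exact: incr_second_moment.
Qed.

Lemma jump_sym t j (f : brv R n -> \bar R) : grid t -> measurable_fun setT f ->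
  (forall y, 0 <= f y)%E ->
  (\int[P]_om f (- jump t j om)%R = \int[P]_om f (jump t j om))%E.
Proof.
move=> gt mf f0; pose g k := t (j + k)%N; have gg : grid g by exact: grid_shift.
pose xi := incr_row W g 1.
have mxi : measurable_fun setT (xi : Omega -> brv R _).
  exact: (@incr_row_measurable _ _ _ P I W hW _ 1 gg).
have mnxi : measurable_fun setT ((fun om => - xi om) : Omega -> brv R _).
  apply: brv_measurable_fun => k; under eq_fun do rewrite mxE.
  by apply: measurableT_comp => //; exact: brv_coord.
have jE om : jump t j om = Zof S (xi om) 0.
  rewrite (Zof_incr W S g om (ltn0Sn 0)) (noise_incr W S g 0 om).
  by apply: eq_bigr => i _; rewrite /incr /g addn0 addn1.
have ZN z : Zof S (- z) 0 = - @Zof R I n S 1 z 0.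
  rewrite /Zof -sumrN; apply: eq_bigr => i _.
  by case: insub => [j'|]; rewrite ?scale0r ?oppr0// mxE scaleNr.
have mZ : measurable_fun setT (fun z : brv R #|{: I * 'I_1}| => @Zof R I n S 1 z 0 : brv R n).
  apply: brv_measurable_fun => k; under eq_fun do rewrite /Zof summxE.
  apply: measurable_sum => i; under eq_fun do rewrite mxE.
  apply: measurable_funM; last exact: measurable_cst.
  by case: insub => [j'|]; [exact: coord_brv|exact: measurable_cst].
have mfZ := measurableT_comp mf mZ.
transitivity (\int[P]_om (f \o (fun z : brv R #|{: I * 'I_1}| => @Zof R I n S 1 z 0)) (- xi om)%R)%E.
  by apply: eq_integral => om _; rewrite jE /= ZN.
transitivity (\int[P]_om (f \o (fun z : brv R #|{: I * 'I_1}| => @Zof R I n S 1 z 0)) (xi om))%E;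
  last by apply: eq_integral => om _; rewrite jE.
rewrite -(ge0_integral_law P mnxi mfZ); last by move=> y; exact: f0.
rewrite -(ge0_integral_law P mxi mfZ); last by move=> y; exact: f0.
pose sg (k : 'I_#|{: I * 'I_1}|) : R :=
  Num.sqrt (g (enum_val k : I * 'I_1).2.+1 - g (enum_val k : I * 'I_1).2).
have s0 k : sg k != 0.
  by rewrite gt_eqF// sqrtr_gt0 subr_gt0; exact: gg.2.
apply: eq_measure_integral => A mA _.
exact: (@gaussian_row_sym R d Omega P _ xi sg s0 mxi (fun C mC => incr_row_probE hW hWind gg mC) A mA).
Qed.

(** The jump and its opposite have the same law, and the parallelogram identity removes the cross
    term while all integrands stay nonnegative. *)
Lemma jump_parallelogram t j (y : 'rV[R]_n) : grid t ->
  (\int[P]_om (dot (y + jump t j om) (y + jump t j om))%:E <=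
   (dot y y + noise_var * (t j.+1 - t j))%:E)%E.
Proof.
move=> gt; have mj := jump_measurable j gt.
pose f (z : brv R n) : \bar R := (dot (y + z) (y + z))%:E.
have f0 z : (0 <= f z)%E by rewrite lee_fin dot_ge0.
have mf : measurable_fun setT f.
  apply/measurable_EFinP; apply: (dot_measurable (X := fun z : brv R n => y + z)).
  apply: brv_measurable_fun => k; under eq_fun do rewrite mxE.
  by apply: measurable_funD; [exact: measurable_cst|exact: coord_brv].
have mN : measurable_fun setT ((fun om => - jump t j om) : Omega -> brv R n).
  apply: brv_measurable_fun => k; under eq_fun do rewrite mxE.
  by apply: measurableT_comp => //; exact: brv_coord.
set a := (X in (X <= _)%E); have aE : a = (\int[P]_om f (jump t j om))%E by [].
have a0 : (0 <= a)%E by apply: integral_ge0 => om _; rewrite lee_fin dot_ge0.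
have v0 : 0 <= noise_var * (t j.+1 - t j).
  by rewrite mulr_ge0 ?noise_var_ge0// subr_ge0 ltW//; exact: gt.2.
have aa : (a + a <= (2 * (dot y y + noise_var * (t j.+1 - t j)))%:E)%E.
  rewrite {1}aE -(jump_sym j gt mf f0) aE -ge0_integralD//; last 2 first.
  - exact: (measurableT_comp mf mN).
  - exact: (measurableT_comp mf mj).
  under eq_integral => om _.
    have -> : (f (- jump t j om)%R + f (jump t j om) =
        (2 * dot y y)%:E + 2%:E * (dot (jump t j om) (jump t j om))%:E)%E.
      rewrite -EFinM -!EFinD; congr (_%:E).
      by rewrite !dotDl !dotDr !dotNl !dotNr (dotC (jump t j om) y); ring.
    over.
  have mdj : measurable_fun setT (fun om => (dot (jump t j om) (jump t j om))%:E).
    by apply/measurable_EFinP; exact: dot_measurable.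
  rewrite ge0_integralD//; last 3 first.
  - by move=> om _; rewrite lee_fin mulr_ge0// dot_ge0.
  - by move=> om _; rewrite mule_ge0// lee_fin dot_ge0.
  - exact: emeasurable_funM.
  rewrite integral_prob_cst ge0_integralZl//; last by move=> om _; rewrite lee_fin dot_ge0.
  have -> : (2 * (dot y y + noise_var * (t j.+1 - t j)))%:E =
      ((2 * dot y y)%:E + 2%:E * (noise_var * (t j.+1 - t j))%:E)%E.
    by rewrite -EFinM -EFinD mulrDr.
  rewrite leeD2l// lee_wpmul2l ?lee_fin//.
  exact: jump_second_moment.
have afin : a \is a fin_num.
  rewrite ge0_fin_numE//; apply: le_lt_trans (ltry (2 * (dot y y + noise_var * (t j.+1 - t j)))).
  by apply: le_trans aa; rewrite leeDl.
move: aa; rewrite -(fineK afin) -EFinD !lee_fin; lra.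
Qed.

End NoiseMoments.

Section Dissipation.
Context {R : realType} {n : nat}.
Variable b : 'rV[R]_n -> 'rV[R]_n.
Hypothesis bL : loclip b.
Hypothesis hD : forall y, 0 <= dot (b y) y.

Lemma loclip_bounded (r : R) : 0 <= r -> exists2 M : R, 0 <= M &
  forall y, `|y| <= r -> `|b y| <= M.
Proof.
move=> r0; have [L L0 HL] := bL r; exists (`|b 0| + L * r); first by rewrite addr_ge0// mulr_ge0.
move=> y yr; rewrite (_ : b y = b 0 + (b y - b 0)); last by rewrite addrC subrK.
apply: le_trans (ler_normD _ _) _; rewrite lerD2l.
apply: le_trans (HL _ _ yr _) _; first by rewrite normr0.
by rewrite subr0 ler_wpM2l.
Qed.

Local Tactic Notation "lra_on" ne_hyp_list(H) := clear - H bL hD; lra.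

(** The scheme is uniformly close to the path, so its dissipation sum dominates, up to [e], the one
    of the path over the interval of length [l] on which the path dissipates at rate [kap]. *)
Lemma dissipation_sum_ge (v : R -> 'rV[R]_n) (E : nat -> nat -> 'rV[R]_n)
    (T t1 l kap e : R) :
  continuous v -> 0 < T ->
  (forall e : R, 0 < e -> exists m0, forall m, (m0 <= m)%N -> forall j, (j <= m.+1)%N ->
    `|E m j - v (j%:R * (T / m.+1%:R))| <= e) ->
  0 <= t1 -> 0 <= l -> t1 + l <= T -> 0 <= kap ->
  (forall s, t1 <= s <= t1 + l -> kap <= dot (b (v s)) (v s)) -> 0 < e ->
  exists m0, forall m, (m0 <= m)%N -> dot (v T) (v T) + 2 * kap * l - e <=
    dot (E m m.+1) (E m m.+1) +
    \sum_(0 <= j < m.+1) 2 * (T / m.+1%:R) * dot (cutoff b (cut m) (E m j)) (E m j).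
Proof.
move=> cv T0 Ev t10 l0 tlT kap0 Hkap e0.
have [r r0 vr] := path_bounded 0 T cv.
have [L L0 HL] := bL (r + 1).
have r10 : 0 <= r + 1 by rewrite addr_ge0.
have [M M0 HM] := loclip_bounded r10.
(* A Lipschitz constant of both [dot (b y) y] and [dot y y] on the ball of radius r + 1. *)
pose Kc : R := n%:R * (L * (r + 1) + M + 2 * (r + 1)) + 1.
have Kc0 : 0 < Kc by rewrite ltr_wpDl// !(mulr_ge0, addr_ge0).
have dlip (x x' y y' : 'rV[R]_n) : `|dot x y - dot x' y'| <= n%:R * (`|x - x'| * `|y| + `|x'| * `|y - y'|).
  rewrite (_ : dot x y - dot x' y' = dot (x - x') y + dot x' (y - y')); last by rewrite dotBl dotBr; ring.
  by rewrite mulrDr; apply: le_trans (ler_normD _ _) _; apply: lerD; exact: dot_le.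
have Dl y y' : `|y| <= r + 1 -> `|y'| <= r + 1 ->
    `|dot (b y) y - dot (b y') y'| <= Kc * `|y - y'|.
  move=> yr yr'; apply: le_trans (dlip _ _ _ _) _.
  have h1 : `|b y - b y'| * `|y| <= L * (r + 1) * `|y - y'|.
    by rewrite mulrAC; apply: ler_pM => //; exact: HL.
  have h2 : `|b y'| * `|y - y'| <= M * `|y - y'| by apply: ler_wpM2r => //; exact: HM.
  apply: (@le_trans _ _ (n%:R * (L * (r + 1) * `|y - y'| + M * `|y - y'|))).
    by apply: ler_wpM2l => //; exact: lerD.
  rewrite /Kc -mulrDl mulrA; apply: ler_wpM2r => //; rewrite -subr_ge0.
  have -> : n%:R * (L * (r + 1) + M + 2 * (r + 1)) + 1 - n%:R * (L * (r + 1) + M) =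
    n%:R * (2 * (r + 1)) + 1 by ring.
  by rewrite addr_ge0// !mulr_ge0.
have dl (y y' : 'rV[R]_n) : `|y| <= r + 1 -> `|y'| <= r + 1 -> `|dot y y - dot y' y'| <= Kc * `|y - y'|.
  move=> yr yr'; apply: le_trans (dlip _ _ _ _) _.
  have h1 : `|y - y'| * `|y| <= (r + 1) * `|y - y'| by rewrite mulrC ler_wpM2r.
  have h2 : `|y'| * `|y - y'| <= (r + 1) * `|y - y'| by rewrite ler_wpM2r.
  apply: (@le_trans _ _ (n%:R * ((r + 1) * `|y - y'| + (r + 1) * `|y - y'|))).
    by apply: ler_wpM2l => //; exact: lerD.
  rewrite /Kc -mulrDl mulrA; apply: ler_wpM2r => //; rewrite -subr_ge0.
  have -> : n%:R * (L * (r + 1) + M + 2 * (r + 1)) + 1 - n%:R * (r + 1 + (r + 1)) =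
    n%:R * (L * (r + 1) + M) + 1 by ring.
  by rewrite addr_ge0// !(mulr_ge0, addr_ge0).
have T20 : 0 < 2 * T + 1 by rewrite ltr_wpDl// mulr_ge0// ltW.
pose del : R := Num.min 1 (e / 2 / ((2 * T + 1) * Kc)).
have del0 : 0 < del by rewrite lt_min ltr01/= divr_gt0 ?divr_gt0 ?mulr_gt0.
have del1 : del <= 1 by rewrite ge_min lexx.
have delE : (2 * T + 1) * (Kc * del) <= e / 2.
  by rewrite mulrA mulrC -ler_pdivlMr ?mulr_gt0// ge_min lexx orbT.
have [m1 Hm1] := Ev _ del0.
have [m2 Hm2] := @cut_large R M.
exists (maxn (maxn m1 m2) (Num.truncn (4 * kap * T / (e / 2)))) => m.
rewrite !geq_max => /andP[/andP[mm1 mm2] mm3].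
set h := T / m.+1%:R; have h0 : 0 < h by rewrite divr_gt0.
have hm : m.+1%:R * h = T by rewrite /h mulrC divfK ?pnatr_eq0.
have hk : 4 * kap * h <= e / 2.
  rewrite /h mulrA ler_pdivrMr// [leRHS]mulrC -ler_pdivrMr ?divr_gt0//.
  by apply: le_trans (ltW (truncnS_gt _)) _; rewrite ler_nat ltnS.
have jT j : (j <= m.+1)%N -> 0 <= j%:R * h <= T.
  by move=> jm; rewrite mulr_ge0 ?(ltW h0)//= -hm ler_pM2r// ler_nat.
have close j : (j <= m.+1)%N -> `|E m j - v (j%:R * h)| <= del by exact: Hm1.
have vj j : (j <= m.+1)%N -> `|v (j%:R * h)| <= r + 1.
  by move=> /jT /vr H; apply: le_trans H _; rewrite lerDl.
have Ej j : (j <= m.+1)%N -> `|E m j| <= r + 1.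
  move=> jm; rewrite (_ : E m j = v (j%:R * h) + (E m j - v (j%:R * h))); last by rewrite addrC subrK.
  apply: le_trans (ler_normD _ _) _; apply: lerD; first by apply: vr; exact: jT.
  exact: le_trans (close j jm) del1.
have DE j : (j <= m.+1)%N -> cutoff b (cut m) (E m j) = b (E m j).
  by move=> jm; rewrite /cutoff (le_trans (HM _ (Ej j jm)) (Hm2 _ mm2)).
have term j : (j <= m.+1)%N -> t1 <= j%:R * h <= t1 + l ->
    kap - Kc * del <= dot (cutoff b (cut m) (E m j)) (E m j).
  move=> jm tj; rewrite DE//; have := Dl _ _ (Ej j jm) (vj j jm).
  have := Hkap _ tj; set D1 := dot _ _; set D2 := dot _ _ => k1 k2.
  have k3 : `|D2 - D1| <= Kc * del.
    by apply: le_trans k2 _; apply: ler_wpM2l; [exact: ltW|exact: close].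
  move: k3; rewrite ler_norml => /andP[k3 _]; lra_on k1 k3.
have term0 j : (j <= m.+1)%N -> 0 <= 2 * h * dot (cutoff b (cut m) (E m j)) (E m j).
  by move=> jm; rewrite DE// !mulr_ge0// ltW.
(* [a] is an index past [t1], at most one step late, and [q] is the number of whole steps in [l].
   Keeping only p = q - 1 steps compensates for the late start and stays within [t1, t1 + l]. *)
pose a := (Num.truncn (t1 / h)).+1; pose q := Num.truncn (l / h).
have th0 : 0 <= t1 / h by rewrite divr_ge0// ltW.
have lh0 : 0 <= l / h by rewrite divr_ge0// ltW.
have ah : t1 <= a%:R * h by rewrite -ler_pdivrMr//; exact/ltW/truncnS_gt.
have ah2 : a%:R * h <= t1 + h.
  rewrite /a -natr1 mulrDl mul1r lerD2r -ler_pdivlMr//; by case/andP: (truncn_itv th0).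
have qh : q%:R * h <= l by rewrite -ler_pdivlMr//; case/andP: (truncn_itv lh0).
have qh2 : l <= (q%:R + 1) * h by rewrite -ler_pdivrMr// natr1; exact/ltW/truncnS_gt.
pose p := q.-1.
have ph2 : l - 2 * h <= p%:R * h.
  have : q%:R <= p%:R + 1 :> R by rewrite natr1 ler_nat /p; case: (q).
  by move=> H; have H' := ler_wpM2r (ltW h0) H; lra_on H' qh2.
have ph1 : p%:R * h <= l.
  by apply: le_trans qh; rewrite ler_pM2r// ler_nat /p leq_pred.
have apm : (0 < p)%N -> (a + p <= m.+1)%N.
  move=> p0; rewrite -(ler_nat R) natrD -(ler_pM2r h0) hm mulrDl.
  have : p%:R + 1 = q%:R :> R by rewrite natr1 /p prednK//; move: p0; rewrite /p; case: (q).
  move=> H; have := congr1 (fun z => z * h) H; rewrite /= mulrDl mul1r => H'; lra_on H' ah2 qh tlT.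
have sumge : p%:R * (2 * h * (kap - Kc * del)) <=
    \sum_(0 <= j < m.+1) 2 * h * dot (cutoff b (cut m) (E m j)) (E m j).
  have [->|p0] := posnP p.
    by rewrite mul0r big_mkord; apply: sumr_ge0 => j _; apply: term0; exact: ltnW.
  have pm := apm p0.
  rewrite (@big_cat_nat _ _ _ a)//=; last by apply: leq_trans pm; exact: leq_addr.
  rewrite [X in _ <= _ + X](@big_cat_nat _ _ _ (a + p))//=; last exact: leq_addr.
  have s1 : 0 <= \sum_(0 <= j < a) 2 * h * dot (cutoff b (cut m) (E m j)) (E m j).
    rewrite big_nat; apply: sumr_ge0 => j /andP[_ ja]; apply: term0.
    by apply: leq_trans pm; apply: leq_trans (leq_addr _ _); exact: ltnW.
  have s2 : 0 <= \sum_(a + p <= j < m.+1) 2 * h * dot (cutoff b (cut m) (E m j)) (E m j).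
    by rewrite big_nat; apply: sumr_ge0 => j /andP[_ ja]; apply: term0; exact: ltnW.
  apply: (@le_trans _ _ (\sum_(a <= j < a + p) 2 * h * dot (cutoff b (cut m) (E m j)) (E m j))); last by lra_on s1 s2.
  have -> : p%:R * (2 * h * (kap - Kc * del)) = \sum_(a <= j < a + p) 2 * h * (kap - Kc * del).
    by rewrite sumr_const_nat addKn mulr_natl.
  rewrite big_nat [leRHS]big_nat; apply: ler_sum => j /andP[aj jap].
  apply: ler_wpM2l; first by rewrite mulr_ge0// ltW.
  apply: term; first by apply: leq_trans pm; exact: ltnW.
  apply/andP; split; first by apply: le_trans ah _; rewrite ler_pM2r// ler_nat.
  have jap' : j%:R + 1 <= (a + p)%:R :> R by rewrite natr1 ler_nat.
  have := ler_wpM2r (ltW h0) jap'; rewrite natrD !mulrDl mul1r => H; lra_on H ah2 ph1.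
have dT : dot (v T) (v T) - Kc * del <= dot (E m m.+1) (E m m.+1).
  have := dl _ _ (Ej _ (leqnn _)) (vj _ (leqnn _)).
  have := close _ (leqnn _); rewrite hm => c1 c2.
  have : `|dot (E m m.+1) (E m m.+1) - dot (v T) (v T)| <= Kc * del.
    by apply: le_trans c2 _; apply: ler_wpM2l => //; exact: ltW.
  by rewrite ler_norml => /andP[H1 H2]; lra_on H1 H2.
have pKd : p%:R * h * (Kc * del) <= T * (Kc * del).
  by apply: ler_wpM2r; [rewrite mulr_ge0// ltW|lra_on ph1 t10 tlT l0].
have pk : kap * (l - 2 * h) <= kap * (p%:R * h) by apply: ler_wpM2l.
have E1 : p%:R * (2 * h * (kap - Kc * del)) = 2 * (kap * (p%:R * h)) - 2 * (p%:R * h * (Kc * del)) by ring.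
rewrite E1 in sumge; nra.
Qed.

End Dissipation.

Section Energy.
Context {R : realType} {d : measure_display} {Omega : measurableType d}.
Variable P : probability Omega R.
Context {I : finType}.
Variable W : I -> R -> Omega -> R.
Hypothesis hW : forall i, brownian P (W i).
Hypothesis hWind : independent_processes P W.
Context {n : nat}.
Variables (b : 'rV[R]_n -> 'rV[R]_n) (S : I -> 'rV[R]_n).
Variable u : 'rV[R]_n -> R -> Omega -> 'rV[R]_n.
Hypotheses (bL : loclip b) (hu : flow P W b S u).
Hypothesis hD : forall y, 0 <= dot (b y) y.

Local Notation nv := (noise_var S).

Lemma indep_comp {d1 d2 d3 d4} {T1 : measurableType d1} {T2 : measurableType d2}
    {T3 : measurableType d3} {T4 : measurableType d4} (X : Omega -> T1) (Y : Omega -> T2)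
    (f : T1 -> T3) (g : T2 -> T4) :
  measurable_fun setT f -> measurable_fun setT g -> indep P X Y ->
  indep P (f \o X) (g \o Y).
Proof.
move=> mf mg XY A B mA mB.
have mA' : measurable (f @^-1` A) by rewrite -[X in measurable X]setTI; exact: mf.
have mB' : measurable (g @^-1` B) by rewrite -[X in measurable X]setTI; exact: mg.
exact: (XY _ _ mA' mB').
Qed.

Let cut_ge0' c y : 0 <= dot (cutoff b c y) y.
Proof. by rewrite /cutoff; case: ifP => // _; rewrite /dot big1// => i _; rewrite mxE mul0r. Qed.

Let emeas h c x j : 0 < h -> measurable_fun setT (eulr W b S 0 h c x j : Omega -> brv R n).
Proof.
by move=> h0; apply: (eulr_measurable (P := P) hW S bL c (Y := fun=> x)) => //; exact: measurable_cst.
Qed.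

Let Dmeas h c x j : 0 < h ->
  measurable_fun setT (fun om => dot (cutoff b c (eulr W b S 0 h c x j om)) (eulr W b S 0 h c x j om)).
Proof.
move=> h0; apply: measurable_sum => k; apply: measurable_funM; last by apply: brv_coord; exact: emeas.
apply: (brv_coord (n := n)); apply: (measurableT_comp (cutoff_measurable bL c)); exact: emeas.
Qed.

(** A discrete Ito formula for the square. The term in [(h * c) ^+ 2] is the second-order error of
    the explicit step, which the cutoff controls; the jump is independent of the state before it. *)
Lemma energy_step h c x j : 0 < h -> 0 <= c ->
  (\int[P]_om (dot (eulr W b S 0 h c x j.+1 om) (eulr W b S 0 h c x j.+1 om))%:E +
   \int[P]_om (2 * h * dot (cutoff b c (eulr W b S 0 h c x j om)) (eulr W b S 0 h c x j om))%:E <=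
   \int[P]_om (dot (eulr W b S 0 h c x j om) (eulr W b S 0 h c x j om))%:E +
   (n%:R * (h * c) ^+ 2 + nv * h)%:E)%E.
Proof.
move=> h0 c0; have gg := ugrid_grid (lexx 0) h0; set g := ugrid 0 h in gg.
pose e := eulr W b S 0 h c x j; have me : measurable_fun setT (e : Omega -> brv R n) by exact: emeas.
pose y om := e om - h *: cutoff b c (e om).
have mye : measurable_fun setT ((fun z => z - h *: cutoff b c z) : brv R n -> brv R n).
  apply: brv_measurable_fun => k; under eq_fun do rewrite !mxE.
  apply: measurable_funB; first exact: coord_brv.
  apply: measurable_funM; first exact: measurable_cst.
  exact: (brv_coord k (cutoff_measurable bL c)).
have my : measurable_fun setT (y : Omega -> brv R n) by exact: (measurableT_comp mye me).
have mj : measurable_fun setT (jump W S g j : Omega -> brv R n) by exact: (jump_measurable hW S j gg).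
have iyj : indep P (y : Omega -> brv R n) (jump W S g j : Omega -> brv R n).
  have -> : y = (fun z => let w := euler b h c (@Zof R I n S j z) x j in w - h *: cutoff b c w) \o incr_row W g j.
    by apply/funext => om /=; rewrite /y /e (eulrE W b S _ _ _ _ _ (leqnn j)).
  pose g' k := g (j + k)%N.
  have -> : jump W S g j = (fun z => @Zof R I n S 1 z 0) \o incr_row W g' 1.
    apply/funext => om /=; rewrite (Zof_incr W S g' om (ltn0Sn 0)) (noise_incr W S g' 0 om).
    by apply: eq_bigr => i _; rewrite /incr /g' addn0 addn1.
  apply: (indep_comp (T1 := brv R _) (T2 := brv R _) (T3 := brv R n) (T4 := brv R n)); last exact: (@incr_row_indep _ _ _ P I W hW hWind g j 1 gg).
  - apply: (measurableT_comp mye).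
    exact: (measurableT_comp (@euler_measurable R I n b S bL j h c j)
      (measurable_fun_pair (measurable_cst (x : brv R n)) (@measurable_id _ _ setT))).
  - apply: brv_measurable_fun => k; under eq_fun do rewrite /Zof summxE.
    apply: measurable_sum => i; under eq_fun do rewrite mxE.
    apply: measurable_funM; last exact: measurable_cst.
    by case: insub => [j'|]; [exact: coord_brv|exact: measurable_cst].
pose phi (z : brv R n * brv R n) : \bar R := (dot (z.1 + z.2 : 'rV[R]_n) (z.1 + z.2 : 'rV[R]_n))%:E.
have mphi : measurable_fun setT phi.
  apply/measurable_EFinP; apply: (dot_measurable (X := fun z : brv R n * brv R n => (z.1 + z.2 : 'rV[R]_n))).
  apply: brv_measurable_fun => k; under eq_fun do rewrite mxE.
  apply: measurable_funD; apply: (measurableT_comp (coord_brv k)).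
    exact: measurable_fst.
  exact: measurable_snd.
have phi0 z : (0 <= phi z)%E by rewrite lee_fin dot_ge0.
have -> : (\int[P]_om (dot (eulr W b S 0 h c x j.+1 om) (eulr W b S 0 h c x j.+1 om))%:E =
    \int[P]_om phi (y om, jump W S g j om))%E.
  by apply: eq_integral => om _; rewrite /phi /= /jump -noise_incr.
rewrite (indep_integral my mj iyj mphi phi0).
pose D om := dot (cutoff b c (e om)) (e om).
have mD : measurable_fun setT D by exact: Dmeas.
have mdy : measurable_fun setT (fun om => dot (y om) (y om)) by exact: dot_measurable.
have mde : measurable_fun setT (fun om => dot (e om) (e om)) by exact: dot_measurable.
have nvh : 0 <= nv * h by rewrite mulr_ge0 ?noise_var_ge0// ltW.
apply: (@le_trans _ _ (\int[P]_om (dot (y om) (y om) + nv * h)%:E + \int[P]_om (2 * h * D om)%:E)%E).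
  rewrite leeD2r//; apply: ge0_le_integral => //.
  - by move=> om _; apply: integral_ge0.
  - have -> : (fun om => \int[P]_om' phi (y om, jump W S g j om'))%E = fubini_F (law P mj) phi \o y.
      apply/funext => om; rewrite /= /fubini_F (ge0_integral_law P mj (f := fun z => phi (y om, z)))//.
      exact: (measurableT_comp mphi (measurable_fun_pair (measurable_cst (y om : brv R n))
        (@measurable_id _ _ setT))).
    exact: (measurableT_comp (measurable_fun_fubini_tonelli_F (m2 := law P mj) phi mphi phi0) my).
  - by apply/measurable_EFinP; apply: measurable_funD => //; exact: measurable_cst.
  - move=> om _; apply: le_trans (jump_parallelogram hW hWind S j (y om) gg) _.
    have -> : g j.+1 - g j = h by rewrite /g /ugrid -natr1; ring.
    by [].
rewrite -ge0_integralD//; last 4 first.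
- by move=> om _; rewrite lee_fin addr_ge0// dot_ge0.
- by apply/measurable_EFinP; apply: measurable_funD => //; exact: measurable_cst.
- by move=> om _; rewrite lee_fin !mulr_ge0// ?(ltW h0)// cut_ge0'.
- by apply/measurable_EFinP; apply: measurable_funM => //; exact: measurable_cst.
rewrite -[X in (_ <= _ + X)%E](integral_prob_cst P) -ge0_integralD//; last 3 first.
- by move=> om _; rewrite lee_fin dot_ge0.
- exact/measurable_EFinP.
- by move=> om _; rewrite lee_fin addr_ge0// mulr_ge0// sqr_ge0.
apply: ge0_le_integral => //.
- move=> om _; rewrite -EFinD lee_fin addr_ge0//; first by rewrite addr_ge0// dot_ge0.
  by rewrite !mulr_ge0// ?(ltW h0)// cut_ge0'.
- apply: emeasurable_funD; apply/measurable_EFinP.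
    by apply: measurable_funD => //; exact: measurable_cst.
  by apply: measurable_funM => //; exact: measurable_cst.
- apply: emeasurable_funD; apply/measurable_EFinP => //; exact: measurable_cst.
move=> om _; rewrite -!EFinD lee_fin /y !dotBl !dotBr !dotZl !dotZr /D.
rewrite (dotC (e om)).
have : dot (cutoff b c (e om)) (cutoff b c (e om)) <= n%:R * c ^+ 2.
  apply: le_trans (dot_upper _) _; apply: ler_wpM2l => //.
  by rewrite lerXn2r ?nnegrE//; exact: cutoff_le.
set q := dot _ _ => qc; have : h ^+ 2 * q <= h ^+ 2 * (n%:R * c ^+ 2) by apply: ler_wpM2l => //; exact: sqr_ge0.
rewrite exprMn; set dd := dot _ _; nra.
Qed.

Let F h c x j om : R := dot (eulr W b S 0 h c x j om) (eulr W b S 0 h c x j om) +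
  \sum_(0 <= i < j) 2 * h * dot (cutoff b c (eulr W b S 0 h c x i om)) (eulr W b S 0 h c x i om).

Let F0 h c x j om : 0 < h -> 0 <= F h c x j om.
Proof.
move=> h0; apply: addr_ge0; first exact: dot_ge0.
by apply: sumr_ge0 => i _; rewrite !mulr_ge0// ?(ltW h0)// cut_ge0'.
Qed.

Let mS h c x j : 0 < h -> measurable_fun setT (fun om => \sum_(0 <= i < j) 2 * h *
  dot (cutoff b c (eulr W b S 0 h c x i om)) (eulr W b S 0 h c x i om)).
Proof.
move=> h0; apply: measurable_sum => i; apply: measurable_funM; first exact: measurable_cst.
exact: Dmeas.
Qed.

Let mF h c x j : 0 < h -> measurable_fun setT (F h c x j).
Proof.
move=> h0; apply: measurable_funD; last exact: mS.
by apply: dot_measurable; exact: emeas.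
Qed.

Let energy_sum h c x j : 0 < h -> 0 <= c ->
  (\int[P]_om (F h c x j om)%:E <=
   (dot x x + j%:R * (n%:R * (h * c) ^+ 2 + nv * h))%:E)%E.
Proof.
move=> h0 c0; elim: j => [|j IH].
  rewrite mul0r addr0 -[X in (_ <= X)%E](integral_prob_cst P) le_eqVlt; apply/orP; left; apply/eqP.
  by apply: eq_integral => om _; rewrite /F big_geq// addr0.
set K := n%:R * _ + _ in IH *.
pose e2 i om := dot (eulr W b S 0 h c x i om) (eulr W b S 0 h c x i om).
pose D om := 2 * h * dot (cutoff b c (eulr W b S 0 h c x j om)) (eulr W b S 0 h c x j om).
pose Sm om := \sum_(0 <= i < j) 2 * h *
  dot (cutoff b c (eulr W b S 0 h c x i om)) (eulr W b S 0 h c x i om).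
have me i : measurable_fun setT (fun om => (e2 i om)%:E).
  by apply/measurable_EFinP; apply: dot_measurable; exact: emeas.
have mD : measurable_fun setT (fun om => (D om)%:E).
  by apply/measurable_EFinP; apply: measurable_funM; [exact: measurable_cst|exact: Dmeas].
have mSm : measurable_fun setT (fun om => (Sm om)%:E) by apply/measurable_EFinP; exact: mS.
have e20 i om : (0 <= (e2 i om)%:E)%E by rewrite lee_fin dot_ge0.
have D0 om : (0 <= (D om)%:E)%E by rewrite lee_fin !mulr_ge0// ?(ltW h0)// cut_ge0'.
have Sm0 om : (0 <= (Sm om)%:E)%E.
  by rewrite lee_fin; apply: sumr_ge0 => i _; rewrite !mulr_ge0// ?(ltW h0)// cut_ge0'.
have -> : (\int[P]_om (F h c x j.+1 om)%:E =
    \int[P]_om (e2 j.+1 om)%:E + \int[P]_om (D om)%:E + \int[P]_om (Sm om)%:E)%E.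
  rewrite -ge0_integralD// -ge0_integralD//; last 2 first.
  - by move=> om _; rewrite adde_ge0.
  - exact: emeasurable_funD.
  apply: eq_integral => om _; rewrite -!EFinD /F /Sm big_nat_recr//= -/(D om) -/(e2 j.+1 om).
  by congr (_%:E); ring.
apply: (@le_trans _ _ (\int[P]_om (e2 j om)%:E + K%:E + \int[P]_om (Sm om)%:E)%E).
  by rewrite leeD2r//; exact: energy_step.
rewrite addeAC -ge0_integralD//.
apply: (@le_trans _ _ ((dot x x + j%:R * K)%:E + K%:E)%E).
  by rewrite leeD2r.
by rewrite -EFinD lee_fin -natr1; lra.
Qed.

(** [energy_step] is summed and the step sent to 0. Pathwise only lower bounds for the discrete
    quantities survive the limit, so, as in Fatou's lemma, minima with a level [k] are used and [k]
    is then sent to infinity. *)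
Lemma energy_dissipation x (T l kap : R) (E : set Omega) : 0 < T -> 0 <= l -> 0 <= kap ->
  measurable E ->
  {ae P, forall om, E om -> exists t1, [/\ 0 <= t1, t1 + l <= T &
    forall s, t1 <= s <= t1 + l -> kap <= dot (b (u x s om)) (u x s om)]} ->
  (\int[P]_om (dot (u x T om) (u x T om))%:E + (2 * kap * l)%:E * P E <=
   (dot x x + nv * T)%:E)%E.
Proof.
move=> T0 l0 kap0 mE HE.
pose Y om : R := dot (u x T om) (u x T om) + 2 * kap * l * \1_E om.
have mdu : measurable_fun setT (fun om => dot (u x T om) (u x T om)).
  by apply: dot_measurable; apply: (flow_meas hu); exact: ltW.
have mY : measurable_fun setT Y.
  apply: measurable_funD => //.
  by apply: measurable_funM; [exact: measurable_cst|exact: measurable_indic].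
have kl0 : 0 <= 2 * kap * l by rewrite !mulr_ge0.
have Y0 om : 0 <= Y om by rewrite addr_ge0 ?dot_ge0// mulr_ge0.
have -> : (\int[P]_om (dot (u x T om) (u x T om))%:E + (2 * kap * l)%:E * P E =
    \int[P]_om (Y om)%:E)%E.
  under [RHS]eq_integral do rewrite /Y EFinD EFinM.
  rewrite ge0_integralD//; last 4 first.
  - by move=> om _; rewrite lee_fin dot_ge0.
  - exact/measurable_EFinP.
  - by move=> om _; rewrite -EFinM lee_fin mulr_ge0.
  - by apply: emeasurable_funM => //; apply/measurable_EFinP; exact: measurable_indic.
  rewrite ge0_integralZl//; last by apply/measurable_EFinP; exact: measurable_indic.
  by rewrite integral_indic// setIT.
pose h m : R := T / m.+1%:R; have h0 m : 0 < h m by rewrite divr_gt0.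
pose X m om := F (h m) (cut m) x m.+1 om.
have X0 m om : 0 <= X m om by exact: F0.
have mX m : measurable_fun setT (X m) by exact: mF.
(* Eventually the discrete energy plus dissipation exceeds its continuous counterpart minus [e].
   Outside [E] the same estimate is used with length and rate 0. *)
have XY : {ae P, forall om, forall e : R, 0 < e -> exists m0, forall m, (m0 <= m)%N ->
    Y om - e <= X m om}.
  apply: filterS3 HE (flow_sol hu x) (eulr_cvg bL hu x (lexx 0) T0) => om Hom [v [vs v0 vu]] eu e e0.
  have cv := vs.1.
  pose Eu m j := eulr W b S 0 (h m) (cut m) x j om.
  have Ev : forall e : R, 0 < e -> exists m0, forall m, (m0 <= m)%N -> forall j, (j <= m.+1)%N ->
      `|Eu m j - v (j%:R * (T / m.+1%:R))| <= e.
    move=> e' e'0; have [m0 Hm] := eu e' e'0; exists m0 => m mm j jm.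
    have := Hm m mm j jm; rewrite -vu// v0 /Eu /h -vu /ugrid add0r//.
    by rewrite mulr_ge0// ltW// -/(h m).
  have [Eom|nE] := pselect (E om).
    have [t1 [t10 t1T Ht1]] := Hom Eom.
    have Hk s : t1 <= s <= t1 + l -> kap <= dot (b (v s)) (v s).
      by move=> /[dup] /andP[t1s _] /Ht1; rewrite vu// (le_trans t10).
    have [m0 Hm] := dissipation_sum_ge bL hD cv T0 Ev t10 l0 t1T kap0 Hk e0.
    exists m0 => m mm; apply: le_trans (Hm m mm).
    by rewrite /Y indicE mem_set// mulr1 (vu T (ltW T0)).
  have Hk s : 0 <= s <= 0 + 0 -> 0 <= dot (b (v s)) (v s) by move=> _; exact: hD.
  have T00 : 0 + 0 <= T by rewrite addr0 ltW.
  have [m0 Hm] := dissipation_sum_ge bL hD cv T0 Ev (lexx 0) (lexx 0) T00 (lexx 0) Hk e0.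
  exists m0 => m mm; apply: le_trans (Hm m mm).
  by rewrite /Y indicE memNset// !mulr0 (vu T (ltW T0)).
have bound (k : R) : 0 < k -> (\int[P]_om (Num.min (Y om) k)%:E <= (dot x x + nv * T)%:E)%E.
  move=> k0; have m0 om : 0 <= Num.min (Y om) k by rewrite le_min Y0 ltW.
  have mm : measurable_fun setT (fun om => Num.min (Y om) k).
    by apply: measurable_minr => //; exact: measurable_cst.
  have mmX m : measurable_fun setT (fun om => Num.min (X m om) (Num.min (Y om) k)).
    exact: measurable_minr.
  (* The factor 1/k brings the truncated variables into [0, 1], the range covered by
     [as_integral_cvg]. *)
  have cv : (\int[P]_om (k^-1 * Num.min (X m om) (Num.min (Y om) k))%:E @[m --> \oo] -->
      \int[P]_om (k^-1 * Num.min (Y om) k)%:E)%E.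
    apply: as_integral_cvg.
    - by move=> m; apply: measurable_funM => //; exact: measurable_cst.
    - by apply: measurable_funM => //; exact: measurable_cst.
    - move=> m om; rewrite mulr_ge0 ?invr_ge0 ?(ltW k0) ?le_min ?X0 ?Y0//=; last exact: ltW.
      by rewrite mulrC ler_pdivrMr// mul1r !ge_min lexx !orbT.
    - apply: filterS XY => om H; apply: cvgM; first exact: cvg_cst.
      apply/cvgrPdist_le => e e0; have [m1 Hm] := H e e0; exists m1 => // m /= mm1.
      have := Hm m mm1; set a := X m om; set z := Num.min (Y om) k => ya.
      have zY : z <= Y om by rewrite ge_min lexx.
      have mz : Num.min a z <= z by rewrite ge_min lexx orbT.
      rewrite ger0_norm ?subr_ge0//.
      by rewrite lerBlDr -lerBlDl le_min; apply/andP; split; lra.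
  have Zk (f : Omega -> R) : measurable_fun setT f -> (forall om, 0 <= f om) ->
      (\int[P]_om (k^-1 * f om)%:E = (k^-1)%:E * \int[P]_om (f om)%:E)%E.
    move=> mf f0; under eq_integral do rewrite EFinM; rewrite ge0_integralZl//.
    - exact/measurable_EFinP.
    - by move=> om _; rewrite lee_fin.
    - by rewrite lee_fin invr_ge0 ltW.
  have k10 : 0 < k^-1 by rewrite invr_gt0.
  have : (\int[P]_om (k^-1 * Num.min (Y om) k)%:E <= (k^-1)%:E * (dot x x + nv * T)%:E)%E.
    have cb : ((k^-1)%:E * (dot x x + m.+1%:R * (n%:R * (h m * cut m) ^+ 2 + nv * h m))%:E
        @[m --> \oo] --> (k^-1)%:E * (dot x x + nv * T)%:E)%E.
      apply: cvgeZl => //; apply: cvg_EFin; first exact: nearW.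
      have -> : fine \o (fun m => (dot x x + m.+1%:R * (n%:R * (h m * cut m) ^+ 2 + nv * h m))%:E) =
          (fun m => dot x x + (n%:R * T ^+ 2 * ((@cut R m) ^+ 2)^-1 + nv * T)).
        apply/funext => m /=; have c4 : m.+1%:R = (@cut R m) ^+ 4.
          by rewrite (exprM _ 2 2) /cut !sqr_sqrtr// sqrtr_ge0.
        have c0 : @cut R m != 0 by rewrite gt_eqF// !sqrtr_gt0.
        by rewrite /h c4; field.
      rewrite -[X in _ --> dot x x + X]add0r; apply: cvgD; first exact: cvg_cst.
      apply: cvgD; last exact: cvg_cst.
      rewrite -(mulr0 (n%:R * T ^+ 2)); apply: cvgM; first exact: cvg_cst.
      apply/cvgrPdist_le => e e0; have [m1 Hm] := @cut_large R (Num.max 1 e^-1).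
      exists m1 => // m /= /Hm; rewrite ge_max => /andP[c1 c2].
      have c0 : 0 < @cut R m by apply: lt_le_trans c1.
      rewrite sub0r normrN ger0_norm ?invr_ge0 ?sqr_ge0// invf_ple ?posrE ?exprn_gt0//.
      by apply: le_trans c2 _; rewrite expr2 ler_peMl// ltW.
    apply: (lee_cvg_to cv cb); apply: nearW => m.
    rewrite (Zk (fun om => Num.min (X m om) (Num.min (Y om) k)))//; last first.
      by move=> om; rewrite !le_min X0 Y0 ltW.
    rewrite lee_wpmul2l ?lee_fin ?(ltW k10)//.
    apply: le_trans (energy_sum x m.+1 (h0 m) (cut_ge0 m)).
    apply: ge0_le_integral => //.
    - by move=> om _; rewrite lee_fin !le_min X0 Y0 ltW.
    - exact/measurable_EFinP.
    - by apply/measurable_EFinP; exact: mX.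
    - by move=> om _; rewrite lee_fin ge_min lexx.
  by rewrite Zk// lee_pmul2l ?lte_fin// fin_numE.
have -> : (\int[P]_om (Y om)%:E = \int[P]_om (lim ((Num.min (Y om) k.+1%:R)%:E @[k --> \oo])))%E.
  apply: eq_integral => om _; apply/esym/cvg_lim => //; apply: cvg_near_cst.
  exists (Num.truncn (Y om)) => // k /= yk; congr EFin; apply/min_idPl.
  by apply: le_trans (ltW (truncnS_gt _)) _; rewrite ler_nat ltnS.
rewrite monotone_convergence//; last 3 first.
- by move=> k; apply/measurable_EFinP; apply: measurable_minr => //; exact: measurable_cst.
- by move=> k om _; rewrite lee_fin le_min Y0 ler0n.
- move=> om _ a c ac; rewrite lee_fin le_min !ge_min lexx/=.
  by rewrite ler_nat ltnS ac orbT.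
apply: lime_le; last by apply: nearW => k; exact: bound.
apply: ereal_nondecreasing_is_cvgn => a c ac; apply: ge0_le_integral => //.
- by move=> om _; rewrite lee_fin le_min Y0 ler0n.
- by apply/measurable_EFinP; apply: measurable_minr => //; exact: measurable_cst.
- by apply/measurable_EFinP; apply: measurable_minr => //; exact: measurable_cst.
- move=> om _; rewrite lee_fin le_min !ge_min lexx/=.
  by rewrite ler_nat ltnS ac orbT.
Qed.

End Energy.

(** * Minorization *)

Section DyadicCubes.
Context {R : realType} {n : nat}.
Implicit Types (x y : 'rV[R]_n) (j : nat).

(** The integer coordinates of the dyadic cube of side 2^-j that contains [x]; a [level_set] is thus
    a union of such cubes. *)
Definition level j x : 'I_n -> int := fun l => Num.floor (2 ^+ j * x 0 l).

Definition level_set j (A : set 'rV[R]_n) := forall x y, level j x = level j y -> A x -> A y.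

Definition unit_cube : set 'rV[R]_n := [set x | forall l, 0 <= x 0 l < 1].

Definition dyadic j (f : {ffun 'I_n -> 'I_(2 ^ j)}) : set 'rV[R]_n :=
  rbox (fun l => `[(f l)%:R / 2 ^+ j, ((f l)%:R + 1) / 2 ^+ j[%classic).

Lemma level_le j x y : level j.+1 x = level j.+1 y -> forall l, level j x l <= level j y l.
Proof.
move=> H l; rewrite /level floor_ge_int; have := congr1 (fun g => g l) H; rewrite /level => Hl.
have k2 : (2 * level j x l)%:~R <= 2 ^+ j.+1 * x 0 l.
  by rewrite intrM exprS -mulrA ler_pM2l// floor_le.
have : 2 * level j x l <= Num.floor (2 ^+ j.+1 * y 0 l) by rewrite -Hl floor_ge_int.
by rewrite floor_ge_int intrM exprS -mulrA ler_pM2l.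
Qed.

Lemma level_refine j x y : level j.+1 x = level j.+1 y -> level j x = level j y.
Proof.
move=> H; apply/funext => l; apply/le_anti; rewrite (level_le H)/=.
by rewrite (level_le (esym H)).
Qed.

Lemma level_set_mono j k A : (j <= k)%N -> level_set j A -> level_set k A.
Proof.
move=> jk; rewrite -(subnKC jk); elim: (k - j)%N => [|i IH]; first by rewrite addn0.
move=> Aj; rewrite addnS => x y H; apply: (IH Aj); exact: level_refine.
Qed.

Let lev_ring : set (set 'rV[R]_n) := [set A | exists j, level_set j A].

Let lev_setring : setring lev_ring.
Proof.
split.
- by exists 0%N => x y.
- move=> A B [j Aj] [k Bk]; exists (maxn j k) => x y xy [Ax|Bx].
    left; apply: (level_set_mono _ Aj) xy Ax; exact: leq_maxl.
  right; apply: (level_set_mono _ Bk) xy Bx; exact: leq_maxr.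
- move=> A B [j Aj] [k Bk]; exists (maxn j k) => x y xy [Ax nBx]; split.
    apply: (level_set_mono _ Aj) xy Ax; exact: leq_maxl.
  move=> By; apply: nBx; apply: (level_set_mono _ Bk) (esym xy) By; exact: leq_maxr.
Qed.

Lemma level_dist j x y : level j x = level j y -> `|x - y| <= (2 ^+ j)^-1.
Proof.
move=> H; apply: rv_norm_le => [|l]; first by rewrite invr_ge0 exprn_ge0.
have := congr1 (fun g => g l) H; rewrite /level !mxE => Hl.
have p2 : 0 < 2 ^+ j :> R by rewrite exprn_gt0.
have /andP[x1 x2] := floor_itv (2 ^+ j * x 0 l).
have /andP[y1 y2] := floor_itv (2 ^+ j * y 0 l).
rewrite -(ler_pM2l p2) mulfV ?gt_eqF// -[X in X * _](gtr0_norm p2) -normrM.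
rewrite Hl in x1 x2; rewrite ler_norml mulrBr.
move: x1 x2 y1 y2; rewrite intrD; set k := _%:~R => *; lra.
Qed.

Lemma open_level (U : set 'rV[R]_n) : open U -> <<sr lev_ring >> U.
Proof.
move=> oU; pose V j : set 'rV[R]_n := [set x | forall y, level j x = level j y -> U y].
have -> : U = \bigcup_j V j.
  apply/seteqP; split=> [x Ux|x [j _ Vx]]; last exact: Vx.
  have /nbhs_ballP[e /= e0 xeU] : nbhs x U by exact: open_nbhs_nbhs.
  exists (Num.truncn e^-1).+1 => // y /level_dist xy; apply: xeU.
  rewrite mx_norm_ball /ball_/=; apply: le_lt_trans xy _.
  rewrite invf_plt ?posrE ?exprn_gt0//; apply: lt_trans (truncnS_gt _) _.
  by rewrite -natrX ltr_nat ltn_expl.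
have [_ _ U3] := smallest_sigma_ring lev_ring.
apply: U3 => j; apply: sub_g_sigma_ring; exists j => x y xy Vx z yz.
by apply: Vx; rewrite xy.
Qed.

Lemma borel_level (B : set (brv R n)) : measurable B -> <<sr lev_ring >> B.
Proof.
have [G0 GD GU] := smallest_sigma_ring lev_ring.
have GT : <<sr lev_ring >> setT by apply: sub_g_sigma_ring; exists 0%N.
apply: smallest_sub; last by move=> U; exact: open_level.
split=> // A GA; exact: GD.
Qed.

Lemma dyadic_measurable j f : measurable (dyadic (j := j) f : set (brv R n)).
Proof. by apply: rbox_measurable => l; exact: measurable_itv. Qed.

Let corner j (f : {ffun 'I_n -> 'I_(2 ^ j)}) : 'rV[R]_n := \row_l ((f l)%:R / 2 ^+ j).

Let pow2 j : 0 < 2 ^+ j :> R. Proof. by rewrite exprn_gt0. Qed.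

Let dyadic_level j (f : {ffun 'I_n -> 'I_(2 ^ j)}) x : dyadic f x ->
  level j x = fun l => (f l : nat)%:Z.
Proof.
move=> H; apply/funext => l; have := H l; rewrite /= in_itv/= => /andP[h1 h2].
apply/eqP; rewrite /level floor_eq intrD -!pmulrn.
by rewrite [_ * x 0 l]mulrC -ler_pdivrMr// h1/= -ltr_pdivlMr.
Qed.

Let corner_level j (f : {ffun 'I_n -> 'I_(2 ^ j)}) : level j (corner f) = fun l => (f l : nat)%:Z.
Proof.
apply: dyadic_level => l; rewrite /= in_itv/= mxE lexx/= ltr_pM2r ?invr_gt0//.
by rewrite ltrDl.
Qed.

Let dyadic_unit j x : unit_cube x -> exists f : {ffun 'I_n -> 'I_(2 ^ j)}, dyadic f x.
Proof.
move=> ux.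
have H l : (Num.truncn (2 ^+ j * x 0 l)%R < 2 ^ j)%N.
  have /andP[x0 x1] := ux l; have p0 : 0 <= 2 ^+ j * x 0 l by rewrite mulr_ge0// ltW.
  rewrite -(ltr_nat R) natrX; have /andP[h _] := truncn_itv p0.
  by apply: le_lt_trans h _; rewrite -[ltRHS]mulr1 ltr_pM2l.
exists [ffun l => Ordinal (H l)] => l; rewrite /= in_itv/= ffunE/=.
have /andP[x0 x1] := ux l; have p0 : 0 <= 2 ^+ j * x 0 l by rewrite mulr_ge0// ltW.
have /andP[h1 h2] := truncn_itv p0.
by rewrite ler_pdivrMr// [x 0 l * _]mulrC h1/= ltr_pdivlMr// natr1 mulrC.
Qed.

Let dyadic_sub j (f : {ffun 'I_n -> 'I_(2 ^ j)}) : dyadic f `<=` unit_cube.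
Proof.
move=> x H l; have := H l; rewrite /= in_itv/= => /andP[h1 h2].
rewrite (le_trans _ h1) ?divr_ge0 ?(ltW (pow2 j))//=; apply: lt_le_trans h2 _.
by rewrite ler_pdivrMr// mul1r natr1 -natrX ler_nat.
Qed.

Let level_setI j A : level_set j A -> A `&` unit_cube =
  \bigcup_(f in [set f : {ffun 'I_n -> 'I_(2 ^ j)} | A (corner f)]) dyadic f.
Proof.
move=> Aj; apply/seteqP; split=> [x [Ax ux]|x [f /= Af fx]].
  have [f fx] := dyadic_unit j ux; exists f => //=.
  by apply: Aj Ax; rewrite corner_level (dyadic_level fx).
split; last exact: dyadic_sub fx.
by apply: Aj Af; rewrite corner_level (dyadic_level fx).
Qed.

Let dyadic_triv j (D : set {ffun 'I_n -> 'I_(2 ^ j)}) : trivIset D (@dyadic j).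
Proof.
move=> f g _ _ [x [fx gx]]; apply/ffunP => l; apply/val_inj/eqP.
have := dyadic_level fx; rewrite (dyadic_level gx) => /(congr1 (fun h => h l)) /eqP.
by rewrite eqz_nat eq_sym.
Qed.

Lemma unit_cube_measurable : measurable (unit_cube : set (brv R n)).
Proof.
have -> : unit_cube = rbox (fun=> `[0, 1[%classic).
  by apply/seteqP; split=> x H l; have := H l; rewrite /= in_itv.
by apply: rbox_measurable => l; exact: measurable_itv.
Qed.

(** Unions of dyadic cubes of a common level form a ring that generates the Borel sets. The
    domination is additive over disjoint cubes and passes to monotone limits, so the monotone class
    theorem for rings applies. *)
Lemma dyadic_domination (mu gam : {measure set (brv R n) -> \bar R}) (c : R) :
  0 <= c -> (mu setT < +oo)%E -> (gam setT < +oo)%E ->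
  (forall j (f : {ffun 'I_n -> 'I_(2 ^ j)}), c%:E * gam (dyadic f) <= mu (dyadic f))%E ->
  forall B : set (brv R n), measurable B -> (c%:E * gam (B `&` unit_cube) <= mu (B `&` unit_cube))%E.
Proof.
move=> c0 muoo gamoo H B mB.
pose G : set (set 'rV[R]_n) := [set A | measurable (A `&` unit_cube : set (brv R n)) /\
  (c%:E * gam (A `&` unit_cube) <= mu (A `&` unit_cube))%E].
suff : G B by case.
have fin (m : {measure set (brv R n) -> \bar R}) A : (m setT < +oo)%E -> measurable A -> (m A < +oo)%E.
  by move=> moo mA; apply: le_lt_trans moo; apply: le_measure; rewrite ?inE.
apply: (monotone_setring_sub_g_sigma_ring (R := lev_ring)) (borel_level mB); last first.
- move=> A [j Aj]; rewrite /G /= (level_setI Aj).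
  set D := [set f | A (corner f)].
  have fD : finite_set D by exact: finite_finset.
  have mD f : D f -> measurable (dyadic f : set (brv R n)) by move=> _; exact: dyadic_measurable.
  split; first exact: fin_bigcup_measurable.
  have E (m : {measure set (brv R n) -> \bar R}) :
      (m (\bigcup_(f in D) dyadic f) = \sum_(f \in D) m (dyadic f))%E.
    by rewrite measure_fin_bigcup//; exact: dyadic_triv.
  rewrite !E ge0_mule_fsumr//; exact: lee_fsum.
- exact: lev_setring.
split=> F mF GF.
  have mFi i : measurable (F i `&` unit_cube : set (brv R n)) by case: (GF i).
  have mU : measurable (\bigcup_i (F i `&` unit_cube) : set (brv R n)) by exact: bigcup_measurable.
  have nd : nondecreasing_seq (fun i => F i `&` unit_cube).
    by move=> a d ad; apply/subsetPset; apply: setSI; exact/subsetPset/mF.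
  rewrite /G /= setI_bigcupl; split=> //.
  have L1 := cvgeZl (isT : c%:E \is a fin_num) (nondecreasing_cvg_mu (mu := gam) mFi mU nd).
  have L2 := nondecreasing_cvg_mu (mu := mu) mFi mU nd.
  by apply: (lee_cvg_to L1 L2); apply: nearW => i; case: (GF i).
have mFi i : measurable (F i `&` unit_cube : set (brv R n)) by case: (GF i).
have -> : G (\bigcap_i F i) = G (\bigcap_i (F i `&` unit_cube)).
  rewrite /G /=; have -> : \bigcap_i F i `&` unit_cube = \bigcap_i (F i `&` unit_cube) `&` unit_cube; last by [].
  apply/seteqP; split=> [x [Fx ux]|x [Fx ux]]; split=> // i _; first by split=> //; exact: Fx.
  by case: (Fx i I).
have mU : measurable (\bigcap_i (F i `&` unit_cube) : set (brv R n)) by exact: bigcapT_measurable.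
have ni : nonincreasing_seq (fun i => F i `&` unit_cube).
  by move=> a d ad; apply/subsetPset; apply: setSI; exact/subsetPset/mF.
have UE : \bigcap_i (F i `&` unit_cube) `&` unit_cube = \bigcap_i (F i `&` unit_cube).
  by apply/setIidPl => x /(_ 0%N I) [].
rewrite /G /= UE; split=> //.
have L1 := cvgeZl (isT : c%:E \is a fin_num)
  (nonincreasing_cvg_mu (mu := gam) (fin _ _ gamoo (mFi 0%N)) mFi mU ni).
have L2 := nonincreasing_cvg_mu (mu := mu) (fin _ _ muoo (mFi 0%N)) mFi mU ni.
by apply: (lee_cvg_to L1 L2); apply: nearW => i; case: (GF i).
Qed.

End DyadicCubes.

Section HalfLine.
Context {R : realType} {V : topologicalType}.

Lemma halfline_continuous (f : R -> V) : {within `[0, +oo[%classic, continuous f} ->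
  continuous (fun t : R => f (Num.max 0 t)).
Proof.
move=> /subspace_continuousP cf t.
have m0 : `[0, +oo[%classic (Num.max 0 t) by rewrite /= in_itv/= le_max lexx.
apply: cvg_comp (cf _ m0).
have cm : {for t, continuous (fun t : R => Num.max 0 t : R)}.
  apply: (continuous_max (f := fun=> 0) (g := id)); [exact: cvg_cst|exact: cvg_id].
move=> A mA.
have : nbhs t ((fun s : R => Num.max 0 s) @^-1` [set x | `[0, +oo[%classic x -> A x]) := cm _ mA.
apply: filterS => s /= H; apply: H.
by rewrite /= in_itv/= le_max lexx.
Qed.

End HalfLine.

(** * Steering the solution into small balls *)

Section GoodEvent.
Context {R : realType} {d : measure_display} {Omega : measurableType d}.
Variable P : probability Omega R.
Context {I : finType}.
Variable W : I -> R -> Omega -> R.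
Hypothesis hW : forall i, brownian P (W i).

(** Rational times make the event measurable; for continuous paths the bound then holds at all times
    of [0, 1]. *)
Definition good (K : R) : set Omega := [set om | forall i (q : rat), 0 <= (ratr q : R) <= 1 ->
  `|W i (ratr q) om - W i 0 om| <= K].

Lemma good_measurable K : measurable (good K).
Proof.
have -> : good K = \bigcap_(i in [set: I]) ~` (\bigcup_(q in [set q : rat | 0 <= (ratr q : R) <= 1])
    [set om | K < `|W i (ratr q) om - W i 0 om|]).
  apply/seteqP; split=> [om H i _ [q /= q01]|om H i q q01].
    by rewrite ltNge H.
  by rewrite leNgt; apply/negP => H2; apply: (H i Logic.I); exists q.
apply: fin_bigcap_measurable => // i _; apply: measurableC.
rewrite bigcup_mkcond; apply: countable_bigcupT_measurable; first exact: countableP.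
move=> q; case: ifPn => [|_]; last exact: measurable0.
rewrite inE => /andP[q0 q1].
have mf : measurable_fun setT (fun om => `|W i (ratr q) om - W i 0 om|).
  by apply: measurableT_comp => //; apply: measurable_funB; exact: (brownian_meas (hW i)).
have := mf measurableT _ (measurable_itv `]K, +oo[); rewrite setTI.
by congr measurable; apply/seteqP; split=> om /=; rewrite in_itv/= andbT.
Qed.

Lemma good_mono K K' : K <= K' -> good K `<=` good K'.
Proof. by move=> KK' om H i q q01; apply: le_trans KK'; exact: H. Qed.

Lemma paths_continuous :
  {ae P, forall om, forall i, continuous (fun t : R => W i (Num.max 0 t) om)}.
Proof.
apply: filter_forall => i; apply: filterS (brownian_cont (hW i)) => om.
exact: halfline_continuous.
Qed.

Lemma good_path om K i t : continuous (fun t : R => W i (Num.max 0 t) om) -> good K om ->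
  0 <= t <= 1 -> `|W i t om - W i 0 om| <= K.
Proof.
move=> ci Kom /andP[t0 t1]; rewrite leNgt; apply/negP => Kt.
pose f (s : R) := `|W i (Num.max 0 s) om - W i 0 om|.
have cf : continuous f.
  by move=> s; apply: cvg_norm; apply: cvgB; [exact: ci|exact: cvg_cst].
have ft : f t = `|W i t om - W i 0 om| by rewrite /f (max_idPr t0).
have /cvgrPdist_lt /(_ (f t - K)) := cf t; rewrite ft subr_gt0 => /(_ Kt).
move=> /nbhs_ballP[e /= e0 H].
have lt1 : Num.max 0 (t - e) < Num.min 1 (t + e).
  by rewrite gt_max !lt_min ltr01/=; apply/andP; split; [|apply/andP; split]; lra.
have [q] := rat_in_itvoo lt1; rewrite in_itv/= gt_max lt_min => /andP[/andP[q0 q1] /andP[q2 q3]].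
have : ball t e (ratr q : R) by rewrite /ball/= distrC ltr_distl; apply/andP; split.
move=> /H; rewrite /f (max_idPr (ltW q0)) ltr_distl => /andP[h1 h2].
have := Kom i q; rewrite (ltW q0) (ltW q2) => /(_ isT); lra.
Qed.

Lemma good_ae : {ae P, forall om, forall K, good K om -> forall i t, 0 <= t <= 1 ->
  `|W i t om - W i 0 om| <= K}.
Proof. by apply: filterS paths_continuous => om ci K Kom i t; exact: good_path. Qed.

Lemma good_prob (e : R) : 0 < e -> exists2 K : R, 1 <= K & ((1 - e)%:E <= P (good K))%E.
Proof.
move=> e0.
have mg n : measurable (good n%:R) by exact: good_measurable.
pose U := \bigcup_n good n%:R; have mU : measurable U by exact: bigcup_measurable.
have nd : nondecreasing_seq (fun n => good n%:R).
  by move=> a b ab; apply/subsetPset; apply: good_mono; rewrite ler_nat.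
have cv : P (good k%:R) @[k --> \oo] --> P U := nondecreasing_cvg_mu (mu := P) mg mU nd.
have PU : P U = 1%E.
  rewrite -(probability_setT P); apply: as_prob_eq => //.
  apply: filterS paths_continuous => om ci; split=> // _.
  have bd i : exists M : R, forall t, 0 <= t <= 1 -> `|W i t om - W i 0 om| <= M.
    have [|c _ H] := @EVT_max R (fun s => `|W i (Num.max 0 s) om - W i 0 om|) 0 1 ler01.
      apply: continuous_subspaceT => s; apply: cvg_norm.
      by apply: cvgB; [exact: ci|exact: cvg_cst].
    eexists => t t01; have := H t; rewrite in_itv/= => /(_ t01).
    by case/andP: t01 => t0 _; rewrite (max_idPr t0) => h; exact: h.
  have [M HM] := choice bd.
  exists (Num.truncn (\sum_i `|M i|)).+1 => // i q q01.
  apply: le_trans (HM i _ q01) _; apply: le_trans (ltW (truncnS_gt _)).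
  apply: le_trans (ler_norm _) _; rewrite (bigD1 i)//= lerDl.
  by apply: sumr_ge0.
rewrite PU in cv; move: cv => /fine_cvgP[_ /cvgrPdist_le /(_ e e0)][n0 _ H].
exists (maxn n0 1)%:R; first by rewrite ler1n leq_maxr.
have := H (maxn n0 1) (leq_maxl _ _); rewrite /= ler_distl => /andP[_ h].
rewrite -(fineK (fin_num_measure P _ (mg (maxn n0 1)))) lee_fin lerBlDr.
by move: h; rewrite [leRHS]addrC -lerBlDl; lra.
Qed.

End GoodEvent.

Section Shooting.
Context {R : realType} {n : nat}.
Variable b : 'rV[R]_n -> 'rV[R]_n.
Hypothesis bL : loclip b.

(** The points [gridpt] form a finite net of mesh a/4 that covers the ball of radius [r]. *)
Definition gridnum (r a : R) : nat := (Num.truncn (4 * r / a)).+1.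

Definition gridpt (r a : R) (f : {ffun 'I_n -> 'I_(gridnum r a).*2.+1}) : 'rV[R]_n :=
  \row_l (a / 4 * ((f l)%:R - (gridnum r a)%:R)).

Lemma gridpt_approx (r a : R) (s : 'rV[R]_n) : 0 <= r -> 0 < a -> `|s| <= r ->
  exists f, `|gridpt (r := r) (a := a) f - s| <= a / 4.
Proof.
move=> r0 a0 sr; set q := gridnum r a.
have a4 : 0 < a / 4 by rewrite divr_gt0.
have rq : r / (a / 4) <= q%:R.
  apply: le_trans (ltW (truncnS_gt _)); rewrite le_eqVlt; apply/orP; left; apply/eqP.
  by field; rewrite gt_eqF.
have sl l : - q%:R <= s 0 l / (a / 4) <= q%:R.
  rewrite -ler_norml normrM [X in _ * X]gtr0_norm ?invr_gt0//; apply: le_trans rq.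
  by rewrite ler_pM2r ?invr_gt0//; apply: le_trans sr; exact: rv_coord_le.
have p0 l : 0 <= s 0 l / (a / 4) + q%:R by have := sl l; lra.
have H l : (Num.truncn (s 0 l / (a / 4) + q%:R)%R < q.*2.+1)%N.
  rewrite ltnS -(ler_nat R) -addnn natrD; have /andP[h _] := truncn_itv (p0 l).
  by have := sl l; lra.
exists [ffun l => Ordinal (H l)]; apply: rv_norm_le => [|l]; first exact: ltW.
rewrite !mxE ffunE /= -/q; have /andP[h1 h2] := truncn_itv (p0 l).
rewrite -[X in _ < X]natr1 in h2; set k := _%:R in h1 h2 *.
have -> : s 0 l = (a / 4) * (s 0 l / (a / 4)) by field; rewrite gt_eqF.
rewrite -mulrBr normrM gtr0_norm// -[leRHS]mulr1 ler_pM2l// ler_norml.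
by apply/andP; split; lra.
Qed.

Lemma gridpt_le (r a : R) f : 0 <= r -> 0 < a -> a <= 1 -> `|gridpt (r := r) (a := a) f| <= r + 1.
Proof.
move=> r0 a0 a1; apply: rv_norm_le => [|l]; first by rewrite addr_ge0.
have a4 : 0 < a / 4 by rewrite divr_gt0.
rewrite mxE normrM gtr0_norm//.
set q := gridnum r a.
have h1 : `|(f l)%:R - q%:R| <= q%:R :> R.
  have : (f l)%:R <= q%:R + q%:R :> R by rewrite -natrD addnn ler_nat -ltnS.
  have : 0 <= (f l)%:R :> R by [].
  by rewrite ler_norml; move=> *; apply/andP; split; lra.
apply: le_trans (ler_wpM2l (ltW a4) h1) _; rewrite /q /gridnum -[X in _ * X]natr1.
have r4 : 0 <= 4 * r / a by rewrite divr_ge0 ?mulr_ge0// ltW.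
have /andP[h _] := truncn_itv r4.
have := ler_wpM2l (ltW a4) h; have -> : a / 4 * (4 * r / a) = r by field; rewrite gt_eqF.
lra.
Qed.

(** A constant drift of total displacement [s] added to the noise over a short time moves the
    endpoint by nearly [s]: the endpoint map satisfies |Phi s - Phi s' - (s - s')| <= |s - s'| / 4,
    so any target is reached by a contraction. The shift is then rounded to a finite net, because a
    union bound over the shifts follows. All constants are uniform in the number of steps. *)
Lemma shooting (r K : R) : 0 <= r -> 0 <= K -> exists2 h0 : R, 0 < h0 & exists M : R,
  forall (h : R) (m : nat) (c : R) (x : 'rV[R]_n) (Z : nat -> 'rV[R]_n),
  0 < h -> h <= h0 -> M <= c -> `|x| <= r ->
  (forall j, (j <= m.+1)%N -> `|\sum_(i < j) Z i| <= K) ->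
  forall (y : 'rV[R]_n) (a : R), `|y| <= 1 -> 0 < a -> a <= 1 ->
  exists f, `|euler b (h / m.+1%:R) c
    (fun i => Z i + m.+1%:R^-1 *: gridpt (r := r + K + 2) (a := a) f) x m.+1 - y| <= a.
Proof.
(* A shift that hits a target of norm at most 1 has norm at most r + K + 2, and a path with a shift
   of norm at most Rp + 1 stays below [r']. *)
move=> r0 K0; pose Rp : R := r + K + 2; pose r' : R := r + K + (Rp + 1) + 1.
have Rp0 : 0 <= Rp by rewrite !addr_ge0.
have r'0 : 0 <= r' by rewrite !addr_ge0.
have [L L0 HL] := bL r'; have [M M0 HM] := loclip_bounded bL r'0.
(* Short enough for h M <= 1, which confines the path, and for 8 h L <= 1, which gives the
   contraction factor 1/4. *)
exists (8 * L + M + 1)^-1; first by rewrite invr_gt0 ltr_wpDl// addr_ge0// mulr_ge0.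
exists M => h m c x Z h0 hh0 Mc xr ZK y a y1 a0 a1.
have hLM : h * (8 * L + M + 1) <= 1.
  by rewrite -ler_pdivlMr ?div1r// ltr_wpDl// addr_ge0// mulr_ge0.
have hL0 : 0 <= h * L by rewrite mulr_ge0// ltW.
have hM0 : 0 <= h * M by rewrite mulr_ge0// ltW.
have hL : 8 * (h * L) <= 1 by lra.
have hM : h * M <= 1 by lra.
pose m1 : R := m.+1%:R; have m10 : 0 < m1 by rewrite ltr0n.
pose de := h / m1; have de0 : 0 < de by rewrite divr_gt0.
pose e s j := euler b de c (fun i => Z i + m1^-1 *: s) x j.
have jde j : (j <= m.+1)%N -> 0 <= j%:R * de <= h.
  move=> jm; rewrite mulr_ge0 ?(ltW de0)//= /de mulrCA ger_pMr// ler_pdivrMr// mul1r.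
  by rewrite ler_nat.
have jm1 j : (j <= m.+1)%N -> 0 <= j%:R / m1 <= 1.
  by move=> jm; rewrite divr_ge0 ?(ltW m10)//= ler_pdivrMr// mul1r ler_nat.
have C1 s j : `|s| <= Rp + 1 -> (j <= m.+1)%N ->
    `|e s j - x - \sum_(i < j) Z i - (j%:R / m1) *: s| <= j%:R * de * M /\ `|e s j| <= r'.
  move=> sR; elim: j => [_|j IH jm].
    rewrite /e/= big_ord0 !mul0r subrr subr0 scale0r subr0 normr0; split=> //.
    by apply: le_trans xr _; rewrite /r' -!addrA lerDl !addr_ge0.
  have [IH1 IH2] := IH (ltnW jm).
  have H1 : `|e s j.+1 - x - \sum_(i < j.+1) Z i - (j.+1%:R / m1) *: s| <= j.+1%:R * de * M.
    rewrite big_ord_recr/= [e s j.+1]/(e s j - de *: cutoff b c (e s j) + (Z j + m1^-1 *: s)).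
    have -> : e s j - de *: cutoff b c (e s j) + (Z j + m1^-1 *: s) - x -
        (\sum_(i < j) Z i + Z j) - (j.+1%:R / m1) *: s =
        (e s j - x - \sum_(i < j) Z i - (j%:R / m1) *: s) - de *: cutoff b c (e s j).
      by apply/rowP => l; rewrite !mxE -natr1; ring.
    apply: le_trans (ler_normB _ _) _.
    have -> : j.+1%:R * de * M = j%:R * de * M + de * M by rewrite -natr1; ring.
    apply: lerD => //; rewrite normrZ gtr0_norm// ler_wpM2l ?(ltW de0)//.
    by rewrite /cutoff; case: ifP => _; rewrite ?normr0//; exact: HM.
  split=> //.
  have -> : e s j.+1 = (e s j.+1 - x - \sum_(i < j.+1) Z i - (j.+1%:R / m1) *: s) +
      (x + \sum_(i < j.+1) Z i + (j.+1%:R / m1) *: s).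
    by apply/rowP => l; rewrite !mxE; ring.
  apply: le_trans (ler_normD _ _) _; rewrite /r' addrC; apply: lerD.
    apply: le_trans (ler_normD _ _) _; apply: lerD.
      by apply: le_trans (ler_normD _ _) _; apply: lerD => //; exact: ZK.
    have /andP[j0 j1] := jm1 _ jm; rewrite normrZ ger0_norm//.
    by apply: le_trans sR; rewrite ler_piMl.
  apply: le_trans H1 _; apply: le_trans hM; rewrite ler_wpM2r//.
  by have /andP[] := jde _ jm.
have C2 s s' j : `|s| <= Rp + 1 -> `|s'| <= Rp + 1 -> (j <= m.+1)%N ->
    `|e s j - e s' j - (j%:R / m1) *: (s - s')| <= j%:R * de * (L * (2 * `|s - s'|)).
  move=> sR s'R; elim: j => [_|j IH jm].
    by rewrite /e/= subrr !mul0r scale0r subr0 normr0.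
  have IHj := IH (ltnW jm).
  have [_ es] := C1 s j sR (ltnW jm); have [_ es'] := C1 s' j s'R (ltnW jm).
  have cE w : `|w| <= r' -> cutoff b c w = b w by move=> /HM wM; rewrite /cutoff (le_trans wM Mc).
  have d2 : `|e s j - e s' j| <= 2 * `|s - s'|.
    have -> : e s j - e s' j = (e s j - e s' j - (j%:R / m1) *: (s - s')) + (j%:R / m1) *: (s - s').
      by rewrite subrK.
    apply: le_trans (ler_normD _ _) _.
    have /andP[j0 j1] := jm1 _ (ltnW jm); rewrite normrZ (ger0_norm j0).
    have /andP[k0 k1] := jde _ (ltnW jm).
    have n0 := normr_ge0 (s - s').
    have t1 : j%:R * de * (L * (2 * `|s - s'|)) <= h * (L * (2 * `|s - s'|)).
      by rewrite ler_wpM2r// !mulr_ge0.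
    have t2 : j%:R / m1 * `|s - s'| <= `|s - s'| by rewrite ler_piMl.
    have t3 : h * (L * (2 * `|s - s'|)) <= `|s - s'|.
      have -> : h * (L * (2 * `|s - s'|)) = 2 * (h * L) * `|s - s'| by ring.
      by rewrite ler_piMl//; lra.
    have -> : 2 * `|s - s'| = `|s - s'| + `|s - s'| by ring.
    by apply: lerD => //; exact: le_trans (le_trans IHj t1) t3.
  rewrite [e s j.+1]/(e s j - de *: cutoff b c (e s j) + (Z j + m1^-1 *: s)).
  rewrite [e s' j.+1]/(e s' j - de *: cutoff b c (e s' j) + (Z j + m1^-1 *: s')) !cE//.
  have -> : e s j - de *: b (e s j) + (Z j + m1^-1 *: s) -
      (e s' j - de *: b (e s' j) + (Z j + m1^-1 *: s')) - (j.+1%:R / m1) *: (s - s') =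
      (e s j - e s' j - (j%:R / m1) *: (s - s')) - de *: (b (e s j) - b (e s' j)).
    by apply/rowP => l; rewrite !mxE -natr1; ring.
  apply: le_trans (ler_normB _ _) _.
  have -> : j.+1%:R * de * (L * (2 * `|s - s'|)) =
      j%:R * de * (L * (2 * `|s - s'|)) + de * (L * (2 * `|s - s'|)) by rewrite -natr1; ring.
  apply: lerD => //; rewrite normrZ gtr0_norm// ler_wpM2l ?(ltW de0)//.
  by apply: le_trans (HL _ _ es es') _; rewrite ler_wpM2l.
pose Phi s := e s m.+1.
have m1m : m.+1%:R / m1 = 1 :> R by rewrite divff// gt_eqF.
have P1 s : `|s| <= Rp + 1 -> `|s - Phi s| <= r + K + 1.
  move=> sR; have [H _] := C1 s m.+1 sR (leqnn _).
  rewrite m1m scale1r in H.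
  have -> : s - Phi s = - (e s m.+1 - x - \sum_(i < m.+1) Z i - s) - (x + \sum_(i < m.+1) Z i).
    by apply/rowP => l; rewrite !mxE; ring.
  apply: le_trans (ler_normB _ _) _; rewrite normrN addrC; apply: lerD.
    by apply: le_trans (ler_normD _ _) _; apply: lerD => //; exact: ZK.
  apply: le_trans H _; apply: le_trans hM; rewrite ler_wpM2r//.
  by have /andP[] := jde _ (leqnn m.+1).
have P2 s s' : `|s| <= Rp + 1 -> `|s'| <= Rp + 1 ->
    `|Phi s - Phi s' - (s - s')| <= 4^-1 * `|s - s'|.
  move=> sR s'R; have := C2 s s' m.+1 sR s'R (leqnn _); rewrite m1m scale1r => H.
  apply: le_trans H _; have -> : m.+1%:R * de = h by rewrite /de mulrC divfK ?gt_eqF.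
  have -> : h * (L * (2 * `|s - s'|)) = 2 * (h * L) * `|s - s'| by ring.
  by rewrite ler_wpM2r//; lra.
(* A fixed point of [step] solves Phi s = y, and each iteration divides the residual by 4. *)
pose step s := s - (Phi s - y).
have step_le s : `|s| <= Rp -> `|step s| <= Rp.
  move=> sR; have -> : step s = (s - Phi s) + y by rewrite /step opprB addrCA addrC.
  apply: le_trans (ler_normD _ _) _.
  have := P1 s; rewrite (le_trans sR) ?lerDl// => /(_ isT); rewrite /Rp; lra.
pose sk k := iter k step 0.
have skR k : `|sk k| <= Rp by elim: k => [|k IH]; [rewrite /sk/= normr0|exact: step_le].
have skR1 k : `|sk k| <= Rp + 1 by apply: le_trans (skR k) _; rewrite lerDl.
have res k : `|Phi (sk k) - y| <= (4 ^+ k)^-1 * Rp.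
  elim: k => [|k IH].
    rewrite expr0 invr1 mul1r; have := P1 0; rewrite normr0 addr_ge0// => /(_ isT).
    rewrite sub0r normrN => H; apply: le_trans (ler_normB _ _) _; rewrite /Rp /sk/=.
    lra.
  have -> : Phi (sk k.+1) - y = Phi (sk k.+1) - Phi (sk k) - (sk k.+1 - sk k).
    by rewrite [sk k.+1]/(step (sk k)) /step; apply/rowP => l; rewrite !mxE; ring.
  apply: le_trans (P2 _ _ (skR1 k.+1) (skR1 k)) _.
  have -> : sk k.+1 - sk k = - (Phi (sk k) - y).
    by rewrite [sk k.+1]/(step (sk k)) /step; apply/rowP => l; rewrite !mxE; ring.
  by rewrite normrN exprS invfM -mulrA ler_wpM2l// invr_ge0.
have [k kE] : exists k, (4 ^+ k)^-1 * Rp <= a / 4.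
  exists (Num.truncn (4 * Rp / a)).+1.
  rewrite mulrC ler_pdivrMr ?exprn_gt0// -ler_pdivrMl ?divr_gt0//.
  have -> : (a / 4)^-1 * Rp = 4 * Rp / a by field; rewrite gt_eqF.
  apply: le_trans (ltW (truncnS_gt _)) _; rewrite -natrX ler_nat.
  by apply: ltnW; apply: ltn_expl.
have [f fE] := gridpt_approx Rp0 a0 (skR k).
exists f; set s := gridpt f in fE *; have sR : `|s| <= Rp + 1 by exact: gridpt_le.
rewrite -/(e s m.+1) -/(Phi s).
have -> : Phi s - y = (Phi s - Phi (sk k) - (s - sk k)) + (s - sk k) + (Phi (sk k) - y).
  by apply/rowP => l; rewrite !mxE; ring.
apply: le_trans (ler_normD _ _) _.
have h1 : `|Phi s - Phi (sk k) - (s - sk k) + (s - sk k)| <= 4^-1 * `|s - sk k| + `|s - sk k|.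
  by apply: le_trans (ler_normD _ _) _; rewrite lerD2r; exact: P2.
have h2 := le_trans (res k) kE; lra.
Qed.

End Shooting.

Section UnionBound.
Context {R : realType} {d : measure_display} {Omega : measurableType d}.
Variable P : probability Omega R.

Lemma union_bound (F : finType) (G : set Omega) (B : F -> set Omega) (p : \bar R) :
  measurable G -> (forall f, measurable (B f)) -> (forall om, G om -> exists f, B f om) ->
  (forall f, P (G `&` B f) <= p)%E -> (P G <= #|F|%:R%:E * p)%E.
Proof.
move=> mG mB GB Bp.
have mGB f : measurable (G `&` B f) by exact: measurableI.
apply: (@le_trans _ _ (\sum_f P (G `&` B f))%E); last first.
  apply: (@le_trans _ _ (\sum_(f : F) p)%E); first exact: lee_sum.
  by rewrite sumr_const mule_natl.
have iE A : measurable A -> (\int[P]_om (\1_A om)%:E = P A)%E.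
  by move=> mA; rewrite integral_indic// setIT.
rewrite -iE//; under eq_bigr do rewrite -iE//.
rewrite -ge0_integral_sum//; last first.
  by move=> f; apply/measurable_EFinP; exact: measurable_indic.
apply: ge0_le_integral => //.
- by apply/measurable_EFinP; exact: measurable_indic.
- by apply: emeasurable_sum => f; apply/measurable_EFinP; exact: measurable_indic.
move=> om _; rewrite sumEFin lee_fin [X in X <= _]indicE.
have [|_] := boolP (om \in G); last exact: sumr_ge0.
rewrite inE => Gom; have [f fom] := GB om Gom.
rewrite (bigD1 f)//= indicE mem_set// lerDl; exact: sumr_ge0.
Qed.

End UnionBound.

Lemma dist_continuous {R : realType} {n : nat} (y0 : 'rV[R]_n) :
  continuous (fun y : 'rV[R]_n => `|y - y0|).
Proof.
move=> y; apply: (@continuous_comp _ _ _ (fun z : 'rV[R]_n => z - y0) (fun z => `|z|));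
  last exact: norm_continuous.
by apply: (continuousB (f := id) (g := cst y0)); [move=> A|exact: cst_continuous].
Qed.

Lemma bump_continuous {R : realType} {n : nat} (y0 : 'rV[R]_n) (a : R) :
  continuous (fun y : 'rV[R]_n => Num.max 0 (Num.min 1 (2 - `|y - y0| / a)) : R).
Proof.
move=> y; apply: (@continuous_comp _ _ _ (fun y : 'rV[R]_n => `|y - y0|)
  (fun t : R => Num.max 0 (Num.min 1 (2 - t / a)))); first exact: dist_continuous.
set t := `|_|; pose g (t : R) : R^o := 2 - t / a.
have cg : {for t, continuous g}.
  apply: cvgB; first exact: cvg_cst.
  by apply: cvgM; [exact: cvg_id|exact: cvg_cst].
apply: (continuous_max (f := fun=> 0) (g := fun t => Num.min 1 (g t))); first exact: cvg_cst.
by apply: (continuous_min (f := fun=> 1) (g := g)); [exact: cvg_cst|exact: cg].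
Qed.

Lemma lee_prod_fin {R : realType} {F : finType} (f g : F -> \bar R) :
  (forall l, 0 <= f l)%E -> (forall l, f l <= g l)%E -> (\prod_l f l <= \prod_l g l)%E.
Proof.
move=> f0 fg.
suff /andP[] : (0 <= \prod_l f l <= \prod_l g l)%E by [].
elim/big_ind2: _ => [|x1 x2 y1 y2 /andP[a b] /andP[c e]|l _]; first by rewrite lee01 lexx.
  by rewrite mule_ge0//= lee_pmul.
by rewrite f0 fg.
Qed.

Section SmallBall.
Context {R : realType} {d : measure_display} {Omega : measurableType d}.
Variable P : probability Omega R.
Context {I : finType}.
Variable W : I -> R -> Omega -> R.
Hypothesis hW : forall i, brownian P (W i).
Hypothesis hWind : independent_processes P W.
Context {n : nat}.
Variables (b : 'rV[R]_n -> 'rV[R]_n) (S : I -> 'rV[R]_n).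
Variable u : 'rV[R]_n -> R -> Omega -> 'rV[R]_n.
Hypotheses (bL : loclip b) (hu : flow P W b S u).
Variables (iota : 'I_n -> I) (sg : 'I_n -> R).
Hypotheses (iota_inj : injective iota) (sg0 : forall l, sg l != 0).
Hypothesis S_iota : forall l, S (iota l) = sg l *: delta_mx 0 l.

Local Tactic Notation "lra_on" ne_hyp_list(H) :=
  clear - H hW hWind bL hu iota_inj sg0 S_iota; lra.

(** The amplitudes of the motions whose joint displacement is [s]; only the motions [iota l], each
    acting on one coordinate, are used. *)
Definition lift_noise (s : 'rV[R]_n) (i : I) : R := \sum_(l | iota l == i) s 0 l / sg l.

Lemma lift_noiseK s : \sum_i lift_noise s i *: S i = s.
Proof.
rewrite [RHS]row_sum_delta (partition_big iota predT)//=; apply: eq_bigr => i _.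
rewrite scaler_suml; apply: eq_bigr => l /eqP <-.
by rewrite S_iota scalerA divfK.
Qed.

Lemma lift_noise_le s i : `|lift_noise s i| <= `|s| * \sum_l `|sg l|^-1.
Proof.
apply: le_trans (ler_norm_sum _ _ _) _; rewrite mulr_sumr.
rewrite [leRHS](bigID (fun l => iota l == i))/= -[leLHS]addr0; apply: lerD.
  apply: ler_sum => l _; rewrite normrM normfV; apply: ler_wpM2r; first by rewrite invr_ge0.
  exact: rv_coord_le.
by apply: sumr_ge0 => l _; rewrite mulr_ge0// invr_ge0.
Qed.

Let sd h m (k : 'I_#|{: I * 'I_m}|) : R :=
  Num.sqrt (ugrid 0 h (enum_val k : I * 'I_m).2.+1 - ugrid 0 h (enum_val k : I * 'I_m).2).

Let sdE h m k : @sd h m k = Num.sqrt h.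
Proof. by rewrite /sd /ugrid -natr1; congr Num.sqrt; ring. Qed.

Let ramp (s : 'rV[R]_n) m : 'rV[R]_#|{: I * 'I_m.+1}| :=
  \row_k (lift_noise s (enum_val k : I * 'I_m.+1).1 / m.+1%:R).

Let Zof_ramp s m xi j : (j < m.+1)%N ->
  Zof S (xi + ramp s m) j = @Zof R I n S m.+1 xi j + m.+1%:R^-1 *: s.
Proof.
move=> jm; rewrite -[in RHS](lift_noiseK s) scaler_sumr /Zof -big_split; apply: eq_bigr => i _.
by rewrite insubT !mxE enum_rankK scalerDl scalerA [_^-1 * _]mulrC.
Qed.

(** All steps are shifted equally, so the exponent telescopes to the increments over [0, h]; hence a
    lower bound for the density that is uniform in the number of steps. *)
Let ramp_density s m h om : 0 < h ->
  row_density (@sd (h / m.+1%:R) m.+1) (ramp s m) (incr_row W (ugrid 0 (h / m.+1%:R)) m.+1 om) =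
  expR (\sum_i (- lift_noise s i * (W i h om - W i 0 om) / h - lift_noise s i ^+ 2 / (h *+ 2))).
Proof.
move=> h0; pose de : R := h / m.+1%:R; rewrite -/de; have de0 : 0 < de by rewrite divr_gt0.
have dm : m.+1%:R * de = h by rewrite /de mulrC divfK ?pnatr_eq0.
rewrite /row_density expR_sum.
transitivity (\prod_(p : I * 'I_m.+1) expR (- (lift_noise s p.1 / m.+1%:R * incr W (ugrid 0 de) p.2 p.1 om) / de
    - (lift_noise s p.1 / m.+1%:R) ^+ 2 / (de *+ 2))).
  rewrite [RHS](reindex (@enum_val _ [pred x : I * 'I_m.+1 | true]))/=; last first.
    by apply: onW_bij; exact: enum_val_bij.
  apply: eq_bigr => k _; rewrite /shift_density sdE sqr_sqrtr ?(ltW de0)// !mxE.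
  by [].
rewrite -(pair_big predT predT (fun i j => expR (- (lift_noise s i / m.+1%:R * incr W (ugrid 0 de) (j : 'I_m.+1) i om) / de
    - (lift_noise s i / m.+1%:R) ^+ 2 / (de *+ 2))))/=.
apply: eq_bigr => i _; rewrite -expR_sum; congr expR.
rewrite big_split/= -mulr_suml sumrN -mulr_sumr sumr_const card_ord.
have -> : \sum_(j < m.+1) incr W (ugrid 0 de) j i om = W i h om - W i 0 om.
  rewrite -(big_mkord predT (fun j => incr W (ugrid 0 de) j i om)) telescope_sumr//.
  by rewrite /ugrid mul0r !add0r dm.
rewrite -dm -[RHS]/(_ + _) !mulr2n -[X in _ + X = _]mulr_natl.
have : 0 < m.+1%:R :> R by [].
clear dm; clearbody de.
move: (m.+1%:R : R) => M M0; field.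
by rewrite !gt_eqF ?addr_gt0 ?mulr_gt0.
Qed.

(** On an event of probability at least 1/2 the noise is sent into the ball of radius [a] by one of
    N shifts, N of order a^-n, and each shift costs at most a factor 1/c0. The union bound gives 1/2
    <= N P(ball) / c0, which is the order a^n of a law with density bounded below. *)
Lemma small_ball (r : R) : 0 <= r -> exists h : R, [/\ 0 < h, h <= 2^-1 &
  exists2 c : R, 0 < c & forall (x y0 : 'rV[R]_n) (a : R), `|x| <= r -> `|y0| <= 1 ->
    0 < a -> a <= 1 -> ((c * a ^+ n)%:E <= P [set om | (`|u x h om - y0| <= 2 * a)%R])%E].
Proof.
move=> r0.
have [|K' K'1 PK'] := good_prob hW (e := 2^-1); first by rewrite invr_gt0.
have K'0 : 0 <= K' by apply: le_trans K'1.
pose K := K' * \sum_i `|S i|; have K0 : 0 <= K by rewrite mulr_ge0// sumr_ge0.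
have [h0 h00 [M HM]] := shooting bL r0 K0.
have [m1 Hm1] := @cut_large R M.
pose h := Num.min h0 2^-1; have hp : 0 < h by rewrite lt_min h00 invr_gt0/=.
have hh0 : h <= h0 by rewrite ge_min lexx.
have h12 : h <= 2^-1 by rewrite ge_min lexx orbT.
have h1 : h <= 1 by lra.
pose Rp := r + K + 2; have Rp0 : 0 <= Rp by rewrite !addr_ge0.
pose B := (Rp + 1) * \sum_l `|sg l|^-1.
have B0 : 0 <= B.
  by rewrite mulr_ge0 ?addr_ge0// sumr_ge0// => l _; rewrite invr_ge0.
pose c0 := expR (- (#|I|%:R * (B * K' / h + B ^+ 2 / (h *+ 2)))).
have c00 : 0 < c0 by rewrite expR_gt0.
exists h; split=> //; exists (c0 / 2 / (8 * Rp + 3) ^+ n).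
  by rewrite !divr_gt0// exprn_gt0// ltr_wpDl// mulr_ge0.
move=> x y0 a xr y01 a0 a1.
pose xi m := incr_row W (ugrid 0 (h / m.+1%:R)) m.+1.
have de0 m : 0 < h / m.+1%:R by rewrite divr_gt0.
have gg m := ugrid_grid (lexx 0) (de0 m).
have mxi m : measurable_fun setT (xi m : Omega -> brv R _).
  exact: (@incr_row_measurable _ _ _ P I W hW _ m.+1 (gg m)).
pose e m (z : brv R #|{: I * 'I_m.+1}|) : brv R n :=
  euler b (h / m.+1%:R) (cut m) (@Zof R I n S m.+1 z) x m.+1.
have me m : measurable_fun setT (e m : brv R #|{: I * 'I_m.+1}| -> brv R n).
  exact: (measurableT_comp (@euler_measurable R I n b S bL m.+1 (h / m.+1%:R) (cut m) m.+1)
    (measurable_fun_pair (measurable_cst (x : brv R n)) (@measurable_id _ _ setT))).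
pose Q : set (brv R n) := [set y | `|(y : 'rV[R]_n) - y0| <= a].
have mdist : measurable_fun setT (fun y : brv R n => `|(y : 'rV[R]_n) - y0|).
  by apply: (continuous_brv (f := fun y : 'rV[R]_n => `|y - y0|)); exact: dist_continuous.
have mball t : measurable ([set y | `|(y : 'rV[R]_n) - y0| <= t] : set (brv R n)).
  have := mdist measurableT _ (measurable_itv `]-oo, t]); rewrite setTI.
  by congr measurable; apply/seteqP; split=> y /=; rewrite in_itv.
have mE m : measurable (e m @^-1` Q).
  by rewrite -[X in measurable X]setTI; exact: (me m measurableT _ (mball a)).
pose N := #|{: {ffun 'I_n -> 'I_(gridnum Rp a).*2.+1}}|.
have PE m : (m1 <= m)%N -> ((2^-1)%:E <= N%:R%:E * ((c0^-1)%:E * P (xi m @^-1` (e m @^-1` Q))))%E.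
  move=> mm; pose de : R := h / m.+1%:R.
  pose G : set Omega := [set om | forall i (j : 'I_m.+2),
    `|W i (ugrid 0 de j) om - W i 0 om| <= K'].
  have gj (j : 'I_m.+2) : 0 <= ugrid 0 de j <= h.
    rewrite /ugrid add0r mulr_ge0 ?(ltW (de0 m))//= /de mulrCA ger_pMr// ler_pdivrMr// mul1r.
    by rewrite ler_nat -ltnS.
  have mG : measurable G.
    have -> : G = \bigcap_(p in [set: I * 'I_m.+2])
        ((fun om => `|W p.1 (ugrid 0 de p.2) om - W p.1 0 om|) @^-1` `]-oo, K']%classic).
      apply/seteqP; split=> [om H [i j] _ /=|om H i j]; first by rewrite in_itv/=; exact: H.
      by have := H (i, j) Logic.I; rewrite /= in_itv.
    apply: fin_bigcap_measurable => // -[i j] _ /=.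
    have mf : measurable_fun setT (fun om => `|W i (ugrid 0 de j) om - W i 0 om|).
      apply: measurableT_comp => //; apply: measurable_funB; apply: (brownian_meas (hW i)) => //.
      by case/andP: (gj j).
    by rewrite -[X in measurable X]setTI; apply: mf => //; exact: measurable_itv.
  have PG : ((2^-1)%:E <= P G)%E.
    have -> : 2^-1 = 1 - 2^-1 :> R by field.
    apply: le_trans PK' _; apply: as_prob_le => //; first exact: (good_measurable hW).
    apply: filterS (good_ae hW) => om H Kom i j; apply: (H K') => //.
    by case/andP: (gj j) => -> /= jh; exact: le_trans jh h1.
  apply: le_trans PG _.
  apply: (union_bound (F := {ffun 'I_n -> 'I_(gridnum Rp a).*2.+1})
    (B := fun f => (fun om => xi m om + ramp (gridpt f) m) @^-1` (e m @^-1` Q))) => //.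
  - move=> f; rewrite -[X in measurable X]setTI.
    have mS : measurable_fun setT ((fun om => xi m om + ramp (gridpt f) m) : Omega -> brv R _).
      apply: brv_measurable_fun => k; under eq_fun do rewrite mxE.
      by apply: measurable_funD; [exact: brv_coord|exact: measurable_cst].
    exact: (mS measurableT _ (mE m)).
  - move=> om Gom.
    pose Z j := noise W S (ugrid 0 de j.+1) om - noise W S (ugrid 0 de j) om.
    have ZK j : (j <= m.+1)%N -> `|\sum_(i < j) Z i| <= K.
      move=> jm; rewrite -(big_mkord predT Z) telescope_sumr// /noise -sumrB.
      apply: le_trans (ler_norm_sum _ _ _) _; rewrite /K mulr_sumr; apply: ler_sum => i _.
      rewrite -scalerBl normrZ ler_wpM2r//.
      have := Gom i (Ordinal (jm : (j < m.+2)%N)); rewrite /ugrid /= mul0r !add0r.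
      by [].
    have [f Hf] := HM h m (cut m) x Z hp hh0 (Hm1 m mm) xr ZK y0 a y01 a0 a1.
    exists f; rewrite /= /Q /= /e; congr (`|_ - _| <= _): Hf.
    apply: euler_ext => i im; rewrite Zof_ramp// (Zof_incr W S _ om im).
    by [].
  - move=> f; have s0 k : @sd de m.+1 k != 0 by rewrite sdE gt_eqF// sqrtr_gt0; exact: de0.
    have cm := cameron_martin_le (xi := xi m) (s := @sd de m.+1) s0 (mxi m)
      (fun C mC => incr_row_probE hW hWind (gg m) mC) (a := ramp (gridpt f) m) (c := c0) mG (mE m).
    rewrite -(@lee_pmul2l _ c0%:E)// ?lte_fin// muleA -EFinM mulfV ?gt_eqF// mul1e.
    apply: cm => om Gom; rewrite ramp_density// ler_expR.
    rewrite -[_ + _ in leLHS]/(B * K' / h + B ^+ 2 / (h *+ 2)) mulr_natl -sumr_const -sumrN.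
    apply: ler_sum => i _.
    have sB : `|lift_noise (gridpt f) i| <= B.
      apply: le_trans (lift_noise_le _ _) _; apply: ler_wpM2r; last exact: gridpt_le.
      by apply: sumr_ge0 => l _; rewrite invr_ge0.
    have WK : `|W i h om - W i 0 om| <= K'.
      have := Gom i ord_max; rewrite /ugrid /= add0r.
      by rewrite /de mulrC divfK ?pnatr_eq0.
    rewrite opprD; apply: lerD; last first.
      rewrite lerN2 ler_pM2r ?invr_gt0 ?pmulrn_lgt0//.
      by rewrite -[leLHS]real_normK ?num_real// lerXn2r ?nnegrE.
    rewrite -mulNr ler_pM2r ?invr_gt0//.
    have : `|lift_noise (gridpt f) i * (W i h om - W i 0 om)| <= B * K'.
      by rewrite normrM; apply: ler_pM.
    by rewrite ler_norml mulNr lerN2 => /andP[].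
have PE2 m : (m1 <= m)%N -> ((c0 / 2 / (8 * Rp + 3) ^+ n * a ^+ n)%:E <= P (xi m @^-1` (e m @^-1` Q)))%E.
  move=> /PE; have pf := fin_num_measure P (xi m @^-1` (e m @^-1` Q)).
  have mx : measurable (xi m @^-1` (e m @^-1` Q)).
    by rewrite -[X in measurable X]setTI; exact: (mxi m measurableT _ (mE m)).
  rewrite -(fineK (pf mx)) -!EFinM !lee_fin; set p := fine _ => H.
  have p0 : 0 <= p by rewrite fine_ge0.
  have NE : N%:R <= ((8 * Rp + 3) / a) ^+ n :> R.
    rewrite /N card_ffun !card_ord natrX lerXn2r ?nnegrE//.
      by rewrite divr_ge0 ?addr_ge0 ?mulr_ge0// ltW.
    rewrite ler_pdivlMr// /gridnum -addnn -natr1 natrD -[X in (X + X + 1)]natr1.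
    have t0 : 0 <= 4 * Rp / a by rewrite divr_ge0 ?mulr_ge0// ltW.
    have /andP[h3 _] := truncn_itv t0; set k := _%:R in h3 *.
    have : k * a <= 4 * Rp by rewrite -ler_pdivlMr.
    lra.
  have h4 : 2^-1 <= ((8 * Rp + 3) / a) ^+ n * (c0^-1 * p).
    by apply: le_trans H _; rewrite ler_wpM2r// mulr_ge0// invr_ge0 ltW.
  have R3 : 0 < 8 * Rp + 3 by rewrite ltr_wpDl// mulr_ge0.
  rewrite expr_div_n in h4.
  have an0 : 0 < a ^+ n by rewrite exprn_gt0.
  have R3n : 0 < (8 * Rp + 3) ^+ n by rewrite exprn_gt0.
  have := ler_wpM2l (ltW (mulr_gt0 c00 (divr_gt0 an0 R3n))) h4.
  set D := (8 * Rp + 3) ^+ n in R3n *; set A := a ^+ n in an0 *.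
  have -> : c0 * (A / D) * (D / A * (c0^-1 * p)) = p by field; rewrite !gt_eqF.
  by congr (_ <= p); field; rewrite gt_eqF.
(* A continuous function between the indicators of the balls of radii [a] and [2 * a] carries the
   bound from the scheme to the solution. *)
pose f (y : 'rV[R]_n) : R := Num.max 0 (Num.min 1 (2 - `|y - y0| / a)).
have cf : continuous f by exact: bump_continuous.
have f01 y : 0 <= f y <= 1 by rewrite /f le_max lexx ge_max ler01/= ge_min lexx.
have := flow_test_cvg hW bL hu (x := x) (conj cf f01) hp.
move=> cvf; apply: (@le_trans _ _ (\int[P]_om (f (u x h om))%:E)%E).
  apply: (cvge_ge _ cvf); exists m1 => // m /= /PE2 H; apply: le_trans H _.
  have mxQ : measurable (xi m @^-1` (e m @^-1` Q)).
    by rewrite -[X in measurable X]setTI; exact: (mxi m measurableT _ (mE m)).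
  rewrite -[P (_ @^-1` _)]/(P (xi m @^-1` (e m @^-1` Q))).
  rewrite -[X in (P X <= _)%E]setIT -integral_indic//; apply: ge0_le_integral => //.
  - by apply/measurable_EFinP; exact: measurable_indic.
  - apply/measurable_EFinP; apply: (measurableT_comp (continuous_brv cf)).
    by apply: (eulr_measurable hW S bL (cut m) m.+1 (lexx 0) (de0 m)); exact: measurable_cst.
  - move=> om _; rewrite lee_fin indicE; have [|_] := boolP (om \in _); last by case/andP: (f01 (eulr W b S 0 (h / m.+1%:R) (cut m) x m.+1 om)).
    rewrite inE /= /Q /= /e -(eulrE W b S _ _ _ _ _ (leqnn m.+1)) => H2.
    rewrite /f le_max le_min lexx/=; apply/orP; right.
    by have : `|eulr W b S 0 (h / m.+1%:R) (cut m) x m.+1 om - y0| / a <= 1; [rewrite ler_pdivrMr// mul1r|lra].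
have mub : measurable [set om | `|u x h om - y0| <= 2 * a].
  have mu := flow_meas hu x (ltW hp).
  by have := mu measurableT _ (mball (2 * a)); rewrite setTI.
rewrite -[X in (_ <= P X)%E]setIT -integral_indic//; apply: ge0_le_integral => //.
- by move=> om _; rewrite lee_fin; case/andP: (f01 (u x h om)).
- by apply/measurable_EFinP; apply: (measurableT_comp (continuous_brv cf)); exact: (flow_meas hu x (ltW hp)).
- by apply/measurable_EFinP; exact: measurable_indic.
- move=> om _; rewrite lee_fin indicE; have [_|/negP] := boolP (om \in _); first by case/andP: (f01 (u x h om)). rewrite inE /= => /negP; rewrite -ltNge => H2; rewrite /f ge_max lexx/= ge_min; apply/orP; right.
  by rewrite subr_le0 ler_pdivlMr// ltW.
Qed.

Let Xrow om : 'rV[R]_n := \row_l incr W (ugrid 0 1) 0 (iota l) om.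

Let g1 : grid (ugrid (0 : R) 1). Proof. exact: ugrid_grid. Qed.

Let mXrow : measurable_fun setT (Xrow : Omega -> brv R n).
Proof.
apply: brv_measurable_fun => l; under eq_fun do rewrite mxE.
exact: (incr_measurable hW 0 (iota l) g1).
Qed.

Let Xrow_prob C : (forall l, measurable (C l)) ->
  P (Xrow @^-1` rbox C) = (\prod_l normal_prob 0 1 (C l))%E.
Proof.
move=> mC; pose C' i (_ : nat) : set R := [set y | forall l, iota l = i -> C l y].
have mC' i j : measurable (C' i j).
  have -> : C' i j = \bigcap_(l in [set l | iota l = i]) C l.
    by apply/seteqP; split=> y H l /=; [move=> li; exact: H|exact: H].
  by apply: fin_bigcap_measurable => //; exact: finite_finset.
have CE l : C' (iota l) 0%N = C l.
  apply/seteqP; split=> y; first exact.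
  by move=> Cy l' /iota_inj ->.
have -> : Xrow @^-1` rbox C = [set om | forall i j, (j < 1)%N -> C' i j (incr W (ugrid 0 1) j i om)].
  apply/seteqP; split=> om H.
    by move=> i [|//] _ l <-; have := H l; rewrite mxE.
  by move=> l; rewrite mxE; have := H (iota l) 0%N isT; rewrite CE.
rewrite (incr_product hW hWind 1 g1 mC').
have sE i : (\prod_(j < 1) step_law (ugrid 0 1) j (C' i j) = normal_prob (0 : R) 1 (C' i 0%N))%E.
  rewrite big_ord_recr big_ord0/= mul1e /step_law.
  have -> : ugrid 0 1 1 - ugrid 0 1 0 = 1 :> R by rewrite /ugrid; ring.
  by rewrite sqrtr1.
under eq_bigr do rewrite sE.
rewrite (bigID (mem (iota @: [set: 'I_n]%SET)))/= [X in (_ * X)%E]big1 ?mule1; last first.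
  move=> i ni; have -> : C' i 0%N = setT; last exact: probability_setT.
  by apply/seteqP; split=> // y _ l li; move: ni; rewrite -li imset_f.
rewrite big_imset/=; last by move=> l l' _ _; exact: iota_inj.
by apply: eq_big => [l|l _]; [rewrite inE|rewrite CE].
Qed.

(** A Gaussian reference measure that plays the role of Lebesgue measure on the unit cube: small
    cubes have mass of at most the order of their volume, and the unit cube has positive mass. *)
Let gam := law P mXrow.

Let gam_dyadic j (f : {ffun 'I_n -> 'I_(2 ^ j)}) :
  (gam (dyadic f) <= ((2 / 2 ^+ j) ^+ n)%:E)%E.
Proof.
have p2 : 0 < 2 ^+ j :> R by rewrite exprn_gt0.
rewrite -[leLHS]/(P (Xrow @^-1` dyadic f)) Xrow_prob; last by move=> l; exact: measurable_itv.
have -> : ((2 / 2 ^+ j) ^+ n)%:E = (\prod_(l < n) (2 / 2 ^+ j : R)%:E)%E.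
  by rewrite prodEFin prodr_const card_ord.
apply: lee_prod_fin => l; first exact: measure_ge0.
(* The half-open side is enlarged to an open interval of twice its length, to which [normal_itv_le]
   applies. *)
apply: (@le_trans _ _ (normal_prob 0 1 `](f l)%:R / 2 ^+ j - 1 / 2 ^+ j, ((f l)%:R + 1) / 2 ^+ j[%classic)).
  apply: le_measure; rewrite ?inE; try exact: measurable_itv.
  apply: subset_itvr; rewrite bnd_simp ltrBlDr ltrDl divr_gt0//.
apply: le_trans (normal_itv_le ltr01 _) _.
  by rewrite lerBlDr -mulrDl ler_pM2r ?invr_gt0//; lra.
by rewrite lee_fin divr1 le_eqVlt; apply/orP; left; apply/eqP; ring.
Qed.

Let gam_cube : (0 < gam unit_cube)%E.
Proof.
have -> : unit_cube = rbox (fun=> `[0, 1[%classic) :> set 'rV[R]_n.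
  by apply/seteqP; split=> x H l; have := H l; rewrite /= in_itv.
rewrite -[ltRHS]/(P (Xrow @^-1` _)) Xrow_prob; last by move=> l; exact: measurable_itv.
have [c c0 Hc] := @normal_itv_ge R 0 1 ltr01.
apply: (@lt_le_trans _ _ (\prod_(l < n) c%:E)%E).
  by rewrite prodEFin lte_fin prodr_gt0.
apply: lee_prod_fin => l; first by rewrite lee_fin ltW.
apply: le_trans (Hc 1 ltr01) _; apply: le_measure; rewrite ?inE; try exact: measurable_itv.
by rewrite mulr0 mulr1; apply: subset_itvr; rewrite bnd_simp.
Qed.

(** At the small time [h] the law dominates a multiple of the reference measure on the unit cube.
    The semigroup carries this to time 1, so [nu] is the image of the normalized reference measure
    under the kernel of time 1 - h. *)
Lemma minorization (r : R) : 0 <= r -> exists (nu : probability (brv R n) R) (c : R), 0 < c /\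
  forall (x : 'rV[R]_n) (B : set (brv R n)), `|x| <= r -> measurable B ->
    (c%:E * nu B <= P (u x 1 @^-1` B))%E.
Proof.
move=> r0; have [h [h0 h12 [c c0 Hc]]] := small_ball r0.
have h1 : 0 < 1 - h by lra.
have mcube := @unit_cube_measurable R n.
pose g0 := fine (gam unit_cube).
have g0E : g0%:E = gam unit_cube by rewrite fineK// fin_num_measure.
have g00 : 0 < g0 by rewrite -lte_fin g0E; exact: gam_cube.
pose nuh : probability (brv R n) R := mnormalize (mrestr gam mcube) gam.
have nuhE B : (nuh B = gam (B `&` unit_cube) * (g0^-1)%:E)%E.
  rewrite /nuh /= /mnormalize.
  change ((if (gam (setT `&` unit_cube) == 0)%E || (gam (setT `&` unit_cube) == +oo)%E
    then (gam : set (brv R n) -> \bar R) else fun U => gam (U `&` unit_cube) *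
      ((fine (gam (setT `&` unit_cube)))^-1)%:E)%E B = (gam (B `&` unit_cube) * (g0^-1)%:E)%E).
  by rewrite setTI -g0E eqe gt_eqF.
pose K1 := transk hW bL hu h1.
pose M : {measure set (brv R n) -> \bar R} := mkcomp_noparam (kcst nuh) K1 (0 : 'rV[R]_n).
have ME B : (M B = \int[nuh]_y K1 y B)%E by [].
have M1 : M setT = 1%E.
  rewrite ME (eq_integral (cst 1%E)) ?integral_prob_cst//.
  by move=> y _; rewrite prob_kernel.
pose nu : probability (brv R n) R := mnormalize M gam.
have nuE B : nu B = M B.
  by rewrite /nu /= /mnormalize M1 eqe oner_eq0/= invr1 mule1.
exists nu, (c / 16 ^+ n * g0); split.
  by rewrite mulr_gt0// divr_gt0// exprn_gt0.
move=> x B xr mB; have mu := flow_meas hu x (ltW h0).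
have cc0 : 0 <= c / 16 ^+ n by rewrite divr_ge0 ?exprn_ge0// ltW.
have dom A : measurable A -> ((c / 16 ^+ n * g0)%:E * nuh A <= transk hW bL hu h0 x A)%E.
  move=> mA; rewrite nuhE.
  have -> : ((c / 16 ^+ n * g0)%:E * (gam (A `&` unit_cube) * (g0^-1)%:E) =
      (c / 16 ^+ n)%:E * gam (A `&` unit_cube))%E.
    by rewrite [(gam _ * _)%E]muleC muleA -EFinM mulfK// gt_eqF.
  apply: (@le_trans _ _ (law P mu (A `&` unit_cube))); last first.
    have mAc : measurable (A `&` unit_cube) by exact: measurableI.
    apply: (@le_measure _ _ _ (law P mu)); rewrite ?inE//; exact: subIsetl.
  apply: dyadic_domination => //; try by change (P setT < +oo)%E; rewrite probability_setT ltry.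
  move=> j f; have p2 : 0 < 2 ^+ j :> R by rewrite exprn_gt0.
  have p21 : 1 <= 2 ^+ j :> R by rewrite exprn_ege1// ler1n.
  pose y0 : 'rV[R]_n := \row_l (((f l)%:R + 2^-1) / 2 ^+ j).
  have fl l : (f l)%:R + 1 <= 2 ^+ j :> R by rewrite natr1 -natrX ler_nat.
  have y01 : `|y0| <= 1.
    apply: rv_norm_le => // l; rewrite mxE ger0_norm ?divr_ge0 ?addr_ge0 ?invr_ge0 ?(ltW p2)//.
    by rewrite ler_pdivrMr// mul1r; have := fl l; lra.
  (* The ball of radius 2 a about the centre lies in the cube of side 2^-j, and a^n is 16^-n times
     the bound (2 / 2^j)^n of [gam_dyadic]. *)
  pose a : R := 8^-1 / 2 ^+ j.
  have a0 : 0 < a by rewrite divr_gt0// invr_gt0.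
  have a1 : a <= 1 by rewrite ler_pdivrMr// mul1r; lra.
  have := Hc x y0 a xr y01 a0 a1 => H.
  apply: (@le_trans _ _ (c * a ^+ n)%:E).
    apply: (@le_trans _ _ ((c / 16 ^+ n)%:E * ((2 / 2 ^+ j) ^+ n)%:E)%E).
      by rewrite lee_wpmul2l// gam_dyadic.
    rewrite -EFinM lee_fin -mulrA ler_pM2l// -exprVn -exprMn le_eqVlt; apply/orP; left; apply/eqP.
    by congr (_ ^+ _); rewrite /a; field; rewrite gt_eqF.
  apply: le_trans H _; apply: le_measure; rewrite ?inE.
  - have -> : [set om | `|u x h om - y0| <= 2 * a] = u x h @^-1` [set y | `|y - y0| <= 2 * a] by [].
    have mball : measurable ([set y | `|(y : 'rV[R]_n) - y0| <= 2 * a] : set (brv R n)).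
      have md : measurable_fun setT (fun y : brv R n => `|(y : 'rV[R]_n) - y0|).
        by apply: (continuous_brv (f := fun y : 'rV[R]_n => `|y - y0|)); exact: dist_continuous.
      have := md measurableT _ (measurable_itv `]-oo, 2 * a]); rewrite setTI.
      by congr measurable; apply/seteqP; split=> y /=; rewrite in_itv.
    by rewrite -[X in measurable X]setTI; exact: (mu measurableT _ mball).
  - by rewrite -[X in measurable X]setTI; exact: (mu measurableT _ (dyadic_measurable f)).
  move=> om /= H2 l; have := le_trans (rv_coord_le _ l) H2.
  rewrite !mxE /= in_itv/= ler_distl /a => /andP[k1 k2].
  have e1 : (f l)%:R / 2 ^+ j + 2^-1 / 2 ^+ j = ((f l)%:R + 2^-1) / 2 ^+ j :> R by rewrite mulrDl.
  have e2 : ((f l)%:R + 1) / 2 ^+ j = (f l)%:R / 2 ^+ j + 1 / 2 ^+ j :> R by rewrite mulrDl.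
  rewrite -e1 in k1 k2; rewrite e2.
  have ip : 0 < 1 / 2 ^+ j :> R by rewrite divr_gt0.
  move: k1 k2 ip; rewrite !mul1r; set i2 := (2 ^+ j)^-1; set F := _ / _ => k1 k2 ip.
  by apply/andP; split; lra_on k1 k2 ip.
have dom_m (f : brv R n -> \bar R) : (forall y, 0 <= f y)%E -> measurable_fun setT f ->
    ((c / 16 ^+ n * g0)%:E * \int[nuh]_y f y <= \int[transk hW bL hu h0 x]_y f y)%E.
  move=> f0 mf; have cg : 0 <= c / 16 ^+ n * g0 by rewrite mulr_ge0// ltW.
  rewrite -(ge0_integral_mscale nuh measurableT (NngNum cg))//.
  by apply: ge0_le_measure_integral => // A mA; exact: dom.
rewrite nuE ME; apply: le_trans (dom_m _ _ _) _.
- by move=> y; exact: measure_ge0.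
- exact: measurable_kernel.
have hs : 0 < h + (1 - h) by rewrite addrC subrK.
rewrite -(transk_comp hW hWind bL hu h0 h1 hs x mB) transkE.
by rewrite le_eqVlt; apply/orP; left; apply/eqP; congr (P (u x _ @^-1` B)); ring.
Qed.

End SmallBall.

(** * Escape from the null space *)

Section Quadratic.
Context {R : realType} {n : nat}.
Implicit Types (x y d : 'rV[R]_n) (M G : 'M[R]_n).

Lemma dot_mulmxE x y : dot x y = (x *m y^T) 0 0.
Proof. by rewrite mxE; apply: eq_bigr => i _; rewrite mxE. Qed.

Lemma dot_trmx x y M : dot (x *m M) y = dot x (y *m M^T).
Proof. by rewrite !dot_mulmxE trmx_mul trmxK mulmxA. Qed.

Lemma mulmx_row_le M : exists2 C : R, 1 <= C & forall x, `|x *m M| <= C * `|x|.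
Proof.
have Mp : 0 <= \sum_i \sum_j `|M i j| by apply: sumr_ge0 => i _; apply: sumr_ge0.
exists (1 + \sum_i \sum_j `|M i j|) => [|x]; first by rewrite lerDl.
apply: rv_norm_le => [|j]; first by rewrite mulr_ge0// addr_ge0.
rewrite mxE; apply: le_trans (ler_norm_sum _ _ _) _.
rewrite mulrDl mul1r mulr_suml -[leLHS]add0r; apply: lerD => //.
apply: ler_sum => i _; rewrite normrM mulrC; apply: ler_pM => //; last exact: rv_coord_le.
by rewrite (bigD1 j)//= lerDl sumr_ge0.
Qed.

Lemma dot_quad_le M : exists2 C : R, 1 <= C & forall x y, `|dot (x *m M) y| <= C * `|x| * `|y|.
Proof.
have [C C1 HC] := mulmx_row_le M.
exists (1 + n%:R * C) => [|x y]; first by rewrite lerDl mulr_ge0// (le_trans ler01).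
apply: le_trans (dot_le _ _) _; rewrite mulrA; apply: ler_wpM2r => //.
rewrite mulrDl mul1r -[leLHS]add0r; apply: lerD => //.
by rewrite -mulrA; apply: ler_wpM2l.
Qed.

Lemma is_derive_quad M (f : R -> 'rV[R]_n) (df : 'rV[R]_n) (t : R) : M^T = M ->
  (forall i, is_derive t 1 (fun s => f s 0 i) (df 0 i)) ->
  is_derive t 1 (fun s => dot (f s *m M) (f s)) (2 * dot (f t *m M) df).
Proof.
move=> Ms H.
have -> : (fun s => dot (f s *m M) (f s)) =
    \sum_(i < n) \sum_(j < n) (fun s : R => M j i *: (f s 0 j * f s 0 i : R^o)).
  apply/funext => s; rewrite fct_sumE /dot; apply: eq_bigr => i _.
  rewrite fct_sumE mxE mulr_suml; apply: eq_bigr => j _.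
  by rewrite /GRing.scale/=; ring.
have -> : 2 * dot (f t *m M) df =
    \sum_(i < n) \sum_(j < n) M j i *: (f t 0 j *: df 0 i + f t 0 i *: df 0 j : R^o).
  transitivity (\sum_(i < n) \sum_(j < n) M j i * f t 0 j * df 0 i
      + \sum_(i < n) \sum_(j < n) M j i * f t 0 i * df 0 j).
    rewrite [X in _ + X]exchange_big/=.
    have e : dot (f t *m M) df = \sum_(i < n) \sum_(j < n) M j i * f t 0 j * df 0 i.
      by apply: eq_bigr => i _; rewrite mxE mulr_suml; apply: eq_bigr => j _; rewrite [M j i * _]mulrC.
    rewrite mulr2n mulrDl mul1r {1}e e; congr (_ + _).
    by apply: eq_bigr => i _; apply: eq_bigr => j _; rewrite -[in LHS]Ms mxE.
  rewrite -big_split; apply: eq_bigr => i _; rewrite -big_split; apply: eq_bigr => j _.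
  by rewrite /GRing.scale/=; ring.
apply: is_derive_sum => i; apply: is_derive_sum => j.
by apply: is_deriveZ; apply: is_deriveM; exact: H.
Qed.

Lemma quad_continuous M (f : R -> 'rV[R]_n) : continuous f ->
  continuous (fun s => dot (f s *m M) (f s)).
Proof.
move=> cf; have cfi i : continuous (fun s => f s 0 i) := coord_path cf.
have sumc (I : finType) (F : I -> R -> R) : (forall i, continuous (F i)) ->
    continuous (fun s => \sum_i F i s).
  move=> cF; have -> : (fun s => \sum_i F i s) = \sum_i F i.
    by apply/funext => s; rewrite fct_sumE.
  elim/big_ind: _ => [s|F1 F2 c1 c2 s|i _]; first exact: cvg_cst.
    by apply: cvgD; [exact: c1|exact: c2].
  exact: cF.
apply: (sumc _ (fun i s => (f s *m M) 0 i * f s 0 i)) => i s.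
apply: (cvgM (f := fun s => (f s *m M) 0 i) (g := fun s => f s 0 i)); last exact: cfi.
have -> : (fun s => (f s *m M) 0 i) = (fun s => \sum_j f s 0 j * M j i).
  by apply/funext => s'; rewrite mxE.
rewrite mxE; apply: (sumc _ (fun j s => f s 0 j * M j i)) => j s'.
by apply: cvgM; [exact: cfi|exact: cvg_cst].
Qed.

(** [G] solves the Lyapunov equation M G + G M^T = 2 rho G + 1. The form may be indefinite, but it
    is positive at the eigenvector [Y] because rho < lam; along d' = d M a positive value grows at
    rate at least 2 rho, and the term [dot d d] is a margin for perturbations. *)
Lemma lyapunov M (lam : R) Y : 0 < lam -> Y != 0 -> Y *m M = lam *: Y ->
  exists G (rho : R), [/\ 0 < rho, G^T = G, 0 < dot (Y *m G) Y &
    forall d, 2 * dot (d *m G) (d *m M) = 2 * rho * dot (d *m G) d + dot d d].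
Proof.
move=> l0 Y0 YM.
pose T := lin_mx (mulmx M \+ mulmxr M^T) : 'M[R]_(n * n).
(* The equation is solvable if 2 rho is not an eigenvalue of X |-> M X + X M^T. There are finitely
   many eigenvalues, so one of the values lam / (j + 2) will do. *)
have [rho [r0 rl rT]] : exists rho : R, [/\ 0 < rho, rho < lam & ~~ root (char_poly T) (2 * rho)].
  pose p := char_poly T; have p0 : p != 0 by rewrite monic_neq0// char_poly_monic.
  pose a j : R := lam / j.+2%:R.
  have aI : injective (fun j => 2 * a j).
    have ne2 : (2 : R) != 0 by rewrite pnatr_eq0.
    by move=> i j /(mulfI ne2)/(mulfI (lt0r_neq0 l0))/invr_inj/eqP; rewrite eqr_nat !eqSS => /eqP.
  have [j jp] : exists j, ~~ root p (2 * a j).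
    apply/not_existsP => H.
    have := max_poly_roots (rs := [seq 2 * a j | j <- iota 0 (size p)]) p0.
    rewrite size_map size_iota ltnn => H2; suff : false by []; apply: H2.
      by apply/allP => x /mapP[j _ ->]; apply: contrapT => /negP; exact: H.
    by rewrite map_inj_uniq ?iota_uniq.
  exists (a j); split=> //; first by rewrite divr_gt0.
  by rewrite /a ltr_pdivrMr// ltr_pMr// ltr1n.
have uT : T - (2 * rho)%:M \in unitmx.
  rewrite -row_free_unit -kermx_eq0; apply/negPn/negP => H.
  by move: rT; rewrite -eigenvalue_root_char /eigenvalue /eigenspace H.
pose X : 'M[R]_n := vec_mx (mxvec 1%:M *m invmx (T - (2 * rho)%:M)).
have EX : M *m X + X *m M^T - (2 * rho) *: X = 1%:M.
  apply: (can_inj mxvecK); rewrite linearB linearZ/=.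
  have <- := mul_vec_lin (mulmx M \+ mulmxr M^T) X.
  rewrite -/T -mul_mx_scalar -mulmxBr /X vec_mxK -mulmxA mulVmx ?mulmx1//.
(* The transpose of a solution is a solution, so the symmetric part is one too. *)
pose G := 2^-1 *: (X + X^T).
have GT : G^T = G by rewrite /G linearZ/= linearD/= trmxK addrC.
have EG : M *m G + G *m M^T - (2 * rho) *: G = 1%:M.
  have EX2 : M *m X^T + X^T *m M^T - (2 * rho) *: X^T = 1%:M.
    by have := congr1 trmx EX; rewrite linearB linearZ linearD/= !trmx_mul trmxK trmx1 => <-; congr (_ - _); exact: addrC.
  have h2 : 2^-1 + 2^-1 = 1 :> R by field.
  transitivity (2^-1 *: ((M *m X + X *m M^T - (2 * rho) *: X) + (M *m X^T + X^T *m M^T - (2 * rho) *: X^T)));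
    last by rewrite EX EX2 scalerDr -scalerDl h2 scale1r.
  rewrite /G.
  rewrite -!scalemxAl -!scalemxAr !mulmxDl !mulmxDr !scalerDr !scalerN !scalerA.
  apply/matrixP => i j; rewrite !mxE; ring.
have key d : 2 * dot (d *m G) (d *m M) = 2 * rho * dot (d *m G) d + dot d d.
  have e1 : dot (d *m G) (d *m M) = dot (d *m (G *m M^T)) d.
    by rewrite mulmxA [RHS]dot_trmx trmxK.
  have e2 : dot (d *m G) (d *m M) = dot (d *m (M *m G)) d.
    by rewrite mulmxA [RHS]dot_trmx GT dotC.
  rewrite mulrDl mul1r {1}e1 e2 -dotDl -mulmxDr.
  have -> : G *m M^T + M *m G = 1%:M + (2 * rho) *: G.
    by rewrite -EG subrK addrC.
  by rewrite mulmxDr mulmx1 dotDl -scalemxAr dotZl addrC.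
exists G, rho; split=> //.
have := key Y; rewrite YM dotZr => HY.
have YY : 0 < dot Y Y.
  rewrite lt_neqAle dot_ge0 andbT eq_sym; apply/negP => /eqP/dot_eq0 Y00.
  by rewrite Y00 eqxx in Y0.
have e3 : dot (Y *m G) Y * (2 * (lam - rho)) = dot Y Y by rewrite -[RHS](addKr (2 * rho * dot (Y *m G) Y)) -HY; ring.
have lr : 0 < 2 * (lam - rho) by rewrite mulr_gt0 ?subr_gt0.
by rewrite -(pmulr_lgt0 _ lr) e3.
Qed.

End Quadratic.

Lemma expR_gt_poly {R : realType} (a C : R) (m : nat) : 0 < a -> 
  exists Q0 : R, forall Q, Q0 <= Q -> C * Q ^+ m < expR (a * Q).
Proof.
move=> a0; pose k : R := m.+1%:R; have k0 : 0 < k by [].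
exists (1 + `|C| * (k / a) ^+ m.+1) => Q HQ.
have ka : 0 < k / a by rewrite divr_gt0.
have Q0 : 0 < Q by apply: lt_le_trans HQ; rewrite ltr_wpDr// mulr_ge0// exprn_ge0// ltW.
have -> : expR (a * Q) = expR (a * Q / k) ^+ m.+1.
  by rewrite -expRM_natl -/k mulrCA mulfV ?mulr1// gt_eqF.
have e1 : (Q / (k / a)) ^+ m.+1 <= expR (a * Q / k) ^+ m.+1.
  rewrite lerXn2r ?nnegrE ?expR_ge0 ?divr_ge0 ?(ltW Q0) ?(ltW ka) ?(ltW a0)//.
  have -> : Q / (k / a) = a * Q / k by field; rewrite !gt_eqF.
  by apply: le_trans (expR_ge1Dx _); rewrite lerDr.
apply: lt_le_trans e1; rewrite expr_div_n ltr_pdivlMr ?exprn_gt0// mulrAC [ltRHS]exprS.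
rewrite ltr_pM2r ?exprn_gt0//.
by apply: lt_le_trans HQ; apply: ltr_pwDl => //; rewrite ler_wpM2r ?ler_norm// exprn_ge0// ltW.
Qed.

Lemma vint_continuous {R : realType} {n : nat} (f : R -> 'rV[R]_n) : continuous f ->
  continuous (vint f 0).
Proof.
move=> cf t; pose m (s : R) := Num.max 0 s.
have vm s : vint f 0 s = vint f 0 (m s).
  have [s0|s0] := leP 0 s; first by rewrite /m (max_idPr s0).
  rewrite /m (max_idPl (ltW s0)) vint0; apply/rowP => i; rewrite !mxE.
  have -> : `[0, s]%classic = set0 :> set R by rewrite set_itv_ge// bnd_simp -ltNge.
  by rewrite Rintegral_set0.
have [M M0 HM] := path_bounded 0 (m t + 1) cf.
have Lip s : `|s - t| <= 1 -> `|vint f 0 t - vint f 0 s| <= M * `|t - s|.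
  move=> st; rewrite (vm t) (vm s).
  have ms : m s <= m t + 1.
    by rewrite /m ge_max addr_ge0 ?le_max ?lexx//=; move: st; rewrite ler_distl => /andP[_ ?]; apply: le_trans (_ : t + 1 <= _) => //; rewrite lerD2r le_max lexx orbT.
  have mm : `|m t - m s| <= `|t - s|.
    have ht := ler_norm (t - s); have hs := ler_norm (s - t); rewrite distrC in hs.
    by rewrite ler_norml /m; apply/andP; split; case: (leP 0 t) => ?; case: (leP 0 s) => ?; lra.
  have m0 s' : 0 <= m s' by rewrite /m le_max lexx.
  have key a c : 0 <= a -> a <= c -> c <= m t + 1 -> `|vint f 0 c - vint f 0 a| <= M * (c - a).
    move=> a0 ac cm; rewrite (vint_add cf a0 ac) addrAC subrr add0r.
    by apply: vint_le => // r /andP[ar rc]; apply: HM; rewrite (le_trans a0 ar) (le_trans rc cm).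
  apply: le_trans (ler_wpM2l M0 mm).
  have [st'|st'] := leP (m s) (m t).
    by rewrite ger0_norm ?subr_ge0//; apply: key => //; rewrite lerDl.
  rewrite distrC [`|m t - _|]distrC ger0_norm ?subr_ge0 ?(ltW st')//; apply: key => //; exact: ltW.
apply/(@cvgrPdist_le _ _ _ (nbhs t) (nbhs_filter t)) => e e0.
near=> s; apply: le_trans (Lip s _) _.
  rewrite distrC; near: s; apply: (@cvgrPdist_le _ _ _ (nbhs t) (nbhs_filter t) id t).1 => //.
apply: (@le_trans _ _ (M * (e / (M + 1)))).
  apply: ler_wpM2l => //; near: s.
  apply: (@cvgrPdist_le _ _ _ (nbhs t) (nbhs_filter t) id t).1 => //.
  by rewrite divr_gt0// ltr_wpDl.
by rewrite mulrCA ger_pMr// ler_pdivrMr ?mul1r ?lerDl// ltr_wpDl.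
Unshelve. all: by end_near. Qed.

Lemma linear_row {R : realType} {n m : nat} (f : 'rV[R]_n -> 'rV[R]_m) :
  (forall a x y, f (a *: x + y) = a *: f x + f y) ->
  forall x, f x = \sum_i x 0 i *: f (delta_mx 0 i).
Proof.
move=> fl x; have f0 : f 0 = 0.
  by have := fl 1 0 0; rewrite !scale1r addr0 => /eqP; rewrite -subr_eq0 opprD addrA subrr sub0r oppr_eq0 => /eqP.
rewrite [in LHS](row_sum_delta x); elim/big_rec2: _ => [|i y1 y2 _ <-]; first exact: f0.
exact: fl.
Qed.

Lemma linear_matrix {R : realType} {n m : nat} (f : 'rV[R]_n -> 'rV[R]_m) :
  (forall a x y, f (a *: x + y) = a *: f x + f y) -> exists M, forall x, x *m M = f x.
Proof.
move=> fl; exists (\matrix_(i, j) f (delta_mx 0 i) 0 j) => x.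
rewrite mulmx_sum_row (linear_row fl); apply: eq_bigr => i _; congr (_ *: _).
by apply/rowP => j; rewrite !mxE.
Qed.

Lemma bilinear_le {R : realType} {n : nat} (B : 'rV[R]_n -> 'rV[R]_n -> 'rV[R]_n) :
  (forall a x y z, B (a *: x + y) z = a *: B x z + B y z) ->
  (forall a x y z, B z (a *: x + y) = a *: B z x + B z y) ->
  exists2 C : R, 1 <= C & forall x y, `|B x y| <= C * `|x| * `|y|.
Proof.
move=> Bl Br.
have Suml (x z : 'rV[R]_n) : B x z = \sum_i x 0 i *: B (delta_mx 0 i) z.
  by apply: (linear_row (f := B ^~ z)) => a y y'; exact: Bl.
have Sumr (x z : 'rV[R]_n) : B z x = \sum_i x 0 i *: B z (delta_mx 0 i).
  by apply: (linear_row (f := B z)) => a y y'; exact: Br.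
pose C := \sum_i \sum_j `|B (delta_mx 0 i) (delta_mx 0 j)|.
have C0 : 0 <= C by apply: sumr_ge0 => i _; apply: sumr_ge0.
exists (1 + C) => [|x y]; first by rewrite lerDl.
rewrite !mulrDl !mul1r -[leLHS]add0r; apply: lerD; first exact: mulr_ge0.
rewrite Suml; apply: le_trans (ler_norm_sum _ _ _) _; rewrite !mulr_suml; apply: ler_sum => i _.
rewrite normrZ Sumr; apply: (@le_trans _ _ (`|x| * (\sum_j `|B (delta_mx 0 i) (delta_mx 0 j)| * `|y|))).
  apply: ler_pM => //; first exact: rv_coord_le.
  apply: le_trans (ler_norm_sum _ _ _) _; apply: ler_sum => j _.
  by rewrite normrZ mulrC; apply: ler_wpM2l => //; exact: rv_coord_le.
by rewrite -mulr_suml mulrA [`|x| * _]mulrC.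
Qed.

(** * Paths driven by bounded noise *)

Section Trap.
Context {R : realType} {n : nat}.
Implicit Types (u v x y z : 'rV[R]_n) (p : R -> 'rV[R]_n).
Variables (Ks : pred 'I_n) (B : 'rV[R]_n -> 'rV[R]_n -> 'rV[R]_n) (A : 'M[R]_n) (CB cA : R).

(** [Ks] will be the modes of the null space of the dissipation; the norm of [pz y] is then the
    distance of [y] to it in the maximum norm. *)
Definition pz y : 'rV[R]_n := \row_i (if Ks i then 0 else y 0 i).

Definition qdrift u := B u u + u *m A.

(** All that the escape argument retains of the Galerkin system. A single constant [CB] bounds [B]
    and [A]; the minus sign in [dd_unstable] is there because the equation of motion has drift
    [- qdrift]. *)
Record dissipative_drift : Prop := DissipativeDrift {
  dd_Bl : forall a x y z, B (a *: x + y) z = a *: B x z + B y z;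
  dd_Br : forall a x y z, B z (a *: x + y) = a *: B z x + B z y;
  dd_CB1 : 1 <= CB;
  dd_B_le : forall x y, `|B x y| <= CB * `|x| * `|y|;
  dd_A_le : forall x, `|x *m A| <= CB * `|x|;
  dd_Bdot : forall u, dot (B u u) u = 0;
  dd_cA0 : 0 < cA;
  dd_A_ge : forall u, cA * `|pz u| ^+ 2 <= dot (u *m A) u;
  dd_A_K : forall u i, Ks i -> (u *m A) 0 i = 0;
  dd_B_K : forall u i, pz u = 0 -> Ks i -> B u u 0 i = 0;
  dd_unstable : forall u, u != 0 -> pz u = 0 -> B u u = 0 ->
    exists (lam : R) Y, [/\ 0 < lam, Y != 0 & - (B Y u + B u Y) = lam *: Y] }.

Hypothesis dd : dissipative_drift.

Let Bl := dd_Bl dd.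
Let Br := dd_Br dd.
Let CB1 := dd_CB1 dd.
Let B_le := dd_B_le dd.
Let A_le := dd_A_le dd.
Let Bdot := dd_Bdot dd.
Let cA0 := dd_cA0 dd.
Let A_ge := dd_A_ge dd.

Let CB0 : 0 <= CB. Proof. exact: le_trans CB1. Qed.

Lemma bilB_l x y z : B (x - y) z = B x z - B y z.
Proof. by rewrite addrC -scaleN1r Bl scaleN1r addrC. Qed.

Lemma bilB_r x y z : B z (x - y) = B z x - B z y.
Proof. by rewrite addrC -scaleN1r Br scaleN1r addrC. Qed.

Lemma bil_diff x y : B x x - B y y = B (x - y) x + B y (x - y).
Proof. by rewrite bilB_l bilB_r addrA subrK. Qed.

Lemma qdrift_dot u : 0 <= dot (qdrift u) u.
Proof.
rewrite /qdrift dotDl Bdot add0r; apply: le_trans (A_ge u).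
by rewrite mulr_ge0 ?exprn_ge0// ltW.
Qed.

Lemma qdrift_le u (M : R) : 1 <= M -> `|u| <= M -> `|qdrift u| <= 2 * CB * M ^+ 2.
Proof.
move=> M1 uM; have M0 : 0 <= M by apply: le_trans M1.
apply: le_trans (ler_normD _ _) _.
have h1 : `|B u u| <= CB * M ^+ 2.
  by apply: le_trans (B_le _ _) _; rewrite -mulrA; apply: ler_wpM2l => //; rewrite expr2; apply: ler_pM.
have h2 : `|u *m A| <= CB * M ^+ 2.
  by apply: le_trans (A_le _) _; apply: ler_wpM2l => //; apply: le_trans uM _; rewrite expr2 ler_peMr.
by lra.
Qed.

Lemma qdrift_loclip : loclip qdrift.
Proof.
move=> r; exists (CB * (2 * `|r| + 1)) => [|x y xr yr]; first by rewrite mulr_ge0// addr_ge0// mulr_ge0.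
have rr := ler_norm r.
rewrite /qdrift opprD addrACA -mulmxBl bil_diff.
apply: le_trans (ler_normD _ _) _; apply: le_trans (lerD (ler_normD _ _) (lexx _)) _.
have h1 : `|B (x - y) x| <= CB * `|r| * `|x - y|.
  apply: le_trans (B_le _ _) _; rewrite -!mulrA; apply: ler_wpM2l => //; rewrite mulrC.
  by apply: ler_wpM2r => //; exact: le_trans rr.
have h2 : `|B y (x - y)| <= CB * `|r| * `|x - y|.
  apply: le_trans (B_le _ _) _; rewrite -!mulrA; apply: ler_wpM2l => //.
  by apply: ler_wpM2r => //; exact: le_trans rr.
have := A_le (x - y).
have -> : CB * (2 * `|r| + 1) * `|x - y| = CB * `|r| * `|x - y| + CB * `|r| * `|x - y| + CB * `|x - y| by ring.
lra.
Qed.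

Let b := qdrift.
Let cb := loclip_continuous qdrift_loclip.

Lemma path_move (g p : R -> 'rV[R]_n) (s t M N : R) : path_sol b g p -> 0 <= s -> s <= t -> 1 <= M ->
  (forall r, s <= r <= t -> `|p r| <= M) -> `|g t - g s| <= N ->
  `|p t - p s| <= 2 * CB * M ^+ 2 * (t - s) + N.
Proof.
move=> [cp Hp] s0 st M1 HM gN; rewrite (Hp s t s0 st) addrAC [p s - _]addrC addrK.
apply: le_trans (ler_normD _ _) _; apply: lerD => //; rewrite normrN.
by apply: vint_le => //; [exact: (path_comp_continuous qdrift_loclip cp)|move=> r /HM; exact: qdrift_le].
Qed.

Definition small_noise (K : R) (g : R -> 'rV[R]_n) := forall t, 0 <= t <= 1 -> `|g t - g 0| <= K.

Lemma small_noise_diff K g s t : small_noise K g -> 0 <= s <= 1 -> 0 <= t <= 1 ->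
  `|g t - g s| <= 2 * K.
Proof.
move=> H s1 t1; have -> : g t - g s = (g t - g 0) - (g s - g 0) by rewrite opprB addrA subrK.
apply: le_trans (ler_normB _ _) _.
by have := H s s1; have := H t t1; lra.
Qed.

(** The path minus the noise, [w], is differentiable. By [qdrift_dot] the derivative of its square
    is at most the product of the noise with the drift, which is quadratic in the path because the
    noise is bounded by [K]; Gronwall's inequality concludes. *)
Lemma apriori (K : R) : 0 <= K -> exists2 C1 : R, 1 <= C1 & forall g p (r : R),
  path_sol b g p -> small_noise K g -> 1 <= r -> `|p 0| <= r ->
  forall t, 0 <= t <= 1 -> `|p t| <= C1 * r.
Proof.
move=> K0; pose lam : R := 2 * n%:R * K * CB * (5 + 4 * K ^+ 2).
have lam0 : 0 <= lam by rewrite !mulr_ge0// addr_ge0// mulr_ge0// exprn_ge0.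
pose D : R := expR lam * n.+1%:R.
have D1 : 1 <= D.
  by rewrite -[1]mulr1; apply: ler_pM => //; [rewrite -expR0 ler_expR|rewrite ler1n].
exists (D + K) => [|g p r [cp Hp] gK r1 pr t /andP[t0 t1]].
  by rewrite (le_trans D1)// lerDl.
have cbp : continuous (b \o p) by exact: (path_comp_continuous qdrift_loclip cp).
pose w (s : R) : 'rV[R]_n := p 0 - vint (b \o p) 0 s.
have pw s : 0 <= s -> p s = w s + (g s - g 0) by move=> s0; rewrite (Hp 0 s (lexx 0) s0).
pose phi s : R := dot (w s *m 1%:M) (w s) + 1.
pose dphi s : R := 2 * dot (w s *m 1%:M) (- b (p s)).
have r0 : 0 <= r by apply: le_trans r1.
have gr : phi t <= expR (lam * t) * phi 0.
  apply: (@gronwall_le _ phi dphi) => //.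
  - have cw : continuous w.
      move=> s; apply: (continuousB (f := cst (p 0)) (g := vint (b \o p) 0)); first exact: cst_continuous.
      exact: (vint_continuous cbp).
    have cq := quad_continuous (M := 1%:M) cw.
    by move=> s; apply: cvgD; [exact: cq|exact: cvg_cst].
  - move=> s /andP[s0 _]; rewrite -[dphi s]addr0; apply: is_deriveD.
    apply: is_derive_quad; first exact: trmx1.
    move=> i; have := vint_derive i cbp s0 => H.
    have -> : (fun s => w s 0 i) = (cst (p 0 0 i) : R -> R^o) - (fun s => vint (b \o p) 0 s 0 i).
      by apply/funext => s'; rewrite /w 2!mxE.
    by apply: (is_derive_eq (is_deriveB (is_derive_cst (p 0 0 i : R^o) s 1) H)); rewrite sub0r [RHS]mxE.
  move=> s /andP[s0 st]; rewrite /dphi mulmx1 /phi mulmx1 dotNr.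
  have gs : `|g s - g 0| <= K by apply: gK; rewrite (ltW s0) (le_trans (ltW st) t1).
  have ws : w s = p s - (g s - g 0) by rewrite pw ?(ltW s0)// addrK.
  have h1 : - dot (w s) (b (p s)) <= `|dot (g s - g 0) (b (p s))|.
    rewrite ws dotBl opprB; apply: le_trans (ler_norm _).
    by rewrite lerBlDr lerDl dotC qdrift_dot.
  have h2 : `|dot (g s - g 0) (b (p s))| <= n%:R * (K * (CB * (`|p s| ^+ 2 + `|p s|))).
    apply: le_trans (dot_le _ _) _; apply: ler_wpM2l => //; apply: ler_pM => //.
    apply: le_trans (ler_normD _ _) _; rewrite mulrDr; apply: lerD; last exact: A_le.
    by rewrite expr2 mulrA; exact: B_le.
  have h3 : `|p s| <= `|w s| + K.
    by rewrite pw ?(ltW s0)//; apply: le_trans (ler_normD _ _) _; rewrite lerD2l.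
  have h4 := dot_lower (w s).
  have h5 : `|p s| ^+ 2 + `|p s| <= (5 + 4 * K ^+ 2) * (dot (w s) (w s) + 1).
    have h6 : `|p s| ^+ 2 <= 2 * `|w s| ^+ 2 + 2 * K ^+ 2.
      have : `|p s| ^+ 2 <= (`|w s| + K) ^+ 2 by rewrite lerXn2r ?nnegrE ?addr_ge0.
      by have := sqr_ge0 (`|w s| - K); rewrite !expr2; nra.
    have h7 : `|p s| <= `|p s| ^+ 2 + 1.
      by have := sqr_ge0 (`|p s| - 1); rewrite !expr2; have := normr_ge0 (p s); nra.
    have KK : 0 <= K ^+ 2 by rewrite exprn_ge0.
    have d0 := dot_ge0 (w s).
    have : 0 <= K ^+ 2 * dot (w s) (w s) by rewrite mulr_ge0.
    by nra.
  apply: (@le_trans _ _ (2 * (n%:R * (K * (CB * ((5 + 4 * K ^+ 2) * (dot (w s) (w s) + 1))))))).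
    apply: ler_wpM2l => //; apply: le_trans h1 _; apply: le_trans h2 _.
    by apply: ler_wpM2l => //; apply: ler_wpM2l => //; apply: ler_wpM2l.
  by rewrite le_eqVlt; apply/orP; left; apply/eqP; rewrite /lam; ring.
have p0 : phi 0 <= n.+1%:R * r ^+ 2.
  rewrite /phi mulmx1 /w vint0 subr0 -natr1 mulrDl mul1r; apply: lerD.
    apply: le_trans (dot_upper _) _; apply: ler_wpM2l => //.
    by rewrite lerXn2r ?nnegrE.
  by rewrite exprn_ege1.
have wt : `|w t| <= D * r.
  rewrite -(ler_pXn2r (n := 2))// ?nnegrE ?mulr_ge0 ?(le_trans _ D1)//.
  apply: le_trans (dot_lower _) _.
  apply: (@le_trans _ _ (phi t)); first by rewrite /phi mulmx1 lerDl.
  apply: le_trans gr _; apply: (@le_trans _ _ (D * r ^+ 2)); last first.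
    by rewrite exprMn ler_wpM2r ?exprn_ge0// expr2 ler_peMr// (le_trans _ D1).
  rewrite /D -mulrA; apply: ler_pM => //.
    by rewrite /phi addr_ge0// mulmx1 dot_ge0.
  by rewrite ler_expR ler_piMr.
rewrite pw// mulrDl; apply: le_trans (ler_normD _ _) _; apply: lerD => //.
by apply: (@le_trans _ _ K); [apply: gK; rewrite t0|rewrite ler_peMr].
Qed.

End Trap.

Lemma pow_absorb {R : realType} (Q D : R) (m k : nat) : 1 <= Q -> D <= Q -> (m < k)%N ->
  D * Q ^+ m <= Q ^+ k.
Proof.
move=> Q1 DQ mk; have Q0 : 0 <= Q by apply: le_trans Q1.
apply: (@le_trans _ _ (Q ^+ m.+1)); last by rewrite ler_weXn2l.
by rewrite exprS ler_wpM2r// exprn_ge0.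
Qed.

Section Escape.
Context {R : realType} {n : nat}.
Implicit Types (u v x y z Y : 'rV[R]_n) (g p : R -> 'rV[R]_n).
Variables (Ks : pred 'I_n) (B : 'rV[R]_n -> 'rV[R]_n -> 'rV[R]_n) (A : 'M[R]_n) (CB cA : R).
Hypothesis dd : dissipative_drift Ks B A CB cA.

Let Bl := dd_Bl dd.
Let Br := dd_Br dd.
Let CB1 := dd_CB1 dd.
Let B_le := dd_B_le dd.
Let A_le := dd_A_le dd.
Let CB0 : 0 <= CB. Proof. exact: le_trans CB1. Qed.
Local Notation b := (qdrift B A).
Local Notation pz := (pz Ks).

Lemma pz_le y : `|pz y| <= `|y|.
Proof.
apply: rv_norm_le => // i; rewrite mxE; case: ifP => _; first by rewrite normr0.
exact: rv_coord_le.
Qed.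

Lemma pzB x y : pz (x - y) = pz x - pz y.
Proof. by apply/rowP => i; rewrite !mxE; case: ifP => _; rewrite ?subr0. Qed.

Lemma pz_idem y : pz (pz y) = pz y.
Proof. by apply/rowP => i; rewrite !mxE; case: (Ks i). Qed.

Lemma pz_compl_le y : `|y - pz y| <= `|y|.
Proof.
apply: rv_norm_le => // i; rewrite !mxE; case: ifP => _; last by rewrite subrr normr0.
by rewrite subr0; exact: rv_coord_le.
Qed.

(** Over the time [ell / Q ^+ 20] drift and noise each displace the path by at most Q^16 / 8, so the
    distance to the null space stays at least Q^16 / 4. *)
Lemma untrapped_dissipation (K : R) : 0 <= K ->
  exists ell Q0 : R, [/\ 0 < ell, ell <= 1, 1 <= Q0 & forall Q g p t1, Q0 <= Q ->
    path_sol b g p -> small_noise K g -> `|p 0| <= 2 * Q ^+ 18 ->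
    0 <= t1 -> t1 + ell / Q ^+ 20 <= 1 -> Q ^+ 16 / 2 <= `|pz (p t1)| ->
    forall s, t1 <= s <= t1 + ell / Q ^+ 20 -> cA * (Q ^+ 16 / 4) ^+ 2 <= dot (b (p s)) (p s)].
Proof.
move=> K0; have [C1 C11 HC1] := apriori dd K0.
have C10 : 0 < C1 by apply: lt_le_trans C11.
have CBp : 0 < CB by apply: lt_le_trans CB1.
(* The speed is at most 2 CB (2 C1 Q^18)^2 = 8 CB C1^2 Q^36, and a displacement Q^16 / 8 is
   allowed. *)
pose D := 64 * CB * C1 ^+ 2.
have D1 : 1 <= D.
  rewrite /D -mulrA; have : 1 <= CB * C1 ^+ 2.
    by rewrite -[1]mulr1; apply: ler_pM => //; rewrite exprn_ege1.
  by lra.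
have D0 : 0 < D by apply: lt_le_trans D1.
exists D^-1, (1 + 16 * K); split; [by rewrite invr_gt0|by rewrite invf_le1|by rewrite lerDl mulr_ge0|].
move=> Q g p t1 QQ sp gK p0 t10 t11 pt s /andP[ts se].
have Q1 : 1 <= Q by apply: le_trans QQ; rewrite lerDl mulr_ge0.
have Qp : 0 < Q by apply: lt_le_trans Q1.
pose M := C1 * (2 * Q ^+ 18).
have q18 : 1 <= 2 * Q ^+ 18.
  by have : 1 <= Q ^+ 18 by [rewrite exprn_ege1]; lra.
have M1 : 1 <= M by rewrite -[1]mulr1; apply: ler_pM.
have s1 : s <= 1 by apply: le_trans se t11.
have s0 : 0 <= s by apply: le_trans t10 ts.
have pM r : 0 <= r <= 1 -> `|p r| <= M by exact: (HC1 g p _ sp gK q18 p0).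
have mv : `|p s - p t1| <= 2 * CB * M ^+ 2 * (s - t1) + 2 * K.
  apply: (path_move dd sp t10 ts M1) => [r /andP[r1 r2]|].
    by apply: pM; rewrite (le_trans t10 r1) (le_trans r2 s1).
  by apply: (small_noise_diff gK); apply/andP; split=> //; apply: le_trans ts s1.
have e1 : 2 * CB * M ^+ 2 * (s - t1) <= Q ^+ 16 / 8.
  apply: (@le_trans _ _ (2 * CB * M ^+ 2 * (D^-1 / Q ^+ 20))).
    by apply: ler_wpM2l; [rewrite mulr_ge0 ?sqr_ge0 ?mulr_ge0|lra].
  rewrite le_eqVlt; apply/orP; left; apply/eqP; rewrite /M /D; field.
  by rewrite !gt_eqF.
have e2 : 16 * K * Q ^+ 0 <= Q ^+ 16.
  by apply: pow_absorb => //; apply: le_trans QQ; rewrite lerDr.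
rewrite expr0 mulr1 in e2.
have pzs : Q ^+ 16 / 4 <= `|pz (p s)|.
  have h1 : `|pz (p t1)| <= `|pz (p s)| + `|p s - p t1|.
    have -> : pz (p t1) = pz (p s) - pz (p s - p t1) by rewrite -pzB opprB addrC subrK.
    by apply: le_trans (ler_normB _ _) _; rewrite lerD2l; exact: pz_le.
  by lra.
rewrite /qdrift dotDl (dd_Bdot dd) add0r; apply: le_trans (dd_A_ge dd _).
apply: ler_wpM2l; first exact: ltW (dd_cA0 dd).
by rewrite lerXn2r ?nnegrE// divr_ge0// exprn_ge0// ltW.
Qed.

(** With [k = u - pz u], [B k k] has no coordinate in [Ks]. The rest of [B u u] is bilinear in
    [pz u] and a state of size at most that of [u], so a trapped path moves slowly along the null
    space. *)
Lemma drift_kernel_coord u i (M q : R) : Ks i -> `|u| <= M -> `|pz u| <= q ->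
  `|b u 0 i| <= 2 * CB * M * q.
Proof.
move=> Ki uM zq; have M0 : 0 <= M by apply: le_trans uM.
rewrite /qdrift mxE (dd_A_K dd)// addr0; pose k := u - pz u.
have k0 : pz k = 0 by rewrite /k pzB pz_idem subrr.
have ukz : u - k = pz u by rewrite /k opprB addrC subrK.
have -> : B u u 0 i = (B (pz u) u + B k (pz u)) 0 i.
  by rewrite -ukz -(bil_diff dd) [RHS]mxE [X in _ = _ + X]mxE (dd_B_K dd k0 Ki) subr0.
apply: le_trans (rv_coord_le _ _) _; apply: le_trans (ler_normD _ _) _.
have h1 : `|B (pz u) u| <= CB * M * q.
  apply: le_trans (B_le _ _) _; rewrite -!mulrA; apply: ler_wpM2l => //.
  by rewrite mulrC; apply: ler_pM.
have h2 : `|B k (pz u)| <= CB * M * q.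
  apply: le_trans (B_le _ _) _; rewrite -!mulrA; apply: ler_wpM2l => //.
  by apply: ler_pM => //; apply: le_trans (pz_compl_le _) _.
by lra.
Qed.

(** Off the null space the path is at most Q^16 by assumption; along it [drift_kernel_coord] allows
    a displacement of order Q^18 Q^16 Q^-17 = Q^17. Both are small against Q^18. *)
Lemma trapped_close (K del : R) u0 : 0 <= K -> 0 < del -> del <= 1 -> `|u0| = 1 -> pz u0 = 0 ->
  exists2 Q0 : R, 1 <= Q0 & forall Q g p, Q0 <= Q ->
    path_sol b g p -> small_noise K g -> `|p 0 - Q ^+ 18 *: u0| <= del * Q ^+ 18 ->
    (forall t : R, 0 <= t <= Q ^- 17 -> `|pz (p t)| <= Q ^+ 16) ->
    forall t : R, 0 <= t <= Q ^- 17 -> `|p t - Q ^+ 18 *: u0| <= 3 * del * Q ^+ 18.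
Proof.
move=> K0 d0 d1 u01 zu0; have [C1 C11 HC1] := apriori dd K0.
have C10 : 0 <= C1 by apply: le_trans C11.
pose D := (4 * CB * C1 + K) / del.
have D0 : 0 <= D by rewrite divr_ge0 ?(ltW d0)// addr_ge0// !mulr_ge0.
exists (1 + D + del^-1) => [|Q g p QQ sp gK p0 trap t /andP[t0 tt]].
  by rewrite -addrA lerDl addr_ge0// invr_ge0 ltW.
have di : 0 < del^-1 by rewrite invr_gt0.
have Q1 : 1 <= Q by lra.
have Qp : 0 < Q by apply: lt_le_trans Q1.
have q18 : 1 <= Q ^+ 18 by rewrite exprn_ege1.
have q180 : 0 <= Q ^+ 18 by rewrite (le_trans _ q18).
have tau1 : Q ^- 17 <= 1 by rewrite invf_le1 ?exprn_gt0// exprn_ege1.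
have p02 : `|p 0| <= 2 * Q ^+ 18.
  rewrite -[p 0](subrK (Q ^+ 18 *: u0)); apply: le_trans (ler_normD _ _) _.
  rewrite normrZ u01 mulr1 ger0_norm//.
  have : del * Q ^+ 18 <= Q ^+ 18 by rewrite ler_piMl.
  by lra.
have q18' : 1 <= 2 * Q ^+ 18 by lra.
have pM r : 0 <= r <= 1 -> `|p r| <= C1 * (2 * Q ^+ 18) by exact: (HC1 g p _ sp gK q18' p02).
apply: rv_norm_le => [|i]; first by rewrite !mulr_ge0// ltW.
rewrite 3!mxE; have [Ki|Ki] := boolP (Ks i); last first.
  have -> : u0 0 i = 0.
    by have /rowP/(_ i) := zu0; rewrite !mxE (negbTE Ki).
  rewrite mulr0 subr0.
  have -> : p t 0 i = pz (p t) 0 i by rewrite mxE (negbTE Ki).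
  apply: le_trans (rv_coord_le _ _) _; apply: le_trans (trap t _) _; first by rewrite t0.
  have : del^-1 * Q ^+ 16 <= Q ^+ 18 by apply: pow_absorb => //; lra.
  rewrite mulrC ler_pdivrMr// mulrC => h.
  have hq : 0 <= del * Q ^+ 18 by rewrite mulr_ge0// ltW.
  by lra.
case: (sp) => cp Hp; rewrite (Hp 0 t (lexx 0) t0).
have cbp : continuous (b \o p) by exact: (path_comp_continuous (qdrift_loclip dd) cp).
have iv : `|vint (b \o p) 0 t 0 i| <= 2 * CB * (C1 * (2 * Q ^+ 18)) * Q ^+ 16 * (t - 0).
  apply: vint_coord_le => // s /andP[s0 st]; apply: drift_kernel_coord => //.
    by apply: pM; rewrite s0 (le_trans st)// (le_trans tt).
  by apply: trap; rewrite s0 (le_trans st).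
have iv2 : 2 * CB * (C1 * (2 * Q ^+ 18)) * Q ^+ 16 * (t - 0) <= 4 * CB * C1 * Q ^+ 17.
  apply: (@le_trans _ _ (2 * CB * (C1 * (2 * Q ^+ 18)) * Q ^+ 16 * Q ^- 17)).
    rewrite subr0; apply: ler_wpM2l => //; apply: mulr_ge0; last by rewrite exprn_ge0// ltW.
    by apply: mulr_ge0; apply: mulr_ge0 => //; lra.
  by rewrite le_eqVlt; apply/orP; left; apply/eqP; field; rewrite gt_eqF.
have gt : `|(g t - g 0) 0 i| <= K.
  by apply: le_trans (rv_coord_le _ _) _; apply: gK; rewrite t0 (le_trans tt).
have p0i : `|(p 0 - Q ^+ 18 *: u0) 0 i| <= del * Q ^+ 18 by apply: le_trans p0; exact: rv_coord_le.
have DQ : 4 * CB * C1 * Q ^+ 17 + K <= del * Q ^+ 18.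
  have : D * Q ^+ 17 <= Q ^+ 18 by apply: pow_absorb => //; lra.
  rewrite /D mulrAC ler_pdivrMr// [Q ^+ 18 * _]mulrC mulrDl; apply: le_trans.
  by rewrite lerD2l ler_peMr// exprn_ege1.
have dQ0 : 0 <= del * Q ^+ 18 by rewrite mulr_ge0// ltW.
have -> : (p 0 - vint (b \o p) 0 t + (g t - g 0)) 0 i - Q ^+ 18 * u0 0 i =
    (p 0 - Q ^+ 18 *: u0) 0 i - vint (b \o p) 0 t 0 i + (g t - g 0) 0 i.
  by rewrite !mxE; ring.
apply: le_trans (ler_normD _ _) _; apply: le_trans (lerD (ler_normB _ _) (lexx _)) _.
by lra.
Qed.

(* States have size [Q^18].  Of two solutions with the same noise started near the ends of the
   segment [x +- Q^-54 Y], one is at distance at least [Q^16] from the kernel before [Q^-17]. *)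
Definition escapes u0 Y (eta : R) := forall K : R, 0 <= K ->
  exists del Q0 : R, [/\ 0 < del, del <= 1, 1 <= Q0 & forall Q x g (v1 v2 : R -> 'rV[R]_n), Q0 <= Q ->
    `|x - Q ^+ 18 *: u0| <= del * Q ^+ 18 -> path_sol b g v1 -> path_sol b g v2 ->
    small_noise K g -> `|v1 0 - x - Q ^- 54 *: Y| <= eta * Q ^- 54 ->
    `|v2 0 - x + Q ^- 54 *: Y| <= eta * Q ^- 54 ->
    exists2 t, 0 <= t <= Q ^- 17 & Q ^+ 16 <= `|pz (v1 t)| \/ Q ^+ 16 <= `|pz (v2 t)|].

Lemma start_close u0 Y (eta del Q : R) x v : 0 <= eta -> 0 < del -> 1 <= Q ->
  2 * (`|Y| + eta) / del <= Q ->
  `|x - Q ^+ 18 *: u0| <= del / 2 * Q ^+ 18 -> `|v - x - Q ^- 54 *: Y| <= eta * Q ^- 54 ->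
  `|v - Q ^+ 18 *: u0| <= del * Q ^+ 18.
Proof.
move=> e0 d0 Q1 QY xu vx; have Qp : 0 < Q by apply: lt_le_trans Q1.
have -> : v - Q ^+ 18 *: u0 = (x - Q ^+ 18 *: u0) + (v - x - Q ^- 54 *: Y) + Q ^- 54 *: Y.
  by apply/rowP => i; rewrite !mxE; ring.
apply: le_trans (ler_normD _ _) _; apply: le_trans (lerD (ler_normD _ _) (lexx _)) _.
have i54 : 0 <= Q ^- 54 <= 1.
  by rewrite invr_ge0 exprn_ge0 ?(ltW Qp)//= invf_le1 ?exprn_gt0// exprn_ege1.
have hY : `|Q ^- 54 *: Y| <= `|Y|.
  by rewrite normrZ; case/andP: i54 => i0 i1; rewrite ger0_norm// ler_piMl.
have he : eta * Q ^- 54 <= eta by case/andP: i54 => i0 i1; rewrite ler_piMr.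
have : (2 * (`|Y| + eta) / del) * Q ^+ 0 <= Q ^+ 18 by apply: pow_absorb.
by rewrite expr0 mulr1 ler_pdivrMr// => h; lra.
Qed.

(** Time 0 already works: the distance to the null space is a fixed fraction of Q^18. *)
Lemma escape_nonkernel u0 : pz u0 != 0 -> escapes u0 0 1.
Proof.
move=> z0 K K0; pose f := `|pz u0|; have f0 : 0 < f by rewrite normr_gt0.
pose del := Num.min 1 (f / 2).
have d0 : 0 < del by rewrite lt_min ltr01/= divr_gt0.
exists (del / 2), (1 + 2 * (`|0 : 'rV[R]_n| + 1) / del + 2 / f).
have q2 : 0 <= 2 * (`|0 : 'rV[R]_n| + 1) / del by rewrite normr0 add0r mulr1 divr_ge0// ltW.
have q3 : 0 < 2 / f by rewrite divr_gt0.
have dl1 : del <= 1 by rewrite ge_min lexx.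
split; [by rewrite divr_gt0|by lra|by lra|].
move=> Q x g v1 v2 QQ xu _ _ _ v10 _; have Q1 : 1 <= Q by lra.
have i17 : 0 <= Q ^- 17 by rewrite invr_ge0 exprn_ge0// (le_trans _ Q1).
exists 0; first by rewrite lexx.
left; have /= := @start_close u0 0 1 del Q x (v1 0) ler01 d0 Q1.
have -> : 2 * (`|0 : 'rV[R]_n| + 1) / del <= Q by lra.
move=> /(_ isT xu v10) H.
have Qp : 0 <= Q ^+ 18 by rewrite exprn_ge0// (le_trans _ Q1).
have h1 : Q ^+ 18 * f <= `|pz (v1 0)| + `|v1 0 - Q ^+ 18 *: u0|.
  have -> : Q ^+ 18 * f = `|pz (Q ^+ 18 *: u0)|.
    have -> : pz (Q ^+ 18 *: u0) = Q ^+ 18 *: pz u0.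
      by apply/rowP => i; rewrite !mxE; case: ifP => _; rewrite ?mulr0.
    by rewrite normrZ ger0_norm.
  have -> : pz (Q ^+ 18 *: u0) = pz (v1 0) - pz (v1 0 - Q ^+ 18 *: u0).
    by rewrite -pzB opprB addrC subrK.
  by apply: le_trans (ler_normB _ _) _; rewrite lerD2l; exact: pz_le.
have h2 : del * Q ^+ 18 <= f / 2 * Q ^+ 18 by apply: ler_wpM2r => //; rewrite ge_min lexx orbT.
have : (2 / f) * Q ^+ 16 <= Q ^+ 18 by apply: pow_absorb => //; lra.
rewrite mulrAC ler_pdivrMr// => h3; lra.
Qed.

Lemma drift_close u0 y (del Q : R) : 0 <= del <= 1 -> `|u0| = 1 -> 1 <= Q ->
  `|y - Q ^+ 18 *: u0| <= 3 * del * Q ^+ 18 ->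
  `|b y - Q ^+ 36 *: B u0 u0| <= 15 * CB * del * Q ^+ 36 + 4 * CB * Q ^+ 18.
Proof.
move=> /andP[d0 d1] u01 Q1 H; have Q0 : 0 <= Q ^+ 18 by rewrite exprn_ge0// (le_trans _ Q1).
have pn : `|y| <= 4 * Q ^+ 18.
  rewrite -[y](subrK (Q ^+ 18 *: u0)); apply: le_trans (ler_normD _ _) _.
  rewrite normrZ u01 mulr1 ger0_norm//.
  have : del * Q ^+ 18 <= Q ^+ 18 by rewrite ler_piMl.
  by lra.
have -> : Q ^+ 36 *: B u0 u0 = B (Q ^+ 18 *: u0) (Q ^+ 18 *: u0).
  have := Bl (Q ^+ 18) u0 0 (Q ^+ 18 *: u0); rewrite addr0 => ->.
  have := Br (Q ^+ 18) u0 0 u0; rewrite addr0 => ->.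
  have B0l z : B 0 z = 0.
    by have := bilB_l dd 0 0 z; rewrite subr0 subrr.
  have B0r z : B z 0 = 0.
    by have := bilB_r dd 0 0 z; rewrite subr0 subrr.
  by rewrite B0l B0r !addr0 scalerA -exprD.
rewrite /qdrift addrAC (bil_diff dd).
apply: le_trans (ler_normD _ _) _; apply: lerD; last first.
  by apply: le_trans (A_le _) _; rewrite -mulrA [4 * _]mulrC -mulrA; apply: ler_wpM2l => //; rewrite mulrC.
apply: le_trans (ler_normD _ _) _.
have h1 : `|B (y - Q ^+ 18 *: u0) y| <= CB * (3 * del * Q ^+ 18) * (4 * Q ^+ 18).
  by apply: le_trans (B_le _ _) _; apply: ler_pM => //; [rewrite mulr_ge0|apply: ler_wpM2l].
have h2 : `|B (Q ^+ 18 *: u0) (y - Q ^+ 18 *: u0)| <= CB * Q ^+ 18 * (3 * del * Q ^+ 18).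
  apply: le_trans (B_le _ _) _; apply: ler_pM => //; [by rewrite mulr_ge0|apply: ler_wpM2l => //].
  by rewrite normrZ u01 mulr1 ger0_norm.
apply: le_trans (lerD h1 h2) _; rewrite le_eqVlt; apply/orP; left; apply/eqP.
by ring.
Qed.

Local Tactic Notation "lra_on" ne_hyp_list(H) :=
  clear - H dd Bl Br CB1 B_le A_le CB0; lra.

(** [B u0 u0] has a nonzero coordinate outside [Ks]. Trapped for a time Q^-17, the solution would
    keep its drift close to Q^36 B u0 u0, and this coordinate would change by the order of Q^19,
    against the bound Q^16. *)
Lemma escape_moving u0 : `|u0| = 1 -> pz u0 = 0 -> B u0 u0 != 0 -> escapes u0 0 1.
Proof.
move=> u01 zu0 F0 K K0.
have [i Fi] : exists i, B u0 u0 0 i != 0.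
  apply: contrapT => H; move/negP: F0; apply; apply/eqP/rowP => i.
  by rewrite [RHS]mxE; apply: contrapT => /eqP Fi; apply: H; exists i.
have Ki : ~~ Ks i by apply/negP => Ki; move: Fi; rewrite (dd_B_K dd zu0 Ki) eqxx.
pose f := `|B u0 u0 0 i|; have f0 : 0 < f by rewrite normr_gt0.
pose del := Num.min 1 (f / (60 * CB)).
have CBp : 0 < CB by apply: lt_le_trans CB1.
have d0 : 0 < del by rewrite lt_min ltr01/= divr_gt0// mulr_gt0.
have dl1 : del <= 1 by rewrite ge_min lexx.
have dlf : 15 * CB * del <= f / 4.
  have : del <= f / (60 * CB) by rewrite ge_min lexx orbT.
  by rewrite ler_pdivlMr ?mulr_gt0//; lra.
have [Q0 Q01 HQ0] := trapped_close K0 d0 dl1 u01 zu0.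
pose D := 8 * (2 + 4 * CB + K) / f.
have D0 : 0 < D by rewrite divr_gt0// mulr_gt0// ltr_wpDr// addr_gt0// mulr_gt0.
have q2 : 0 <= 2 * (`|0 : 'rV[R]_n| + 1) / del by rewrite normr0 add0r mulr1 divr_ge0// ltW.
exists (del / 2), (Q0 + 2 * (`|0 : 'rV[R]_n| + 1) / del + D).
split; [by rewrite divr_gt0|by lra_on d0 dl1|by lra_on Q01 q2 D0|].
move=> Q x g v1 v2 QQ xu sp _ gK v10 _; have Q1 : 1 <= Q by lra_on QQ Q01 q2 D0.
have Qp : 0 < Q by apply: lt_le_trans Q1.
apply: contrapT => Hno.
have trap t : 0 <= t <= Q ^- 17 -> `|pz (v1 t)| <= Q ^+ 16.
  by move=> tt; rewrite leNgt; apply/negP => h; apply: Hno; exists t => //; left; exact: ltW.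
have st : `|v1 0 - Q ^+ 18 *: u0| <= del * Q ^+ 18.
  by apply: (start_close (Y := 0) (eta := 1) (x := x)) => //; lra.
have QQ0 : Q0 <= Q by lra_on QQ q2 D0.
have cl := HQ0 Q g v1 QQ0 sp gK st trap.
have t170 : 0 <= Q ^- 17 by rewrite invr_ge0 exprn_ge0// ltW.
have t171 : Q ^- 17 <= 1 by rewrite invf_le1 ?exprn_gt0// exprn_ege1.
case: (sp) => cp Hp.
have cbp : continuous (b \o v1) by exact: (path_comp_continuous (qdrift_loclip dd) cp).
have dev : `|vint (b \o v1) 0 (Q ^- 17) 0 i - Q ^- 17 * (Q ^+ 36 * B u0 u0 0 i)| <=
    (15 * CB * del * Q ^+ 36 + 4 * CB * Q ^+ 18) * Q ^- 17.
  have -> : vint (b \o v1) 0 (Q ^- 17) 0 i - Q ^- 17 * (Q ^+ 36 * B u0 u0 0 i) =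
     vint (fun s => (b \o v1) s - Q ^+ 36 *: B u0 u0) 0 (Q ^- 17) 0 i.
    rewrite -(vintB _ _ cbp (@cst_continuous _ _ (Q ^+ 36 *: B u0 u0))) vint_cst// subr0.
    by rewrite [RHS]mxE [X in _ = _ + X]mxE [X in _ = _ - X]mxE [X in _ = _ - _ * X]mxE.
  have cd : continuous (fun s => (b \o v1) s - Q ^+ 36 *: B u0 u0).
    move=> s; apply: (continuousB (f := b \o v1) (g := cst (Q ^+ 36 *: B u0 u0))); first exact: cbp.
    exact: cst_continuous.
  have bd s : 0 <= s <= Q ^- 17 -> `|(b \o v1) s - Q ^+ 36 *: B u0 u0| <=
      15 * CB * del * Q ^+ 36 + 4 * CB * Q ^+ 18.
    by move=> sI; apply: drift_close => //; [rewrite ltW|exact: cl].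
  by apply: le_trans (rv_coord_le _ _) _; have := vint_le cd t170 bd; rewrite subr0.
have zt := trap (Q ^- 17); have z0 := trap 0.
rewrite t170 lexx in zt; rewrite lexx t170 in z0.
have vt : `|v1 (Q ^- 17) 0 i| <= Q ^+ 16.
  have -> : v1 (Q ^- 17) 0 i = pz (v1 (Q ^- 17)) 0 i by rewrite mxE (negbTE Ki).
  by apply: le_trans (rv_coord_le _ _) _; exact: zt.
have v0 : `|v1 0 0 i| <= Q ^+ 16.
  have -> : v1 0 0 i = pz (v1 0) 0 i by rewrite mxE (negbTE Ki).
  by apply: le_trans (rv_coord_le _ _) _; exact: z0.
have gt : `|(g (Q ^- 17) - g 0) 0 i| <= K.
  by apply: le_trans (rv_coord_le _ _) _; apply: gK; rewrite t170.
have e : v1 (Q ^- 17) 0 i = v1 0 0 i - vint (b \o v1) 0 (Q ^- 17) 0 i + (g (Q ^- 17) - g 0) 0 i.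
  rewrite (Hp 0 (Q ^- 17) (lexx 0) t170) [LHS]mxE; congr (_ + _).
  by rewrite [LHS]mxE; congr (_ + _); rewrite [LHS]mxE.
have e2 : Q ^- 17 * (Q ^+ 36 * B u0 u0 0 i) = v1 0 0 i - v1 (Q ^- 17) 0 i +
    (g (Q ^- 17) - g 0) 0 i - (vint (b \o v1) 0 (Q ^- 17) 0 i - Q ^- 17 * (Q ^+ 36 * B u0 u0 0 i)).
  by rewrite [X in _ = _ - X + _ - _]e; ring.
have e3 : Q ^+ 19 * f <= Q ^+ 16 + Q ^+ 16 + K + (15 * CB * del * Q ^+ 19 + 4 * CB * Q ^+ 1).
  have -> : Q ^+ 19 * f = `|Q ^- 17 * (Q ^+ 36 * B u0 u0 0 i)|.
    rewrite mulrA normrM; congr (_ * _); rewrite ger0_norm; last by rewrite mulr_ge0// exprn_ge0// ltW.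
    by field; rewrite gt_eqF.
  rewrite e2; apply: le_trans (ler_normB _ _) _; apply: lerD.
    apply: le_trans (ler_normD _ _) _; apply: lerD => //.
    by apply: le_trans (ler_normB _ _) _; apply: lerD.
  apply: le_trans dev _; rewrite le_eqVlt; apply/orP; left; apply/eqP.
  by field; rewrite gt_eqF.
have DQ0 : D <= Q by lra_on QQ q2 Q01.
have DQ : D * Q ^+ 16 <= Q ^+ 19 by exact: pow_absorb.
rewrite /D mulrAC ler_pdivrMr// in DQ.
have q1 : 1 <= Q ^+ 16 by rewrite exprn_ege1.
have qq : Q ^+ 1 <= Q ^+ 16 by rewrite ler_weXn2l.
have q19 : 0 < Q ^+ 19 by rewrite exprn_gt0.
have k1 : K <= K * Q ^+ 16 by rewrite ler_peMr.
have k2 : CB * Q ^+ 1 <= CB * Q ^+ 16 by rewrite ler_wpM2l.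
have k3 : 15 * CB * del * Q ^+ 19 <= f / 4 * Q ^+ 19 by rewrite ler_wpM2r// ltW.
have k4 : 0 < Q ^+ 19 * f by rewrite mulr_gt0.
lra_on e3 DQ k1 k2 k3 k4 q1 qq q19.
Qed.

(** With the same noise, the difference of two solutions obeys an equation without noise, which near
    Q^18 u0 is a small perturbation of the linearization at Q^18 u0. *)
Lemma drift_diff_close u0 y1 y2 (del Q : R) : 0 < del -> del^-1 <= Q -> 1 <= Q ->
  `|y1 - Q ^+ 18 *: u0| <= 3 * del * Q ^+ 18 -> `|y2 - Q ^+ 18 *: u0| <= 3 * del * Q ^+ 18 ->
  `|- (b y1 - b y2) - Q ^+ 18 *: - (B (y1 - y2) u0 + B u0 (y1 - y2))| <=
    7 * CB * del * Q ^+ 18 * `|y1 - y2|.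
Proof.
move=> d0 dQ Q1 H1 H2; set d := y1 - y2; pose r := Q ^+ 18.
have B0l z : B 0 z = 0 by have := bilB_l dd 0 0 z; rewrite subr0 subrr.
have B0r z : B z 0 = 0 by have := bilB_r dd 0 0 z; rewrite subr0 subrr.
have rl : r *: B u0 d = B (r *: u0) d by have := Bl r u0 0 d; rewrite B0l !addr0.
have rr : r *: B d u0 = B d (r *: u0) by have := Br r u0 0 d; rewrite B0r !addr0.
have -> : - (b y1 - b y2) - r *: - (B d u0 + B u0 d) =
    - (B d (y1 - r *: u0) + B (y2 - r *: u0) d + d *m A).
  rewrite scalerN scalerDr rl rr (bilB_r dd y1 (r *: u0) d) (bilB_l dd y2 (r *: u0) d) /qdrift [d *m A]mulmxBl.
  have := bil_diff dd y1 y2; rewrite -/d => /(canRL (subrK _)) ->.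
  by apply/rowP => i; rewrite !mxE; ring.
rewrite normrN; apply: le_trans (ler_normD _ _) _; apply: le_trans (lerD (ler_normD _ _) (lexx _)) _.
have r0 : 0 <= r by rewrite exprn_ge0// (le_trans _ Q1).
have h1 : `|B d (y1 - r *: u0)| <= CB * `|d| * (3 * del * r).
  by apply: le_trans (B_le _ _) _; apply: ler_wpM2l => //; rewrite mulr_ge0.
have h2 : `|B (y2 - r *: u0) d| <= CB * `|d| * (3 * del * r).
  apply: le_trans (B_le _ _) _; rewrite -!mulrA; apply: ler_wpM2l => //; rewrite [leRHS]mulrC.
  by apply: ler_wpM2r => //; rewrite mulrA.
have h3 : `|d *m A| <= CB * `|d| * (del * r).
  apply: le_trans (A_le _) _; rewrite ler_peMr ?mulr_ge0//.
  have : del^-1 * Q ^+ 0 <= r by apply: pow_absorb.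
  by rewrite expr0 mulr1 => h; have := ler_wpM2l (ltW d0) h; rewrite mulfV// gt_eqF.
have -> : 7 * CB * del * Q ^+ 18 * `|d| = CB * `|d| * (3 * del * r) + CB * `|d| * (3 * del * r) + CB * `|d| * (del * r).
  by rewrite /r; ring.
by lra.
Qed.

(* Two solutions driven by the same noise separate along the unstable direction at rate
   [exp (2 rho Q^18 t)], which on [0, Q^-17] beats every power of [Q], while solutions that
   stay trapped near the kernel are confined to a ball of radius [O(Q^18)]. *)
Lemma escape_unstable u0 : `|u0| = 1 -> pz u0 = 0 -> B u0 u0 = 0 ->
  exists Y (eta : R), 0 < eta /\ escapes u0 Y eta.
Proof.
move=> u01 zu0 F0; have u00 : u0 != 0 by rewrite -normr_gt0 u01.
have [lam [Y [l0 Y0 YL]]] := dd_unstable dd u00 zu0 F0.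
have [M HM] : exists M : 'M[R]_n, forall x, x *m M = - (B x u0 + B u0 x).
  apply: linear_matrix => a x y; rewrite Bl Br.
  by apply/rowP => i; rewrite !mxE; ring.
have [|G [rho [rho0 GT GY HG]]] := lyapunov l0 Y0 (M := M); first by rewrite HM.
have [CG CG1 HCG] := dot_quad_le G.
have CGp : 0 < CG by apply: lt_le_trans CG1.
have CBp : 0 < CB by apply: lt_le_trans CB1.
set g0 := dot (Y *m G) Y in GY.
pose c := CG * (8 * `|Y| + 4).
have c0 : 0 < c by rewrite mulr_gt0// ltr_wpDl// mulr_ge0.
pose eta := Num.min 1 (3 * g0 / c).
have e0 : 0 < eta by rewrite lt_min ltr01/= divr_gt0// mulr_gt0.
have e1 : eta <= 1 by rewrite ge_min lexx.
have ec : eta * c <= 3 * g0 by rewrite -ler_pdivlMr// ge_min lexx orbT.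
(* The rescaled initial difference is 2 Y up to an error 2 eta; [eta] is chosen so that the form of
   [G], equal to 4 g0 at 2 Y, stays at least g0. *)
have quad e : `|e| <= 2 * eta -> g0 <= dot ((2 *: Y + e) *m G) (2 *: Y + e).
  move=> he; have -> : dot ((2 *: Y + e) *m G) (2 *: Y + e) = 4 * g0 + 4 * dot (Y *m G) e + dot (e *m G) e.
    rewrite mulmxDl -scalemxAl !dotDl !dotDr !dotZl !dotZr -/g0.
    have -> : dot (e *m G) Y = dot (Y *m G) e by rewrite dot_trmx GT dotC.
    by ring.
  have h1 := HCG Y e; have h2 := HCG e e.
  rewrite ler_norml in h1; rewrite ler_norml in h2; case/andP: h1 => h1 _; case/andP: h2 => h2 _.
  have h3 : CG * `|Y| * `|e| <= CG * `|Y| * (2 * eta) by apply: ler_wpM2l => //; rewrite mulr_ge0// ltW.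
  have h4 : CG * `|e| * `|e| <= CG * (2 * eta) * (2 * eta).
    by apply: ler_pM => //; [rewrite mulr_ge0// ltW|apply: ler_wpM2l => //; exact: ltW].
  have h5 : CG * (2 * eta) * (2 * eta) <= 4 * CG * eta.
    have : CG * eta * eta <= CG * eta by rewrite ler_piMr// mulr_ge0 ?ltW.
    by lra.
  by rewrite /c in ec; lra.
exists Y, eta; split=> // K K0.
(* The error of [drift_diff_close] changes the derivative of the form by at most 14 CG CB del Q^18
   |d|^2, which the margin [dot d d] of [lyapunov], multiplied by Q^18, absorbs. *)
pose del := Num.min 1 (14 * CG * CB)^-1.
have gg : 0 < 14 * CG * CB by rewrite !mulr_gt0.
have d0 : 0 < del by rewrite lt_min ltr01/= invr_gt0.
have dl1 : del <= 1 by rewrite ge_min lexx.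
have dlG : 14 * CG * CB * del <= 1 by rewrite mulrC -ler_pdivlMr// mul1r ge_min lexx orbT.
have [Q0 Q01 HQ0] := trapped_close K0 d0 dl1 u01 zu0.
(* 144 = 36 + 108: the form is at most of order Q^36 at the end and at least of order Q^-108 at the
   start. *)
have [|Q1 HQ1] := @expR_gt_poly R (2 * rho) (64 * CG / g0) 144; first by rewrite mulr_gt0.
pose q2 := 2 * (`|Y| + eta) / del.
have q20 : 0 <= q2 by rewrite divr_ge0 ?(ltW d0)// mulr_ge0// addr_ge0// ltW.
have di : 0 < del^-1 by rewrite invr_gt0.
exists (del / 2), (Q0 + `|Q1| + q2 + del^-1).
have Q1n := ler_norm Q1; have Q1p := normr_ge0 Q1.
split; [by rewrite divr_gt0|by lra_on d0 dl1|by lra_on Q01 Q1p q20 di|].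
move=> Q x g v1 v2 QQ xu sp1 sp2 gK v10 v20; have Qge1 : 1 <= Q by lra_on QQ Q01 Q1p q20 di.
have Qp : 0 < Q by apply: lt_le_trans Qge1.
apply: contrapT => Hno.
have trap1 t : 0 <= t <= Q ^- 17 -> `|pz (v1 t)| <= Q ^+ 16.
  by move=> tt; rewrite leNgt; apply/negP => h; apply: Hno; exists t => //; left; exact: ltW.
have trap2 t : 0 <= t <= Q ^- 17 -> `|pz (v2 t)| <= Q ^+ 16.
  by move=> tt; rewrite leNgt; apply/negP => h; apply: Hno; exists t => //; right; exact: ltW.
have q2Q : q2 <= Q by lra_on QQ Q01 Q1p di.
have QQ0 : Q0 <= Q by lra_on QQ Q1p q20 di.
have dQ : del^-1 <= Q by lra_on QQ Q01 Q1p q20.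
have st1 := start_close (ltW e0) d0 Qge1 q2Q xu v10.
have st2 : `|v2 0 - Q ^+ 18 *: u0| <= del * Q ^+ 18.
  by apply: (start_close (Y := - Y) (eta := eta) (x := x) _ d0 Qge1); rewrite ?normrN ?scalerN ?opprK// ltW.
have cl1 := HQ0 Q g v1 QQ0 sp1 gK st1 trap1.
have cl2 := HQ0 Q g v2 QQ0 sp2 gK st2 trap2.
have t170 : 0 <= Q ^- 17 by rewrite invr_ge0 exprn_ge0// ltW.
case: (sp1) => cp1 Hp1; case: (sp2) => cp2 Hp2.
have cb1 : continuous (b \o v1) by exact: (path_comp_continuous (qdrift_loclip dd) cp1).
have cb2 : continuous (b \o v2) by exact: (path_comp_continuous (qdrift_loclip dd) cp2).
pose d (t : R) : 'rV[R]_n := v1 t - v2 t.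
have cd : continuous d by move=> t; apply: (continuousB (f := v1) (g := v2)); [exact: cp1|exact: cp2].
pose phi (t : R) : R := dot (d t *m G) (d t).
pose d' (t : R) : 'rV[R]_n := - (b (v1 t) - b (v2 t)).
pose D (t : R) : 'rV[R]_n := v1 0 - v2 0 - (vint (b \o v1) 0 t - vint (b \o v2) 0 t).
have dD (t : R) : 0 <= t -> d t = D t.
  by move=> t0; rewrite /d (Hp1 0 t (lexx 0) t0) (Hp2 0 t (lexx 0) t0) /D; apply/rowP => i; rewrite !mxE; ring.
have dphi (t : R) : 0 < t -> is_derive t 1 (fun s => dot (D s *m G) (D s)) (2 * dot (d t *m G) (d' t)).
  move=> t0; rewrite (dD t (ltW t0)); apply: is_derive_quad => // i.
  have h1 := vint_derive i cb1 t0; have h2 := vint_derive i cb2 t0.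
  have -> : (fun s => D s 0 i) = (cst (v1 0 0 i - v2 0 0 i) : R -> R^o) -
      ((fun s => vint (b \o v1) 0 s 0 i) - (fun s => vint (b \o v2) 0 s 0 i)).
    by apply/funext => s; rewrite /D [LHS]mxE [X in X + _ = _]mxE [X in _ + X + _ = _]mxE [X in _ + X = _]mxE [X in _ - X = _]mxE [X in _ - (_ + X) = _]mxE.
  apply: (is_derive_eq (is_deriveB (is_derive_cst _ t 1) (is_deriveB h1 h2))).
  by rewrite sub0r [RHS]mxE [X in _ = - X]mxE [X in _ = - (_ + X)]mxE.
have D0 : D 0 = d 0 by rewrite dD.
have grow : expR (2 * rho * Q ^+ 18 * Q ^- 17) * phi 0 <= phi (Q ^- 17).
  rewrite /phi (dD 0)// (dD (Q ^- 17))//.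
  apply: (@gronwall_ge _ (fun s => dot (D s *m G) (D s)) (fun t => 2 * dot (d t *m G) (d' t))) => //.
  - apply: quad_continuous => t.
    apply: (continuousB (f := cst (v1 0 - v2 0)) (g := vint (b \o v1) 0 - vint (b \o v2) 0)).
      exact: cst_continuous.
    by apply: (continuousB (f := vint (b \o v1) 0) (g := vint (b \o v2) 0)); exact: vint_continuous.
  - by move=> t /andP[t0 _]; exact: dphi.
  move=> t /andP[t0 tt]; rewrite -(dD t (ltW t0)).
  have tI : 0 <= t <= Q ^- 17 by rewrite (ltW t0) (ltW tt).
  have H := drift_diff_close d0 dQ Qge1 (cl1 t tI) (cl2 t tI).
  rewrite -/(d t) -/(d' t) -HM in H; set e := d' t - _ in H.
  have d'E : d' t = Q ^+ 18 *: (d t *m M) + e by rewrite /e addrC subrK.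
  have -> : dot (d t *m G) (d' t) = Q ^+ 18 * dot (d t *m G) (d t *m M) + dot (d t *m G) e.
    by rewrite {1}d'E [LHS]dotDr [X in X + _ = _]dotZr.
  have -> : 2 * (Q ^+ 18 * dot (d t *m G) (d t *m M) + dot (d t *m G) e) =
     Q ^+ 18 * (2 * dot (d t *m G) (d t *m M)) + 2 * dot (d t *m G) e by ring.
  rewrite HG.
  have h1 : `|dot (d t *m G) e| <= CG * `|d t| * (7 * CB * del * Q ^+ 18 * `|d t|).
    by apply: le_trans (HCG _ _) _; apply: ler_wpM2l => //; rewrite mulr_ge0// ltW.
  rewrite ler_norml in h1; case/andP: h1 => h1 _.
  have h2 := dot_lower (d t).
  have q18 : 0 <= Q ^+ 18 by rewrite exprn_ge0// ltW.
  have h3 : Q ^+ 18 * `|d t| ^+ 2 <= Q ^+ 18 * dot (d t) (d t) by apply: ler_wpM2l.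
  have h4 : 14 * CG * CB * del * (Q ^+ 18 * `|d t| ^+ 2) <= Q ^+ 18 * `|d t| ^+ 2.
    by rewrite ler_piMl// mulr_ge0// exprn_ge0.
  have h5 : CG * `|d t| * (7 * CB * del * Q ^+ 18 * `|d t|) * 2 = 14 * CG * CB * del * (Q ^+ 18 * `|d t| ^+ 2) by ring.
  lra_on h1 h2 h3 h4 h5.
have up : phi (Q ^- 17) <= 64 * CG * Q ^+ 36.
  have nv v : `|v - Q ^+ 18 *: u0| <= 3 * del * Q ^+ 18 -> `|v| <= 4 * Q ^+ 18.
    move=> h; rewrite -[v](subrK (Q ^+ 18 *: u0)); apply: le_trans (ler_normD _ _) _.
    rewrite normrZ u01 mulr1 ger0_norm ?exprn_ge0 ?(ltW Qp)//.
    have h' : del * Q ^+ 18 <= Q ^+ 18 by rewrite ler_piMl// exprn_ge0// ltW.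
    by lra_on h h'.
  have tI : 0 <= Q ^- 17 <= Q ^- 17 by rewrite t170 lexx.
  have n1 := nv _ (cl1 _ tI); have n2 := nv _ (cl2 _ tI).
  have nd : `|d (Q ^- 17)| <= 8 * Q ^+ 18 by apply: le_trans (ler_normB _ _) _; lra_on n1 n2.
  apply: le_trans (ler_norm _) _; apply: le_trans (HCG _ _) _.
  have -> : 64 * CG * Q ^+ 36 = CG * (8 * Q ^+ 18) * (8 * Q ^+ 18) by ring.
  by apply: ler_pM => //; [rewrite mulr_ge0// ltW|apply: ler_wpM2l => //; exact: ltW].
have low : g0 * Q ^- 108 <= phi 0.
  pose e := Q ^+ 54 *: (v1 0 - x - Q ^- 54 *: Y - (v2 0 - x + Q ^- 54 *: Y)).
  have q54 : 0 < Q ^+ 54 by rewrite exprn_gt0.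
  have he : `|e| <= 2 * eta.
    rewrite /e normrZ gtr0_norm// mulrC -ler_pdivlMr//.
    by apply: le_trans (ler_normB _ _) _; lra_on v10 v20.
  have d0E : d 0 = Q ^- 54 *: (2 *: Y + e).
    rewrite /d /e; apply/rowP => i; rewrite !mxE; field; rewrite gt_eqF//.
  rewrite /phi d0E -scalemxAl dotZl dotZr.
  have -> : g0 * Q ^- 108 = Q ^- 54 * (Q ^- 54 * g0) by field; rewrite gt_eqF.
  by do 2![apply: ler_wpM2l; first by rewrite invr_ge0 ltW]; exact: quad.
have := HQ1 Q; have -> : Q1 <= Q by lra_on QQ Q01 Q1n q20 di.
move=> /(_ isT) big.
have e17 : 2 * rho * Q ^+ 18 * Q ^- 17 = 2 * rho * Q by field; rewrite gt_eqF.
rewrite e17 in grow.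
have h1 : expR (2 * rho * Q) * (g0 * Q ^- 108) <= 64 * CG * Q ^+ 36.
  by apply: le_trans up; apply: le_trans grow; apply: ler_wpM2l => //; exact: expR_ge0.
have q108 : 0 < Q ^+ 108 by rewrite exprn_gt0.
rewrite mulrA ler_pdivrMr// in h1.
have h2 : 64 * CG * Q ^+ 36 * Q ^+ 108 = 64 * CG / g0 * Q ^+ 144 * g0 by field; rewrite gt_eqF.
have h3 : 64 * CG / g0 * Q ^+ 144 * g0 < expR (2 * rho * Q) * g0 by rewrite ltr_pM2r.
by rewrite h2 in h1; have := lt_le_trans h3 h1; rewrite ltxx.
Qed.

Lemma escape_exists u0 : `|u0| = 1 -> exists Y (eta : R), 0 < eta /\ escapes u0 Y eta.
Proof.
move=> u01; have [zu0|zu0] := eqVneq (pz u0) 0; last first.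
  by exists 0, 1; split=> //; exact: escape_nonkernel.
have [F0|F0] := eqVneq (B u0 u0) 0; first exact: escape_unstable.
by exists 0, 1; split=> //; exact: escape_moving.
Qed.

End Escape.

(** * Probability of escape and the drift inequality *)

Section Gain.
Context {R : realType} {d : measure_display} {Omega : measurableType d}.
Variable P : probability Omega R.
Context {I : finType}.
Variable W : I -> R -> Omega -> R.
Hypothesis hW : forall i, brownian P (W i).
Hypothesis hWind : independent_processes P W.
Context {n : nat}.
Variable S : I -> 'rV[R]_n.
Variables (Ks : pred 'I_n) (B : 'rV[R]_n -> 'rV[R]_n -> 'rV[R]_n) (A : 'M[R]_n) (CB cA : R).
Hypothesis dd : dissipative_drift Ks B A CB cA.
Local Notation b := (qdrift B A).
Local Notation pz := (pz Ks).
Variable u : 'rV[R]_n -> R -> Omega -> 'rV[R]_n.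
Hypothesis hu : flow P W b S u.
Variables (iota : 'I_n -> I) (sg : 'I_n -> R).
Hypotheses (iota_inj : injective iota) (sg0 : forall l, sg l != 0).
Hypothesis S_iota : forall l, S (iota l) = sg l *: delta_mx 0 l.

Let bL := qdrift_loclip dd.
Let CB1 := dd_CB1 dd.
Let CBp : 0 < CB. Proof. exact: lt_le_trans CB1. Qed.
Let nv := noise_var S.
Let SS := \sum_i `|S i|.
Let SS0 : 0 <= SS. Proof. exact: sumr_ge0. Qed.

Lemma prob_inter_ge (F G : set Omega) (a e : R) : measurable F -> measurable G ->
  (a%:E <= P F)%E -> ((1 - e)%:E <= P G)%E -> ((a - e)%:E <= P (F `&` G))%E.
Proof.
move=> mF mG; have mFG : measurable (F `&` G) by exact: measurableI.
have mFD : measurable (F `\` G) by exact: measurableD.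
have pf C : measurable C -> P C \is a fin_num by move=> mC; exact: fin_num_measure.
have h1 : (P F <= P (F `&` G) + P (F `\` G))%E.
  by rewrite -{1}(setUIDK F G); apply: measureU2.
have h2 : (P (F `\` G) <= 1 - P G)%E.
  rewrite -probability_setC//; apply: le_measure; rewrite ?inE//; first exact: measurableC.
rewrite -(fineK (pf F mF)) -(fineK (pf G mG)) -(fineK (pf _ mFG)) in h1 h2 *.
rewrite -(fineK (pf _ mFD)) -?EFinD -?EFinB !lee_fin in h1 h2 *.
by lra.
Qed.

(** Brownian scaling: the bound [q] is independent of [h] because the constant of [normal_itv_ge] is
    independent of the standard deviation. *)
Lemma noise_box (s : I -> R) (eta : R) : 0 < eta -> exists2 q : R, 0 < q & forall h : R, 0 < h ->
  measurable [set om | forall i, `|W i h om - W i 0 om - Num.sqrt h * s i| <= eta * Num.sqrt h] /\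
  (q%:E <= P [set om | forall i, (`|W i h om - W i 0 om - Num.sqrt h * s i| <= eta * Num.sqrt h)%R])%E.
Proof.
move=> e0; have /choice[c Hc] : forall i, exists c : R, 0 < c /\ forall r, 0 < r ->
    (c%:E <= normal_prob 0%R r `](r * (s i - eta))%R, (r * (s i + eta))%R[%classic)%E.
  move=> i; have [|c c0 H] := @normal_itv_ge R (s i - eta) (s i + eta); first by lra.
  by exists c.
exists (\prod_i c i) => [|h h0]; first by rewrite prodr_gt0// => i _; case: (Hc i).
have sh : 0 < Num.sqrt h by rewrite sqrtr_gt0.
have mW i : measurable_fun setT (fun om => W i h om - W i 0 om).
  by apply: measurable_funB; apply: (brownian_meas (hW i)) => //; exact: ltW.
have mE : measurable [set om | forall i, `|W i h om - W i 0 om - Num.sqrt h * s i| <= eta * Num.sqrt h].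
  have -> : [set om | forall i, `|W i h om - W i 0 om - Num.sqrt h * s i| <= eta * Num.sqrt h] =
      \bigcap_(i in [set: I]) ((fun om => `|W i h om - W i 0 om - Num.sqrt h * s i|) @^-1` `]-oo, eta * Num.sqrt h]%classic).
    apply/seteqP; split=> [om H i _ /=|om H i]; first by rewrite in_itv/=; exact: H.
    by have := H i Logic.I; rewrite /= in_itv.
  apply: fin_bigcap_measurable => // i _; rewrite -[X in measurable X]setTI.
  have mf : measurable_fun setT (fun om => `|W i h om - W i 0 om - Num.sqrt h * s i|).
    by apply: measurableT_comp => //; apply: measurable_funB => //; exact: mW.
  exact: (mf measurableT _ (measurable_itv _)).
split=> //.
have gh : grid (ugrid 0 h) by exact: ugrid_grid.
pose C i (_ : nat) : set R := `](Num.sqrt h * (s i - eta)), (Num.sqrt h * (s i + eta))[%classic.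
have mC i j : measurable (C i j) by exact: measurable_itv.
apply: (@le_trans _ _ (\prod_i \prod_(j < 1) step_law (ugrid 0 h) j (C i j))%E).
  rewrite -prodEFin; apply: lee_prod_fin => i; first by rewrite lee_fin ltW//; case: (Hc i).
  rewrite big_ord_recr big_ord0/= mul1e /step_law.
  have -> : ugrid 0 h 1 - ugrid 0 h 0 = h :> R by rewrite /ugrid; ring.
  by case: (Hc i) => _; apply.
rewrite -(incr_product hW hWind 1 gh mC).
have mi : measurable [set om | forall i j, (j < 1)%N -> C i j (incr W (ugrid 0 h) j i om)].
  have -> : [set om | forall i j, (j < 1)%N -> C i j (incr W (ugrid 0 h) j i om)] =
      \bigcap_(i in [set: I]) (incr W (ugrid 0 h) 0 i @^-1` C i 0%N).
    apply/seteqP; split=> [om H i _|om H i [|//] _]; first exact: H.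
    exact: (H i Logic.I).
  apply: fin_bigcap_measurable => // i _; rewrite -[X in measurable X]setTI.
  exact: (incr_measurable hW 0 i gh).
apply: le_measure; rewrite ?inE// => om H i.
have := H i 0%N isT; rewrite /C /= in_itv/= /incr /ugrid mulr1n mul0r mul1r !add0r => /andP[h1 h2].
by rewrite ler_norml; apply/andP; split; lra.
Qed.

Lemma small_noise_good (K : R) om : 
  (forall i t, 0 <= t <= 1 -> `|W i t om - W i 0 om| <= K) -> small_noise (K * SS) (noise W S ^~ om).
Proof.
move=> H t t01; rewrite /noise -sumrB.
apply: le_trans (ler_norm_sum _ _ _) _; rewrite mulr_sumr; apply: ler_sum => i _.
by rewrite -scalerBl normrZ ler_wpM2r//; exact: H.
Qed.

Lemma pow_inv_le (Q : R) (k : nat) (e : R) : 1 <= Q -> 0 < e -> e^-1 <= Q -> (0 < k)%N -> Q ^- k <= e.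
Proof.
move=> Q1 e0 eQ k0; have Qp : 0 < Q by apply: lt_le_trans Q1.
have : e^-1 * Q ^+ 0 <= Q ^+ k by apply: pow_absorb.
rewrite expr0 mulr1 => h; rewrite -[e]invrK lef_pV2// posrE ?exprn_gt0// invr_gt0//.
Qed.

Let ball_meas (y0 : 'rV[R]_n) (a : R) : measurable ([set y | `|(y : 'rV[R]_n) - y0| <= a] : set (brv R n)).
Proof.
have md : measurable_fun setT (fun y : brv R n => `|(y : 'rV[R]_n) - y0|).
  by apply: (continuous_brv (f := fun y : 'rV[R]_n => `|y - y0|)); exact: dist_continuous.
have := md measurableT _ (measurable_itv `]-oo, a]); rewrite setTI.
by congr measurable; apply/seteqP; split=> y /=; rewrite in_itv.
Qed.

(** In a time Q^-108 the noise has size Q^-54, while the drift moves the solution by only O(Q^36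
    Q^-108) = O(Q^-72). *)
Lemma hit_box (Y : 'rV[R]_n) (eta : R) : 0 < eta -> exists q Q0 : R, [/\ 0 < q, 1 <= Q0 &
  forall Q x, Q0 <= Q -> `|x| <= 2 * Q ^+ 18 ->
    (q%:E <= P (u x (Q ^- 108) @^-1` [set y | (`|y - (x + Q ^- 54 *: Y)| <= eta * Q ^- 54)%R]))%E].
Proof.
move=> e0; pose eta' := eta / (2 * (1 + SS)).
have s1 : 0 < 2 * (1 + SS) by rewrite mulr_gt0// ltr_pwDl.
have e'0 : 0 < eta' by rewrite divr_gt0.
have [q q0 Hq] := noise_box (lift_noise iota sg Y) e'0.
have [|K' K'1 PK'] := good_prob hW (e := q / 2); first by rewrite divr_gt0.
have K'0 : 0 <= K' by apply: le_trans K'1.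
pose K := K' * SS; have K0 : 0 <= K by rewrite mulr_ge0.
have [C1 C11 HC1] := apriori dd K0.
have C10 : 0 <= C1 by apply: le_trans C11.
pose D := 8 * CB * C1 ^+ 2; have D0 : 0 <= D by rewrite !mulr_ge0 ?exprn_ge0// ltW.
have DD : 0 <= 2 * D / eta by rewrite divr_ge0 ?mulr_ge0// ltW.
exists (q / 2), (1 + 2 * D / eta); split; [by rewrite divr_gt0|by rewrite lerDl|].
move=> Q x QQ xQ; have Q1 : 1 <= Q by lra.
have Qp : 0 < Q by apply: lt_le_trans Q1.
pose h := Q ^- 108; have h0 : 0 < h by rewrite invr_gt0 exprn_gt0.
have h1 : h <= 1 by rewrite invf_le1 ?exprn_gt0// exprn_ege1.
have sh : Num.sqrt h = Q ^- 54.
  have -> : h = (Q ^- 54) ^+ 2 by rewrite /h exprVn -exprM.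
  by rewrite sqrtr_sqr ger0_norm// invr_ge0 exprn_ge0// ltW.
have [mF PF] := Hq h h0; rewrite sh in mF PF; set F := [set om | _] in mF PF.
have qE : q / 2 = q - q / 2 by lra.
rewrite {1}qE; apply: le_trans (prob_inter_ge mF (good_measurable hW K') PF PK') _.
apply: as_prob_le.
- by apply: measurableI => //; exact: good_measurable.
- rewrite -[X in measurable X]setTI; have mu := flow_meas hu x (ltW h0).
  exact: (mu measurableT _ (ball_meas _ _)).
apply: filterS2 (good_ae hW) (flow_sol hu x) => om HK [v [sp v0 vu]] [Fom Kom] /=.
have gK := small_noise_good (HK K' Kom).
rewrite -/h -(vu h (ltW h0)).
have q18 : 1 <= 2 * Q ^+ 18 by have : 1 <= Q ^+ 18 by [rewrite exprn_ege1]; lra.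
have pM r : 0 <= r <= 1 -> `|v r| <= C1 * (2 * Q ^+ 18).
  by apply: (HC1 _ v _ sp gK q18); rewrite v0.
case: (sp) => cv Hv; rewrite (Hv 0 h (lexx 0) (ltW h0)) v0.
have -> : x - vint (b \o v) 0 h + (noise W S h om - noise W S 0 om) - (x + Q ^- 54 *: Y) =
   (noise W S h om - noise W S 0 om - Q ^- 54 *: Y) - vint (b \o v) 0 h.
  by apply/rowP => i; rewrite !mxE; ring.
apply: le_trans (ler_normB _ _) _.
have hn : `|noise W S h om - noise W S 0 om - Q ^- 54 *: Y| <= eta / 2 * Q ^- 54.
  rewrite -[Y in Q ^- 54 *: Y](lift_noiseK sg0 S_iota) scaler_sumr /noise -!sumrB.
  apply: le_trans (ler_norm_sum _ _ _) _.
  apply: (@le_trans _ _ (\sum_i eta' * Q ^- 54 * `|S i|)).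
    apply: ler_sum => i _; rewrite scalerA -!scalerBl normrZ; apply: ler_wpM2r => //.
  rewrite -mulr_sumr -/SS mulrAC; apply: ler_wpM2r; first by rewrite invr_ge0 exprn_ge0// ltW.
  rewrite /eta' -mulrA [_^-1 * _]mulrC mulrA ler_pdivrMr//.
  by have : 0 <= eta by [exact: ltW]; nra.
have hv : `|vint (b \o v) 0 h| <= eta / 2 * Q ^- 54.
  have M1 : 1 <= C1 * (2 * Q ^+ 18) by apply: (le_trans q18); rewrite ler_peMl// (le_trans _ q18).
  have cbv : continuous (b \o v) by exact: (path_comp_continuous bL cv).
  have bd s : 0 <= s <= h -> `|(b \o v) s| <= 2 * CB * (C1 * (2 * Q ^+ 18)) ^+ 2.
    move=> /andP[s0 s1']; apply: (qdrift_le dd M1); apply: pM.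
    by rewrite s0 (le_trans s1' h1).
  apply: le_trans (vint_le cbv (ltW h0) bd) _; rewrite subr0.
  have -> : 2 * CB * (C1 * (2 * Q ^+ 18)) ^+ 2 * h = D * Q ^- 18 * Q ^- 54.
    by rewrite /h /D; field; rewrite gt_eqF.
  apply: ler_wpM2r; first by rewrite invr_ge0 exprn_ge0// ltW.
  rewrite ler_pdivrMr ?exprn_gt0//.
  have : (2 * D / eta) * Q ^+ 0 <= Q ^+ 18 by apply: pow_absorb => //; lra.
  rewrite expr0 mulr1 ler_pdivrMr// => hh; lra.
by lra.
Qed.

(** Rational times make the event measurable; the factor 1/2 and the doubled time leave room for
    replacing a real time of escape by a rational one. *)
Let untrapped (K : R) y (Q : R) : set Omega := good W K `&`
  \bigcup_(q in [set q : rat | 0 <= (ratr q : R) <= 2 * Q ^- 17])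
    [set om | Q ^+ 16 / 2 < `|pz (u y (ratr q) om)|].

Let pz_continuous : continuous (fun y : 'rV[R]_n => `|pz y|).
Proof.
move=> y; apply/(@cvgrPdist_le _ _ _ (nbhs y) (nbhs_filter y)) => e e0.
have : \forall z \near nbhs y, `|y - z| <= e.
  by apply: (@cvgrPdist_le _ _ _ (nbhs y) (nbhs_filter y) id y).1 => //; exact: cvg_id.
apply: filterS => z; apply: le_trans; apply: le_trans (ler_dist_dist _ _) _.
by rewrite -pzB; exact: pz_le.
Qed.

Let untrapped_meas K y Q : measurable (untrapped K y Q).
Proof.
apply: measurableI; first exact: good_measurable.
rewrite bigcup_mkcond; apply: countable_bigcupT_measurable; first exact: countableP.
move=> q; case: ifPn => [|_]; last exact: measurable0.
rewrite inE => /andP[q0 q1].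
have mf : measurable_fun setT (fun om => `|pz (u y (ratr q) om)|).
  exact: (measurableT_comp (continuous_brv pz_continuous) (flow_meas hu y q0)).
have := mf measurableT _ (measurable_itv `]Q ^+ 16 / 2, +oo[); rewrite setTI.
by congr measurable; apply/seteqP; split=> om /=; rewrite in_itv/= andbT.
Qed.

Let rational_time (v : R -> 'rV[R]_n) (t Q : R) : continuous v -> 1 <= Q -> 0 <= t <= Q ^- 17 ->
  Q ^+ 16 <= `|pz (v t)| ->
  exists2 q : rat, 0 <= (ratr q : R) <= 2 * Q ^- 17 & Q ^+ 16 / 2 < `|pz (v (ratr q))|.
Proof.
move=> cv Q1 /andP[t0 tt] Ht; have Qp : 0 < Q by apply: lt_le_trans Q1.
have Q16 : 0 < Q ^+ 16 by rewrite exprn_gt0.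
have t17 : 0 < Q ^- 17 by rewrite invr_gt0 exprn_gt0.
have cf : continuous (fun s => `|pz (v s)|).
  by move=> s; apply: (@continuous_comp _ _ _ v (fun y => `|pz y|)); [exact: cv|exact: pz_continuous].
have q4 : 0 < Q ^+ 16 / 4 by rewrite divr_gt0.
have /cvgrPdist_le /(_ _ q4) := cf t.
move=> /nbhs_ballP[e /= e1 H].
have te : t < t + Num.min e (Q ^- 17) by rewrite ltrDl lt_min e1.
have [q] := rat_in_itvoo te.
rewrite in_itv/= => /andP[tq qe].
exists q.
  rewrite (le_trans t0 (ltW tq))/=; have : Num.min e (Q ^- 17) <= Q ^- 17 by rewrite ge_min lexx orbT.
  by lra.
have := H (ratr q); rewrite /ball/= => /(_ _) h.
have : `|t - ratr q| < e.
  have : Num.min e (Q ^- 17) <= e by rewrite ge_min lexx.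
  by rewrite distrC gtr0_norm ?subr_gt0//; lra.
by move=> /h; rewrite ler_distl => /andP[h1 h2]; lra.
Qed.

Local Tactic Notation "lra_on" ne_hyp_list(H) :=
  clear - H hW hWind dd hu iota_inj sg0 S_iota bL CB1 CBp nv SS SS0 ball_meas untrapped pz_continuous
    untrapped_meas rational_time; lra.

(** The energy balance is applied on [0, Q^-108], where the noise chooses the starting point, and on
    the remaining time, where the solution escapes; the Markov property joins the two, whence
    [2 * nv]. *)
Lemma local_gain (u0 : 'rV[R]_n) : `|u0| = 1 -> exists eps del Q0 : R, [/\ 0 < eps, 0 < del, 1 <= Q0 &
  forall Q x, Q0 <= Q -> `|x - Q ^+ 18 *: u0| <= del * Q ^+ 18 ->
    (\int[P]_om (dot (u x 1 om) (u x 1 om))%:E + (eps * Q ^+ 12)%:E <= (dot x x + 2 * nv)%:E)%E].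
Proof.
move=> u01; have [Y [eta [e0 esc]]] := escape_exists dd u01.
have [|K' K'1 PK'] := good_prob hW (e := 2^-1); first by rewrite invr_gt0.
have K'0 : 0 <= K' by apply: le_trans K'1.
pose K := K' * SS; have K0 : 0 <= K by rewrite mulr_ge0.
have [del [Q1 [d0 d1 Q11 Hesc]]] := esc K K0.
have [ell [Q2 [l0 l1 Q21 Hdis]]] := untrapped_dissipation dd K0.
have [q1 [Q3 [q10 Q31 Hb1]]] := hit_box Y e0.
have [q2 [Q4 [q20 Q41 Hb2]]] := hit_box (- Y) e0.
pose q := Num.min q1 q2; have q0 : 0 < q by rewrite lt_min q10.
have cA0 := dd_cA0 dd.
pose eps := cA * ell * q / 32.
have Y0 := normr_ge0 Y.
exists eps, (del / 2), (Q1 + Q2 + Q3 + Q4 + 8 + `|Y| + eta); split.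
- by rewrite divr_gt0// !mulr_gt0.
- by rewrite divr_gt0.
- by lra_on Q11 Q21 Q31 Q41 Y0 e0.
move=> Q x QQ xu; have Qge1 : 1 <= Q by lra_on QQ Q11 Q21 Q31 Q41 Y0 e0.
have Qp : 0 < Q by apply: lt_le_trans Qge1.
have q18 : 1 <= Q ^+ 18 by rewrite exprn_ege1.
pose h := Q ^- 108; have h0 : 0 < h by rewrite invr_gt0 exprn_gt0.
have e8 : (0 : R) < 8^-1 by rewrite invr_gt0.
have e8Q : (8^-1)^-1 <= Q by rewrite invrK; lra_on QQ Q11 Q21 Q31 Q41 Y0 e0.
have h8 : h <= 8^-1 by exact: pow_inv_le.
have t8 : Q ^- 17 <= 8^-1 by exact: pow_inv_le.
have l8 : ell / Q ^+ 20 <= 8^-1.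
  apply: le_trans (_ : Q ^- 20 <= _); last exact: pow_inv_le.
  by rewrite ler_piMl// invr_ge0 exprn_ge0// ltW.
have s0 : 0 < 1 - h by lra_on h8.
have hs1 : 1 - h <= 1 by lra_on h0.
have hh1 : h <= 1 by lra_on h8.
have i54 : 0 <= Q ^- 54 <= 1.
  by rewrite invr_ge0 exprn_ge0 ?(ltW Qp)//= invf_le1 ?exprn_gt0// exprn_ege1.
have xu' : `|x - Q ^+ 18 *: u0| <= del * Q ^+ 18.
  by apply: le_trans xu _; apply: ler_wpM2r; [exact: le_trans q18|lra_on d0].
have x2 : `|x| <= 3 / 2 * Q ^+ 18.
  rewrite -[x](subrK (Q ^+ 18 *: u0)); apply: le_trans (ler_normD _ _) _.
  rewrite normrZ u01 mulr1 ger0_norm ?(le_trans _ q18)//.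
  have h1 : del / 2 * Q ^+ 18 <= 1 / 2 * Q ^+ 18 by apply: ler_wpM2r; [exact: le_trans q18|lra_on d1].
  by lra_on h1 xu.
pose box Y' : set (brv R n) := [set y | `|(y : 'rV[R]_n) - (x + Q ^- 54 *: Y')| <= eta * Q ^- 54].
have box_le Y' y : `|Y'| = `|Y| -> box Y' y -> `|y| <= 2 * Q ^+ 18.
  move=> YY; rewrite /box /= => H.
  have -> : y = (y - (x + Q ^- 54 *: Y')) + x + Q ^- 54 *: Y' by rewrite -addrA subrK.
  apply: le_trans (ler_normD _ _) _; apply: le_trans (lerD (ler_normD _ _) (lexx _)) _.
  have h1 : `|Q ^- 54 *: Y'| <= `|Y|.
    by rewrite normrZ YY; case/andP: i54 => i0 i1; rewrite ger0_norm// ler_piMl.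
  have h2 : eta * Q ^- 54 <= eta by case/andP: i54 => i0 i1; rewrite ler_piMr// ltW.
  have : (2 * (`|Y| + eta)) * Q ^+ 0 <= Q ^+ 18.
    have YeQ : `|Y| + eta <= Q by lra_on QQ Q11 Q21 Q31 Q41.
    have Q2' : 2 <= Q by lra_on QQ Q11 Q21 Q31 Q41 Y0 e0.
    have : (`|Y| + eta) * Q ^+ 1 <= Q ^+ 2 by exact: pow_absorb.
    have : 2 * Q ^+ 2 <= Q ^+ 18 by exact: pow_absorb.
    rewrite expr0 expr1 mulr1 => h3 h4; have : `|Y| + eta <= (`|Y| + eta) * Q by rewrite ler_peMr// addr_ge0// ltW.
    by lra_on h3 h4.
  by rewrite expr0 mulr1 => h3; lra_on H x2 h1 h2 h3.
pose kap := cA * (Q ^+ 16 / 4) ^+ 2; have kap0 : 0 <= kap by rewrite mulr_ge0 ?(ltW cA0)// sqr_ge0.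
pose l := ell / Q ^+ 20; have l00 : 0 <= l by rewrite divr_ge0 ?(ltW l0)// exprn_ge0// ltW.
have nv0 : 0 <= nv by exact: noise_var_ge0.
have dis y : `|y| <= 2 * Q ^+ 18 -> (((4^-1 : R))%:E <= P (untrapped K' y Q))%E ->
    (\int[P]_om (dot (u y (1 - h) om) (u y (1 - h) om))%:E + (2 * kap * l / 4)%:E <= (dot y y + nv)%:E)%E.
  move=> yQ PU; have := @energy_dissipation _ _ _ P _ W hW hWind _ b S u bL hu (qdrift_dot dd) y (1 - h) l kap _ s0 l00 kap0 (untrapped_meas K' y Q) _.
  move=> H; apply: le_trans (le_trans (H _) _).
  - apply: leeD2l; rewrite EFinM; apply: lee_wpmul2l => //.
    by rewrite lee_fin mulr_ge0// mulr_ge0.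
  - apply: filterS2 (good_ae hW) (flow_sol hu y) => om HK [v [sp v0 vu]] [Kom [r /= /andP[r0 r1] Hr]].
    exists (ratr r); split=> //; first by rewrite /l; lra_on r1 t8 l8 h8.
    move=> s /andP[sr se]; have gK := small_noise_good (HK K' Kom).
    rewrite -(vu s (le_trans r0 sr)).
    have Q2Q : Q2 <= Q by lra_on QQ Q11 Q21 Q31 Q41 Y0 e0.
    have v0Q : `|v 0| <= 2 * Q ^+ 18 by rewrite v0.
    have rl1 : ratr r + ell / Q ^+ 20 <= 1 by lra_on r1 t8 l8.
    have Hr' : Q ^+ 16 / 2 <= `|pz (v (ratr r))| by rewrite vu// ltW.
    by apply: (Hdis Q _ v (ratr r) Q2Q sp gK v0Q r0 rl1 Hr'); rewrite sr.
  by rewrite lee_fin lerD2l; exact: (ler_piMr nv0 hs1).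
(* Either every point of the box at +Y escapes with probability at least 1/4, or some [y1] in it
   does not. In the second case the escape events of [y1] and of any [y2] in the box at -Y cover an
   event of probability at least 1/2, so every such [y2] escapes with probability at least 1/4. The
   favourable box is thus fixed before the noise acts. *)
have dich : exists2 Y', `|Y'| = `|Y| /\ (q%:E <= P (u x h @^-1` box Y'))%E &
    forall y, box Y' y -> (((4^-1 : R))%:E <= P (untrapped K' y Q))%E.
  have x22 : `|x| <= 2 * Q ^+ 18 by lra_on x2 q18.
  have hb1 : (q%:E <= P (u x h @^-1` box Y))%E.
    apply: le_trans (Hb1 Q x _ x22); last by lra_on QQ Q11 Q21 Q31 Q41 Y0 e0.
    by rewrite lee_fin ge_min lexx.
  have hb2 : (q%:E <= P (u x h @^-1` box (- Y)%R))%E.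
    apply: le_trans (Hb2 Q x _ x22); last by lra_on QQ Q11 Q21 Q31 Q41 Y0 e0.
    by rewrite lee_fin ge_min lexx orbT.
  have [H|/existsNP[y1 /not_implyP[b1 P1]]] := pselect (forall y, box Y y -> (((4^-1 : R))%:E <= P (untrapped K' y Q))%E).
    by exists Y.
  exists (- Y); first by rewrite normrN.
  move=> y2 b2.
  have U12 : (P (good W K') <= P (untrapped K' y1 Q `|` untrapped K' y2 Q))%E.
    apply: as_prob_le; [exact: good_measurable|exact: measurableU|].
    apply: filterS3 (good_ae hW) (flow_sol hu y1) (flow_sol hu y2) => om HK [v1 [sp1 v10 vu1]] [v2 [sp2 v20 vu2]] Kom.
    have gK := small_noise_good (HK K' Kom).
    have [] := Hesc Q x _ v1 v2 _ xu' sp1 sp2 gK.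
    - by lra_on QQ Q11 Q21 Q31 Q41 Y0 e0.
    - by rewrite v10 -addrA -opprD.
    - by rewrite v20; move: b2; rewrite /box /= scalerN opprD opprK addrA.
    move=> t tI [Ht|Ht].
      have [r rI Hr] := rational_time sp1.1 Qge1 tI Ht; left; split=> //; exists r => //=.
      by rewrite -vu1//; case/andP: rI.
    have [r rI Hr] := rational_time sp2.1 Qge1 tI Ht; right; split=> //; exists r => //=.
    by rewrite -vu2//; case/andP: rI.
  have m1 := untrapped_meas K' y1 Q; have m2 := untrapped_meas K' y2 Q.
  have U : ((1 - 2^-1)%:E <= P (untrapped K' y1 Q) + P (untrapped K' y2 Q))%E.
    by apply: le_trans PK' (le_trans U12 _); exact: measureU2.
  have f1 := fineK (fin_num_measure P _ m1); have f2 := fineK (fin_num_measure P _ m2).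
  move/negP: P1 U; rewrite -f1 -f2 -EFinD !lee_fin -ltNge => h1 h2; lra_on h1 h2.
case: dich => Y' [YY hbox] HU.
pose kl : R := 2 * kap * l / 4; have kl0 : 0 <= kl by rewrite divr_ge0// mulr_ge0// mulr_ge0.
pose inner y := (\int[P]_om (dot (u y (1 - h) om) (u y (1 - h) om))%:E)%E.
have dd0 (y : 'rV[R]_n) : (0 <= (dot y y : R)%:E)%E by rewrite lee_fin dot_ge0.
have mdot : measurable_fun setT (fun y : brv R n => (dot (y : 'rV[R]_n) (y : 'rV[R]_n))%:E).
  apply/measurable_EFinP.
  by apply: (dot_measurable (T := brv R n) (X := fun y : brv R n => (y : 'rV[R]_n))); exact: measurable_id.
have minner : measurable_fun setT (inner : brv R n -> \bar R).
  have -> : inner = fun y => (\int[transk hW bL hu s0 y]_z (dot z z)%:E)%E.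
    by apply/funext => y; rewrite integral_transk.
  by apply: measurable_fun_integral_kernel => // U mU; exact: measurable_kernel.
have inner0 y : (0 <= inner y)%E by apply: integral_ge0 => om _; exact: dd0.
have base y : (inner y <= (dot y y + nv)%:E)%E.
  have := @energy_dissipation _ _ _ P _ W hW hWind _ b S u bL hu (qdrift_dot dd) y (1 - h) 0 0 set0 s0 (lexx 0) (lexx 0) measurable0 _.
  rewrite mulr0 mul0e adde0 => H; apply: le_trans (H _) _; first exact: aeW.
  by rewrite lee_fin lerD2l; exact: (ler_piMr nv0 hs1).
have key y : (inner y + (kl * \1_(box Y') y)%:E <= (dot y y + nv)%:E)%E.
  rewrite indicE; have [|_] := boolP (y \in box Y'); last by rewrite mulr0 adde0.
  by rewrite inE mulr1 => bx; apply: dis; [exact: (box_le Y')|exact: HU].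
have mbox : measurable (box Y') by exact: ball_meas.
have mu : measurable_fun setT (u x h : Omega -> brv R n) := flow_meas hu x (ltW h0).
have e1 : (\int[P]_om (dot (u x 1 om) (u x 1 om))%:E = \int[P]_om inner (u x h om))%E.
  have -> : 1 = h + (1 - h) :> R by rewrite addrC subrK.
  by rewrite -(transk_comp_integral hW hWind bL hu h0 s0 x mdot dd0).
have mio : measurable_fun setT (fun om => inner (u x h om)) := measurableT_comp minner mu.
have m1 : measurable_fun setT (fun om => (kl * \1_(box Y') (u x h om))%:E).
  apply/measurable_EFinP; apply: measurable_funM => //.
  exact: (measurableT_comp (measurable_indic mbox) mu).
have e2 : (\int[P]_om (kl * \1_(box Y') (u x h om))%:E = kl%:E * P (u x h @^-1` box Y'))%E.
  have mp : measurable (u x h @^-1` box Y') by rewrite -[X in measurable X]setTI; exact: (mu measurableT _ mbox).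
  under eq_integral do rewrite EFinM.
  rewrite ge0_integralZl_EFin//.
    by congr (_ * _)%E; rewrite -[in RHS](setIT (u x h @^-1` box Y')) -integral_indic.
  by apply/measurable_EFinP; exact: (measurableT_comp (measurable_indic mbox) mu).
have e3 : (\int[P]_om (inner (u x h om) + (kl * \1_(box Y') (u x h om))%:E) <=
    \int[P]_om (dot (u x h om) (u x h om) + nv)%:E)%E.
  apply: ge0_le_integral => //.
  - by move=> om _; rewrite adde_ge0// lee_fin mulr_ge0.
  - exact: emeasurable_funD.
  - apply/measurable_EFinP; apply: measurable_funD => //; exact: dot_measurable.
have e4 : (\int[P]_om (dot (u x h om) (u x h om) + nv)%:E <= (dot x x + 2 * nv)%:E)%E.
  under eq_integral do rewrite EFinD.
  rewrite ge0_integralD//; last by apply/measurable_EFinP; exact: dot_measurable.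
  rewrite integral_prob_cst.
  have := @energy_dissipation _ _ _ P _ W hW hWind _ b S u bL hu (qdrift_dot dd) x h 0 0 set0 h0 (lexx 0) (lexx 0) measurable0 _.
  rewrite mulr0 mul0e adde0 => H; apply: le_trans (leeD2r _ (H _)) _; first exact: aeW.
  rewrite -EFinD lee_fin -addrA lerD2l.
  have : nv * h <= nv by exact: (ler_piMr nv0 hh1).
  by rewrite /nv => h2; lra_on h2.
rewrite e1; apply: le_trans (le_trans e3 e4).
have -> : (\int[P]_om (inner (u x h om) + (kl * \1_(box Y') (u x h om))%:E) =
    \int[P]_om inner (u x h om) + \int[P]_om (kl * \1_(box Y') (u x h om))%:E)%E.
  apply: ge0_integralD => //.
  by move=> om _; rewrite lee_fin mulr_ge0.
rewrite e2; apply: leeD2l.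
have -> : eps * Q ^+ 12 = kl * q by rewrite /eps /kl /kap /l; field; rewrite gt_eqF.
by rewrite EFinM; apply: lee_wpmul2l => //; rewrite lee_fin.
Qed.

End Gain.

Section Drift.
Context {R : realType} {d : measure_display} {Omega : measurableType d}.
Variable P : probability Omega R.
Context {I : finType}.
Variable W : I -> R -> Omega -> R.
Hypothesis hW : forall i, brownian P (W i).
Hypothesis hWind : independent_processes P W.
Context {n : nat}.
Variable S : I -> 'rV[R]_n.
Variables (Ks : pred 'I_n) (B : 'rV[R]_n -> 'rV[R]_n -> 'rV[R]_n) (A : 'M[R]_n) (CB cA : R).
Hypothesis dd : dissipative_drift Ks B A CB cA.
Local Notation b := (qdrift B A).
Local Notation pz := (pz Ks).
Variable u : 'rV[R]_n -> R -> Omega -> 'rV[R]_n.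
Hypothesis hu : flow P W b S u.
Variables (iota : 'I_n -> I) (sg : 'I_n -> R).
Hypotheses (iota_inj : injective iota) (sg0 : forall l, sg l != 0).
Hypothesis S_iota : forall l, S (iota l) = sg l *: delta_mx 0 l.

Let bL := qdrift_loclip dd.
Let nv := noise_var S.

Lemma sphere_compact : compact [set y : 'rV[R]_n | `|y| = 1].
Proof.
case: n => [|m].
  have -> : [set y : 'rV[R]_0 | `|y| = 1] = set0; last exact: compact0.
  apply/seteqP; split=> y //= y1; have : y = 0 by apply/rowP => -[].
  by move=> y0; move: y1; rewrite y0 normr0 => /eqP; rewrite eq_sym oner_eq0.
apply: bounded_closed_compact.
  by exists 1; split; [exact: num_real|move=> M M1 y /= ->; exact: ltW].
apply: (@closed_comp _ _ (fun y : 'rV[R]_m.+1 => `|y|) [set 1]).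
  by move=> y _; exact: norm_continuous.
exact: closed_eq.
Qed.

Lemma drift_bound : exists eps C : R, [/\ 0 < eps, 0 <= C & forall x,
  (\int[P]_om (dot (u x 1 om) (u x 1 om))%:E + (eps * `|x| `^ (2 / 3))%:E <= (dot x x + C)%:E)%E].
Proof.
have nv0 : 0 <= nv by exact: noise_var_ge0.
have base x : (\int[P]_om (dot (u x 1 om) (u x 1 om))%:E <= (dot x x + nv)%:E)%E.
  have := @energy_dissipation _ _ _ P _ W hW hWind _ b S u bL hu (qdrift_dot dd) x 1 0 0 set0 ltr01 (lexx 0) (lexx 0) measurable0 _.
  by rewrite mulr0 mul0e adde0 mulr1; apply; exact: aeW.
(* A single parameter is both the threshold for [Q] and the inverse of the gain, so that compactness
   of the sphere yields one [M] for all directions. *)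
pose good_gain (M : R) (y : 'rV[R]_n) := forall Q : R, M <= Q ->
  (\int[P]_om (dot (u (Q ^+ 18 *: y) 1 om) (u (Q ^+ 18 *: y) 1 om))%:E + (M^-1 * Q ^+ 12)%:E <=
    (dot (Q ^+ 18 *: y) (Q ^+ 18 *: y) + 2 * nv)%:E)%E.
have : \forall M \near +oo%R, [set y : 'rV[R]_n | `|y| = 1] `<=` good_gain M.
  have nc := (compact_near_coveringP _).1 sphere_compact.
  apply: (nc R (+oo%R) good_gain) => u0 /= u01.
  have [eps [del [Q0 [e0 d0 Q01 H]]]] := local_gain hW hWind dd hu sg0 S_iota u01.
  exists ([set y | `|u0 - y| <= del], [set M | Num.max Q0 eps^-1 <= M]) => /=.
    split; last by apply: nbhs_pinfty_ge; exact: num_real.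
    by apply: (@cvgrPdist_le _ _ _ (nbhs u0) (nbhs_filter u0) id u0).1 => //; exact: cvg_id.
  move=> [y M] /= [yd]; rewrite ge_max => /andP[QM eM] Q MQ.
  have M0 : 0 < M by apply: lt_le_trans eM; rewrite invr_gt0.
  have Q1 : 1 <= Q by rewrite (le_trans Q01)// (le_trans QM).
  apply: le_trans (H Q (Q ^+ 18 *: y) (le_trans QM MQ) _).
    apply: leeD2l; rewrite lee_fin ler_wpM2r ?exprn_ge0 ?(le_trans _ Q1)//.
    by rewrite -[eps]invrK lef_pV2// posrE invr_gt0.
  rewrite -scalerBr normrZ distrC ger0_norm ?exprn_ge0 ?(le_trans _ Q1)// mulrC.
  by rewrite ler_wpM2r// exprn_ge0// (le_trans _ Q1).
move=> [M0 [_ HM]]; pose M := 1 + `|M0|.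
have M1 : 1 <= M by rewrite lerDl.
have Mp : 0 < M by apply: lt_le_trans M1.
have HG := HM M; have MM : M0 < M by rewrite /M ltr_pwDl// ler_norm.
have {}HG := HG MM; have Mi0 : 0 < M^-1 by rewrite invr_gt0.
exists M^-1, (2 * nv + M^-1 * M ^+ 12); split=> //.
  by apply: addr_ge0; apply: mulr_ge0 => //; [exact: ltW|exact: exprn_ge0 (ltW Mp)].
move=> x; pose Q := `|x| `^ (18^-1).
have Q0 : 0 <= Q by exact: powR_ge0.
have Q18 : Q ^+ 18 = `|x|.
  by rewrite -powR_mulrn// /Q -powRrM mulVf ?pnatr_eq0// powRr1.
have Q12 : `|x| `^ (2 / 3) = Q ^+ 12.
  by rewrite -powR_mulrn// /Q -powRrM; congr (_ `^ _); field.
rewrite Q12; have [QM|MQ] := leP Q M.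
  apply: (@le_trans _ _ ((dot x x + nv)%:E + (M^-1 * M ^+ 12)%:E)%E).
    by apply: leeD => //; rewrite lee_fin ler_wpM2l ?(ltW Mi0)// lerXn2r// nnegrE ltW.
  by rewrite -EFinD lee_fin; lra.
have x0 : 0 < `|x| by rewrite -Q18 exprn_gt0// (lt_trans Mp).
pose y := `|x|^-1 *: x.
have y1 : `|y| = 1 by rewrite normrZ normfV normr_id mulVf// gt_eqF.
have xE : x = Q ^+ 18 *: y by rewrite Q18 scalerA mulfV ?scale1r// gt_eqF.
have := HG y y1 Q (ltW MQ); rewrite -xE => H; apply: le_trans H _.
by rewrite lee_fin lerD2l lerDl mulr_ge0 ?exprn_ge0// ltW.
Qed.

End Drift.

(** * Invariant measure of the abstract system *)

Section Ergodic.
Context {R : realType} {d : measure_display} {Omega : measurableType d}.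
Variable P : probability Omega R.
Context {I : finType}.
Variable W : I -> R -> Omega -> R.
Hypothesis hW : forall i, brownian P (W i).
Hypothesis hWind : independent_processes P W.
Context {n : nat}.
Variable S : I -> 'rV[R]_n.
Variables (Ks : pred 'I_n) (B : 'rV[R]_n -> 'rV[R]_n -> 'rV[R]_n) (A : 'M[R]_n) (CB cA : R).
Hypothesis dd : dissipative_drift Ks B A CB cA.
Local Notation b := (qdrift B A).
Local Notation pz := (pz Ks).
Variable u : 'rV[R]_n -> R -> Omega -> 'rV[R]_n.
Hypothesis hu : flow P W b S u.
Variables (iota : 'I_n -> I) (sg : 'I_n -> R).
Hypotheses (iota_inj : injective iota) (sg0 : forall l, sg l != 0).
Hypothesis S_iota : forall l, S (iota l) = sg l *: delta_mx 0 l.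

Let bL := qdrift_loclip dd.
Theorem ergodic : exists mu : probability (brv R n) R,
  [/\ forall (t : R) (B : set (brv R n)), 0 <= t -> measurable B -> (\int[mu]_x P (u x t @^-1` B) = mu B)%E,
      forall nu : probability (brv R n) R,
        (forall B : set (brv R n), measurable B -> (\int[nu]_x P (u x 1 @^-1` B) = nu B)%E) ->
        forall B : set (brv R n), measurable B -> nu B = mu B
    & (\int[mu]_x (`|x : 'rV[R]_n| `^ (2 / 3))%:E < +oo)%E].
Proof.
pose K t (t0 : 0 < t) := transk hW bL hu t0.
pose K1 := K 1 ltr01.
have [eps [C [e0 C0 drift]]] := drift_bound hW hWind dd hu sg0 S_iota.
pose c3 (x : 'rV[R]_n) : R := `|x| `^ (2 / 3).
have c30 x : 0 <= c3 x by exact: powR_ge0.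
(* Half of the gain is kept in [f]; the other half exceeds C + 1 outside the ball of radius [r],
   which serves as small set. *)
pose f (x : brv R n) : R := 1 + eps / 2 * c3 x.
pose V (x : brv R n) : R := dot (x : 'rV[R]_n) x.
pose r : R := (2 * (C + 1) / eps) `^ (3 / 2).
have r0 : 0 <= r by exact: powR_ge0.
pose Cr : set (brv R n) := [set x | `|x : 'rV[R]_n| <= r].
have cn : continuous (fun x : 'rV[R]_n => `|x|) by move=> x; exact: norm_continuous.
have mn : measurable_fun setT (fun x : brv R n => `|x : 'rV[R]_n|) := continuous_brv cn.
have mc3 : measurable_fun setT (c3 : brv R n -> R).
  exact: (measurableT_comp (@measurable_powR R (2 / 3)) mn).
have mCr : measurable Cr.
  have := mn measurableT _ (measurable_itv `]-oo, r]); rewrite setTI.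
  by congr measurable; apply/seteqP; split=> x /=; rewrite in_itv.
have mf : measurable_fun setT f.
  by apply: measurable_funD => //; apply: measurable_funM.
have mV : measurable_fun setT V.
  by apply: (dot_measurable (T := brv R n) (X := fun y : brv R n => (y : 'rV[R]_n))); exact: measurable_id.
have [nu [c [c0 minor]]] := minorization hW hWind bL hu iota_inj sg0 S_iota r0.
have V0 x : 0 <= V x by exact: dot_ge0.
have f1 x : 1 <= f x by rewrite lerDl mulr_ge0// divr_ge0// ltW.
have C10 : 0 <= C + 1 by rewrite addr_ge0.
have dr (x : brv R n) : (\int[K1 x]_y (V y)%:E + (f x)%:E <= (V x + (C + 1) * \1_Cr x)%:E)%E.
  rewrite integral_transk//; last exact/measurable_EFinP.
  have h1 := drift x; rewrite -/(c3 x) in h1.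
  have h2 : (\int[P]_om (V (u x 1 om))%:E <= (V x + C - eps * c3 x)%:E)%E.
    by rewrite EFinB leeBrDr.
  apply: le_trans (leeD2r _ h2) _; rewrite -EFinD lee_fin /f.
  suff : 0 <= (C + 1) * \1_Cr x - C - 1 + eps / 2 * c3 x by lra.
  rewrite indicE; have [_|] := boolP (x \in Cr); rewrite ?mulr1 ?mulr0.
    have : 0 <= eps / 2 * c3 x by rewrite mulr_ge0// divr_ge0// ltW.
    by lra.
  move/negP; rewrite inE /Cr /= => /negP; rewrite -ltNge => rx.
  have h3 : 2 * (C + 1) / eps <= c3 x.
    have -> : 2 * (C + 1) / eps = r `^ (2 / 3).
      rewrite /r -powRrM; have -> : 3 / 2 * (2 / 3) = 1 :> R by field.
      by rewrite powRr1// divr_ge0 ?mulr_ge0// ltW.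
    by apply: ge0_ler_powR; rewrite ?nnegrE ?divr_ge0 ?(ltW rx).
  have : eps / 2 * (2 * (C + 1) / eps) <= eps / 2 * c3 x by rewrite ler_wpM2l// divr_ge0// ltW.
  have -> : eps / 2 * (2 * (C + 1) / eps) = C + 1 by field; rewrite gt_eqF.
  by lra.
have Cr0 : Cr (0 : 'rV[R]_n) by rewrite /Cr /= normr0.
have minor' (x : brv R n) (D : set (brv R n)) : Cr x -> measurable D -> (c%:E * nu D <= K1 x D)%E.
  by move=> Cx mD; exact: minor.
have [mu [mui muu muf]] := harris c0 mCr minor' V0 f1 mV mf C10 dr Cr0.
exists mu; split; last 1 first.
- have i0 : (\int[mu]_x (c3 x)%:E <= (2 / eps)%:E * \int[mu]_x (f x)%:E)%E.
    rewrite -ge0_integralZl_EFin//; last 3 first.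
    + by move=> x _; rewrite lee_fin (le_trans ler01).
    + exact/measurable_EFinP.
    + by rewrite divr_ge0// ltW.
    apply: ge0_le_integral => //.
    + by move=> x _; rewrite lee_fin.
    + exact/measurable_EFinP.
    + by apply/measurable_EFinP; apply: measurable_funM.
    move=> x _; rewrite -EFinM lee_fin /f mulrDr mulrA.
    have -> : 2 / eps * (eps / 2) = 1 by field; rewrite gt_eqF.
    by rewrite mul1r mulr1 lerDr divr_ge0// ltW.
  apply: le_lt_trans i0 _; rewrite lte_mul_pinfty// ?lee_fin ?divr_ge0// ltW//.
- move=> t D; rewrite le_eqVlt => /orP[/eqP <- mD|t0 mD].
    transitivity (\int[mu]_x (\1_D x)%:E)%E; last by rewrite integral_indic// setIT.
    apply: eq_integral => x _; rewrite indicE.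
    have m0 : measurable (u x 0 @^-1` D).
      rewrite -[X in measurable X]setTI; have m := flow_meas hu x (lexx 0).
      exact: (m measurableT _ mD).
    have [xD|xD] := boolP (x \in D).
      rewrite -(probability_setT P); apply: as_prob_eq => //.
      by apply: filterS (flow_init hu x) => om /= ->; split=> // _; rewrite inE in xD.
    transitivity (P set0); last by rewrite measure0.
    apply: as_prob_eq => //.
    by apply: filterS (flow_init hu x) => om /= ->; split=> // Dx; move/negP: xD; rewrite inE.
  (* The image of [mu] under the kernel of time [t] is invariant for time 1, because the kernels
     commute, and is therefore [mu] by uniqueness. *)
  pose M : {measure set (brv R n) -> \bar R} := mkcomp_noparam (kcst mu) (K t t0) (0 : 'rV[R]_n).
  have ME B' : (M B' = \int[mu]_y K t t0 y B')%E by [].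
  have M1 : M setT = 1%E.
    rewrite ME (eq_integral (cst 1%E)) ?integral_prob_cst//.
    by move=> y _; rewrite prob_kernel.
  pose mut : probability (brv R n) R := mnormalize M mu.
  have mutE B' : mut B' = M B'.
    by rewrite /mut /= /mnormalize M1 eqe oner_eq0/= invr1 mule1.
  rewrite -[LHS]/(M D) -mutE; apply: muu => // B' mB'.
  transitivity (\int[M]_x K1 x B')%E.
    by apply: eq_measure_integral => F mF _; exact: mutE.
  rewrite integral_kcomp_noparam//; last exact: measurable_kernel.
  have t10 : 0 < t + 1 by rewrite addr_gt0.
  have t01 : 0 < 1 + t by rewrite addr_gt0.
  transitivity (\int[mu]_y (K (t + 1)%R t10 y B'))%E.
    by apply: eq_integral => y _; rewrite (transk_comp hW hWind bL hu t0 ltr01 t10).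
  transitivity (\int[mu]_y (K (1 + t)%R t01 y B'))%E.
    by apply: eq_integral => y _; rewrite /K !transkE addrC.
  transitivity (\int[mu]_y (\int[K1 y]_z K t t0 z B'))%E.
    by apply: eq_integral => y _; rewrite (transk_comp hW hWind bL hu ltr01 t0 t01).
  rewrite (invariant_integral mui)//; last exact: measurable_kernel.
- by move=> nu' H; apply: muu.
Qed.

End Ergodic.

(** * Trigonometric states *)

Section TorusIntegrals.
Context {R : realType}.
Local Notation mu := (@lebesgue_measure R).
Local Notation D := (`[0%R, (2 * pi)%R]%classic : set R).
Implicit Types (j k : int * int) (t : R).

(** A phase treats cosines and sines at once, the sine being the phase -pi/2. *)
Definition trig j t (x : R * R) : R := cos (phase j x + t).

Lemma phaseD j k (x : R * R) : phase (j + k) x = phase j x + phase k x :> R.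
Proof. by rewrite /phase /= !intrD; ring. Qed.

Lemma phaseN j (x : R * R) : phase (- j) x = - phase j x :> R.
Proof. by rewrite /phase /= !intrN; ring. Qed.

Lemma cosM (a c : R) : cos a * cos c = 2^-1 * (cos (a - c) + cos (a + c)).
Proof. by rewrite cosB cosD; field. Qed.

Lemma sinM (a c : R) : sin a * sin c = 2^-1 * (cos (a - c) - cos (a + c)).
Proof. by rewrite cosB cosD; field. Qed.

Lemma trigM j k s t x : trig j s x * trig k t x =
  2^-1 * (trig (j - k) (s - t) x + trig (j + k) (s + t) x).
Proof.
rewrite /trig cosM !phaseD phaseN; congr (_ * (cos _ + cos _)); ring.
Qed.

Lemma sinDint (x : R) (m : int) : sin (x + m%:~R * (2 * pi)) = sin x.
Proof.
have e n a : sin (a + n%:R * (2 * pi)) = sin a :> R.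
  by rewrite mulr_natl [2 * pi]mulr_natl (periodicn (@sinD2pi R)).
by case: m => n; [exact: e|rewrite NegzE mulrNz mulNr -[in RHS](subrK (n.+1%:R * (2 * pi)) x) e].
Qed.

Lemma is_derive_affine (a c y : R) : is_derive y 1 (fun y : R => a + c * y) c.
Proof.
have -> : (fun y : R => a + c * y) = (cst a : R -> R^o) + c *: (id : R -> R^o) by [].
apply: (is_derive_eq (is_deriveD (is_derive_cst (a : R^o) y 1) (is_deriveZ _ (is_derive_id y 1)))).
by rewrite /GRing.scale/= mulr1 add0r.
Qed.

Lemma integral_cos_period (r c : R) (m : int) :
  (\int[mu]_(y in D) (r * cos (c + m%:~R * y))%:E =
   (if m == 0 then r * (2 * pi * cos c) else 0)%:E)%E.
Proof.
have p0 : 0 < 2 * pi :> R by rewrite mulr_gt0 ?pi_gt0.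
have [->|m0] := eqVneq m 0.
  under eq_integral do rewrite mul0r addr0.
  rewrite integral_cst//= lebesgue_measure_itv/= lte_fin p0 -EFinB -EFinM subr0.
  by congr _%:E; ring.
have m0' : m%:~R != 0 :> R by rewrite intr_eq0.
pose F (y : R) : R := r * sin (c + m%:~R * y) / m%:~R.
have dF (y : R) : is_derive y 1 F (r * cos (c + m%:~R * y)).
  have h := is_derive_affine c m%:~R y.
  have h2 := is_derive1_comp (f := @sin R) (g := fun y : R => c + m%:~R * y) (x := y) (is_derive_sin _) h.
  have -> : F = (r / m%:~R) *: (sin \o (fun y : R => c + m%:~R * y)).
    by apply/funext => z; rewrite /F /= mulrAC.
  apply: (is_derive_eq (is_deriveZ _ h2)).
  by rewrite /GRing.scale/=; field.
have cF : continuous F.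
  by move=> y; apply: differentiable_continuous; apply/derivable1_diffP; case: (dF y).
have cc : continuous (fun y : R => r * cos (c + m%:~R * y)).
  move=> y; apply: cvgM; first exact: cvg_cst.
  apply: (@continuous_comp _ _ _ (fun y : R => c + m%:~R * y) cos); last exact: continuous_cos.
  by apply: cvgD; [exact: cvg_cst|apply: cvgM; [exact: cvg_cst|exact: cvg_id]].
rewrite (continuous_FTC2 (F := F) p0).
- by rewrite -EFinB /F sinDint mulr0 addr0 subrr.
- exact: continuous_subspaceT.
- split; [by move=> y _; case: (dF y)|apply: cvg_at_right_filter; exact: cF|apply: cvg_at_left_filter; exact: cF].
- by move=> y _; rewrite derive1E; case: (dF y).
Qed.

Local Notation LR := (g_sigma_algebraType (R.-ocitv.-measurable)).

Lemma torus_dom_measurable : measurable (@torus_dom R : set (LR * LR)).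
Proof. by apply: measurableX; exact: measurable_itv. Qed.

Lemma trig_measurable j t : measurable_fun setT (trig j t).
Proof.
apply: (measurableT_comp (f := cos)); first by apply: continuous_measurable_fun; exact: continuous_cos.
by apply: measurable_funD => //; apply: measurable_funD; apply: measurable_funM.
Qed.

Lemma torus_integrable (f : R * R -> R) (M : R) : measurable_fun setT f -> (forall x, `|f x| <= M) ->
  (mu \x mu)%E.-integrable torus_dom (EFin \o f).
Proof.
move=> mf fM; have tf : ((mu \x mu)%E (@torus_dom R) < +oo)%E.
  have -> : (mu \x mu)%E torus_dom = (mu D * mu D)%E by apply: product_measure1E; exact: measurable_itv.
  by apply: lte_mul_pinfty; rewrite ?measure_ge0//= lebesgue_measure_itv/=; case: ifP => _; rewrite ?ltry.
apply: measurable_bounded_integrable.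
- exact: torus_dom_measurable.
- exact: tf.
- exact: measurable_funTS.
- by exists M; split; [exact: num_real|move=> a Ma x _ /=; apply: le_trans (fM x) (ltW Ma)].
Qed.

Lemma trig_le j t x : `|trig j t x| <= 1.
Proof. by rewrite ler_norml cos_geN1 cos_le1. Qed.

Lemma torus_int_trig j t : torus_int (trig j t) = if j == 0 then (2 * pi) ^+ 2 * cos t else 0.
Proof.
have iT := (integrable_mkcond _ torus_dom_measurable).1 (torus_integrable (trig_measurable j t) (@trig_le j t)).
rewrite /torus_int /Rintegral integral_mkcond -(integral12_prod_meas1 iT).
pose F (x : R) : \bar R := (if j.2 == 0 then 1 * (2 * pi * cos (t + j.1%:~R * x)) else 0)%:E.
have -> : (\int[mu]_x fubini_F mu ((EFin \o trig j t) \_ torus_dom) x = \int[mu]_x (F \_ D) x)%E.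
  apply: eq_integral => x _; rewrite /fubini_F patchE; case: ifPn => [|/negP]; rewrite inE => xI.
    rewrite /F -(integral_cos_period 1 (t + j.1%:~R * x) j.2) [RHS]integral_mkcond.
    apply: eq_integral => y _; rewrite !patchE.
    have -> : ((x, y) \in torus_dom) = (y \in `[0, 2 * pi]%classic) :> bool.
      by apply/idP/idP; rewrite !inE; [case|split].
    by case: ifP => // _; rewrite /trig /phase /=; rewrite mul1r; congr (cos _)%:E; ring.
  rewrite (eq_integral (cst 0%E)) ?integral0// => y _; rewrite patchE ifF//.
  by apply/negP; rewrite inE => -[].
rewrite -integral_mkcond /F; case: j {iT F} => j1 j2 /=; rewrite xpair_eqE.
have [j20|j20] := eqVneq j2 0; last by rewrite integral0 andbF.
under eq_integral do rewrite mul1r.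
rewrite integral_cos_period andbT /=; case: ifP => // _.
by rewrite mulrA expr2.
Qed.

End TorusIntegrals.

Section BoundedFunctions.
Context {R : realType}.
Implicit Types (f g : R * R -> R) (j k : int * int) (s t : R).

(** A class closed under sums and products on which [torus_int] is linear. *)
Definition bmeas f := measurable_fun setT f /\ exists M, forall x, `|f x| <= M.

Lemma bmeasD f g : bmeas f -> bmeas g -> bmeas (fun x => f x + g x).
Proof.
move=> [mf [M HM]] [mg [M' HM']]; split; first exact: measurable_funD.
by exists (M + M') => x; apply: le_trans (ler_normD _ _) _; exact: lerD.
Qed.

Lemma bmeasM f g : bmeas f -> bmeas g -> bmeas (fun x => f x * g x).
Proof.
move=> [mf [M HM]] [mg [M' HM']]; split; first exact: measurable_funM.
by exists (M * M') => x; rewrite normrM; exact: ler_pM.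
Qed.

Lemma bmeas_cst c : bmeas (fun=> c).
Proof. by split; [exact: measurable_cst|exists `|c|]. Qed.

Lemma bmeas_sum (I : finType) (F : I -> R * R -> R) : (forall i, bmeas (F i)) ->
  bmeas (fun x => \sum_i F i x).
Proof.
move=> HF; elim: (index_enum I) => [|i r IH].
  by under [X in bmeas X]eq_fun do rewrite big_nil; exact: bmeas_cst.
by under [X in bmeas X]eq_fun do rewrite big_cons; exact: bmeasD.
Qed.

Lemma bmeas_trig j t : bmeas (trig j t).
Proof. by split; [exact: trig_measurable|exists 1; exact: trig_le]. Qed.

Lemma torus_intD f g : bmeas f -> bmeas g ->
  torus_int (fun x => f x + g x) = torus_int f + torus_int g.
Proof.
move=> [mf [M HM]] [mg [M' HM']].
by apply: RintegralD; [exact: torus_dom_measurable|exact: torus_integrable HM|exact: torus_integrable HM'].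
Qed.

Lemma torus_intZ c f : bmeas f -> torus_int (fun x => c * f x) = c * torus_int f.
Proof.
by move=> [mf [M HM]]; apply: RintegralZl; [exact: torus_dom_measurable|exact: torus_integrable HM].
Qed.

Lemma torus_int_sum (I : finType) (F : I -> R * R -> R) : (forall i, bmeas (F i)) ->
  torus_int (fun x => \sum_i F i x) = \sum_i torus_int (F i).
Proof.
move=> HF; elim: (index_enum I) => [|i r IH].
  rewrite big_nil; under [X in torus_int X]eq_fun do rewrite big_nil -(mul0r 0).
  by rewrite (torus_intZ 0 (bmeas_cst 0)) mul0r.
rewrite big_cons -IH -torus_intD//.
  by congr torus_int; apply/funext => x; rewrite big_cons.
elim: r {IH} => [|a r IH].
  by under [X in bmeas X]eq_fun do rewrite big_nil; exact: bmeas_cst.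
by under [X in bmeas X]eq_fun do rewrite big_cons; exact: bmeasD.
Qed.

Lemma torus_int_trigM j k s t : torus_int (fun x => trig j s x * trig k t x) =
  2 * pi ^+ 2 * ((j == k)%:R * cos (s - t) + (j == - k)%:R * cos (s + t)).
Proof.
under [X in torus_int X]eq_fun do rewrite trigM.
rewrite torus_intZ; last by apply: bmeasD; exact: bmeas_trig.
rewrite torus_intD ?torus_int_trig//; [|exact: bmeas_trig|exact: bmeas_trig].
by rewrite subr_eq0 addr_eq0; case: eqP => _; case: eqP => _; rewrite ?mul1r ?mul0r ?addr0 ?add0r ?mulr0//; field.
Qed.

Lemma cos_phase j (x : R * R) : cos (phase j x) = trig j 0 x.
Proof. by rewrite /trig addr0. Qed.

Lemma sin_phase j (x : R * R) : sin (phase j x) = trig j (- (pi / 2)) x.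
Proof. by rewrite /trig cosBpihalf. Qed.

End BoundedFunctions.

(** * Coordinates of trigonometric states and the projection *)

Section Modes.
Context {R : realType} {N : nat}.
Local Notation n := (#|{: mode N}|).
Implicit Types (j k : int * int) (s t : R) (v w : 'rV[R]_n).

Definition inbox k := (`|k.1| <= N%:Z) && (`|k.2| <= N%:Z).

Definition fr (i : 'I_n) : int * int := mfreq (enum_val i).

Definition th (i : 'I_n) : R := if lex_pos (fr i) then 0 else - (pi / 2).

Lemma inboxN k : inbox (- k) = inbox k.
Proof. by rewrite /inbox /= !normrN. Qed.

Lemma freq_inbox (b : box N) : inbox (freq b).
Proof.
by case: b => a c; rewrite /inbox /freq /=; have := ltn_ord a; have := ltn_ord c; lia.
Qed.

Lemma freq_inj : injective (@freq N).
Proof.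
move=> [a c] [a' c'] /= []; rewrite /freq /= => h1 h2.
by congr (_, _); apply: val_inj => /=; lia.
Qed.

Lemma inbox_freq k : inbox k -> exists b : box N, freq b = k.
Proof.
case: k => k1 k2; rewrite /inbox /= => /andP[h1 h2].
have l1 : (`|(k1 + N%:Z)%R|%N < N.*2.+1)%N by lia.
have l2 : (`|(k2 + N%:Z)%R|%N < N.*2.+1)%N by lia.
by exists (Ordinal l1, Ordinal l2); rewrite /freq /=; congr (_, _); lia.
Qed.

Lemma fr_inbox i : inbox (fr i).
Proof. exact: freq_inbox. Qed.

Lemma fr_neq0 i : fr i != 0.
Proof. exact: (valP (enum_val i)). Qed.

Lemma fr_inj : injective fr.
Proof. by move=> i j /freq_inj/val_inj/enum_val_inj. Qed.

Lemma fr_surj k : k != 0 -> inbox k -> exists i, fr i = k.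
Proof.
move=> k0 /inbox_freq[b bk]; have fb : freq b != 0 by rewrite bk.
exists (enum_rank (exist _ b fb : mode N)); rewrite /fr enum_rankK.
by rewrite /mfreq /=.
Qed.

Lemma opp_neq k : k != 0 -> k != - k.
Proof.
apply: contra; case: k => a c /eqP[h1 h2].
by apply/eqP; congr (_, _); lia.
Qed.

Lemma lex_posN k : k != 0 -> lex_pos (- k) = ~~ lex_pos k.
Proof.
case: k => a c k0; rewrite /lex_pos /=; apply/idP/idP; first by lia.
move=> h; suff : (a, c) = 0 \/ a <> 0 \/ c <> 0 by case=> [e|]; [rewrite e eqxx in k0|lia].
have [->|] := eqVneq a 0; last by move/eqP; auto.
have [->|] := eqVneq c 0; last by move/eqP; auto.
by left.
Qed.

(** Of the two opposite frequencies one carries the cosine and the other the sine. *)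
Lemma th_opp i i' : fr i' = - fr i -> th i' = - (pi / 2) - th i.
Proof.
move=> e; rewrite /th e lex_posN ?fr_neq0//; case: (lex_pos (fr i)) => /=; first by rewrite subr0.
by rewrite subrr.
Qed.

Lemma basis_trig i x : basis_fun (enum_val i) x = trig (fr i) (th i) x :> R.
Proof.
by rewrite /basis_fun /th -/(fr i); case: ifP => _; rewrite ?cos_phase ?sin_phase.
Qed.

Lemma vortE w x : vort w x = \sum_i w 0 i * trig (fr i) (th i) x.
Proof. by apply: eq_bigr => i _; rewrite basis_trig. Qed.

(* The state whose vorticity is [cos (k.x + t)], and [0] when [k] is not a mode. *)
Definition st k t : 'rV[R]_n :=
  \row_i ((fr i == k)%:R * cos (t - th i) + (fr i == - k)%:R * cos (t + th i)).

(** The linear relations of (k, t) |-> cos (k.x + t): parity, and expression through two phases a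
    quarter period apart. By [st_sum] a map with these relations is determined by its values at the
    basis functions. *)
Definition trig_like (V : lmodType R) (Phi : int * int -> R -> V) :=
  (forall k t, Phi (- k) (- t) = Phi k t) /\
  forall k s t, Phi k t = cos (t - s) *: Phi k s + sin (t - s) *: Phi k (s + pi / 2).

Lemma st_sum (V : lmodType R) (Phi : int * int -> R -> V) k t : trig_like Phi ->
  k != 0 -> inbox k -> \sum_i st k t 0 i *: Phi (fr i) (th i) = Phi k t.
Proof.
move=> [PN PT] k0 kb; have [i0 e0] := fr_surj k0 kb.
have k0' : - k != 0 by rewrite oppr_eq0.
have [|i1 e1] := fr_surj k0'; first by rewrite inboxN.
have ne : i1 != i0 by apply/eqP => e; move: (opp_neq k0); rewrite -[X in X != _]e0 -e e1 eqxx.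
rewrite (bigD1 i0)//= (bigD1 i1)//= big1 ?addr0; last first.
  move=> i /andP[i_0 i_1]; rewrite mxE -e0 (inj_eq fr_inj) (negbTE i_0) e0 -e1 (inj_eq fr_inj) (negbTE i_1).
  by rewrite !mul0r addr0 scale0r.
have tt : th i1 = - (pi / 2) - th i0 by apply: th_opp; rewrite e1 e0.
rewrite (PT k (th i0) t) !mxE e0 e1 !eqxx tt.
rewrite (negbTE (opp_neq k0)) -[- k == k]eqr_opp opprK (negbTE (opp_neq k0)) !mul0r addr0 add0r !mul1r.
congr (_ + _); have -> : t + (- (pi / 2) - th i0) = t - th i0 - pi / 2 by ring.
by rewrite cosBpihalf -[RHS]/(_ *: _) -PN; congr (_ *: Phi _ _); ring.
Qed.

Lemma st_out k t : ~~ inbox k || (k == 0) -> st k t = 0.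
Proof.
move=> H; apply/rowP => i; rewrite !mxE.
have -> : (fr i == k) = false.
  by apply/eqP => e; move: H; rewrite -e fr_inbox (negbTE (fr_neq0 i)).
have -> : (fr i == - k) = false.
  by apply/eqP => e; move: H; rewrite -inboxN -oppr_eq0 -e fr_inbox (negbTE (fr_neq0 i)).
by rewrite !mul0r addr0.
Qed.

Lemma stN k t : st (- k) (- t) = st k t.
Proof.
apply/rowP => i; rewrite !mxE opprK addrC; congr (_ * _ + _ * _).
  by rewrite -cosN; congr cos; ring.
by rewrite -cosN; congr cos; ring.
Qed.

Lemma cos_lin (a s t : R) : cos (a + t) = cos (t - s) * cos (a + s) + sin (t - s) * cos (a + (s + pi / 2)).
Proof.
have -> : a + (s + pi / 2) = a + s + pi / 2 by ring.
rewrite cosDpihalf mulrN -cosD; congr cos; ring.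
Qed.

Lemma st_lin k s t : st k t = cos (t - s) *: st k s + sin (t - s) *: st k (s + pi / 2).
Proof.
apply/rowP => i; rewrite !mxE.
have h1 : cos (t - th i) = cos (t - s) * cos (s - th i) + sin (t - s) * cos (s + pi / 2 - th i).
  by have := cos_lin (- th i) s t; rewrite ![- th i + _]addrC.
have h2 : cos (t + th i) = cos (t - s) * cos (s + th i) + sin (t - s) * cos (s + pi / 2 + th i).
  by have := cos_lin (th i) s t; rewrite ![th i + _]addrC.
by rewrite h1 h2; ring.
Qed.

Lemma trig_trig_like x : trig_like (fun k t => trig k t x : R^o).
Proof.
split=> [k t|k s t]; first by rewrite /trig phaseN -opprD cosN.
exact: cos_lin.
Qed.

Lemma vort_st k t x : k != 0 -> inbox k -> vort (st k t) x = trig k t x.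
Proof. by move=> k0 kb; rewrite vortE -(st_sum t (trig_trig_like x) k0 kb). Qed.

Lemma vort_lin a v w x : vort (a *: v + w) x = a * vort v x + vort w x.
Proof.
rewrite /vort mulr_sumr -big_split; apply: eq_bigr => i _; rewrite !mxE /=; ring.
Qed.

Lemma vort0 x : vort (0 : 'rV[R]_n) x = 0.
Proof. by rewrite /vort big1// => i _; rewrite mxE mul0r. Qed.

(** The right-hand side is [trig_like] in (k, t), so [st_sum] expands it along the coordinates of
    [st k t]. *)
Lemma dot_st j k s t : k != 0 -> inbox k ->
  dot (st j s) (st k t) = (k == j)%:R * cos (s - t) + (k == - j)%:R * cos (s + t).
Proof.
move=> k0 kb; pose Phi k t : R^o := (k == j)%:R * cos (s - t) + (k == - j)%:R * cos (s + t).
have HP : trig_like Phi.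
  split=> [k' t'|k' r t']; rewrite /Phi.
    by rewrite eqr_opp -[- k' == j]eqr_opp opprK opprK addrC.
  have h1 : cos (s - t') = cos (t' - r) * cos (s - r) + sin (t' - r) * cos (s - (r + pi / 2)).
    have := cos_lin (- s) r t'; rewrite -cosN opprD opprK => ->.
    by congr (_ * _ + _ * _); rewrite -cosN; congr cos; ring.
  by rewrite h1 (cos_lin s r t') /GRing.scale/=; ring.
rewrite -[RHS]/(Phi k t) -(st_sum t HP k0 kb) dotC; apply: eq_bigr => i _.
by rewrite [X in _ * X = _]mxE.
Qed.

Lemma L2_ip_vort v w : L2_ip (vort v) (vort w) = 2 * pi ^+ 2 * dot v w.
Proof.
have bv (u : 'rV[R]_n) : bmeas (fun x : R * R => vort u x : R).
  have -> : (fun x => vort u x : R) = fun x => \sum_i u 0 i * trig (fr i) (th i) x.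
    by apply/funext => x; rewrite vortE.
  by apply: bmeas_sum => i; apply: bmeasM; [exact: bmeas_cst|exact: bmeas_trig].
rewrite /L2_ip.
transitivity (\sum_i v 0 i * torus_int (fun x => trig (fr i) (th i) x * vort w x)).
  have bi i : bmeas (fun x => trig (fr i) (th i) x * vort w x : R) by apply: bmeasM => //; exact: bmeas_trig.
  under eq_bigr do rewrite -torus_intZ//.
  rewrite -torus_int_sum; last by move=> i; apply: bmeasM => //; exact: bmeas_cst.
  congr torus_int; apply/funext => x; rewrite vortE mulr_suml; apply: eq_bigr => i _.
  by rewrite mulrA.
rewrite /dot mulr_sumr; apply: eq_bigr => i _; rewrite mulrCA; congr (_ * _).
transitivity (\sum_l w 0 l * torus_int (fun x => trig (fr i) (th i) x * trig (fr l) (th l) x)).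
  have bi l : bmeas (fun x => trig (fr i) (th i) x * trig (fr l) (th l) x : R) by apply: bmeasM; exact: bmeas_trig.
  under eq_bigr do rewrite -torus_intZ//.
  rewrite -torus_int_sum; last by move=> l; apply: bmeasM => //; exact: bmeas_cst.
  congr torus_int; apply/funext => x; rewrite vortE mulr_sumr; apply: eq_bigr => l _.
  by rewrite mulrCA.
rewrite (bigD1 i)//= big1 ?addr0 => [|l li]; last first.
  rewrite torus_int_trigM (inj_eq fr_inj) eq_sym (negbTE li) mul0r add0r.
  have [e|_] := eqVneq (fr i) (- fr l); last by rewrite mul0r !mulr0.
  by rewrite (th_opp e) subrK cosN cos_pihalf !mulr0.
rewrite torus_int_trigM eqxx subrr cos0 (negbTE (opp_neq (fr_neq0 i))) mul0r addr0 !mul1r mulr1.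
by rewrite mulrC.
Qed.

Lemma vort_inj v w : (forall x, vort v x = vort w x) -> v = w.
Proof.
move=> H; apply/eqP; rewrite -subr_eq0; apply/eqP/dot_eq0.
have := L2_ip_vort (v - w) (v - w); rewrite /L2_ip.
have -> : (fun x : R * R => vort (v - w) x * vort (v - w) x) = fun=> 0 * 0.
  apply/funext => x; have := vort_lin (- 1) w v x; rewrite scaleN1r addrC H mulN1r addNr => ->.
  by rewrite mulr0.
rewrite (torus_intZ 0 (bmeas_cst 0)) mul0r => /esym/eqP; rewrite mulf_eq0 => /orP[|/eqP//].
by rewrite mulf_eq0 pnatr_eq0/= expf_eq0/= gt_eqF ?pi_gt0.
Qed.

Lemma Pi_leD (f g : R * R -> R) x : bmeas f -> bmeas g ->
  Pi_le N (fun y => f y + g y) x = Pi_le N f x + Pi_le N g x.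
Proof.
move=> bf bg; rewrite /Pi_le -big_split; apply: eq_bigr => k _.
under [X in torus_int X]eq_fun do rewrite mulrDl cos_phase.
under [X in _ + torus_int X * _]eq_fun do rewrite mulrDl sin_phase.
have bt j s : bmeas (trig j s) by exact: bmeas_trig.
rewrite !torus_intD; try by apply: bmeasM.
under [X in _ = _ * (torus_int X * _ + _) + _]eq_fun do rewrite cos_phase.
under [X in _ = _ * (_ + torus_int X * _) + _]eq_fun do rewrite sin_phase.
under [X in _ = _ + _ * (torus_int X * _ + _)]eq_fun do rewrite cos_phase.
under [X in _ = _ + _ * (_ + torus_int X * _)]eq_fun do rewrite sin_phase.
by ring.
Qed.

Lemma Pi_leZ c (f : R * R -> R) x : bmeas f -> Pi_le N (fun y => c * f y) x = c * Pi_le N f x.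
Proof.
move=> bf; rewrite /Pi_le mulr_sumr; apply: eq_bigr => k _.
have e1 : torus_int (fun y => c * f y * cos (phase (freq k) y)) = c * torus_int (fun y => f y * cos (phase (freq k) y)).
  rewrite -torus_intZ; last first.
    by under [X in bmeas X]eq_fun do rewrite cos_phase; apply: bmeasM => //; exact: bmeas_trig.
  by congr torus_int; apply/funext => y; rewrite mulrA.
have e2 : torus_int (fun y => c * f y * sin (phase (freq k) y)) = c * torus_int (fun y => f y * sin (phase (freq k) y)).
  rewrite -torus_intZ; last first.
    by under [X in bmeas X]eq_fun do rewrite sin_phase; apply: bmeasM => //; exact: bmeas_trig.
  by congr torus_int; apply/funext => y; rewrite mulrA.
by rewrite e1 e2; ring.
Qed.

Lemma Pi_le_sum (I : finType) (F : I -> R * R -> R) x : (forall i, bmeas (F i)) ->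
  Pi_le N (fun y => \sum_i F i y) x = \sum_i Pi_le N (F i) x.
Proof.
move=> HF; suff [] : bmeas (fun y => \sum_i F i y) /\
  Pi_le N (fun y => \sum_i F i y) x = \sum_i Pi_le N (F i) x by [].
elim: (index_enum I) => [|i r [br IH]].
  have e : (fun y => \sum_(i <- [::]) F i y) = fun=> 0 * 0.
    by apply/funext => y; rewrite big_nil mul0r.
  split; first by rewrite e; exact: bmeas_cst.
  by rewrite e big_nil (Pi_leZ 0 x (bmeas_cst 0)) mul0r.
have e : (fun y => \sum_(i <- i :: r) F i y) = fun y => F i y + \sum_(i <- r) F i y.
  by apply/funext => y; rewrite big_cons.
by rewrite e big_cons Pi_leD// IH; split=> //; exact: bmeasD.
Qed.

(** Only the summands of frequency j and -j survive, each giving half of the function; outside the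
    box both sides vanish. *)
Lemma Pi_le_trig j t x : j != 0 -> Pi_le N (trig j t) x = vort (st j t) x.
Proof.
move=> j0; rewrite /Pi_le.
have term (k : box N) : (2 * pi) ^- 2 *
    (torus_int (fun y => trig j t y * cos (phase (freq k) y)) * cos (phase (freq k) x) +
     torus_int (fun y => trig j t y * sin (phase (freq k) y)) * sin (phase (freq k) x)) =
    2^-1 * ((freq k == j)%:R + (freq k == - j)%:R) * trig j t x.
  under [X in torus_int X * _ + _]eq_fun do rewrite cos_phase.
  under [X in _ + torus_int X * _]eq_fun do rewrite sin_phase.
  have p0 : pi != 0 :> R by rewrite gt_eqF// pi_gt0.
  rewrite !torus_int_trigM subr0 addr0 opprK cosDpihalf cosBpihalf.
  rewrite [j == freq k]eq_sym [freq k == - j]eq_sym -[- j == freq k]eqr_opp opprK /trig.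
  have [e|ne] := eqVneq (freq k) j.
    rewrite e (negbTE (opp_neq j0)) cosD; move: (pi : R) p0 => p p0.
    by rewrite mulr1n mulr0n; field.
  have [e|ne'] := eqVneq j (- freq k); last first.
    by move: (pi : R) p0 => p p0; rewrite mulr0n; field.
  have -> : phase j x = - phase (freq k) x :> R by rewrite e phaseN.
  rewrite cosD cosN sinN; move: (pi : R) p0 => p p0.
  by rewrite mulr1n mulr0n; field.
rewrite (eq_bigr _ (fun (b : box N) _ => term b)) -mulr_suml -mulr_sumr big_split/=.
have cnt i : inbox i -> \sum_(k : box N) (freq k == i)%:R = 1 :> R.
  move=> /inbox_freq[b <-]; rewrite (bigD1 b)//= eqxx big1 ?addr0// => k kb.
  by rewrite (inj_eq freq_inj) (negbTE kb).
have [jb|jb] := boolP (inbox j).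
  by rewrite !cnt ?inboxN// vort_st//; field.
rewrite st_out ?jb// vort0 !big1 ?addr0 ?mulr0 ?mul0r// => k _.
  by case: eqP => // e; move: jb; rewrite -inboxN -e freq_inbox.
by case: eqP => // e; move: jb; rewrite -e freq_inbox.
Qed.

End Modes.

Section DirectionalDerivative.
Context {R : realType}.

Lemma is_derive_line (V : normedModType R) (f : V -> R) (x v : V) (df : R) :
  is_derive (0 : R) 1 (fun h : R => f (h *: v + x) : R^o) df -> is_derive x v (f : V -> R^o) df.
Proof.
have e : (fun h : R => h^-1 *: ((f (h *: v + x) : R^o) - f x)) =
    (fun h : R => h^-1 *: ((f ((h *: (1 : R) + 0) *: v + x) : R^o) - f (0 *: v + x))).
  by apply/funext => h; rewrite addr0 scale0r add0r /GRing.scale/= mulr1.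
by move=> [d0 d1]; apply: DeriveDef; [move: d0|rewrite -d1]; rewrite /derivable /derive e.
Qed.

Lemma is_derive_trig (k : int * int) (t : R) (x v : R * R) :
  is_derive x v (trig k t : R * R -> R^o) (- (phase k v * sin (phase k x + t))).
Proof.
apply: is_derive_line.
have h := is_derive_affine (phase k x + t) (phase k v) 0.
have := is_derive1_comp (f := @cos R) (g := fun h : R => phase k x + t + phase k v * h) (x := 0) (is_derive_cos _) h.
rewrite mulr0 addr0 => H.
have -> : (fun h : R => trig k t (h *: v + x) : R^o) = @cos R \o (fun h : R => phase k x + t + phase k v * h).
  by apply/funext => r; rewrite /trig /phase /= /GRing.scale/=; congr cos; ring.
by apply: (is_derive_eq H); ring.
Qed.

End DirectionalDerivative.

(** * The projected nonlinearity *)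

Section Nonlinearity.
Context {R : realType} {N : nat}.
Local Notation n := (#|{: mode N}|).
Implicit Types (j k p q : int * int) (s t : R) (v w : 'rV[R]_n).
Local Notation fr := (@fr N).
Local Notation th := (@th R N).
Local Notation st := (@st R N).

Definition cross p q : R := (p.1 * q.2 - p.2 * q.1)%:~R.
Lemma crossE p q : cross p q = p.1%:~R * q.2%:~R - p.2%:~R * q.1%:~R.
Proof. by rewrite /cross intrD intrN !intrM. Qed.

Definition nrm2 p : R := (p.1 ^+ 2 + p.2 ^+ 2)%:~R.

Lemma nrm2_gt0 p : p != 0 -> 0 < nrm2 p.
Proof.
case: p => a c p0; rewrite /nrm2 ltr0z /=.
have [a0|a0] := eqVneq a 0; last first.
  by apply: ltr_pwDl; [rewrite exprn_even_gt0|exact: sqr_ge0].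
rewrite a0 expr0n add0r exprn_even_gt0//=; move: p0; rewrite a0.
by apply: contra => /eqP ->.
Qed.

(* [u.grad w] for [w = cos (q.x + t)] and [u] the velocity of [cos (p.x + s)], projected. *)
Definition adv_st p s q t : 'rV[R]_n :=
  (cross p q / (2 * nrm2 p)) *: (st (p - q) (s - t) - st (p + q) (s + t)).

(** Fixed by [adv_st] on basis functions; [bilin_st] extends the formula to all phases because
    [adv_st] is [trig_like] in each argument. *)
Definition bilin v w : 'rV[R]_n :=
  \sum_i \sum_j (v 0 i * w 0 j) *: adv_st (fr i) (th i) (fr j) (th j).

Lemma bilin_l a v v' w : bilin (a *: v + v') w = a *: bilin v w + bilin v' w.
Proof.
rewrite /bilin scaler_sumr -big_split; apply: eq_bigr => i _.
rewrite scaler_sumr -big_split; apply: eq_bigr => j _.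
by rewrite !mxE mulrDl scalerDl scalerA mulrA.
Qed.

Lemma bilin_r a v w w' : bilin v (a *: w + w') = a *: bilin v w + bilin v w'.
Proof.
rewrite /bilin scaler_sumr -big_split; apply: eq_bigr => i _.
rewrite scaler_sumr -big_split; apply: eq_bigr => j _.
by rewrite !mxE mulrDr scalerDl scalerA mulrCA.
Qed.

Lemma adv_trig_like_l q t : trig_like (fun p s => adv_st p s q t).
Proof.
split=> [p s|p s s'].
  have -> : adv_st (- p) (- s) q t = (- (cross p q / (2 * nrm2 p))) *: (st (p + q) (s + t) - st (p - q) (s - t)).
    rewrite /adv_st; have -> : cross (- p) q = - cross p q.
      by rewrite /cross -intrN /=; congr intr; ring.
    have -> : nrm2 (- p) = nrm2 p by rewrite /nrm2 /= !sqrrN.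
    rewrite mulNr; congr (_ *: (_ - _)).
      by rewrite -opprD -stN opprK; congr st; ring.
    by rewrite -stN; congr st; [rewrite opprD opprK|ring].
  by rewrite scaleNr -scalerN opprB.
rewrite /adv_st; set c := cross p q / _; rewrite (st_lin (p - q) (s - t)) (st_lin (p + q) (s + t)).
have -> : s' - t - (s - t) = s' - s by ring.
have -> : s' + t - (s + t) = s' - s by ring.
have -> : s + pi / 2 - t = s - t + pi / 2 by ring.
have -> : s + pi / 2 + t = s + t + pi / 2 by ring.
move: (st (p - q) (s - t)) (st (p - q) (s - t + pi / 2)) (st (p + q) (s + t)) (st (p + q) (s + t + pi / 2)) => a1 a2 a3 a4.
by apply/rowP => i; rewrite !mxE; ring.
Qed.

Lemma adv_trig_like_r p s : trig_like (adv_st p s).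
Proof.
split=> [q t|q t t'].
  rewrite /adv_st; have -> : cross p (- q) = - cross p q.
    by rewrite /cross -intrN /=; congr intr; ring.
  by rewrite !opprK mulNr scaleNr -scalerN opprB.
rewrite /adv_st; set c := cross p q / _.
have e1 : st (p - q) (s - t') = cos (t' - t) *: st (p - q) (s - t) + sin (t' - t) *: st (p - q) (s - (t + pi / 2)).
  rewrite -[st (p - q) (s - t')]stN -[st (p - q) (s - t)]stN -[st (p - q) (s - (t + pi / 2))]stN.
  rewrite (st_lin _ (- (s - t))); congr (cos _ *: _ + sin _ *: st _ _); ring.
have e2 : st (p + q) (s + t') = cos (t' - t) *: st (p + q) (s + t) + sin (t' - t) *: st (p + q) (s + (t + pi / 2)).
  rewrite (st_lin _ (s + t)); congr (cos _ *: _ + sin _ *: st _ _); ring.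
rewrite e1 e2; move: (st _ _) (st _ _) (st _ _) (st _ _) => a1 a2 a3 a4.
by apply/rowP => i; rewrite !mxE; ring.
Qed.

Lemma bilin_st p s q t : p != 0 -> inbox (N := N) p -> q != 0 -> inbox (N := N) q ->
  bilin (st p s) (st q t) = adv_st p s q t.
Proof.
move=> p0 pb q0 qb; rewrite /bilin -(st_sum s (adv_trig_like_l q t) p0 pb).
apply: eq_bigr => i _; rewrite -(st_sum t (adv_trig_like_r (fr i) (th i)) q0 qb) scaler_sumr.
by apply: eq_bigr => j _; rewrite scalerA.
Qed.

Lemma partial_vort w (x v : R * R) :
  'D_v (vort w : R * R -> R^o) x = \sum_i w 0 i * - (phase (fr i) v * sin (phase (fr i) x + th i)).
Proof.
have -> : (vort w : R * R -> R^o) = \sum_i (w 0 i *: (trig (fr i) (th i) : R * R -> R^o)).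
  by apply/funext => y; rewrite vortE fct_sumE.
have : is_derive x v (\sum_i (w 0 i *: (trig (fr i) (th i) : R * R -> R^o)))
    (\sum_i w 0 i *: (- (phase (fr i) v * sin (phase (fr i) x + th i)) : R^o)).
  by apply: is_derive_sum => i; apply: is_deriveZ; exact: is_derive_trig.
by case.
Qed.

Lemma advectionE w x : advection w x = \sum_i \sum_j
  w 0 i * w 0 j * (cross (fr i) (fr j) / (2 * nrm2 (fr i))) *
  (trig (fr i - fr j) (th i - th j) x - trig (fr i + fr j) (th i + th j) x).
Proof.
rewrite /advection /velocity1 /velocity2 /partial1 /partial2 !partial_vort.
rewrite -sumrN !mulr_suml -big_split; apply: eq_bigr => i _.
rewrite !mulr_sumr -big_split; apply: eq_bigr => j _.
have n0 := nrm2_gt0 (fr_neq0 i).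
have -> : trig (fr i - fr j) (th i - th j) x - trig (fr i + fr j) (th i + th j) x =
    2 * (sin (phase (fr i) x + th i) * sin (phase (fr j) x + th j)).
  rewrite sinM mulrA mulfV ?pnatr_eq0// mul1r /trig !phaseD phaseN.
  by congr (cos _ - cos _); ring.
rewrite mxE -/(mfreq (enum_val i)) -/(fr i) -/(nrm2 (fr i)) crossE /phase /= !mulr0 !mulr1 !addr0 !add0r.
by move: (nrm2 (fr i)) n0 => m m0; field; rewrite gt_eqF.
Qed.

Lemma Pi_le_advection w x : Pi_le N (advection w) x = vort (bilin w w) x.
Proof.
pose F (i j : 'I_n) : R * R -> R := fun x => w 0 i * w 0 j * (cross (fr i) (fr j) / (2 * nrm2 (fr i))) *
  (trig (fr i - fr j) (th i - th j) x - trig (fr i + fr j) (th i + th j) x).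
have bt j t : bmeas (trig j t : R * R -> R) by exact: bmeas_trig.
have bF' (i j : 'I_n) : bmeas (fun x : R * R => trig (fr i - fr j) (th i - th j) x + -1 * trig (fr i + fr j) (th i + th j) x : R).
  by apply: bmeasD => //; apply: bmeasM => //; exact: bmeas_cst.
have FE (i j : 'I_n) : F i j = fun x => w 0 i * w 0 j * (cross (fr i) (fr j) / (2 * nrm2 (fr i))) *
    (trig (fr i - fr j) (th i - th j) x + -1 * trig (fr i + fr j) (th i + th j) x).
  by apply/funext => y; rewrite /F mulN1r.
have bF (i j : 'I_n) : bmeas (F i j) by rewrite FE; apply: bmeasM => //; exact: bmeas_cst.
have -> : advection w = fun x => \sum_i \sum_j F i j x.
  by apply/funext => y; exact: advectionE.
rewrite Pi_le_sum; last by move=> i; apply: bmeas_sum.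
have vs (I : finType) (G : I -> 'rV[R]_n) : vort (\sum_i G i) x = \sum_i vort (G i) x.
  elim/big_ind2: _ => [|a b c d <- <-|//]; first exact: vort0.
  by have := vort_lin 1 b d x; rewrite scale1r mul1r.
rewrite /bilin vs; apply: eq_bigr => i _; rewrite vs Pi_le_sum//; apply: eq_bigr => j _.
rewrite FE Pi_leZ// Pi_leD//; last by apply: bmeasM => //; exact: bmeas_cst.
rewrite Pi_leZ// /adv_st scalerA -[X in vort X](addr0 (_ *: _)) vort_lin vort0 addr0.
(* [Pi_le_trig] concerns nonzero frequencies. If the difference or the sum of the two frequencies is
   0, they are parallel and the coefficient vanishes. *)
have [c0|c0] := eqVneq (cross (fr i) (fr j)) 0; first by rewrite c0 !mul0r !mulr0 !mul0r.
congr (_ * _); have -> : st (fr i - fr j) (th i - th j) - st (fr i + fr j) (th i + th j) =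
   (-1) *: st (fr i + fr j) (th i + th j) + st (fr i - fr j) (th i - th j).
  by rewrite scaleN1r addrC.
rewrite vort_lin addrC !Pi_le_trig//.
  apply: contra c0; rewrite addr_eq0 => /eqP ->.
  by rewrite /cross intr_eq0 /=; apply/eqP; ring.
apply: contra c0; rewrite addr_eq0 => /eqP ->.
by rewrite /cross intr_eq0 /=; apply/eqP; ring.
Qed.

Let tri p s q t r u : R := cross p q * ((r == p - q)%:R * cos (s - t - u) + (r == - (p - q))%:R * cos (s - t + u)
  - ((r == p + q)%:R * cos (s + t - u) + (r == - (p + q))%:R * cos (s + t + u))).

(** For a fixed advecting mode [p] the advection is antisymmetric in the other two: each resonance
    between p, q and r can be read from q to r or from r to q, with opposite contributions. *)
Let tri_anti p s q t r u : tri p s q t r u + tri p s r u q t = 0.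
Proof.
rewrite /tri.
have -> : (q == p - r) = (r == p - q) by apply/eqP/eqP => ->; ring.
have -> : (q == p + r) = (r == - (p - q)) by apply/eqP/eqP => ->; ring.
have -> : (q == - (p - r)) = (r == p + q) by apply/eqP/eqP => ->; ring.
have -> : (q == - (p + r)) = (r == - (p + q)) by apply/eqP/eqP => ->; ring.
have e1 : (r == p - q)%:R * (cross p q + cross p r) = 0.
  by case: eqP => [->|_]; rewrite ?mul0r// mul1r /cross -intrD /=; apply/eqP; rewrite intr_eq0; apply/eqP; ring.
have e2 : (r == - (p - q))%:R * (cross p q - cross p r) = 0.
  by case: eqP => [->|_]; rewrite ?mul0r// mul1r /cross -intrB /=; apply/eqP; rewrite intr_eq0; apply/eqP; ring.
have e3 : (r == p + q)%:R * (cross p q - cross p r) = 0.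
  by case: eqP => [->|_]; rewrite ?mul0r// mul1r /cross -intrB /=; apply/eqP; rewrite intr_eq0; apply/eqP; ring.
have e4 : (r == - (p + q))%:R * (cross p q + cross p r) = 0.
  by case: eqP => [->|_]; rewrite ?mul0r// mul1r /cross -intrD /=; apply/eqP; rewrite intr_eq0; apply/eqP; ring.
have -> : s - u - t = s - t - u by ring.
have -> : s - u + t = s + t - u by ring.
have -> : s + u - t = s - t + u by ring.
have -> : s + u + t = s + t + u by ring.
transitivity (cos (s - t - u) * ((r == p - q)%:R * (cross p q + cross p r)) +
  cos (s - t + u) * ((r == - (p - q))%:R * (cross p q - cross p r)) -
  cos (s + t - u) * ((r == p + q)%:R * (cross p q - cross p r)) -
  cos (s + t + u) * ((r == - (p + q))%:R * (cross p q + cross p r))); first by ring.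
by rewrite e1 e2 e3 e4 !mulr0 !addr0 !subr0.
Qed.

(** By [tri_anti] the triple sum equals its opposite once the last two modes are exchanged: the
    truncated advection conserves the L2 norm of the vorticity. *)
Lemma bilin_dot w : dot (bilin w w) w = 0.
Proof.
have -> : dot (bilin w w) w = \sum_i w 0 i / (2 * nrm2 (fr i)) *
    (\sum_j \sum_r w 0 j * w 0 r * tri (fr i) (th i) (fr j) (th j) (fr r) (th r)).
  rewrite /dot; under eq_bigr do rewrite /bilin summxE mulr_suml.
  rewrite exchange_big/=; apply: eq_bigr => i _.
  under eq_bigr do rewrite summxE mulr_suml.
  rewrite exchange_big/= mulr_sumr; apply: eq_bigr => j _.
  rewrite mulr_sumr; apply: eq_bigr => r _.
  rewrite /tri mxE [adv_st _ _ _ _ 0 r]mxE [X in cross _ _ / _ * X]mxE [X in cross _ _ / _ * (_ + X)]mxE.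
  rewrite [st (fr i - fr j) _ 0 r]mxE [st (fr i + fr j) _ 0 r]mxE.
  by move: ((2 * nrm2 (fr i))^-1) => m; ring.
rewrite big1// => i _; set S := \sum_j _.
suff e : S = - S.
  have S0 : S = 0 by move: e; move: (S) => r e; lra.
  by rewrite S0 mulr0.
rewrite /S -sumrN exchange_big/=; apply: eq_bigr => j _; rewrite -sumrN; apply: eq_bigr => r _.
by rewrite -mulrN [w 0 r * _]mulrC; congr (_ * _); apply/eqP; rewrite -addr_eq0 addrC tri_anti.
Qed.

End Nonlinearity.

(** * Instability of shear flows *)

Lemma polar {R : realType} (x y : R) : exists a t : R, [/\ 0 <= a, x = a * cos t & y = a * sin t].
Proof.
pose a := Num.sqrt (x ^+ 2 + y ^+ 2).
have s0 : 0 <= x ^+ 2 + y ^+ 2 by rewrite addr_ge0 ?sqr_ge0.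
have aa : a ^+ 2 = x ^+ 2 + y ^+ 2 by rewrite sqr_sqrtr.
have [a0|a0] := eqVneq a 0.
  exists 0, 0; rewrite !mul0r; move: aa; rewrite a0 expr0n /= => /esym/eqP.
  by rewrite paddr_eq0 ?sqr_ge0// !sqrf_eq0 => /andP[/eqP -> /eqP ->].
have ap : 0 < a by rewrite lt_def a0 sqrtr_ge0.
pose c := x / a; pose s := y / a.
have cs : c ^+ 2 + s ^+ 2 = 1 by rewrite /c /s !expr_div_n -mulrDl -aa mulfV// expf_neq0.
have c1 : -1 <= c <= 1.
  have c2 : c ^+ 2 <= 1 by rewrite -cs lerDl sqr_ge0.
  by rewrite -ler_norml -(ler_pXn2r (n := 2))// ?nnegrE// real_normK ?num_real// expr1n.
have sc : 1 - c ^+ 2 = s ^+ 2 by rewrite -cs addrC addKr.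
have xE : x = a * c by rewrite /c mulrC divfK.
have yE : y = a * s by rewrite /s mulrC divfK.
have [s_ge|s_lt] := leP 0 s.
  exists a, (acos c); split; [exact: ltW|by rewrite acosK|].
  by rewrite sin_acos// sc sqrtr_sqr ger0_norm.
exists a, (- acos c); split; [exact: ltW|by rewrite cosN acosK|].
by rewrite sinN sin_acos// sc sqrtr_sqr ltr0_norm// opprK.
Qed.

Section Recursion.
Context {R : realType}.
Variables (L M : nat).
Hypotheses (L2 : (2 <= L)%N) (M1 : (0 < M)%N).

(** The factor 1 - |p|^2 / |m p + e|^2 for |p| = L and a unit vector [e] orthogonal to [p]. It is
    positive for m >= 1 and, as L >= 2, negative for m = 0, which is the source of the
    instability. *)
Definition ladder_coef (m : nat) : R := 1 - L%:R ^+ 2 / (L%:R ^+ 2 * m%:R ^+ 2 + 1).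

(** The three-term recursion run from the edge of the box inwards, carrying two consecutive values:
    index j stands for a mode number of absolute value M + 1 - j. The value 0 at j = 0 expresses the
    truncation, the value 1 at j = 1 is a normalization. *)
Fixpoint ladder2 (lam : R) (j : nat) : R * R :=
  if j is j'.+1 then let f := ladder2 lam j' in
    (f.2, f.1 + lam * f.2 / ladder_coef (M - j'))
  else (0, 1).

Definition ladder lam j := (ladder2 lam j).1.

Lemma ladder0 lam : ladder lam 0 = 0. Proof. by []. Qed.
Lemma ladder1 lam : ladder lam 1 = 1. Proof. by []. Qed.
Lemma ladderSS lam j : ladder lam j.+2 = ladder lam j + lam * ladder lam j.+1 / ladder_coef (M - j).
Proof. by []. Qed.

Let Lp : 4 <= L%:R ^+ 2 :> R.
Proof. by rewrite -natrX ler_nat; rewrite -[4%N]/(2 ^ 2)%N leq_exp2r. Qed.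

Lemma ladder_coef_gt0 m : (0 < m)%N -> 0 < ladder_coef m.
Proof.
move=> m0; have m1 : 1 <= m%:R ^+ 2 :> R by rewrite exprn_ege1// ler1n.
have h : L%:R ^+ 2 <= L%:R ^+ 2 * m%:R ^+ 2 :> R by rewrite ler_peMr// sqr_ge0.
by have Lp' := Lp; rewrite /ladder_coef subr_gt0 ltr_pdivrMr; lra.
Qed.

Lemma ladder_coef_le1 m : ladder_coef m <= 1.
Proof. by rewrite /ladder_coef lerBlDr lerDl divr_ge0 ?sqr_ge0// addr_ge0 ?mulr_ge0 ?sqr_ge0. Qed.

Lemma ladder_coef1 : ladder_coef 1 = (L%:R ^+ 2 + 1)^-1.
Proof. by have := Lp; rewrite /ladder_coef expr1n mulr1 => h; field; rewrite gt_eqF//; lra. Qed.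

Lemma ladder_coef0 : ladder_coef 0 = 1 - L%:R ^+ 2.
Proof. by rewrite /ladder_coef expr0n mulr0 add0r divr1. Qed.

Lemma ladder_pos lam j : 0 < lam -> (j <= M)%N -> 0 <= ladder lam j /\ 0 < ladder lam j.+1.
Proof.
move=> l0; elim: j => [|j IH] jM; first by rewrite ladder0 ladder1 lexx ltr01.
have [h1 h2] := IH (ltnW jM); split; first exact: ltW.
by rewrite ladderSS ltr_wpDl// divr_gt0 ?mulr_gt0 ?ladder_coef_gt0// subn_gt0.
Qed.

Lemma ladder_continuous j : continuous (fun lam => ladder lam j).
Proof.
suff : continuous (fun lam => ladder lam j) /\ continuous (fun lam => ladder lam j.+1) by case.
elim: j => [|j [c1 c2]]; first by split; move=> x; exact: cvg_cst.
split=> // x; apply: cvgD; first exact: c1.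
by apply: cvgM; [apply: cvgM; [exact: cvg_id|exact: c2]|exact: cvg_cst].
Qed.

(** The equation is the recursion at mode number 0 for the extension by symmetry. In the form [hE],
    the bounds 0 <= lam f(M-1) <= f(M) of the ladder [f] show that the difference of the two sides
    is nonpositive at 1/2 and nonnegative at 2. *)
Lemma ladder_eigenvalue : exists lam : R, 0 < lam /\
  lam * ladder lam M.+1 = 2 * (L%:R ^+ 2 - 1) * ladder lam M.
Proof.
pose h lam := lam * ladder lam M.+1 - 2 * (L%:R ^+ 2 - 1) * ladder lam M.
have ch : continuous h.
  move=> x; apply: cvgB; first by apply: cvgM; [exact: cvg_id|exact: ladder_continuous].
  by apply: cvgM; [exact: cvg_cst|exact: ladder_continuous].
have hE lam : h lam = lam * ladder lam M.-1 + (lam ^+ 2 * (L%:R ^+ 2 + 1) - 2 * (L%:R ^+ 2 - 1)) * ladder lam M.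
  have := ladderSS lam M.-1; rewrite prednK// (_ : M - M.-1 = 1)%N; last by lia.
  by rewrite ladder_coef1 invrK /h => ->; ring.
have fM lam : 0 < lam -> 0 < ladder lam M.
  move=> l0; case: M M1 (@ladder_pos lam M.-1 l0) => // m _ /= H.
  by case: H => //; rewrite leqnSn.
have fM1 lam : 0 < lam -> 0 <= lam * ladder lam M.-1 <= ladder lam M.
  move=> l0; have [f0 _] := @ladder_pos lam M.-1 l0 (leq_pred M).
  rewrite mulr_ge0 ?(ltW l0)//=; have := fM lam l0.
  case EM : M M1 f0 => [//|[|m]] _ f0 fp; first by rewrite /= ladder0 mulr0 ltW.
  have mM : (m <= M)%N by rewrite EM; lia.
  have [g0 g1] := ladder_pos l0 mM.
  rewrite /= ladderSS.
  have c2 : 0 < ladder_coef (M - m) by apply: ladder_coef_gt0; rewrite EM; lia.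
  rewrite -[leLHS]add0r; apply: lerD => //.
  rewrite ler_pdivlMr//; apply: ler_piMr; last exact: ladder_coef_le1.
  by apply: mulr_ge0; exact: ltW.
have Lp' := Lp.
have h1 : h 2^-1 <= 0.
  rewrite hE; have l0 : (0 : R) < 2^-1 by rewrite invr_gt0.
  have /andP[_ a1] := fM1 _ l0; have a2 := fM _ l0.
  have : (1 + (2^-1 ^+ 2 * (L%:R ^+ 2 + 1) - 2 * (L%:R ^+ 2 - 1))) * ladder 2^-1 M <= 0.
    have q : 2^-1 ^+ 2 = 4^-1 :> R by field.
    by apply: mulr_le0_ge0; [rewrite q; lra|exact: ltW].
  by rewrite mulrDl mul1r; lra.
have h2 : 0 <= h 2.
  rewrite hE; have l0 : (0 : R) < 2 by [].
  have /andP[a1 _] := fM1 _ l0; have a2 := fM _ l0.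
  have q : 2 ^+ 2 = 4 :> R by ring.
  by apply: addr_ge0 => //; apply: mulr_ge0; [rewrite q; lra|exact: ltW].
have [||c] := @IVT R h 2^-1 2 0 _ (continuous_subspaceT ch).
- by apply: (@le_trans _ _ 1); [rewrite invf_le1// ler1n|rewrite ler1n].
- by rewrite ge_min le_max h1 h2 orbT.
rewrite in_itv /= => /andP[c1 _] hc; exists c; split; first by apply: lt_le_trans c1; rewrite invr_gt0.
by apply/eqP; rewrite -subr_eq0 -/(h c) hc.
Qed.

(* Extends the ladder to a solution of the eigenvalue recursion on all of [-M-1, M+1], shifted
   by [M+1], using the symmetry [x_(-n) = (-1)^n x_n]. *)
Definition ladder_ext (lam : R) (i : nat) : R :=
  if (i <= M.+1)%N then (-1) ^+ (M.+1 - i) * ladder lam i else ladder lam (M.*2.+2 - i).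

(** One of the two truncated differences is 0, and their sum is |i - (M + 1)|. *)
Definition ext_coef (i : nat) : R := ladder_coef ((M.+1 - i) + (i - M.+1)).

Lemma ladder_ext_rec lam i : lam * ladder lam M.+1 = 2 * (L%:R ^+ 2 - 1) * ladder lam M ->
  (i < M.*2.+1)%N ->
  ladder_ext lam i - ladder_ext lam i.+2 = lam * ladder_ext lam i.+1 / ext_coef i.+1.
Proof.
move=> HL iM; rewrite /ladder_ext /ext_coef.
have [iM1|Mi] := ltnP i M.
  have e1 : (i <= M.+1)%N by lia.
  have e2 : (i.+2 <= M.+1)%N by lia.
  have e3 : (i.+1 <= M.+1)%N by lia.
  rewrite e1 e2 e3 (_ : M.+1 - i = (M.+1 - i.+2).+2)%N; last by lia.
  rewrite (_ : M.+1 - i.+1 = (M.+1 - i.+2).+1)%N; last by lia.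
  rewrite (_ : (M.+1 - i.+2).+1 + (i.+1 - M.+1) = M - i)%N; last by lia.
  by rewrite ladderSS !exprS; ring.
have [Mi'|iM'] := ltnP M i; last first.
  have -> : i = M by lia.
  rewrite leqnSn ltnn leqnn subSnn subnn addn0 expr1 expr0 ladder_coef0.
  rewrite (_ : M.*2.+2 - M.+2 = M)%N; last by lia.
  rewrite mul1r HL; have := Lp => Lp'; field.
  by rewrite lt_eqF//; lra.
pose r := (M.*2 - i)%N.
have e2 : (i.+2 <= M.+1)%N = false by lia.
have e3 : (i.+1 <= M.+1)%N = false by lia.
rewrite e2 e3 (_ : M.*2.+2 - i.+2 = r)%N; last by rewrite /r; lia.
rewrite (_ : M.*2.+2 - i.+1 = r.+1)%N; last by rewrite /r; lia.
rewrite (_ : M.+1 - i.+1 + (i.+1 - M.+1) = M - r)%N; last by rewrite /r; lia.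
have -> : (if (i <= M.+1)%N then (-1) ^+ (M.+1 - i) * ladder lam i else ladder lam (M.*2.+2 - i)) = ladder lam r.+2.
  case: ifP => h; last by congr ladder; rewrite /r; lia.
  by rewrite (_ : M.+1 - i = 0)%N ?expr0 ?mul1r; [congr ladder; rewrite /r|]; lia.
by rewrite ladderSS addrAC subrr add0r.
Qed.

End Recursion.

Section Shear.
Context {R : realType} {N : nat}.
Local Notation n := (#|{: mode N}|).
Local Notation st := (@st R N).
Local Notation adv_st := (@adv_st R N).
Local Notation bilin := (@bilin R N).
Local Notation cross := (@cross R).
Local Notation nrm2 := (@nrm2 R).
Implicit Types (p q : int * int) (s t : R).

(** Gives the coefficients of the linearization at a single mode; the interactions of modes of equal
    length cancel. *)
Lemma adv_pair p s q t : adv_st p s q t + adv_st q t p s =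
  (cross p q / 2 * ((nrm2 p)^-1 - (nrm2 q)^-1)) *: (st (p - q) (s - t) - st (p + q) (s + t)).
Proof.
rewrite /adv_st.
have -> : st (q - p) (t - s) = st (p - q) (s - t) by rewrite -stN !opprB.
rewrite [q + p]addrC [t + s]addrC -scalerDl; congr (_ *: _).
have -> : cross q p = - cross p q by rewrite !crossE; ring.
by rewrite !invfM; ring.
Qed.

Variables (L : nat) (p e : int * int).
Hypotheses (L2 : (2 <= L)%N) (LN : (L <= N)%N).
Hypothesis pe : (p = (L%:Z, 0) /\ e = (0, 1)) \/ (p = (0, L%:Z) /\ e = (- 1, 0)).

(** The ladder of modes m p + e coupled by the shear. The sign of [e] is such that the cross product
    with [p] is [L] in both cases. *)
Let lq (m : int) : int * int := (m * p.1 + e.1, m * p.2 + e.2).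

Let lq_inbox m : inbox (N := N) (lq m) = (`|m|%N * L <= N)%N.
Proof.
rewrite /inbox /lq; case: pe => -[-> ->] /=; rewrite ?mulr0 ?add0r ?addr0.
  have -> : (`|m * L%:Z| <= N%:Z) = (`|m|%N * L <= N)%N by rewrite normrM; lia.
  by rewrite normr1 andb_idr// => _; lia.
have -> : (`|m * L%:Z| <= N%:Z) = (`|m|%N * L <= N)%N by rewrite normrM; lia.
by rewrite normrN normr1 andb_idl// => _; lia.
Qed.

Let lq_inj : injective lq.
Proof.
by move=> m m'; rewrite /lq; case: pe => -[-> ->] /= []; rewrite ?mulr0 ?add0r ?addr0; nia.
Qed.

Let lq_opp m m' : (lq m == - lq m') = false.
Proof.
by apply/eqP; rewrite /lq; case: pe => -[-> ->] /= []; rewrite ?mulr0 ?add0r ?addr0 ?opprK; lia.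
Qed.

Let lq_neq0 m : lq m != 0.
Proof. by apply/eqP; rewrite /lq; case: pe => -[-> ->] /= []; rewrite ?mulr0 ?add0r ?addr0; lia. Qed.

Let lq_cross m : cross p (lq m) = L%:R.
Proof. by rewrite /cross /lq; case: pe => -[-> ->] /=; rewrite -[RHS]/(L%:~R); congr intr; ring. Qed.

Let lq_nrm2 m : nrm2 (lq m) = L%:R ^+ 2 * m%:~R ^+ 2 + 1.
Proof.
rewrite /nrm2 /lq; case: pe => -[-> ->] /=.
  have -> : (m * L%:Z + 0) ^+ 2 + (m * 0 + 1) ^+ 2 = (L%:Z * m) ^+ 2 + 1 by ring.
  by rewrite intrD rmorphXn /= intrM exprMn.
have -> : (m * 0 + -1) ^+ 2 + (m * L%:Z + 0) ^+ 2 = (L%:Z * m) ^+ 2 + 1 by ring.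
by rewrite intrD rmorphXn /= intrM exprMn.
Qed.

Let p_nrm2 : nrm2 p = L%:R ^+ 2.
Proof.
rewrite /nrm2; case: pe => -[-> _] /=; rewrite expr0n /= ?addr0 ?add0r; exact: rmorphXn.
Qed.

Let p_neq0 : p != 0.
Proof. by apply/eqP; case: pe => -[-> _] []; lia. Qed.

Let p_inbox : inbox (N := N) p.
Proof. by rewrite /inbox; case: pe => -[-> _] /=; lia. Qed.

Let subp m : p - lq m = - lq (m - 1).
Proof. by rewrite /lq; case: p => p1 p2; congr (_, _) => /=; ring. Qed.

Let addp m : p + lq m = lq (m + 1).
Proof. by rewrite /lq; case: p => p1 p2; congr (_, _) => /=; ring. Qed.

(** The linearization sends a ladder mode to its two neighbours. The phases m al in [G] absorb the
    phase of the shear flow, so the coefficients are real and follow [ladder_ext_rec]; M is the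
    largest m whose mode lies in the box, so the ladder is cut off at both ends. *)
Lemma shear_unstable (a al : R) : 0 < a -> exists (lam : R) (Y : 'rV[R]_n), [/\ 0 < lam, Y != 0 &
  - (bilin Y (a *: st p al) + bilin (a *: st p al) Y) = lam *: Y].
Proof.
move=> a0; pose M := (N %/ L)%N.
have M1 : (0 < M)%N by rewrite divn_gt0 //; lia.
have ML : (M * L <= N)%N by exact: leq_trunc_div.
have ML1 : (N < M.+1 * L)%N by apply: ltn_ceil; lia.
have Lp : 4 <= L%:R ^+ 2 :> R by rewrite -natrX ler_nat -[4%N]/(2 ^ 2)%N leq_exp2r.
have L0 : 0 < L%:R :> R by rewrite ltr0n; lia.
have [lam [l0 HL]] := @ladder_eigenvalue R L M L2 M1.
pose X := ladder_ext (R := R) L M lam.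
pose C := ext_coef (R := R) L M.
pose nu (i : nat) : int := i%:Z - M.+1%:Z.
pose G i : 'rV[R]_n := st (lq (nu i)) ((nu i)%:~R * al).
have G0 : G 0 = 0 by rewrite /G st_out// lq_inbox /nu; apply/orP; left; lia.
have GT : G M.*2.+2 = 0 by rewrite /G st_out// lq_inbox /nu; apply/orP; left; lia.
have X0 : X 0 = 0 by rewrite /X /ladder_ext /= ladder0 mulr0.
have XT : X M.*2.+2 = 0.
  by rewrite /X /ladder_ext ifF ?subnn ?ladder0//; lia.
have CE i : C i = 1 - L%:R ^+ 2 / nrm2 (lq (nu i)).
  rewrite /C /ext_coef /ladder_coef lq_nrm2; congr (1 - _ / (_ * _ + 1)).
  rewrite /nu; have [h|h] := leqP M.+1 i.
    by rewrite (_ : M.+1 - i + (i - M.+1) = i - M.+1)%N; [rewrite natrB// intrB|lia].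
  rewrite (_ : M.+1 - i + (i - M.+1) = M.+1 - i)%N; last by lia.
  by rewrite natrB 1?ltnW// intrB -sqrrN opprB.
have C0 i : C i != 0.
  rewrite /C /ext_coef; set m := (_ + _)%N; case: m => [|m].
    by rewrite ladder_coef0 lt_eqF//; lra.
  by rewrite gt_eqF// ladder_coef_gt0.
have pair i : (i < M.*2.+1)%N -> bilin (G i.+1) (st p al) + bilin (st p al) (G i.+1) =
    (C i.+1 / (2 * L%:R)) *: (G i - G i.+2).
  move=> iM; have ib : inbox (N := N) (lq (nu i.+1)).
    by rewrite lq_inbox /nu; apply: leq_trans ML; rewrite leq_pmul2r; lia.
  rewrite (bilin_st _ _ (lq_neq0 _) ib p_neq0 p_inbox) (bilin_st _ _ p_neq0 p_inbox (lq_neq0 _) ib) addrC adv_pair subp addp p_nrm2 lq_cross.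
  have e1 : nu i.+1 - 1 = nu i by rewrite /nu; lia.
  have e2 : nu i.+1 + 1 = nu i.+2 by rewrite /nu; lia.
  have -> : st (- lq (nu i.+1 - 1)) (al - (nu i.+1)%:~R * al) = G i.
    have e1' : (nu i)%:~R = (nu i.+1)%:~R - 1 :> R by rewrite -e1 [LHS]intrB.
    by rewrite e1 /G -[RHS]stN e1'; congr st; ring.
  have -> : st (lq (nu i.+1 + 1)) (al + (nu i.+1)%:~R * al) = G i.+2.
    have e2' : (nu i.+2)%:~R = (nu i.+1)%:~R + 1 :> R by rewrite -e2 [LHS]intrD.
    by rewrite e2 /G e2'; congr st; ring.
  congr (_ *: _); rewrite CE; move: (nrm2 (lq (nu i.+1))) (nrm2_gt0 (R := R) (lq_neq0 (nu i.+1))) => q q0.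
  by move: (L%:R : R) L0 => r r0; field; rewrite !gt_eqF.
(* Division by [C] turns the recursion for [X] into the eigenvalue equation. *)
pose Y : 'rV[R]_n := \sum_(i < M.*2.+1) (X i.+1 / C i.+1) *: G i.+1.
exists (a * lam / (2 * L%:R)), Y; split; first by rewrite divr_gt0 ?mulr_gt0.
  apply/negP => /eqP Y0.
  have eb : inbox (N := N) (lq 0) by rewrite lq_inbox mul0n.
  have : dot Y (st (lq 0) 0) = 0 by rewrite Y0 /dot big1// => i _; rewrite mxE mul0r.
  have -> : dot Y (st (lq 0) 0) = X M.+1 / C M.+1.
    have dsum (F : 'I_M.*2.+1 -> 'rV[R]_n) z : dot (\sum_i F i) z = \sum_i dot (F i) z.
      elim/big_ind2: _ => [|u v u' v' <- <-|//]; last by rewrite dotDl.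
      by rewrite /dot big1// => i _; rewrite mxE mul0r.
    have MM : (M < M.*2.+1)%N by lia.
    rewrite /Y dsum (bigD1 (Ordinal MM))//= big1 ?addr0 => [|i iM].
      rewrite dotZl /G (_ : nu M.+1 = 0); last by rewrite /nu subrr.
      by rewrite mulr0z mul0r dot_st// eqxx lq_opp subr0 cos0 mul0r addr0 mul1r mulr1.
    rewrite dotZl /G dot_st// lq_opp mul0r addr0 (inj_eq lq_inj).
    have -> : (0 == nu i.+1) = false.
      apply/eqP => h; move: iM; rewrite -val_eqE /= => /eqP; apply.
      by move: h; rewrite /nu; lia.
    by rewrite mul0r mulr0.
  have [_ fp] := @ladder_pos R L M L2 lam M l0 (leqnn M).
  rewrite /X /ladder_ext leqnn subnn expr0 mul1r => /eqP.
  by rewrite mulf_eq0 invr_eq0 (negbTE (C0 _)) orbF gt_eqF.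
have bl x y z : bilin (x + y) z = bilin x z + bilin y z.
  by have := bilin_l 1 x y z; rewrite !scale1r.
have br x y z : bilin z (x + y) = bilin z x + bilin z y.
  by have := bilin_r 1 z x y; rewrite !scale1r.
have b0l z : bilin 0 z = 0 by have := bilin_l (-1) z z z; rewrite !scaleN1r !addNr.
have b0r z : bilin z 0 = 0 by have := bilin_r (-1) z z z; rewrite !scaleN1r !addNr.
have bZl c x z : bilin (c *: x) z = c *: bilin x z.
  by have := bilin_l c x 0 z; rewrite !addr0 b0l addr0.
have bZr c x z : bilin z (c *: x) = c *: bilin z x.
  by have := bilin_r c z x 0; rewrite !addr0 b0r addr0.
have -> : bilin Y (a *: st p al) + bilin (a *: st p al) Y =
    \sum_(i < M.*2.+1) (a * X i.+1 / (2 * L%:R)) *: (G i - G i.+2).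
  have bs_l m (F : 'I_m -> 'rV[R]_n) z : bilin (\sum_i F i) z = \sum_i bilin (F i) z.
    by apply: (big_morph (fun x => bilin x z)) => [x y|]; [exact: bl|exact: b0l].
  have bs_r m (F : 'I_m -> 'rV[R]_n) z : bilin z (\sum_i F i) = \sum_i bilin z (F i).
    by apply: (big_morph (fun x => bilin z x)) => [x y|]; [exact: br|exact: b0r].
  have -> : bilin Y (a *: st p al) = \sum_(i < M.*2.+1) (a * X i.+1 / C i.+1) *: bilin (G i.+1) (st p al).
    by rewrite bZr /Y bs_l scaler_sumr; apply: eq_bigr => i _; rewrite bZl scalerA mulrA.
  have -> : bilin (a *: st p al) Y = \sum_(i < M.*2.+1) (a * X i.+1 / C i.+1) *: bilin (st p al) (G i.+1).
    by rewrite bZl /Y bs_r scaler_sumr; apply: eq_bigr => i _; rewrite bZr scalerA mulrA.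
  rewrite -big_split; apply: eq_bigr => i _ /=; rewrite -scalerDr pair// scalerA; congr (_ *: _).
  by move: (C i.+1) (C0 i.+1) (L%:R : R) L0 => c c0 r r0; field; rewrite c0 gt_eqF.
(* Summation by parts; there are no boundary terms because [G] and [X] vanish at both ends. *)
have shift : \sum_(i < M.*2.+1) X i.+1 *: (G i - G i.+2) = \sum_(i < M.*2.+1) (X i.+2 - X i) *: G i.+1.
  have cyc (F : nat -> 'rV[R]_n) : F 0 = 0 -> F M.*2.+1 = 0 ->
      \sum_(i < M.*2.+1) F i = \sum_(i < M.*2.+1) F i.+1.
    move=> F0 FT; rewrite -(big_mkord predT F) -(big_mkord predT (fun i => F i.+1)).
    rewrite [RHS]big_nat_recr//= FT addr0 [LHS]big_nat_recl//= F0 add0r //.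
  have s1 : \sum_(i < M.*2.+1) X i.+1 *: G i = \sum_(i < M.*2.+1) X i.+2 *: G i.+1.
    by apply: (cyc (fun i => X i.+1 *: G i)); rewrite ?G0 ?XT ?scaler0 ?scale0r.
  have s2 : \sum_(i < M.*2.+1) X i.+1 *: G i.+2 = \sum_(i < M.*2.+1) X i *: G i.+1.
    by apply/esym/(cyc (fun i => X i *: G i.+1)); rewrite ?GT ?X0 ?scaler0 ?scale0r.
  under eq_bigr do rewrite scalerBr; rewrite sumrB s1 s2 -sumrB.
  by apply: eq_bigr => i _; rewrite scalerBl.
have -> : \sum_(i < M.*2.+1) (a * X i.+1 / (2 * L%:R)) *: (G i - G i.+2) =
    (a / (2 * L%:R)) *: \sum_(i < M.*2.+1) (X i.+2 - X i) *: G i.+1.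
  by rewrite -shift scaler_sumr; apply: eq_bigr => i _; rewrite scalerA mulrAC.
rewrite /Y !scaler_sumr -sumrN; apply: eq_bigr => i _.
rewrite -scalerN -scaleNr !scalerA; congr (_ *: _).
have := @ladder_ext_rec R L M L2 M1 lam i HL (ltn_ord i); rewrite -/X -/(C i.+1) => h.
by rewrite opprB h; ring.
Qed.

End Shear.

(** * The Galerkin system *)

(** A spectral gap. With [D] the projection onto the coordinates [Ks], [A + D] is invertible, which
    bounds z = pz x by y = z A; positivity at z - y / c gives |y|^2 <= c (y, z) for the Euclidean
    norm. *)
Lemma psd_coercive {R : realType} {n : nat} (Ks : pred 'I_n) (A : 'M[R]_n) :
  (forall x y : 'rV_n, dot (x *m A) y = dot x (y *m A)) -> (forall x : 'rV_n, 0 <= dot (x *m A) x) ->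
  (forall x : 'rV_n, x *m A = 0 <-> pz Ks x = 0) ->
  (forall (x : 'rV[R]_n) i, Ks i -> (x *m A) 0 i = 0) /\
  exists2 c : R, 0 < c & forall x : 'rV[R]_n, c * `|pz Ks x| ^+ 2 <= dot (x *m A) x.
Proof.
move=> sA pA kA.
have AK (x : 'rV[R]_n) i : Ks i -> (x *m A) 0 i = 0.
  move=> Ki; have <- : dot (x *m A) (delta_mx 0 i) = (x *m A) 0 i.
    rewrite /dot (bigD1 i)//= big1 => [|j ji]; first by rewrite [delta_mx _ _ _ _]mxE !eqxx mulr1 addr0.
    by rewrite [delta_mx _ _ _ _]mxE (negbTE ji) andbF mulr0.
  rewrite sA; have -> : (delta_mx 0 i : 'rV[R]_n) *m A = 0.
    apply/kA/rowP => j; rewrite !mxE; case: ifP => // Kj.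
    by case: (j =P i) => // ji; move: Ki; rewrite -ji Kj.
  by rewrite /dot big1// => j _; rewrite mxE mulr0.
split=> //.
pose D : 'M[R]_n := diag_mx (\row_i (Ks i)%:R).
have DE (x : 'rV[R]_n) i : (x *m D) 0 i = if Ks i then x 0 i else 0.
  by rewrite mul_mx_diag !mxE; case: ifP => _; rewrite ?mulr1 ?mulr0.
have U : A + D \in unitmx.
  rewrite -row_free_unit; apply/inj_row_free => x; rewrite mulmxDr => H.
  have H' i : (x *m A) 0 i + (x *m D) 0 i = 0 by have := congr1 (fun M : 'rV_n => M 0 i) H; rewrite !mxE.
  have xA : x *m A = 0.
    apply/rowP => i; rewrite [RHS]mxE; have := H' i; rewrite DE.
    by case: ifP => [Ki _|_]; [exact: AK|rewrite addr0].
  have pzx := (kA x).1 xA; apply/rowP => i; have := H' i; rewrite DE xA !mxE add0r.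
  by case: ifP => // Ki _; have := congr1 (fun M : 'rV_n => M 0 i) pzx; rewrite !mxE Ki.
have [C C1 HC] := mulmx_row_le (invmx (A + D)).
have [C' C1' HC'] := mulmx_row_le A.
pose c := n%:R * C' + 1.
have c0 : 0 < c by rewrite ltr_wpDl// mulr_ge0// (le_trans _ C1').
have C0 : 0 < C by apply: lt_le_trans C1.
have Cc : 0 < C ^+ 2 * c by rewrite mulr_gt0// exprn_gt0.
exists (C ^+ 2 * c)^-1; first by rewrite invr_gt0.
move=> x; pose z := pz Ks x; pose y := z *m A.
have xz : x *m A = y.
  have : (x - z) *m A = 0.
    by apply/kA/rowP => i; rewrite !mxE; case: ifP => // Ki; rewrite Ki subrr.
  by rewrite mulmxBl => /eqP; rewrite subr_eq0 => /eqP.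
have zy : z = y *m invmx (A + D).
  have -> : y = z *m (A + D).
    rewrite mulmxDr -[LHS]addr0; congr (_ + _); apply/rowP => i; rewrite DE !mxE.
    by case: ifP => // ->.
  by rewrite mulmxK.
have xAx : dot (x *m A) x = dot y z by rewrite xz {1}/y sA xz dotC.
have ny : `|y| ^+ 2 <= dot y y by exact: dot_lower.
have cs : dot y y <= c * dot y z.
  have h0 := pA (z - c^-1 *: y).
  have h1 : dot (y *m A) y <= c * dot y y.
    apply: (le_trans (ler_norm _)); apply: (le_trans (dot_le _ _)).
    apply: (@le_trans _ _ (n%:R * (C' * `|y| ^+ 2))).
      by apply: ler_wpM2l => //; rewrite expr2 mulrA; apply: ler_wpM2r => //; exact: HC'.
    rewrite mulrA; apply: ler_pM => //; first by rewrite mulr_ge0// (le_trans _ C1').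
    by rewrite /c lerDl.
  have h2 : dot ((z - c^-1 *: y) *m A) (z - c^-1 *: y) = dot y z - 2 * c^-1 * dot y y + c^-1 ^+ 2 * dot (y *m A) y.
    rewrite mulmxBl -/y -scalemxAl !(dotBl, dotBr, dotZl, dotZr) (sA y z) -/y; ring.
  rewrite h2 in h0.
  have h3 : c^-1 ^+ 2 * dot (y *m A) y <= c^-1 * dot y y.
    have -> : c^-1 * dot y y = c^-1 ^+ 2 * (c * dot y y) by field; rewrite gt_eqF.
    by apply: ler_wpM2l => //; rewrite exprn_ge0// invr_ge0 ltW.
  have h4 : c^-1 * dot y y <= dot y z by lra.
  by rewrite -(ler_pM2l (_ : 0 < c^-1)) ?invr_gt0// mulrA mulVf ?mul1r ?gt_eqF.
rewrite xAx ler_pdivrMl// -mulrA.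
apply: (@le_trans _ _ (C ^+ 2 * `|y| ^+ 2)).
  have zle : `|z| <= C * `|y| by rewrite {1}zy; exact: HC.
  by rewrite -exprMn -/z; apply: lerXn2r => //; rewrite nnegrE//; apply: mulr_ge0 => //; exact: ltW.
by apply: ler_wpM2l; [rewrite exprn_ge0// ltW|exact: le_trans cs].
Qed.

Lemma sum_freqs (l k : nat) (p := (l%:Z, 0) : int * int) (q := (0, k%:Z) : int * int) :
  (0 < l)%N -> (0 < k)%N ->
  [/\ p - q != 0, (p - q == p + q) = false & (p - q == - (p + q)) = false].
Proof. by move=> l0 k0; split; apply/eqP => -[]; lia. Qed.

Lemma inbox_sum (N l k : nat) : (l <= N)%N -> (k <= N)%N ->
  inbox (N := N) ((l%:Z, 0) - (0, k%:Z) : int * int).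
Proof. by move=> lN kN; rewrite /inbox /= subr0 sub0r normrN; lia. Qed.

(** * The null space as sums of two shear flows *)

Section Kernel.
Context {R : realType} {N : nat} (l k : nat).
Hypotheses (hl : (2 <= l)%N) (hk : (2 <= k)%N) (hlk : l <> k) (hlkN : (maxn l k <= N)%N).
Local Notation n := (#|{: mode N}|).
Local Notation fr := (@fr N).
Local Notation th := (@th R N).
Local Notation st := (@st R N).
Local Notation bilin := (@bilin R N).
Local Notation cross := (@cross R).
Local Notation nrm2 := (@nrm2 R).
Implicit Types (j : int * int) (u v w : 'rV[R]_n).

Let p : int * int := (l%:Z, 0).
Let q : int * int := (0, k%:Z).

Definition kernel_mode (i : 'I_n) :=
  [|| fr i == (l%:Z, 0), fr i == - (l%:Z, 0), fr i == (0, k%:Z) | fr i == - (0, k%:Z)].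
Local Notation pz := (pz kernel_mode).

Let lN : (l <= N)%N. Proof. by rewrite (leq_trans (leq_maxl l k)). Qed.
Let kN : (k <= N)%N. Proof. by rewrite (leq_trans (leq_maxr l k)). Qed.

Let p0 : p != 0. Proof. by apply/eqP => -[]; lia. Qed.
Let q0 : q != 0. Proof. by apply/eqP => -[]; lia. Qed.
Let pb : inbox (N := N) p. Proof. by rewrite /inbox /p /=; lia. Qed.
Let qb : inbox (N := N) q. Proof. by rewrite /inbox /q /=; lia. Qed.

(** Polar coordinates in the plane spanned by the modes j and -j. *)
Lemma st_polar j u : j != 0 -> inbox (N := N) j -> exists a al : R, 0 <= a /\
  forall i, fr i = j \/ fr i = - j -> u 0 i = a * st j al 0 i.
Proof.
move=> j0 jb; have [i0 e0] := fr_surj j0 jb.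
have [i1 e1] : exists i, fr i = - j by apply: fr_surj; rewrite ?oppr_eq0 ?inboxN.
have [a [t [a0 ha hb]]] := polar (u 0 i0) (u 0 i1).
have jN : (j == - j) = false by apply/negbTE/opp_neq.
exists a, (t + th i0); split => // i [e|e].
  have -> : i = i0 by apply: fr_inj; rewrite e e0.
  by rewrite mxE e0 eqxx jN mul0r addr0 mul1r addrK.
have -> : i = i1 by apply: fr_inj; rewrite e e1.
rewrite mxE e1 eqxx eq_sym jN mul0r add0r mul1r (@th_opp R N i0 i1) ?e1 ?e0// hb.
have -> : t + th i0 + (- (pi / 2) - th i0) = - (pi / 2 - t) by ring.
by rewrite cosN cosB cos_pihalf sin_pihalf mul0r add0r mul1r.
Qed.

Lemma st_off j t i : fr i != j -> fr i != - j -> st j t 0 i = 0.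
Proof. by move=> /negbTE h1 /negbTE h2; rewrite mxE h1 h2 !mul0r addr0. Qed.

Let lincomb (a b : R) (x y : 'rV[R]_n) i : (a *: x + b *: y) 0 i = a * x 0 i + b * y 0 i.
Proof. by rewrite !mxE. Qed.

Lemma kernel_modeE i : kernel_mode i = (fr i == p) || (fr i == - p) || ((fr i == q) || (fr i == - q)).
Proof. by rewrite /kernel_mode -!orbA. Qed.

Let pq_disj (x : int * int) : ((x == p) || (x == - p)) -> (x == q) || (x == - q) -> False.
Proof. by case: x => x1 x2 /orP[] /eqP [-> ->] /orP[] /eqP []; lia. Qed.

Lemma kernel_form u : pz u = 0 -> exists a al b be : R,
  [/\ 0 <= a, 0 <= b & u = a *: st p al + b *: st q be].
Proof.
move=> pu; have [a [al [a0 Ha]]] := st_polar u p0 pb; have [b [be [b0 Hb]]] := st_polar u q0 qb.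
exists a, al, b, be; split=> //; apply/rowP => i; rewrite lincomb.
have [Pi|] := boolP ((fr i == p) || (fr i == - p)).
  have : ~~ ((fr i == q) || (fr i == - q)) by apply/negP => /(pq_disj Pi).
  rewrite negb_or => /andP[h1 h2]; rewrite (st_off _ h1 h2) mulr0 addr0.
  by apply: Ha; case/orP: Pi => /eqP ->; [left|right].
rewrite negb_or => /andP[h1 h2]; rewrite (st_off _ h1 h2) mulr0 add0r.
have [Qi|] := boolP ((fr i == q) || (fr i == - q)).
  by apply: Hb; case/orP: Qi => /eqP ->; [left|right].
rewrite negb_or => /andP[h3 h4]; rewrite (st_off _ h3 h4) mulr0.
have := congr1 (fun M : 'rV_n => M 0 i) pu.
by rewrite !mxE kernel_modeE (negbTE h1) (negbTE h2) (negbTE h3) (negbTE h4).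
Qed.

Lemma pz_kernel a s b t : pz (a *: st p s + b *: st q t) = 0.
Proof.
apply/rowP => i; rewrite mxE [RHS]mxE; case: ifP => // /negbT.
rewrite kernel_modeE !negb_or => /andP[/andP[h1 h2] /andP[h3 h4]].
by rewrite lincomb (st_off _ h1 h2) (st_off _ h3 h4) !mulr0 addr0.
Qed.

Let V1P w : V1 l w <-> exists a s, w = a *: st p s.
Proof.
have tr t (x : R * R) : trig p t x = cos (l%:R * x.1 + t).
  by rewrite /trig /phase /p /= mul0r addr0.
split=> [[a [b H]]|[a [s ->]]].
  have [r [s [_ ha hb]]] := polar a b; exists r, (- s); apply: vort_inj => x.
  have := vort_lin r (st p (- s)) 0 x; rewrite addr0 vort0 addr0 => ->.
  rewrite vort_st// tr H ha hb cosB; ring.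
exists (a * cos s), (- a * sin s) => x.
have := vort_lin a (st p s) 0 x; rewrite addr0 vort0 addr0 => ->.
rewrite vort_st// tr cosD; ring.
Qed.

Let V2P w : V2 k w <-> exists a s, w = a *: st q s.
Proof.
have tr t (x : R * R) : trig q t x = cos (k%:R * x.2 + t).
  by rewrite /trig /phase /q /= mul0r add0r.
split=> [[a [b H]]|[a [s ->]]].
  have [r [s [_ ha hb]]] := polar a b; exists r, (- s); apply: vort_inj => x.
  have := vort_lin r (st q (- s)) 0 x; rewrite addr0 vort0 addr0 => ->.
  rewrite vort_st// tr H ha hb cosB; ring.
exists (a * cos s), (- a * sin s) => x.
have := vort_lin a (st q s) 0 x; rewrite addr0 vort0 addr0 => ->.
rewrite vort_st// tr cosD; ring.
Qed.

Lemma kernel_pz u : [set v1 + v2 | v1 in V1 l & v2 in V2 k] u <-> pz u = 0.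
Proof.
split=> [[v1 /V1P[a [s ->]] [v2 /V2P[b [t ->]] <-]]|/kernel_form[a [al [b [be [_ _ ->]]]]]].
  exact: pz_kernel.
exists (a *: st p al); first by apply/V1P; exists a, al.
by exists (b *: st q be) => //; apply/V2P; exists b, be.
Qed.

(** A single shear flow is steady, its modes being parallel. The two mixed terms combine by
    [adv_pair], with a factor that is nonzero because l and k differ. *)
Lemma bilin_kernel a s b t : bilin (a *: st p s + b *: st q t) (a *: st p s + b *: st q t) =
  (a * b * (l%:R * k%:R / 2 * ((l%:R ^+ 2)^-1 - (k%:R ^+ 2)^-1))) *:
    (st (p - q) (s - t) - st (p + q) (s + t)).
Proof.
have b0l z : bilin 0 z = 0 by have := bilin_l (-1) z z z; rewrite !scaleN1r !addNr.
have b0r z : bilin z 0 = 0 by have := bilin_r (-1) z z z; rewrite !scaleN1r !addNr.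
have bZl c x z : bilin (c *: x) z = c *: bilin x z.
  by have := bilin_l c x 0 z; rewrite !addr0 b0l addr0.
have bZr c x z : bilin z (c *: x) = c *: bilin z x.
  by have := bilin_r c z x 0; rewrite !addr0 b0r addr0.
have sq j r : j != 0 -> inbox (N := N) j -> bilin (st j r) (st j r) = 0.
  move=> j0 jb; rewrite bilin_st// /adv_st.
  have -> : cross j j = 0 by rewrite crossE mulrC subrr.
  by rewrite mul0r scale0r.
rewrite bilin_l !bilin_r !bZl !bZr !sq// !scaler0 add0r addr0 !scalerA -scalerDr.
rewrite !bilin_st// adv_pair scalerA; congr (_ *: _); congr (_ * (_ / _ * (_^-1 - _^-1))).
- by rewrite /cross /p /q /= mul0r subr0 intrM.
- by rewrite /nrm2 /p /= expr0n /= addr0; exact: rmorphXn.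
- by rewrite /nrm2 /q /= expr0n /= add0r; exact: rmorphXn.
Qed.

Let coef0 : l%:R * k%:R / 2 * ((l%:R ^+ 2)^-1 - (k%:R ^+ 2)^-1) != 0 :> R.
Proof.
have l0 : l%:R != 0 :> R by rewrite pnatr_eq0; lia.
have k0 : k%:R != 0 :> R by rewrite pnatr_eq0; lia.
apply: mulf_neq0; first by apply: mulf_neq0; [exact: mulf_neq0|rewrite invr_eq0 pnatr_eq0].
rewrite subr_eq0 (inj_eq invr_inj).
by rewrite eqrXn2// eqr_nat; apply/eqP.
Qed.

(** The frequencies produced have both components nonzero, whereas those of kernel modes lie on the
    axes. *)
Lemma bilin_kernel_mode u i : pz u = 0 -> kernel_mode i -> bilin u u 0 i = 0.
Proof.
move=> /kernel_form[a [al [b [be [_ _ ->]]]]]; rewrite bilin_kernel kernel_modeE => Ki.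
have h (e : int * int) : e = p - q \/ e = p + q -> fr i != e /\ fr i != - e.
  move=> he; split; apply/eqP => E; move: Ki; rewrite E;
    case: he => ->; rewrite /p /q => /orP[] /orP[] /eqP []; lia.
have [h1 h2] := h _ (or_introl erefl); have [h3 h4] := h _ (or_intror erefl).
have dif c (x y : 'rV[R]_n) : (c *: (x - y)) 0 i = c * (x 0 i - y 0 i) by rewrite !mxE.
by rewrite dif (st_off _ h1 h2) (st_off _ h3 h4) subr0 mulr0.
Qed.

Lemma kernel_unstable u : u != 0 -> pz u = 0 -> bilin u u = 0 ->
  exists (lam : R) Y, [/\ 0 < lam, Y != 0 & - (bilin Y u + bilin u Y) = lam *: Y].
Proof.
move=> u0 /kernel_form[a [al [b [be [a0 b0 ue]]]]].
have [pq0 d1 d2] := @sum_freqs l k (ltnW hl) (ltnW hk).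
have pqb : inbox (N := N) (p - q) by exact: inbox_sum.
rewrite {1}ue {1}ue bilin_kernel => H.
(* Tested against the mode p - q, which lies in the box and is orthogonal to the mode p + q. *)
have : a * b = 0.
  have := congr1 (fun z => dot z (st (p - q) (al - be))) H.
  rewrite dotZl dotBl !dot_st// eqxx.
  have -> : (p - q == - (p - q)) = false by apply/negbTE/opp_neq.
  rewrite d1 d2 !mul0r subrr cos0 !mul1r !addr0 subr0 mulr1.
  have -> : dot 0 (st (p - q) (al - be)) = 0 by rewrite /dot big1// => i _; rewrite mxE mul0r.
  by move/eqP; rewrite mulf_eq0 (negbTE coef0) orbF => /eqP.
move=> /eqP; rewrite mulf_eq0 => /orP[] /eqP e; rewrite ue e scale0r ?add0r ?addr0.
  have b1 : 0 < b.
    rewrite lt_neqAle b0 andbT; apply/eqP => b'; move/eqP: u0; apply.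
    by rewrite ue e -b' !scale0r addr0.
  by apply: (shear_unstable (e := (-1, 0)) hk kN) b1; right.
have a1 : 0 < a.
  rewrite lt_neqAle a0 andbT; apply/eqP => a'; move/eqP: u0; apply.
  by rewrite ue e -a' !scale0r addr0.
by apply: (shear_unstable (e := (0, 1)) hl lN) a1; left.
Qed.

Lemma kernel_drift (A : {linear state R N -> state R N}) : L2_psd A ->
  [set v | A v = 0] = [set v1 + v2 | v1 in V1 l & v2 in V2 k] ->
  exists Am CB cA, (forall x, x *m Am = A x) /\ dissipative_drift kernel_mode bilin Am CB cA.
Proof.
move=> [symA psdA] hker.
have [Am HA] : exists Am : 'M[R]_n, forall x : 'rV[R]_n, x *m Am = A x.
  by apply: linear_matrix => a x y; exact: linearP.
have c0 : 0 < 2 * pi ^+ 2 :> R by rewrite mulr_gt0// exprn_gt0// pi_gt0.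
have sA (x y : 'rV[R]_n) : dot (x *m Am) y = dot x (y *m Am).
  have := symA x y; rewrite !L2_ip_vort !HA => /(mulfI _); apply; by rewrite gt_eqF.
have pA (x : 'rV[R]_n) : 0 <= dot (x *m Am) x.
  by have := psdA x; rewrite L2_ip_vort pmulr_rge0// HA.
have kA (x : 'rV[R]_n) : x *m Am = 0 <-> pz x = 0.
  rewrite HA -kernel_pz -hker; exact: iff_refl.
have [AK [cA cA0 HcA]] := psd_coercive sA pA kA.
have [C1 hC1 HC1] := bilinear_le (@bilin_l R N) (fun a x y z => @bilin_r R N a z x y).
have [C2 hC2 HC2] := mulmx_row_le Am.
exists Am, (Num.max C1 C2), cA; split => //; split => //.
- exact: bilin_l.
- by move=> a x y z; exact: bilin_r.
- by rewrite le_max hC1.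
- move=> x y; apply: le_trans (HC1 x y) _; rewrite -!mulrA; apply: ler_wpM2r; first exact: mulr_ge0.
  by rewrite le_max lexx.
- by move=> x; apply: le_trans (HC2 x) _; apply: ler_wpM2r => //; rewrite le_max lexx orbT.
- exact: bilin_dot.
- by move=> u i; exact: bilin_kernel_mode.
- exact: kernel_unstable.
Qed.

End Kernel.

(** * From the stochastic equation to the abstract flow *)

Section GalerkinFlow.
Context {R : realType} {N : nat} {d : measure_display} {Omega : measurableType d}.
Variables (P : probability Omega R) (A : {linear state R N -> state R N}).
Variables (sigma : mode N -> bool -> R) (W : mode N * bool -> R -> Omega -> R).
Variable w : state R N -> R -> Omega -> state R N.
Hypothesis hw : forall w0, solves_GNS P A sigma W w0 (w w0).
Variable Am : 'M[R]_(#|{: mode N}|).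
Hypothesis HAm : forall x, x *m Am = A x.
Local Notation st := (@st R N).
Local Notation b := (qdrift (@bilin R N) Am).
Hypothesis bL : loclip b.

Definition forcing_dir (kj : mode N * bool) : 'rV[R]_(#|{: mode N}|) :=
  sigma kj.1 kj.2 *: st (mfreq kj.1) (if kj.2 then - (pi / 2) else 0).

Let vortD (u v : 'rV[R]_(#|{: mode N}|)) x : vort (u + v) x = vort u x + vort v x.
Proof. by have := vort_lin 1 u v x; rewrite scale1r mul1r. Qed.

Let vortZ a (v : 'rV[R]_(#|{: mode N}|)) x : vort (a *: v) x = a * vort v x.
Proof. by have := vort_lin a v 0 x; rewrite addr0 vort0 addr0. Qed.

Let vortB (u v : 'rV[R]_(#|{: mode N}|)) x : vort (u - v) x = vort u x - vort v x.
Proof. by rewrite -scaleN1r vortD vortZ mulN1r. Qed.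

Lemma mfreq_inbox (k : mode N) : inbox (N := N) (mfreq k).
Proof. exact: freq_inbox. Qed.

Lemma mfreq_neq0 (k : mode N) : mfreq k != 0.
Proof. exact: valP k. Qed.

Lemma forcing_noise t om x : forcing sigma W t om x = vort (noise W forcing_dir t om) x.
Proof.
rewrite /noise (big_morph (fun v => vort v x) (fun u v => vortD u v x) (vort0 x)).
transitivity (\sum_k \sum_j vort (W (k, j) t om *: forcing_dir (k, j)) x); last first.
  by rewrite pair_bigA; apply: eq_bigr => -[k j] _.
apply: eq_bigr => k _; rewrite big_bool /= !vortZ /= !vort_st ?mfreq_neq0 ?mfreq_inbox//.
by rewrite cos_phase sin_phase addrC; congr (_ + _); rewrite mulrC.
Qed.

Lemma vort_vint (f : R -> 'rV[R]_(#|{: mode N}|)) t x : continuous f ->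
  vort (vint f 0 t) x = \int[lebesgue_measure]_(s in `[0, t]) vort (f s) x.
Proof.
move=> cf; rewrite /vort; pose c (i : 'I_#|{: mode N}|) : R := basis_fun (enum_val i) x.
have ci i : lebesgue_measure.-integrable `[0, t] (EFin \o (fun s => f s 0 i * c i)).
  by apply: path_integrable => s; apply: cvgMl; exact: coord_path.
suff [] : lebesgue_measure.-integrable `[0, t] (EFin \o (fun s => \sum_i f s 0 i * c i)) /\
    \sum_i vint f 0 t 0 i * c i = \int[lebesgue_measure]_(s in `[0, t]) \sum_i f s 0 i * c i by [].
elim: (index_enum _) => [|i r [IH1 IH2]].
  split; last by rewrite big_nil; under eq_Rintegral do rewrite big_nil; rewrite Rintegral_cst ?mul0r.
  rewrite (_ : _ \o _ = cst 0%E); first exact: integrable0.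
  by apply/funext => s; rewrite /= big_nil.
split.
  rewrite (_ : _ \o _ = (fun s => (f s 0 i * c i)%:E + (\sum_(j <- r) f s 0 j * c j)%:E)%E).
    by apply: integrableD; [|exact: ci|exact: IH1].
  by apply/funext => s; rewrite /= big_cons EFinD.
rewrite big_cons IH2; under [RHS]eq_Rintegral do rewrite big_cons.
rewrite RintegralD//; congr (_ + _); rewrite mxE RintegralZr//.
exact/path_integrable/coord_path.
Qed.

(** A state is determined by its vorticity, so the equation between functions on the torus is an
    equation in coordinates; the solution is extended to t < 0 by its initial value. *)
Lemma GNS_flow : flow P W b forcing_dir w.
Proof.
split=> [x t t0|x]; first exact: GNS_meas (hw x) t t0.
apply: filterS3 (GNS_init (hw x)) (GNS_cont (hw x)) (GNS_eq (hw x)) => om e0 cw ew.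
pose v (t : R) : 'rV[R]_(#|{: mode N}|) := w x (Num.max 0 t) om.
have cv : continuous v by exact: (halfline_continuous cw).
have cb : continuous (b \o v).
  by move=> s; apply: continuous_comp; [exact: cv|exact: loclip_continuous].
have vE t : 0 <= t -> v t = w x t om by move=> t0; rewrite /v (max_idPr t0).
have key t : 0 <= t -> v t = x - vint (b \o v) 0 t + noise W forcing_dir t om.
  move=> t0; apply: vort_inj => y; rewrite vE// ew// e0 forcing_noise vortD; congr (_ + _).
  rewrite vortB vort_vint//; congr (_ - _).
  apply: eq_Rintegral => s; rewrite inE/= in_itv/= => /andP[s0 _].
  by rewrite Pi_le_advection -vortD -HAm -vE.
exists v; split=> //; last by rewrite vE.
split=> // s t s0 st.
have h := vint_add cb s0 st.
rewrite (key t (le_trans s0 st)) (key s s0) h.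
move: (vint _ 0 s) (vint _ s t) (noise W forcing_dir t om) (noise W forcing_dir s om) => a1 a2 a3 a4.
by apply/rowP => i; rewrite !mxE; ring.
Qed.

(** Each basis function is itself a forcing direction, of cosine type for a lexicographically
    positive frequency and of sine type otherwise; with nonzero coefficients every coordinate is
    excited separately. *)
Lemma forcing_dir_basis (i : 'I_#|{: mode N}|) :
  forcing_dir (enum_val i, ~~ lex_pos (fr i)) =
    sigma (enum_val i) (~~ lex_pos (fr i)) *: delta_mx 0 i.
Proof.
rewrite /forcing_dir /=; congr (_ *: _).
have -> : (if ~~ lex_pos (fr i) then - (pi / 2) else 0) = th i :> R.
  by rewrite /th; case: (lex_pos _).
apply/rowP => j; rewrite !mxE -/(fr i) (inj_eq fr_inj) /=.
have [->|ji] := eqVneq j i.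
  by rewrite subrr cos0 mulr1 (negbTE (opp_neq (fr_neq0 i))) mul0r addr0.
rewrite mul0r add0r; have [e|_] := eqVneq (fr j) (- fr i); last by rewrite mul0r.
have -> : th j = - (pi / 2) - th i :> R by exact: th_opp.
by rewrite addrC subrK cosN cos_pihalf mulr0.
Qed.

End GalerkinFlow.

Lemma L2_norm_le {R : realType} {N : nat} : exists2 C : R, 0 <= C &
  forall v : state R N, L2_norm v <= C * `|v : 'rV[R]_(#|{: mode N}|)|.
Proof.
set n := #|{: mode N}|; exists (Num.sqrt (2 * pi ^+ 2 * n%:R)); first exact: sqrtr_ge0.
move=> v; have p0 : 0 <= 2 * pi ^+ 2 :> R by rewrite mulr_ge0// sqr_ge0.
have e : L2_norm v = Num.sqrt (2 * pi ^+ 2 * dot v v) by rewrite /L2_norm L2_ip_vort.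
have h : `|v : 'rV[R]_n| = Num.sqrt (`|v : 'rV[R]_n| ^+ 2) by rewrite sqrtr_sqr normr_id.
rewrite e [in leRHS]h -sqrtrM; last by apply: mulr_ge0.
apply: ler_wsqrtr.
by rewrite -[leRHS]mulrA; apply: ler_wpM2l => //; exact: dot_upper.
Qed.

Lemma L2_norm_measurable {R : realType} {N : nat} :
  measurable_fun setT (@L2_norm R N : borel_state R N -> R).
Proof.
have -> : @L2_norm R N = (fun v => Num.sqrt (2 * pi ^+ 2 * dot v v)).
  by apply/funext => v; rewrite /L2_norm L2_ip_vort.
have ms : measurable_fun setT (@Num.sqrt R).
  by apply: continuous_measurable_fun; exact: sqrt_continuous.
apply: (measurableT_comp ms).
apply: measurable_funM => //.
by apply: (dot_measurable (T := brv R #|{: mode N}|) (X := id)); exact: measurable_id.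
Qed.

Lemma powR_le_add1 {R : realType} (y p q : R) : 0 <= y -> 0 <= p -> p <= q ->
  y `^ p <= 1 + y `^ q.
Proof.
move=> y0 p0 pq; have [y1|y1] := leP y 1.
  have : y `^ p <= 1 `^ p by apply: ge0_ler_powR; rewrite ?nnegrE.
  rewrite powR1 => /le_trans; apply; rewrite lerDl; exact: powR_ge0.
have /le_trans := ler_powR (ltW y1) pq; apply; rewrite lerDr; exact: ler01.
Qed.

Theorem theorem1p4 (R : realType) (N l k : nat)
    (d : measure_display) (Omega : measurableType d) (P : probability Omega R)
    (A : {linear state R N -> state R N})
    (sigma : mode N -> bool -> R)
    (W : mode N * bool -> R -> Omega -> R)
    (w : state R N -> R -> Omega -> state R N)
    (hN : (3 <= N)%N) (hl : (2 <= l)%N) (hk : (2 <= k)%N)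
    (hlk : l <> k) (hlkN : (maxn l k <= N)%N)
    (hW : forall i, brownian P (W i))
    (hWind : independent_processes P W)
    (hw : forall w0, solves_GNS P A sigma W w0 (w w0))
    (hA : L2_psd A)
    (hsigma : forall (p : mode N) (j : bool), sigma p j <> 0)
    (hker : [set v | A v = 0] = [set v1 + v2 | v1 in V1 l & v2 in V2 k]) :
  exists mu : probability (borel_state R N) R,
    [/\ invariant_measure P w mu,
        (forall nu : probability (borel_state R N) R, invariant_measure P w nu ->
           forall B, measurable B -> nu B = mu B)
      & forall p : R, 0 <= p -> p < 2 / 3 ->
          (\int[mu]_v ((L2_norm v `^ p)%:E) < +oo)%E ].
Proof.
have [Am [CB [cA [HAm dd]]]] := kernel_drift hl hk hlk hlkN hA hker.
have hu := GNS_flow hw HAm (qdrift_loclip dd).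
pose iota (i : 'I_#|{: mode N}|) : mode N * bool := (enum_val i, ~~ lex_pos (fr i)).
have iota_inj : injective iota by move=> i j [/enum_val_inj].
pose sg (i : 'I_#|{: mode N}|) := sigma (enum_val i) (~~ lex_pos (fr i)).
have sg0 i : sg i != 0 by apply/eqP; exact: hsigma.
have [mu [inv uniq mom]] :=
  ergodic hW hWind dd hu iota_inj sg0 (forcing_dir_basis sigma).
exists mu; split.
- by move=> t B t0 mB; exact: inv.
(* Uniqueness holds already among the measures invariant at time 1. *)
- by move=> nu hnu B mB; apply: uniq => // C mC; exact: (hnu 1 C ler01 mC).
move=> p p0 p23; have [C C0 HC] := @L2_norm_le R N.
have q0 : 0 <= 2 / 3 :> R by rewrite divr_ge0.
pose g (v : borel_state R N) : R := `|v : 'rV[R]_(#|{: mode N}|)| `^ (2 / 3).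
have mg : measurable_fun setT g.
  apply: (measurableT_comp (@measurable_powR R (2 / 3))).
  by apply: (@continuous_brv R #|{: mode N}|) => x; exact: norm_continuous.
have g0 v : 0 <= g v by exact: powR_ge0.
pose K := C `^ (2 / 3); have K0 : 0 <= K by exact: powR_ge0.
have bound (v : borel_state R N) : L2_norm v `^ p <= 1 + K * g v.
  apply: le_trans (powR_le_add1 (sqrtr_ge0 _) p0 (ltW p23)) _.
  rewrite lerD2l -powRM//; apply: ge0_ler_powR; rewrite ?nnegrE ?sqrtr_ge0 ?mulr_ge0//.
  exact: HC.
apply: (@le_lt_trans _ _ (\int[mu]_v (1 + K%:E * (g v)%:E))%E).
  apply: ge0_le_integral => //.
  - by move=> v _; rewrite lee_fin powR_ge0.
  - apply/measurable_EFinP; apply: (measurableT_comp (@measurable_powR R p)).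
    exact: L2_norm_measurable.
  - apply: emeasurable_funD => //; apply: emeasurable_funM => //; exact/measurable_EFinP.
  - by move=> v _; rewrite -EFinM -EFinD lee_fin.
rewrite ge0_integralD//; last 2 first.
- by move=> v _; rewrite mule_ge0// lee_fin.
- by apply: emeasurable_funM => //; exact/measurable_EFinP.
rewrite ge0_integralZl_EFin//; [|by move=> v _; rewrite lee_fin|exact/measurable_EFinP].
rewrite integral_cst// mul1e; apply: lte_add_pinfty.
  by apply: (@le_lt_trans _ _ 1%E); [exact: probability_le1|exact: ltry].
by apply: lte_mul_pinfty.
Qed.
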